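(* Let $\Omega=\mathbb{D}$ be the unit disk in $\mathbb{R}^2$, with $\Gamma=\mathbb{S}^1$. The following statements hold. (1) For $k=1$ and $\alpha\in(0,1]$, the constant density $\rho\equiv\alpha$ is a maximizer of $\lambda_1$ over $\mathcal{A}_\alpha$. (2) Let $\alpha\in(0,1]$. For even $k\ge2$, the constant density $\rho\equiv\alpha$ is a critical point for the problem of minimizing $\lambda_k$ over $\mathcal{A}_\alpha$, in the sense that there is no admissible perturbation with negative Gateaux derivative. For odd $k\ge1$, the constant density $\rho\equiv\alpha$ is not a local minimizer of $\lambda_k$ over $\mathcal{A}_\alpha$. For odd $k\ge1$, the constant density $\rho\equiv\alpha$ is a critical point for the problem of maximizing $\lambda_k$ over $\mathcal{A}_\alpha$, in the sense that there is no admissible perturbation with positive Gateaux derivative. For even $k\ge2$, the constant density $\rho\equiv\alpha$ is not a local maximizer of $\lambda_k$ over $\mathcal{A}_\alpha$. (3) Let $k\ge1$ be fixed and, for $0<\varepsilon\ll 1$, consider the problems of minimizing, respectively maximizing, $\sigma_k(\Gamma_S)$ over measurable $\Gamma_S\subset\mathbb{S}^1$ with $|\Gamma_S|=(1-\varepsilon)|\Gamma|$. In the limit as $\varepsilon\to0$, $\Gamma_S=\mathcal{I}^{k+1}_{1-\varepsilon}$ is a local minimizer and $\Gamma_S=\mathcal{I}^{k}_{1-\varepsilon}$ is a local maximizer, in the sense that the linearizations of these problems about $\varepsilon=0$ have these properties, that is, $$\lim_{\varepsilon\to0^+}\nu_k\big(\mathbb{S}^1\setminus\mathcal{I}^{k+1}_{1-\varepsilon}\big)=\lim_{\varepsilon\to0^+}\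 \inf_{|S|=2\pi\varepsilon}\nu_k(S),\qquad \lim_{\varepsilon\to0^+}\nu_k\big(\mathbb{S}^1\setminus\mathcal{I}^{k}_{1-\varepsilon}\big)=\lim_{\varepsilon\to0^+}\ \sup_{|S|=2\pi\varepsilon}\nu_k(S),$$ where $S$ ranges over measurable subsets of $\mathbb{S}^1$ and $\nu_k(S)$ is the first-order coefficient defined in the context. (4) Let $\alpha\in(0,1]$. The eigenvalues of the Steklov–Neumann eigenproblem with $\Gamma_S=\mathcal{I}^n_\alpha$ converge, as $n\to\infty$, to the eigenvalues of the weighted Steklov eigenproblem with constant density $\rho\equiv\alpha$; i.e. $\sigma_k(\mathcal{I}^n_\alpha)\to\lambda_k(\alpha)$ for each fixed $k\ge 0$.
   Context: Here $|\cdot|$ denotes arc-length measure on $\Gamma=\mathbb{S}^1$ (so $|\Gamma|=2\pi$), $\mathbb{S}^1$ is parametrized by the angle $\theta$ modulo $2\pi$, and $\mathbf{1}_S$ is the indicator function of $S$. For $\rho\in L^\infty(\Gamma)$ with $\rho\ge 0$ a.e. and $\rho$ not a.e. zero, the weighted Steklov eigenproblem is: $\Delta u=0$ in $\Omega$, $\partial_n u=\lambda\rho u$ on $\Gamma$ (understood weakly). Its eigenvalues, enumerated with multiplicity, are $0=\lambda_0(\rho)<\lambda_1(\rho)\le\lambda_2(\rho)\le\cdots\nearrow\infty$. For measurable $\Gamma_S\subset\Gamma$ of positive measure, with $\Gamma_N=\Gamma\setminus\Gamma_S$, the Steklov–Neumann eigenproblem is: $\Delta u=0$ in $\Omega$,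 $\partial_nu=\sigma u$ on $\Gamma_S$, $\partial_nu=0$ on $\Gamma_N$; its eigenvalues, enumerated in increasing order with multiplicity from $\sigma_0=0$, are $\sigma_k(\Gamma_S)=\lambda_k(\mathbf{1}_{\Gamma_S})$. For $\alpha\in(0,1]$ the admissible set is $$\mathcal{A}_\alpha=\Big\{\rho\in L^\infty(\Gamma):\ 0\le\rho(s)\le1\text{ for a.e. }s\in\Gamma,\ \int_\Gamma\rho\,ds=\alpha|\Gamma|\Big\}.$$ Admissible perturbations of $\rho\equiv\alpha$ are $\delta\rho\in L^\infty(\Gamma)$ with $\alpha+\varepsilon\,\delta\rho\in\mathcal{A}_\alpha$ for all sufficiently small $\varepsilon>0$ (in particular $\int_\Gamma\delta\rho\,ds=0$). The Gateaux derivative of $\lambda_k$ at $\alpha$ in direction $\delta\rho$ is the one-sided derivative $\lim_{\varepsilon\to0^+}\frac{\lambda_k(\alpha+\varepsilon\delta\rho)-\lambda_k(\alpha)}{\varepsilon}$. Local minimizers/maximizers over $\mathcal{A}_\alpha$ are with respect to the $L^\infty(\Gamma)$ norm. $\mathcal{I}^n_\alpha\subset\mathbb{S}^1$ is the union of $n$ evenly spaced intervals of equal length: $$\mathcal{I}^n_\alpha=\bigcup_{\ell=1}^n\left[\frac{\pi(2\ell-\alpha)}{n},\ \frac{\pi(2\ell+\alpha)}{n}\right]\ (\text{angles mod }2\pi),\qquad |\mathcal{I}^n_\alpha|=2\pi\alpha.$$ Linearization about $\varepsilon=0$: for the full circle $\Gamma_S=\mathbb{S}^1$ the eigenvalues are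 $\sigma_{2m-1}=\sigma_{2m}=m$, $m\ge1$. For measurable $S\subset\mathbb{S}^1$ (playing the role of $\Gamma_N$) with $|S|=2\pi\varepsilon>0$ and $m\ge1$, the first-order perturbation matrix is $$M_m(S)=\frac{m}{\pi\varepsilon}\int_S\begin{pmatrix}\cos^2(m\theta)&\cos(m\theta)\sin(m\theta)\\ \cos(m\theta)\sin(m\theta)&\sin^2(m\theta)\end{pmatrix}d\theta .$$ Let $\nu_{2m-1}(S)$ and $\nu_{2m}(S)$ denote the smaller and the larger eigenvalue of $M_m(S)$, respectively; the linearized eigenvalues of the problem with $\Gamma_N=S$ are $m+\varepsilon\,\nu_{2m-1}(S)$ and $m+\varepsilon\,\nu_{2m}(S)$.
   Formalization: In (2) the two ''not a local minimizer/maximizer'' claims are proved for α<1 only (at α=1 the set A_α is just ρ≡1 a.e., so they fail); in (3) the maximizer claim is proved for k≥2 only (for k=1 the left limit is 0 and the right limit is 1). *)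

(* Defs.v *)
From HB Require Import structures.
From mathcomp Require Import all_boot all_order all_algebra.
From mathcomp Require Import all_classical all_reals all_analysis.

Set Implicit Arguments.
Unset Strict Implicit.
Unset Printing Implicit Defensive.
Import Order.TTheory GRing.Theory Num.Theory.
Import numFieldNormedType.Exports.
Local Open Scope classical_set_scope.
Local Open Scope ring_scope.

Section Steklov.
Variable R : realType.

Local Notation leb1 := (@lebesgue_measure R).
Local Notation leb2 := ((@lebesgue_measure R) \x (@lebesgue_measure R))%E.

Definition disk : set (R * R) := [set z | z.1 ^+ 2 + z.2 ^+ 2 < 1].

(* The unit circle is parametrized by the angle, with arc-length measure the
   Lebesgue measure on [0, 2 pi[; a function on the circle is a function R -> R
   of which only the values on [0, 2 pi[ are used. *)
Definition circle : set R := `[0, 2 * pi[.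

(* A function on a domain is in L^p when its extension by zero is. *)
Definition L2disk (f : R * R -> R) := f \_ disk \in Lfun leb2 2%:E.
Definition L2circle (f : R -> R) := f \_ circle \in Lfun leb1 2%:E.
Definition Loocircle (f : R -> R) := f \_ circle \in Lfun leb1 +oo%E.
Definition Loonorm (f : R -> R) : \bar R :=
  ('N[leb1]_+oo[EFin \o (f \_ circle)])%E.

Definition e1 : R * R := (1, 0).
Definition e2 : R * R := (0, 1).

Definition C1 (phi : R * R -> R) :=
  forall v, v = e1 \/ v = e2 ->
    (forall z, derivable phi z v) /\ continuous ('D_v phi).

Definition C1c_disk (phi : R * R -> R) := C1 phi /\
  exists2 r, r < 1 & forall z, r <= z.1 ^+ 2 + z.2 ^+ 2 -> phi z = 0.

Definition weak_partial (v : R * R) (u p : R * R -> R) :=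
  forall phi, C1c_disk phi ->
    (\int[leb2]_(z in disk) (u z * 'D_v phi z) =
     - \int[leb2]_(z in disk) (p z * phi z))%R.

Definition H1_grad (u px py : R * R -> R) :=
  [/\ L2disk u, L2disk px, L2disk py, weak_partial e1 u px
    & weak_partial e2 u py].

(* The boundary trace of u in H^1(disk), (px, py) being the weak gradient of u,
   is the function g in L^2(circle) for which the Gauss-Green formula holds
   against all C^1 functions: it exists for every u in H^1(disk) and is unique
   a.e. The outward unit normal is (cos, sin). *)
Definition is_trace (u px py : R * R -> R) (g : R -> R) := L2circle g /\
  forall phi, C1 phi ->
    (\int[leb2]_(z in disk) (u z * 'D_e1 phi z + px z * phi z) =
     \int[leb1]_(t in circle) (g t * phi (cos t, sin t) * cos t))%R /\
    (\int[leb2]_(z in disk) (u z * 'D_e2 phi z + py z * phi z) =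
     \int[leb1]_(t in circle) (g t * phi (cos t, sin t) * sin t))%R.

(* Weak solutions u in H^1(disk) of: Laplacian u = 0 in the disk, normal
   derivative of u = lam rho u on the circle. The zero function is included. *)
Definition weak_steklov (rho : R -> R) (lam : R) (u : R * R -> R) :=
  exists px py g, [/\ H1_grad u px py, is_trace u px py g &
    forall v qx qy h, H1_grad v qx qy -> is_trace v qx qy h ->
      (\int[leb2]_(z in disk) (px z * qx z + py z * qy z) =
       lam * \int[leb1]_(t in circle) (rho t * g t * h t))%R].

Definition lin_indep (n : nat) (u : 'I_n -> R * R -> R) :=
  forall c : 'I_n -> R,
    {ae leb2, forall z, disk z -> \sum_i c i * u i z = 0} ->
    forall i, c i = 0.

(* steklov_ev rho k is the eigenvalue of index k in the nondecreasing
   enumeration, with multiplicity, starting at index 0: the least mu such that the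
   eigenvalues at most mu have total multiplicity at least k + 1. *)
Definition steklov_ev (rho : R -> R) (k : nat) : R :=
  inf [set mu | exists u : 'I_k.+1 -> R * R -> R, lin_indep u /\
    forall i, exists2 lam, lam <= mu & weak_steklov rho lam (u i)].

Definition steklov_neumann_ev (GS : set R) (k : nat) : R :=
  steklov_ev (\1_GS) k.

Definition admissible (alpha : R) : set (R -> R) :=
  [set rho | [/\ Loocircle rho,
    {ae leb1, forall t, circle t -> 0 <= rho t <= 1} &
    (\int[leb1]_(t in circle) rho t = alpha * (2 * pi))%R]].

Definition perturb (alpha : R) (drho : R -> R) (e : R) : R -> R :=
  fun t => alpha + e * drho t.

Definition admissible_perturbation (alpha : R) (drho : R -> R) :=
  Loocircle drho /\ \forall e \near 0^'+, admissible alpha (perturb alpha drho e).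

Definition gateaux (k : nat) (alpha : R) (drho : R -> R) (d : R) :=
  (steklov_ev (perturb alpha drho e) k - steklov_ev (cst alpha) k) / e
    @[e --> 0^'+] --> d.

Definition maximizer (A : set (R -> R)) (F : (R -> R) -> R) (rho : R -> R) :=
  A rho /\ forall eta, A eta -> F eta <= F rho.

Definition local_minimizer (A : set (R -> R)) (F : (R -> R) -> R)
    (rho : R -> R) :=
  A rho /\ exists2 r, 0 < r & forall eta, A eta ->
    (Loonorm (fun t => eta t - rho t)%R < r%:E)%E -> F rho <= F eta.

Definition local_maximizer (A : set (R -> R)) (F : (R -> R) -> R)
    (rho : R -> R) :=
  A rho /\ exists2 r, 0 < r & forall eta, A eta ->
    (Loonorm (fun t => eta t - rho t)%R < r%:E)%E -> F eta <= F rho.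

Definition arcs (n : nat) (alpha : R) : set R :=
  [set t | circle t /\ exists l : nat, exists z : int, (1 <= l <= n)%N /\
    pi * (2 * l%:R - alpha) / n%:R <= t + 2 * pi * z%:~R
      <= pi * (2 * l%:R + alpha) / n%:R].

Definition trig (m : nat) (i : 'I_2) (t : R) : R :=
  if i == 0 then cos (m%:R * t) else sin (m%:R * t).

(* eps is determined by S through |S| = 2 pi eps. *)
Definition pert_mx (m : nat) (S : set R) : 'M[R]_2 :=
  let eps := fine (leb1 S) / (2 * pi) in
  \matrix_(i, j)
    (m%:R / (pi * eps) * \int[leb1]_(t in S) (trig m i t * trig m j t))%R.

(* Index k belongs to the pair {2m - 1, 2m} with m = uphalf k; odd k is the
   smaller eigenvalue (inf) and even k the larger one (sup). *)
Definition nu (k : nat) (S : set R) : R :=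
  let spec := [set a | eigenvalue (pert_mx (uphalf k) S) a] in
  if odd k then inf spec else sup spec.

Definition subsets_of_length (l : R) : set (set R) :=
  [set S | [/\ measurable S, S `<=` circle & leb1 S = l%:E]].

End Steklov.

(* Main.v *)
(* Let E_k be the Fourier basis of L^2 of the circle and freq k = ceil (k / 2). The
   Dirichlet energy of the harmonic extension of f is sum_k freq k <f, E_k>^2, so
   the eigenfunctions for lam are the extensions of the f such that
   freq k <f, E_k> = lam int rho f E_k for all k, and the eigenvalues are the
   min-max values of the energy relative to B(f, f) = int rho f^2. Eigenfunctions
   are produced by maximising B, deflated by those already found, on a compact
   ball of the energy. Hence steklov_ev rho k is bounded below through k linear
   constraints and above through test spaces of dimension k + 1.

   (1) (Hersch) The components phi_1, phi_2 of a Moebius map of the disk have energy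
   pi, and phi_1^2 + phi_2^2 = 1 on the circle. The critical points a in the disk of
   int rho ln |1 - conj a z|^2 - 2 pi alpha ln (1 - |a|^2) are those for which
   int rho phi_i = 0, and a minimum exists. The test space spanned by 1 and the
   phi_i with int rho phi_i^2 >= pi alpha gives the bound 1 / alpha.

   (2) The diagonal entries of a mean-zero perturbation on span (cos (m t), sin (m t))
   add up to zero, so the double eigenvalue m / alpha can only open up to first
   order; it does for the perturbation cos (2 m t).

   (3) The eigenvalues of M_m(S) are m (1 - r) and m (1 + r), where r <= 1 is the modulus
   of the normalized moment of order 2m of S. For n equal gaps r vanishes unless n
   divides 2m, and r tends to 1 with the length of the gaps when n = 2m.

   (4) The Fourier coefficients of the indicator of n equal arcs vanish at all nonzero
   frequencies that n does not divide, so a fixed number of modes only sees the average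
   alpha, while the modes of frequency comparable to n have large energy. *)

Require Import Defs.
From HB Require Import structures.
From mathcomp Require Import all_boot all_order all_algebra.
From mathcomp Require Import all_classical all_reals all_analysis.
From mathcomp Require Import measurable_realfun ess_sup_inf.
From mathcomp Require Import ring lra zify.

Set Implicit Arguments.
Unset Strict Implicit.
Unset Printing Implicit Defensive.
Import Order.TTheory GRing.Theory Num.Theory.
Import numFieldNormedType.Exports HBNNSimple.
Local Open Scope classical_set_scope.
Local Open Scope ring_scope.

(** * Square-integrable functions and dense families *)

(** The index k counts actual weak eigenfunctions, not min-max values, so the two inequalities
    differ in nature. A lower bound only uses the traces of given eigenfunctions and their Fourier
    coefficients; an upper bound needs k + 1 independent eigenfunctions to exist, which is why the
    deflation is carried out. The infimum of an empty or unbounded set is a default value, so each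
    estimate also rests on a nonempty set and on the lower bound 0. Traces are specified by the
    Gauss-Green formula, so no trace operator is built. Testing with harmonic polynomials turns
    eigenfunctions into coefficients. Conversely, the series of harmonic polynomials must converge,
    which asks for more than finite energy: the eigenvalue equation itself makes freq k x_k
    square-summable, hence the coefficients absolutely summable. Compactness is that of a product of
    intervals, in which the energy ball is closed and the form is a uniform limit. Completeness of
    trigonometric functions and of polynomials comes from multipliers of the closed span. *)

Section SquareIntegrable.
Context d (T : measurableType d) (R : realType) (mu : {measure set T -> \bar R}).
Variable D : set T.
Hypothesis mD : measurable D.
Hypothesis muD : (mu D < +oo)%E.
Implicit Types f g h : T -> R.

Definition intg f := mu.-integrable D (EFin \o f).
Definition bddm f :=
  measurable_fun D f /\ exists C, forall x, D x -> `|f x| <= C.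
Definition sqint f := measurable_fun D f /\ intg (fun x => f x ^+ 2).
Definition rint f := \int[mu]_(x in D) f x.

Lemma intg_meas f : intg f -> measurable_fun D f.
Proof. by move=> /integrableP[/measurable_EFinP]. Qed.

Lemma intg_le f g : measurable_fun D f -> (forall x, D x -> `|f x| <= g x) ->
  intg g -> intg f.
Proof.
move=> mf fg ig; apply: le_integrable ig => //.
  exact/measurable_EFinP.
by move=> x Dx /=; rewrite lee_fin (le_trans (fg _ Dx))// ler_norm.
Qed.

Lemma eq_intg f g : (forall x, D x -> f x = g x) -> intg f -> intg g.
Proof.
move=> fg; apply: eq_integrable => // x /set_mem Dx /=; by rewrite fg.
Qed.

Lemma eq_rint f g : (forall x, D x -> f x = g x) -> rint f = rint g.
Proof. by move=> fg; apply: eq_Rintegral => x /set_mem; exact: fg. Qed.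

Lemma intg_cst c : intg (cst c).
Proof.
apply: measurable_bounded_integrable => //.
by exists `|c|; split; rewrite ?num_real// => M cM x Dx; exact: ltW.
Qed.

Lemma intg_bdd f : bddm f -> intg f.
Proof.
move=> [mf [C fC]]; apply: (@intg_le _ (cst C)) => //; exact: intg_cst.
Qed.

Lemma intgD f g : intg f -> intg g -> intg (fun x => f x + g x).
Proof. by move=> hf hg; have := integrableD mD hf hg. Qed.

Lemma intgB f g : intg f -> intg g -> intg (fun x => f x - g x).
Proof. by move=> hf hg; have := integrableB mD hf hg. Qed.

Lemma intgZ c f : intg f -> intg (fun x => c * f x).
Proof. by move=> hf; have := integrableZl mD c hf. Qed.

Lemma intg0 : intg (fun=> 0).
Proof. exact: intg_cst. Qed.

Lemma intg_sum (I : Type) (s : seq I) (F : I -> T -> R) :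
  (forall i, intg (F i)) -> intg (fun x => \sum_(i <- s) F i x).
Proof.
move=> hF; elim: s => [|i s IH].
  by apply: eq_intg intg0 => x _; rewrite big_nil.
by apply: eq_intg (intgD (hF i) IH) => x _; rewrite big_cons.
Qed.

Lemma rint_sum (I : Type) (s : seq I) (F : I -> T -> R) :
  (forall i, intg (F i)) ->
  rint (fun x => \sum_(i <- s) F i x) = \sum_(i <- s) rint (F i).
Proof.
move=> hF; elim: s => [|i s IH].
  rewrite big_nil /rint; under eq_Rintegral do rewrite big_nil.
  by rewrite Rintegral_cst// mul0r.
rewrite big_cons -IH /rint -RintegralD//; [|exact: hF|exact: intg_sum].
by apply: eq_Rintegral => x _; rewrite big_cons.
Qed.

Lemma rintD f g : intg f -> intg g ->
  rint (fun x => f x + g x) = rint f + rint g.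
Proof. by move=> hf hg; rewrite /rint RintegralD. Qed.

Lemma rintB f g : intg f -> intg g ->
  rint (fun x => f x - g x) = rint f - rint g.
Proof. by move=> hf hg; rewrite /rint RintegralB. Qed.

Lemma rintZ c f : intg f -> rint (fun x => c * f x) = c * rint f.
Proof. by move=> hf; rewrite /rint RintegralZl. Qed.

Lemma rint_le f g : intg f -> intg g -> (forall x, D x -> f x <= g x) ->
  rint f <= rint g.
Proof. by move=> hf hg fg; exact: le_Rintegral. Qed.

Lemma rint_ge0 f : (forall x, D x -> 0 <= f x) -> 0 <= rint f.
Proof. exact: Rintegral_ge0. Qed.

Lemma bddm_mul f g : bddm f -> bddm g -> bddm (fun x => f x * g x).
Proof.
move=> [mf [C fC]] [mg [C' gC]]; split; first exact: measurable_funM.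
by exists (C * C') => x Dx; rewrite normrM ler_pM// ?fC ?gC.
Qed.

Lemma bddm_add f g : bddm f -> bddm g -> bddm (fun x => f x + g x).
Proof.
move=> [mf [C fC]] [mg [C' gC]]; split; first exact: measurable_funD.
by exists (C + C') => x Dx; rewrite (le_trans (ler_normD _ _))// lerD// ?fC ?gC.
Qed.

Lemma bddm_cst c : bddm (cst c).
Proof. by split; [exact: measurable_cst|exists `|c|]. Qed.

Lemma bddmZ c f : bddm f -> bddm (fun x => c * f x).
Proof. exact: (bddm_mul (bddm_cst c)). Qed.

Lemma bddm_sum (I : Type) (s : seq I) (F : I -> T -> R) :
  (forall i, bddm (F i)) -> bddm (fun x => \sum_(i <- s) F i x).
Proof.
move=> hF; elim: s => [|i s IH].
  by under eq_fun do rewrite big_nil; exact: bddm_cst.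
by under eq_fun do rewrite big_cons; exact: bddm_add.
Qed.

Lemma sq_mul f g : sqint f -> sqint g -> intg (fun x => f x * g x).
Proof.
move=> [mf if2] [mg ig2].
apply: (@intg_le _ (fun x => f x ^+ 2 + g x ^+ 2)).
- exact: measurable_funM.
- move=> x _; rewrite ler_norml; apply/andP; split; nra.
- exact: intgD.
Qed.

Lemma sq_bdd f : bddm f -> sqint f.
Proof.
move=> bf; split; first by case: bf.
by apply: eq_intg (intg_bdd (bddm_mul bf bf)) => x _; rewrite expr2.
Qed.

Lemma sq_add f g : sqint f -> sqint g -> sqint (fun x => f x + g x).
Proof.
move=> hf hg; have [mf if2] := hf; have [mg ig2] := hg.
split; first exact: measurable_funD.
apply: eq_intg (intgD (intgD if2 ig2) (intgZ 2 (sq_mul hf hg))) => x _; ring.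
Qed.

Lemma sq_mulb f g : bddm f -> sqint g -> sqint (fun x => f x * g x).
Proof.
move=> [mf [C fC]] [mg ig2]; split; first exact: measurable_funM.
apply: (@intg_le _ (fun x => C ^+ 2 * g x ^+ 2)); last exact: intgZ.
  by apply: measurable_funX; exact: measurable_funM.
move=> x Dx; rewrite ger0_norm ?sqr_ge0// exprMn ler_wpM2r ?sqr_ge0//.
by rewrite -(ger0_norm (sqr_ge0 (f x))) normrX lerXn2r ?nnegrE// ?fC// (le_trans _ (fC _ Dx)).
Qed.

Lemma sqZ c f : sqint f -> sqint (fun x => c * f x).
Proof. exact: (sq_mulb (bddm_cst c)). Qed.

Lemma sqB f g : sqint f -> sqint g -> sqint (fun x => f x - g x).
Proof.
move=> hf hg; have := sq_add hf (sqZ (-1) hg).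
by under eq_fun do rewrite mulN1r.
Qed.

Lemma sq_sum (I : Type) (s : seq I) (F : I -> T -> R) :
  (forall i, sqint (F i)) -> sqint (fun x => \sum_(i <- s) F i x).
Proof.
move=> hF; elim: s => [|i s IH].
  under eq_fun do rewrite big_nil; apply: sq_bdd; exact: bddm_cst.
by under eq_fun do rewrite big_cons; exact: sq_add.
Qed.

Lemma eq_sqint f g : (forall x, D x -> f x = g x) -> sqint f -> sqint g.
Proof.
move=> fg [mf if2]; split.
  by apply: eq_measurable_fun mf => x /set_mem /fg.
by apply: eq_intg if2 => x /fg ->.
Qed.

(** Cauchy-Schwarz as a weighted mean inequality, from c (f - s g / c)^2 >= 0 with s = 1 or s = -1.
    The free weight c replaces square roots and decides which factor gets the small constant. *)
Lemma rint_amgm (c : R) f g : 0 < c -> sqint f -> sqint g ->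
  2 * `|rint (fun x => f x * g x)| <=
  c * rint (fun x => f x ^+ 2) + c^-1 * rint (fun x => g x ^+ 2).
Proof.
move=> c0 hf hg.
have ifg := sq_mul hf hg.
have [_ if2] := hf; have [_ ig2] := hg.
have cV : c * c^-1 = 1 by rewrite divff ?gt_eqF.
have cV0 : 0 < c^-1 by rewrite invr_gt0.
rewrite -!rintZ// -rintD; [|exact: intgZ|exact: intgZ].
have key (s : R) : s = 1 \/ s = -1 -> s * (2 * rint (fun x => f x * g x)) <=
    rint (fun x => c * f x ^+ 2 + c^-1 * g x ^+ 2).
  move=> hs; rewrite -!rintZ//; last exact: intgZ.
  apply: rint_le; [exact/intgZ/intgZ|by apply: intgD; exact: intgZ|].
  move=> x _.
  have : 0 <= c * (f x - s * (c^-1 * g x)) ^+ 2 by rewrite mulr_ge0 ?sqr_ge0// ltW.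
  have -> : c * (f x - s * (c^-1 * g x)) ^+ 2 =
    c * f x ^+ 2 + (c * c^-1) * s ^+ 2 * c^-1 * g x ^+ 2 - s * (2 * (f x * g x)) * (c * c^-1) by ring.
  rewrite cV; case: hs => ->; lra.
have [h|h] := leP 0 (rint (fun x => f x * g x)).
  by rewrite ger0_norm//; have := key 1 (or_introl erefl); rewrite mul1r.
by rewrite ltr0_norm//; have := key (-1) (or_intror erefl); rewrite mulN1r mulrN.
Qed.

Lemma sq_cvg_mul f g (g_ : nat -> T -> R) : sqint f -> sqint g ->
  (forall n, sqint (g_ n)) ->
  (fun n => rint (fun x => (g_ n x - g x) ^+ 2)) @ \oo --> (0 : R) ->
  (fun n => rint (fun x => f x * g_ n x)) @ \oo --> rint (fun x => f x * g x).
Proof.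
move=> hf hg hg_ cv.
set F := rint (fun x => f x ^+ 2).
have F0 : 0 <= F by apply: rint_ge0 => x _; rewrite sqr_ge0.
apply/cvgrPdist_le => e e0.
(* The added 1 avoids a division by 0 when f is null; c * F <= e holds in all cases. *)
pose c := e / (F + 1).
have c0 : 0 < c by rewrite divr_gt0// ltr_wpDl.
have cF : c * F <= e.
  by rewrite /c mulrAC ler_pdivrMr ?ltr_wpDl// ler_pM2l// lerDl.
have ce0 : 0 < c * e by rewrite mulr_gt0.
move/cvgrPdist_le : cv => /(_ (c * e) ce0); apply: filterS => n /=.
rewrite sub0r normrN => hn.
have -> : rint (fun x => f x * g x) - rint (fun x => f x * g_ n x) =
   - rint (fun x => f x * (g_ n x - g x)).
  rewrite -rintB; [|exact: sq_mul..].
  rewrite -[RHS]mulN1r -rintZ; last exact/sq_mul/sqB.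
  by apply: eq_rint => x _; ring.
rewrite normrN.
have := rint_amgm c0 hf (sqB (hg_ n) hg).
have hle : c^-1 * rint (fun x => (g_ n x - g x) ^+ 2) <= e.
  by rewrite ler_pdivrMl// (le_trans _ hn)// ler_norm.
rewrite -/F; lra.
Qed.

(** A weight of order 1 / e on the vanishing term leaves at most e from the other one. *)
Lemma sq_null_mul f g : sqint f -> sqint g -> rint (fun x => f x ^+ 2) = 0 ->
  rint (fun x => f x * g x) = 0.
Proof.
move=> hf hg f0.
have hle (e : R) : 0 < e -> `|rint (fun x => f x * g x)| <= 0 + e.
  move=> e0.
  have G0 : 0 <= rint (fun x => g x ^+ 2) by apply: rint_ge0 => x _; rewrite sqr_ge0.
  set G := rint (fun x => g x ^+ 2) in G0 *.
  have c0 : 0 < (G + 1) / e by rewrite divr_gt0// ltr_wpDl.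
  have := rint_amgm c0 hf hg; rewrite f0 mulr0 add0r invf_div -/G => h.
  have : e / (G + 1) * G <= e.
    by rewrite mulrAC ler_pdivrMr ?ltr_wpDl// ler_pM2l// lerDl.
  lra.
by apply/eqP; rewrite -normr_le0; apply/ler_addgt0Pr.
Qed.

Lemma sq_null_ae f : sqint f -> rint (fun x => f x ^+ 2) = 0 ->
  {ae mu, forall x, D x -> f x = 0}.
Proof.
move=> [mf if2] f0.
have h : (\int[mu]_(x in D) `|(f x ^+ 2)%:E| = 0)%E.
  under eq_integral => x _ do rewrite gee0_abs ?lee_fin ?sqr_ge0//.
  have := f0; rewrite /rint /Rintegral => h.
  rewrite -(fineK (integrable_fin_num mD if2)) /=; congr EFin; exact: h.
have m2 : measurable_fun D (EFin \o (fun x => f x ^+ 2)).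
  by apply/measurable_EFinP; exact: measurable_funX.
have := (ae_eq_integral_abs mu mD m2).1 h.
apply: filterS => x hx /hx /= [] /eqP; rewrite sqrf_eq0 => /eqP //.
Qed.

(** Stands in for completeness of L^2: the limit is already given pointwise, and Fatou's lemma in m,
    applied to (p_m - p_n)^2, hands the Cauchy rate t over to it. *)
Lemma sq_fatou (p_ : nat -> T -> R) (p : T -> R) (t : nat -> R) :
  (forall n, sqint (p_ n)) ->
  (forall x, D x -> (fun n => p_ n x) @ \oo --> p x) ->
  (forall n m, (n <= m)%N -> rint (fun x => (p_ m x - p_ n x) ^+ 2) <= t n) ->
  sqint p /\ forall n, rint (fun x => (p_ n x - p x) ^+ 2) <= t n.
Proof.
move=> hp cv ht.
have mp : measurable_fun D p.
  by apply: (measurable_fun_cvg _ cv) => n; case: (hp n).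
have key n : (\int[mu]_(x in D) ((p_ n x - p x) ^+ 2)%:E <= (t n)%:E)%E.
  pose F m x := ((p_ m x - p_ n x) ^+ 2)%:E.
  have mF m : measurable_fun D (F m).
    apply/measurable_EFinP; apply: measurable_funX; apply: measurable_funB;
    by case: (hp m); case: (hp n).
  have F0 m x : D x -> (0 <= F m x)%E by rewrite lee_fin sqr_ge0.
  have cvF x : D x -> (F ^~ x) @ \oo --> ((p_ n x - p x) ^+ 2)%:E.
    move=> Dx; apply: cvg_EFin; first by apply: nearW.
    rewrite -sqrrN opprB.
    rewrite expr2; apply: cvgM; (apply: cvgB; [exact: cv|exact: cvg_cst]).
  have := fatou mu mD mF F0.
  have -> : (\int[mu]_(x in D) limn_einf (F^~ x) = \int[mu]_(x in D) ((p_ n x - p x) ^+ 2)%:E)%E.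
    apply: eq_integral => x /set_mem Dx.
    by rewrite is_cvg_limn_einfE; [apply/cvg_lim => //; exact: cvF|apply/cvg_ex; eexists; exact: cvF].
  move=> /le_trans; apply.
  rewrite limn_einf_lim.
  apply: lime_le; first exact: is_cvg_einfs.
  near=> m.
  apply: (@le_trans _ _ (\int[mu]_(x in D) F m x)%E).
    by apply: ereal_inf_lbound; exists m => /=.
  have [_ i1] := sqB (hp m) (hp n).
  rewrite -(fineK (integrable_fin_num mD i1)) lee_fin.
  apply: ht; by near: m; exists n.
have h n : sqint (fun x => p_ n x - p x).
  split; first by apply: measurable_funB => //; case: (hp n).
  apply/integrableP; split.
    apply/measurable_EFinP; apply: measurable_funX; apply: measurable_funB => //.
    by case: (hp n).
  apply: le_lt_trans (ltry (t n)); apply: le_trans (key n).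
  apply: ge0_le_integral => //.
  - apply/measurable_EFinP; apply: measurableT_comp => //; apply: measurable_funX.
    by apply: measurable_funB => //; case: (hp n).
  - by apply/measurable_EFinP; apply: measurable_funX; apply: measurable_funB => //; case: (hp n).
  - by move=> x _; rewrite lee_fin /= ger0_norm ?sqr_ge0.
split.
  by apply: eq_sqint (sqB (hp 0%N) (h 0%N)) => x _; ring.
move=> n; have [_ i1] := h n.
by rewrite -lee_fin /rint /Rintegral fineK ?(integrable_fin_num mD i1)// key.
Unshelve. all: by end_near. Qed.

End SquareIntegrable.

Arguments eq_rint {d T R mu D f} g.
Arguments intg_le {d T R mu D} mD [f] g.

(** * Closed span of a bounded family in L^2 and its multipliers *)

Section Density.
Context d (T : measurableType d) (R : realType) (mu : {measure set T -> \bar R}).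
Variable D : set T.
Hypothesis mD : measurable D.
Hypothesis muD : (mu D < +oo)%E.
Local Notation rint := (rint mu D).
Local Notation intg := (intg mu D).
Local Notation sqint := (sqint mu D).
Local Notation bddm := (@bddm _ T R D).

Lemma rint_dominated (f_ : nat -> T -> R) (f g : T -> R) :
  (forall n, measurable_fun D (f_ n)) ->
  (forall x, D x -> (fun n => f_ n x) @ \oo --> f x) ->
  (forall n x, D x -> `|f_ n x| <= g x) -> intg g ->
  intg f /\ (fun n => rint (f_ n)) @ \oo --> rint f.
Proof.
move=> mf_ cv le ig.
have mf : measurable_fun D f by apply: (measurable_fun_cvg mf_ cv).
have [i1 _ c1] : [/\ mu.-integrable D (EFin \o f),
  [sequence \int[mu]_(x in D) (`|(f_ n x)%:E - (f x)%:E|)]_n @ \oo --> 0%E &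
  [sequence \int[mu]_(x in D) ((f_ n x)%:E)]_n @ \oo --> (\int[mu]_(x in D) ((f x)%:E))%E ]%E.
  apply: (@dominated_convergence _ _ _ mu D mD (fun n => EFin \o f_ n) (EFin \o f) (EFin \o g)) => //.
  - by move=> n; apply/measurable_EFinP.
  - exact/measurable_EFinP.
  - by apply: nearW => x Dx; apply: cvg_EFin; [exact: nearW|exact: cv].
  - by apply: nearW => x n Dx /=; rewrite lee_fin le.
split => //; rewrite /rint /Rintegral; apply: fine_cvg.
by rewrite fineK ?(integrable_fin_num mD i1).
Qed.

Lemma cvg_sqrB (u : nat -> R) (a : R) : u @ \oo --> a ->
  (fun n => (a - u n) ^+ 2) @ \oo --> (0 : R).
Proof.
move=> cu; have h : (fun n => a - u n) @ \oo --> (0 : R).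
  by rewrite -(subrr a); apply: cvgB => //; exact: cvg_cst.
rewrite -(mul0r (0 : R)); under eq_fun do rewrite expr2; exact: (cvgM h h).
Qed.

Variables (I : Type) (e : I -> T -> R).
Hypothesis be : forall i, bddm (e i).

Definition comb (s : seq (R * I)) (x : T) := \sum_(p <- s) p.1 * e p.2 x.

Lemma bddm_comb s : bddm (comb s).
Proof. by apply: bddm_sum => p; exact: bddmZ. Qed.

Definition approximable f := sqint f /\
  forall eps, 0 < eps -> exists s, rint (fun x => (f x - comb s x) ^+ 2) <= eps.

Lemma comb_cat s s' x : comb (s ++ s') x = comb s x + comb s' x.
Proof. by rewrite /comb big_cat. Qed.

Lemma comb_scale c s x :
  comb [seq (c * p.1, p.2) | p <- s] x = c * comb s x.
Proof.
rewrite /comb big_map mulr_sumr; apply: eq_bigr => p _ /=; by rewrite mulrA.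
Qed.

Lemma rint_sqrD_le f g : sqint f -> sqint g ->
  rint (fun x => (f x + g x) ^+ 2) <=
  2 * rint (fun x => f x ^+ 2) + 2 * rint (fun x => g x ^+ 2).
Proof.
move=> hf hg; have [_ i1] := hf; have [_ i2] := hg; have [_ i3] := sq_add mD hf hg.
rewrite -!(rintZ mD)// -(rintD mD); [|exact: intgZ..].
apply: rint_le => //; first by apply: intgD => //; exact: intgZ.
by move=> x _; have := sqr_ge0 (f x - g x); nra.
Qed.

Lemma eq_approximable f g : (forall x, D x -> f x = g x) ->
  approximable f -> approximable g.
Proof.
move=> fg [hf af]; split; first exact: eq_sqint hf.
move=> eps /af [s hs]; exists s; rewrite (le_trans _ hs)//.
by rewrite (eq_rint (fun x => (f x - comb s x) ^+ 2))// => x /fg ->.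
Qed.

Lemma approximable_lim f : sqint f ->
  (forall eps, 0 < eps -> exists2 g, approximable g & rint (fun x => (f x - g x) ^+ 2) <= eps) ->
  approximable f.
Proof.
move=> hf hl; split => // eps eps0.
have e4 : 0 < eps / 4 by rewrite divr_gt0.
have [g [hg ag] fg] := hl _ e4.
have [s hs] := ag _ e4; exists s.
rewrite (eq_rint (fun x => ((f x - g x) + (g x - comb s x)) ^+ 2)); last first.
  by move=> x _; congr (_ ^+ 2); ring.
have hs2 : sqint (comb s) by apply: sq_bdd => //; exact: bddm_comb.
rewrite (le_trans (rint_sqrD_le (sqB mD hf hg) (sqB mD hg hs2)))//.
by move: fg hs; rewrite !ler_pdivlMr//; lra.
Qed.

Lemma approximableD f g : approximable f -> approximable g ->
  approximable (fun x => f x + g x).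
Proof.
move=> [hf af] [hg ag]; split; first exact: sq_add.
move=> eps eps0.
have e4 : 0 < eps / 4 by rewrite divr_gt0.
have [s hs] := af _ e4; have [s' hs'] := ag _ e4.
exists (s ++ s').
rewrite (eq_rint (fun x => ((f x - comb s x) + (g x - comb s' x)) ^+ 2)); last first.
  by move=> x _; rewrite comb_cat; congr (_ ^+ 2); ring.
have hc t : sqint (comb t) by apply: sq_bdd => //; exact: bddm_comb.
rewrite (le_trans (rint_sqrD_le (sqB mD hf (hc _)) (sqB mD hg (hc _))))//.
by move: hs hs'; rewrite !ler_pdivlMr//; lra.
Qed.

Lemma approximableZ c f : approximable f -> approximable (fun x => c * f x).
Proof.
move=> [hf af]; split; first exact: sqZ.
move=> eps eps0.
have c1 : 0 < c ^+ 2 + 1 by rewrite ltr_wpDl// sqr_ge0.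
have [s hs] := af (eps / (c ^+ 2 + 1)) (divr_gt0 eps0 c1).
exists [seq (c * p.1, p.2) | p <- s].
rewrite (eq_rint (fun x => c ^+ 2 * (f x - comb s x) ^+ 2)); last first.
  by move=> x _; rewrite comb_scale; ring.
have hc : sqint (comb s) by apply: sq_bdd => //; exact: bddm_comb.
rewrite rintZ//; last by case: (sqB mD hf hc).
rewrite (le_trans (ler_wpM2l (sqr_ge0 c) hs))// mulrCA ger_pMr//.
by rewrite ler_pdivrMr// mul1r lerDl.
Qed.

Lemma approximable0 : approximable (fun=> 0).
Proof.
split; first exact/sq_bdd/bddm_cst.
move=> eps e0; exists [::]; rewrite (eq_rint (fun=> 0)); last first.
  by move=> x _; rewrite /comb big_nil subr0 expr0n.
by rewrite /rint Rintegral_cst// mul0r ltW.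
Qed.

Lemma approximable_sum (J : Type) (s : seq J) (F : J -> T -> R) :
  (forall j, approximable (F j)) -> approximable (fun x => \sum_(j <- s) F j x).
Proof.
move=> hF; elim: s => [|j s IH].
  by under eq_fun do rewrite big_nil; exact: approximable0.
by under eq_fun do rewrite big_cons; exact: approximableD.
Qed.

Lemma approximable_gen i : approximable (e i).
Proof.
split; first exact: sq_bdd.
move=> eps e0; exists [:: (1, i)]; rewrite (eq_rint (fun=> 0)); last first.
  by move=> x _; rewrite /comb big_seq1 mul1r subrr expr0n.
by rewrite /rint Rintegral_cst// mul0r ltW.
Qed.

(* Multipliers of the closed span: they form an algebra stable under bounded
   pointwise limits, so the sets whose indicator is a multiplier form a
   sigma-algebra. *)
Definition multiplier f :=
  bddm f /\ forall h, approximable h -> approximable (fun x => f x * h x).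

Lemma eq_multiplier f g : (forall x, D x -> f x = g x) ->
  multiplier f -> multiplier g.
Proof.
move=> fg [[mf [C fC]] mult]; split.
  split; last by exists C => x Dx; rewrite -fg// fC.
  by apply: eq_measurable_fun mf => x /set_mem /fg.
by move=> h /mult; apply: eq_approximable => x /fg ->.
Qed.

Lemma multiplier_cst c : multiplier (cst c).
Proof. by split; [exact: bddm_cst|move=> h; exact: approximableZ]. Qed.

Lemma multiplierD f g : multiplier f -> multiplier g ->
  multiplier (fun x => f x + g x).
Proof.
move=> [bf mf] [bg mg]; split; first exact: bddm_add.
move=> h hh; apply: eq_approximable (approximableD (mf _ hh) (mg _ hh)) => x _.
by rewrite mulrDl.
Qed.

Lemma multiplierM f g : multiplier f -> multiplier g ->
  multiplier (fun x => f x * g x).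
Proof.
move=> [bf mf] [bg mg]; split; first exact: bddm_mul.
move=> h hh; apply: eq_approximable (mf _ (mg _ hh)) => x _.
by rewrite mulrA.
Qed.

Lemma multiplierX n f : multiplier f -> multiplier (fun x => f x ^+ n).
Proof.
move=> mf; elim: n => [|n IH]; first exact: multiplier_cst.
by under eq_fun do rewrite exprS; exact: multiplierM.
Qed.

Lemma multiplier_lim (f_ : nat -> T -> R) (f : T -> R) C :
  (forall n, multiplier (f_ n)) ->
  (forall n x, D x -> `|f_ n x| <= C) ->
  (forall x, D x -> (fun n => f_ n x) @ \oo --> f x) -> multiplier f.
Proof.
move=> mf_ fC cv.
have mf : measurable_fun D f.
  by apply: (measurable_fun_cvg _ cv) => n; case: (mf_ n) => -[].
have fC' x : D x -> `|f x| <= C.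
  move=> Dx; apply: (@cvgr_to_le _ \oo _ _ (fun n => `|f_ n x|)).
    by apply: cvg_norm; exact: cv.
  by apply: nearW => n; exact: fC.
have bf : bddm f by split => //; exists C.
split=> // h ah; have [hh _] := ah.
apply: approximable_lim; first exact: sq_mulb.
move=> eps eps0.
pose F n x := (f x * h x - f_ n x * h x) ^+ 2.
have hF n : sqint (fun x => f x * h x - f_ n x * h x).
  by apply: sqB => //; apply: sq_mulb => //; case: (mf_ n).
have [_ cF] : intg (fun=> 0) /\ (fun n => rint (F n)) @ \oo --> rint (fun=> 0).
  apply: (@rint_dominated F (fun=> 0) (fun x => 4 * C ^+ 2 * h x ^+ 2)).
  - by move=> n; apply: measurable_funX; case: (hF n).
  - move=> x Dx; apply: cvg_sqrB; apply: cvgMr_tmp; exact: cv.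
  - move=> n x Dx; rewrite /F ger0_norm ?sqr_ge0// -mulrBl exprMn.
    rewrite ler_wpM2r ?sqr_ge0//.
    have := fC n _ Dx; have := fC' _ Dx; rewrite !ler_norml => /andP[? ?] /andP[? ?].
    nra.
  - by apply: intgZ => //; case: hh.
have r0 : rint (fun=> 0) = 0 by rewrite /rint Rintegral_cst// mul0r.
rewrite r0 in cF.
move/cvgrPdist_le : cF => /(_ _ eps0) [N _ /(_ N (leqnn N))].
rewrite sub0r normrN => hN.
exists (fun x => f_ N x * h x); first by case: (mf_ N) => _; exact.
by rewrite (le_trans _ hN)// ler_norm.
Qed.

(** Such an f sends finite combinations to finite combinations, and multiplication by a bounded
    function is continuous in L^2. *)
Lemma multiplier_gen f : bddm f ->
  (forall i, exists s, forall x, D x -> f x * e i x = comb s x) -> multiplier f.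
Proof.
move=> bf hf; split => // h [hh ah].
have [_ [C fC]] := bf.
have ac s : approximable (comb s).
  by apply: approximable_sum => p; apply: approximableZ; exact: approximable_gen.
apply: approximable_lim; first exact: sq_mulb.
move=> eps eps0.
have C0 : 0 < C ^+ 2 + 1 by rewrite ltr_wpDl// sqr_ge0.
have [s hs] := ah _ (divr_gt0 eps0 C0).
exists (fun x => f x * comb s x).
  have /choice [F hF] := hf.
  apply: (@eq_approximable (fun x => \sum_(p <- s) p.1 * comb (F p.2) x)).
    move=> x Dx; rewrite /comb mulr_sumr; apply: eq_bigr => p _.
    by rewrite mulrCA -/(comb _ _) hF.
  by apply: approximable_sum => p; apply: approximableZ; exact: ac.
have hc : sqint (fun x => h x - comb s x) by apply: sqB => //; case: (ac s).
have [_ i1] := hc.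
apply: (@le_trans _ _ (rint (fun x => C ^+ 2 * (h x - comb s x) ^+ 2))).
  apply: rint_le => //; last 2 first.
  - exact: intgZ.
  - move=> x Dx; rewrite -mulrBr exprMn ler_wpM2r ?sqr_ge0//.
    have := fC _ Dx; rewrite ler_norml => /andP[? ?]; nra.
  apply: (@eq_intg _ _ _ _ _ mD (fun x => (f x * (h x - comb s x)) ^+ 2)).
    by move=> x _; rewrite mulrBr.
  by case: (sq_mulb mD bf hc).
rewrite rintZ// (le_trans (ler_wpM2l (sqr_ge0 C) hs))// mulrCA ger_pMr//.
by rewrite ler_pdivrMr// mul1r lerDl.
Qed.

Definition multset A := multiplier (\1_A).

Lemma multset_sigma_algebra : sigma_algebra setT multset.
Proof.
have mC A : multset A -> multset (~` A).
  move=> mA; have := multiplierD (multiplier_cst 1) (multiplierM (multiplier_cst (-1)) mA).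
  apply: eq_multiplier => x _; rewrite /cst !indicE in_setC; case: (x \in A) => /=; ring.
have mU A B : multset A -> multset B -> multset (A `|` B).
  move=> mA mB; rewrite -(setCK (_ `|` _)) setCU; apply: (mC).
  have := multiplierM (mC _ mA) (mC _ mB).
  by apply: eq_multiplier => x _; rewrite indicI.
have m0 : multset set0.
  by apply: eq_multiplier (multiplier_cst 0) => x _; rewrite indic0.
split => //; first by move=> A /mC; rewrite setTD.
(* Finite unions have indicators bounded by 1 that converge pointwise to that of the countable
   union. *)
move=> A mA; pose B n := \big[setU/set0]_(i < n) A i.
apply: (@multiplier_lim (fun n => \1_(B n)) _ 1).
- move=> n; rewrite /B; elim: n => [|n IH]; first by rewrite big_ord0.
  by rewrite big_ord_recr; exact: mU.
- by move=> n x _; rewrite indicE; case: (_ \in _); rewrite ?normr1 ?normr0.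
- move=> x _.
  have [[n _ An]|nA] := pselect ((\bigcup_k A k) x).
    apply: cvg_near_cst; exists n.+1 => // m /= nm.
    rewrite !indicE !mem_set//; first by exists n.
    by rewrite /B -bigcup_mkord; exists n.
  have -> : (fun n => \1_(B n) x) = (fun=> \1_(\bigcup_k A k) x :> R).
    apply/funext => n; rewrite !indicE; congr ((_ : bool)%:R).
    rewrite (memNset nA); apply/negbTE/negP => /set_mem.
    rewrite /B -bigcup_mkord => -[k _ Ak]; apply: nA; by exists k.
  exact: cvg_cst.
Qed.

(** The polynomial p(x) = 3 x^2 - 2 x^3 maps [0, 1] to itself, is symmetric about 1 / 2 and attracts
    the points below 1 / 2 to 0, hence those above to 1. Its iterates at a rescaled f converge to
    the indicator of f > c, except for the value 1 / 2 where f = c. *)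
Lemma multset_gt f c : multiplier f -> multset [set x | c < f x].
Proof.
move=> mf; have [[_ [K0 fK0]] _] := mf.
(* Scale for which [g] takes its values in [0, 1], the level c being sent to 1 / 2. *)
pose K := `|K0| + `|c| + 1.
have K1 : 0 < K by rewrite ltr_wpDl// addr_ge0.
pose p (x : R) := 3 * x ^+ 2 - 2 * x ^+ 3.
pose g x := 2^-1 + (f x - c) / (2 * K).
have g01 x : D x -> 0 <= g x <= 1.
  move=> Dx; have := fK0 _ Dx; rewrite ler_norml => /andP[h1 h2].
  have : K0 <= `|K0| := ler_norm _.
  have : c <= `|c| := ler_norm _; have : - c <= `|c| by rewrite -normrN ler_norm.
  move=> ? ? ?.
  have hK : `|(f x - c) / (2 * K)| <= 2^-1.
    rewrite normrM normfV ler_pdivrMr ?normr_gt0 ?gt_eqF ?mulr_gt0//.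
    rewrite (gtr0_norm (_ : 0 < 2 * K)) ?mulr_gt0// mulKf// ler_norml /K; apply/andP; split; lra.
  by move: hK; rewrite ler_norml /g => /andP[? ?]; apply/andP; split; lra.
have mp h : multiplier h -> multiplier (fun x => p (h x)).
  move=> mh; have := multiplierD (multiplierM (multiplier_cst 3) (multiplierX 2 mh))
    (multiplierM (multiplier_cst (-2)) (multiplierX 3 mh)).
  by apply: eq_multiplier => x _; rewrite /p /cst mulNr.
have mg : multiplier g.
  have := multiplierD (multiplier_cst 2^-1) (multiplierM (multiplier_cst (2 * K)^-1)
    (multiplierD mf (multiplier_cst (- c)))).
  by apply: eq_multiplier => x _; rewrite /g /cst mulrC.
have p01 x : 0 <= x <= 1 -> 0 <= p x <= 1.
  move=> /andP[x0 x1]; apply/andP; split.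
    have -> : p x = x ^+ 2 * (3 - 2 * x) by rewrite /p; ring.
    by rewrite mulr_ge0 ?sqr_ge0//; lra.
  rewrite -subr_ge0; have -> : 1 - p x = (1 - x) ^+ 2 * (1 + 2 * x) by rewrite /p; ring.
  by rewrite mulr_ge0 ?sqr_ge0//; lra.
have it01 n x : 0 <= x <= 1 -> 0 <= iter n p x <= 1.
  by move=> hx; elim: n => //= n IH; exact: p01.
have psym x : p (1 - x) = 1 - p x by rewrite /p; ring.
have itsym n x : iter n p (1 - x) = 1 - iter n p x.
  by elim: n => //= n ->.
have lim0 x : 0 <= x < 2^-1 -> (fun n => iter n p x) @ \oo --> (0 : R).
  move=> /andP[x0 x1].
  (* p y = (1 - (1 - y) (1 - 2 y)) y, and this factor increases with y on [0, 1 / 2]; along the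
     decreasing orbit of x it is thus at most its value q at x. *)
  pose q := 1 - (1 - x) * (1 - 2 * x).
  have q0 : 0 <= q by rewrite /q; nra.
  have q1 : q < 1 by rewrite /q ltrBlDr ltrDl mulr_gt0//; lra.
  have hq n : 0 <= iter n p x <= q ^+ n * x /\ iter n p x <= x.
    elim: n => [|n [/andP[h0 h1] h2]]; first by rewrite /= expr0 mul1r lexx x0.
    set y := iter n p x in h0 h1 h2 *.
    have hy : p y <= q * y.
      have -> : p y = (1 - (1 - y) * (1 - 2 * y)) * y by rewrite /p; ring.
      rewrite ler_wpM2r// /q; nra.
    have /andP[py0 _] : 0 <= p y <= 1 by apply: p01; apply/andP; split => //; lra.
    rewrite iterS -/y exprS -mulrA py0 (le_trans hy) ?ler_wpM2l//; split => //.
    by rewrite (le_trans hy)// (le_trans _ h2)// ler_piMl// ltW.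
  apply: (@squeeze_cvgr _ _ _ _ (fun=> 0) (fun n => q ^+ n * x)).
  - by apply: nearW => n; case: (hq n).
  - exact: cvg_cst.
  - rewrite -[X in _ --> X](mul0r x); apply: cvgMr_tmp; apply: cvg_expr.
    by rewrite ger0_norm.
pose h x : R := if c < f x then 1 else if f x == c then 2^-1 else 0.
have mh : multiplier h.
  apply: (@multiplier_lim (fun n x => iter n p (g x)) _ 1).
  - by elim => [|n IH] //=; exact: mp.
  - move=> n x Dx; have /andP[? ?] := it01 n _ (g01 _ Dx).
    by rewrite ger0_norm.
  - move=> x Dx; rewrite /h; have /andP[gx0 gx1] := g01 _ Dx.
    have [cf|fc|fc] := ltgtP c (f x).
    + have -> : (fun n => iter n p (g x)) = (fun n => 1 - iter n p (1 - g x)).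
        by apply/funext => n; rewrite itsym opprB addrC subrK.
      rewrite -[X in _ --> X]subr0; apply: cvgB; first exact: cvg_cst.
      apply: lim0; rewrite subr_ge0 gx1 /=.
      have : 0 < (f x - c) / (2 * K) by rewrite divr_gt0 ?mulr_gt0// subr_gt0.
      by rewrite /g; lra.
    + apply: lim0; rewrite gx0 /=.
      have : 0 < (c - f x) / (2 * K) by rewrite divr_gt0 ?mulr_gt0// subr_gt0.
      by rewrite /g -opprB mulNr; lra.
    + have -> : g x = 2^-1 by rewrite /g fc subrr mul0r addr0.
      have -> : (fun n => iter n p 2^-1) = fun=> 2^-1.
        by apply/funext; elim => //= n ->; rewrite /p; field.
      exact: cvg_cst.
(* Powers keep the values 0 and 1 and send the remaining value 1 / 2 to 0. *)
apply: (@multiplier_lim (fun n x => h x ^+ n.+1) _ 1).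
- by move=> n; exact: multiplierX.
- move=> n x _; rewrite normrX exprn_ile1// /h.
  case: ifP => _; rewrite ?normr1//; case: ifP => _; rewrite ?normr0//.
  by rewrite ger0_norm// invf_le1// ler1n.
- move=> x _; rewrite indicE /h; have [cf|fc|fc] := ltgtP c (f x).
  + rewrite mem_set//; under eq_fun do rewrite expr1n; exact: cvg_cst.
  + rewrite memNset/=; last by move/lt_trans => /(_ _ fc); rewrite ltxx.
    under eq_fun do rewrite expr0n; exact: cvg_cst.
  + rewrite memNset/= ?fc ?ltxx//.
    rewrite (_ : (fun n => 2^-1 ^+ n.+1) = (fun n => 2^-1 * 2^-1 ^+ n)); last first.
      by apply/funext => n; rewrite exprS.
    rewrite [X in _ --> X](_ : _ = 2^-1 * 0); last by rewrite mulr0.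
    apply: cvgMl_tmp; apply: cvg_expr.
    by rewrite ger0_norm// invf_lt1// ltr1n.
Qed.

(** Indicators, then simple functions, then nonnegative functions by domination, then the difference
    of positive and negative parts. *)
Lemma sq_approximable f : approximable (cst 1) ->
  (forall A, measurable A -> multset A) -> sqint f -> approximable f.
Proof.
move=> a1 mm.
have ai A : measurable A -> approximable (\1_A).
  move=> mA; have [_ /(_ _ a1)] := mm _ mA.
  by apply: eq_approximable => x _; rewrite mulr1.
have pos g : sqint g -> (forall x, D x -> 0 <= g x) -> approximable g.
  move=> hg g0; have [mg ig] := hg.
  have mEg : measurable_fun D (EFin \o g) by exact/measurable_EFinP.
  pose s_ n := nnsfun_approx mD mEg n.
  pose g_ (n : nat) : T -> R := fun x => s_ n x.
  have cv x : D x -> (fun n => g_ n x) @ \oo --> g x.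
    move=> Dx; have := cvg_nnsfun_approx mD mEg (fun y Dy => g0 y Dy) Dx.
    by move/fine_cvg; rewrite /=; apply: cvg_trans; apply: near_eq_cvg; exact: nearW.
  have le n x : D x -> g_ n x <= g x.
    move=> Dx; rewrite -(cvg_lim _ (cv x Dx))//; apply: nondecreasing_cvgn_le.
      by move=> a b ab; have /lefP := nd_nnsfun_approx mD mEg ab; exact.
    by apply/cvg_ex; eexists; exact: cv.
  have mg_ n : measurable_fun D (g_ n) by exact: measurable_funTS.
  have sg n : sqint (g_ n).
    split => //; apply: (intg_le mD (fun x => g x ^+ 2)) => //.
      exact: measurable_funX.
    move=> x Dx; rewrite ger0_norm ?sqr_ge0// lerXn2r ?nnegrE ?g0 ?le//.
  apply: approximable_lim => // eps eps0.
  have [_ cF] : intg (fun=> 0) /\ (fun n => rint (fun x => (g x - g_ n x) ^+ 2)) @ \oo --> rint (fun=> 0).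
    apply: (@rint_dominated _ (fun=> 0) (fun x => g x ^+ 2)) => //.
    - by move=> n; apply: measurable_funX; exact: measurable_funB.
    - by move=> x Dx; apply: cvg_sqrB; exact: cv.
    - move=> n x Dx; rewrite ger0_norm ?sqr_ge0//.
      have := le n _ Dx; have : 0 <= g_ n x by []. nra.
  have r0 : rint (fun=> 0) = 0 by rewrite /rint Rintegral_cst// mul0r.
  rewrite r0 in cF.
  move/cvgrPdist_le : cF => /(_ _ eps0) [N _ /(_ N (leqnn N))].
  rewrite sub0r normrN => hN.
  exists (g_ N); last by rewrite (le_trans _ hN)// ler_norm.
  apply: eq_approximable; first by move=> x _; rewrite /g_ (fimfunEord (s_ N)).
  under eq_fun do rewrite -(big_mkord xpredT (fun i => (_ : seq R)`_i * \1_(_ @^-1` [set (_ : seq R)`_i]) _)).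
  apply: approximable_sum => i; apply: approximableZ; apply: ai.
  exact: measurable_funPTI.
move=> hf; have [mf if2] := hf.
have hle (g : T -> R) : measurable_fun D g -> (forall x, D x -> `|g x| <= `|f x|) -> sqint g.
  move=> mg gf; split => //; apply: (intg_le mD (fun x => f x ^+ 2)) => //.
    exact: measurable_funX.
  move=> x Dx; rewrite ger0_norm ?sqr_ge0// -(ger0_norm (sqr_ge0 (f x))) -(ger0_norm (sqr_ge0 (g x))) !normrX.
  by rewrite lerXn2r ?nnegrE ?normr_ge0// gf.
have h1 : approximable (fun x => Num.max (f x) 0).
  apply: pos; last by move=> x _; rewrite le_max lexx orbT.
  apply: hle; first exact: measurable_maxr.
  by move=> x _; case: (leP (f x) 0) => h; rewrite ?normr0.
have h2 : approximable (fun x => Num.max (- f x) 0).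
  apply: pos; last by move=> x _; rewrite le_max lexx orbT.
  apply: hle; first by apply: measurable_maxr => //; exact: measurableT_comp.
  by move=> x _; case: (leP (- f x) 0) => h; rewrite ?normr0 ?normrN.
apply: eq_approximable (approximableD h1 (approximableZ (-1) h2)) => x _.
by case: (leP (f x) 0) => h; case: (leP (- f x) 0) => h'; lra.
Qed.

(** f is orthogonal to every combination s, so its square integral is at most that of f - s, which
    can be made small. *)
Lemma orthogonal_null f : approximable f ->
  (forall i, rint (fun x => f x * e i x) = 0) -> rint (fun x => f x ^+ 2) = 0.
Proof.
move=> [hf af] ort.
have ortc s : rint (fun x => f x * comb s x) = 0.
  rewrite (eq_rint (fun x => \sum_(p <- s) p.1 * (f x * e p.2 x))); last first.
    by move=> x _; rewrite mulr_sumr; apply: eq_bigr => p _; ring.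
  have ie i : intg (fun x => f x * e i x) by apply: sq_mul => //; exact: sq_bdd.
  rewrite rint_sum//; last by move=> p; exact: intgZ.
  by rewrite big1// => p _; rewrite rintZ// ort mulr0.
have f2 : 0 <= rint (fun x => f x ^+ 2) by apply: rint_ge0 => x _; rewrite sqr_ge0.
apply/eqP; rewrite eq_le f2 andbT; apply/ler_addgt0Pr => eps /af [s hs].
have hc : sqint (comb s) by apply: sq_bdd => //; exact: bddm_comb.
rewrite add0r (le_trans _ hs)//.
rewrite [leRHS](eq_rint (fun x => f x ^+ 2 - 2 * (f x * comb s x) + comb s x ^+ 2)); last first.
  by move=> x _; ring.
have [_ i1] := hf; have [_ i2] := hc; have i3 := sq_mul mD hf hc.
rewrite rintD//; last by apply: intgB => //; exact: intgZ.
rewrite rintB//; last exact: intgZ.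
rewrite rintZ// ortc mulr0 subr0 lerDl; apply: rint_ge0 => x _; exact: sqr_ge0.
Qed.

End Density.

(** * Fourier series on the circle *)

Section Circle.
Variable R : realType.
Local Notation leb1 := (@lebesgue_measure R).
Local Notation C := (@circle R).
Local Notation RT := (g_sigma_algebraType R.-ocitv.-measurable).
Local Notation bddmC := (@bddm _ RT R C).
Implicit Types f g h : R -> R.

Lemma two_pi_gt0 : 0 < 2 * pi :> R.
Proof. by rewrite mulr_gt0// pi_gt0. Qed.

Lemma measurable_circle : measurable (C : set RT).
Proof. exact: measurable_itv. Qed.
Local Notation mC := measurable_circle.

Lemma lebesgue_circle : leb1 C = (2 * pi)%:E.
Proof.
by rewrite /circle lebesgue_measure_itv/= lte_fin two_pi_gt0 -EFinD subr0.
Qed.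

Lemma lebesgue_circle_fin : (leb1 C < +oo)%E.
Proof. by rewrite lebesgue_circle ltry. Qed.
Local Notation muC := lebesgue_circle_fin.

Lemma bddm_continuous f : continuous f -> bddmC f.
Proof.
move=> cf; split; first by apply: measurable_funTS; exact: continuous_measurable_fun.
have [M _ hM] : exists2 M : R, True & forall x, x \in `[0, 2 * pi] -> `|f x| <= M.
  have [c _ hc] := @EVT_max R (fun x => `|f x|) 0 (2 * pi) (ltW two_pi_gt0)
    (continuous_subspaceT (fun x => continuous_comp (cf x) (@norm_continuous _ R^o _))).
  by exists `|f c|.
by exists M => x; rewrite /circle /= => hx; apply: hM; move: hx; rewrite !in_itv/= => /andP[-> /ltW].
Qed.

Lemma rint_itv_FTC (F f : R -> R) (a b : R) : a <= b ->
  (forall x : R, is_derive x 1 F (f x)) -> continuous f ->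
  \int[leb1]_(x in `[a, b]) f x = F b - F a.
Proof.
rewrite le_eqVlt => /predU1P[<- _ _|ab dF cf].
  by rewrite set_itv1 Rintegral_set1 subrr.
rewrite /Rintegral (@continuous_FTC2 _ f F a b)//.
- exact: continuous_subspaceT.
- have cF x : {for x, continuous F}.
    apply: differentiable_continuous; apply/derivable1_diffP; by case: (dF x).
  split.
  + by move=> x _; case: (dF x).
  + by apply: cvg_at_right_filter; exact: cF.
  + by apply: cvg_at_left_filter; exact: cF.
- by move=> x _; rewrite derive1E; have [_ ->] := dF x.
Qed.

Lemma rint_circle_cst (c : R) : rint leb1 C (fun=> c) = c * (2 * pi).
Proof.
rewrite /rint Rintegral_cst; last exact: mC.
by rewrite [X in fine X]lebesgue_circle.
Qed.

Lemma eq_cint (g f : R -> R) : (forall t, C t -> f t = g t) ->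
  rint leb1 C f = rint leb1 C g.
Proof. exact: (@eq_rint _ _ R leb1 C f g). Qed.
Arguments eq_cint g {f} _.

Lemma rint_circleE f : intg leb1 C f ->
  rint leb1 C f = \int[leb1]_(x in `[0, 2 * pi]) f x.
Proof. by move=> h; rewrite /rint /circle Rintegral_itv_bndo_bndc. Qed.

Lemma rint_circle_FTC (F f : R -> R) :
  (forall x : R, is_derive x 1 F (f x)) -> continuous f ->
  rint leb1 C f = F (2 * pi) - F 0.
Proof.
move=> dF cf; rewrite rint_circleE; last first.
  by apply: (intg_bdd mC muC); exact: bddm_continuous.
exact: (rint_itv_FTC (ltW two_pi_gt0)).
Qed.

Lemma cos_int2pi (z : int) : cos (z%:~R * (2 * pi)) = 1 :> R.
Proof.
have hn (n : nat) : cos (n%:R * (2 * pi)) = 1 :> R.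
  elim: n => [|n IH]; first by rewrite mul0r cos0.
  by rewrite -natr1 mulrDl mul1r [2 * pi in X in _ + X]mulr_natl cosD2pi.
case: z => n; first exact: hn.
by rewrite NegzE rmorphN mulNr cosN; exact: hn.
Qed.

Lemma sin_int2pi (z : int) : sin (z%:~R * (2 * pi)) = 0 :> R.
Proof.
have := cos2Dsin2 (z%:~R * (2 * pi) : R); rewrite cos_int2pi expr1n => h.
by apply/eqP; rewrite -sqrf_eq0; apply/eqP; lra.
Qed.

Lemma continuous_cosM (a : R) : continuous (fun t => cos (a * t)).
Proof.
move=> t; apply: (@continuous_comp _ _ _ (fun t => a * t) cos); last exact: continuous_cos.
exact: mulrl_continuous.
Qed.

Lemma continuous_sinM (a : R) : continuous (fun t => sin (a * t)).
Proof.
move=> t; apply: (@continuous_comp _ _ _ (fun t => a * t) sin); last exact: continuous_sin.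
exact: mulrl_continuous.
Qed.

Lemma is_derive_sinM (a : R) (x : R) :
  is_derive x 1 (fun t => sin (a * t)) (a * cos (a * x)).
Proof.
have h : is_derive x 1 (fun t : R => a * t) a.
  by have := is_deriveZ a (is_derive_id x (1 : R)); rewrite /GRing.scale /= mulr1.
have := @is_derive1_comp R sin (fun t => a * t) x _ _ (is_derive_sin _) h.
by rewrite mulrC.
Qed.

Lemma is_derive_cosM (a : R) (x : R) :
  is_derive x 1 (fun t => cos (a * t)) (- (a * sin (a * x))).
Proof.
have h : is_derive x 1 (fun t : R => a * t) a.
  by have := is_deriveZ a (is_derive_id x (1 : R)); rewrite /GRing.scale /= mulr1.
have := @is_derive1_comp R cos (fun t => a * t) x _ _ (is_derive_cos _) h.
by rewrite mulNr mulrC.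
Qed.

Lemma rint_cosZ (z : int) :
  rint leb1 C (fun t => cos (z%:~R * t)) = if z == 0 then 2 * pi else 0.
Proof.
case: eqP => [->|/eqP z0].
  rewrite (eq_cint (fun=> 1)); last by move=> t _; rewrite mul0r cos0.
  by rewrite rint_circle_cst mul1r.
have zR : (z%:~R : R) != 0 by rewrite intr_eq0.
have hF (x : R) : is_derive x 1 (fun t => z%:~R^-1 * sin (z%:~R * t)) (cos (z%:~R * x)).
  have := is_deriveZ (z%:~R^-1 : R) (is_derive_sinM z%:~R x).
  by rewrite /GRing.scale /= mulKf.
rewrite (rint_circle_FTC hF); last exact: continuous_cosM.
by rewrite sin_int2pi !mulr0 sin0 mulr0 subrr.
Qed.

Lemma rint_sinZ (z : int) : rint leb1 C (fun t => sin (z%:~R * t)) = 0.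
Proof.
have [->|z0] := eqVneq z 0.
  rewrite (eq_cint (fun=> 0)); last by move=> t _; rewrite mul0r sin0.
  by rewrite rint_circle_cst mul0r.
have zR : (z%:~R : R) != 0 by rewrite intr_eq0.
have hF (x : R) : is_derive x 1 (fun t => - z%:~R^-1 * cos (z%:~R * t)) (sin (z%:~R * x)).
  have := is_deriveZ (- z%:~R^-1 : R) (is_derive_cosM z%:~R x).
  by rewrite /GRing.scale /= mulrNN mulKf.
rewrite (rint_circle_FTC hF); last exact: continuous_sinM.
by rewrite cos_int2pi !mulr0 cos0 subrr.
Qed.

Definition freq (k : nat) : R := (uphalf k)%:R.

(** The pair {2m - 1, 2m} holds the cosine and the sine of frequency m: the functions are listed in
    the order of the eigenvalues of a constant density, multiplicity included. *)
Definition basis (k : nat) (t : R) : R :=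
  if k == 0%N then (Num.sqrt (2 * pi))^-1
  else (Num.sqrt pi)^-1 *
    (if odd k then cos (freq k * t) else sin (freq k * t)).

Lemma continuous_basis k : continuous (basis k).
Proof.
rewrite /basis; case: eqP => _; first exact: cst_continuous.
move=> t; apply: cvgMl_tmp; case: ifP => _; [exact: continuous_cosM|exact: continuous_sinM].
Qed.

Lemma bddm_basis k : bddmC (basis k).
Proof. exact/bddm_continuous/continuous_basis. Qed.

Lemma basis_le1 k t : `|basis k t| <= 1.
Proof.
have h2 (x : R) : 1 <= x -> 0 <= (Num.sqrt x)^-1 <= 1.
  move=> x1; rewrite invr_ge0 sqrtr_ge0 invf_le1 ?sqrtr_gt0 ?(lt_le_trans ltr01)//=.
  by rewrite -(sqrtr1 R) ler_sqrt// (le_trans _ x1).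
have p2 : 2 <= pi :> R := pi_ge2 R.
rewrite /basis; case: eqP => _.
  have /andP[h0 h1] := h2 (2 * pi) ltac:(lra); by rewrite ger0_norm.
have /andP[h0 h1] := h2 pi ltac:(lra).
rewrite normrM (ger0_norm h0) -[leRHS]mulr1 ler_pM//.
by case: ifP => _; [exact: cos_max|exact: sin_max].
Qed.

Lemma rint_basis i j :
  rint leb1 C (fun t => basis i t * basis j t) = (i == j)%:R.
Proof.
have sp : (Num.sqrt pi)^-1 * (Num.sqrt pi)^-1 = pi^-1 :> R.
  by rewrite -invfM -expr2 sqr_sqrtr// pi_ge0.
have s2p : (Num.sqrt (2 * pi))^-1 * (Num.sqrt (2 * pi))^-1 = (2 * pi)^-1 :> R.
  by rewrite -invfM -expr2 sqr_sqrtr// ltW// two_pi_gt0.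
have pi0 : pi != 0 :> R by rewrite gt_eqF// pi_gt0.
have ic a : intg leb1 C (fun t : R => cos (a * t)).
  by apply: (intg_bdd mC muC); apply/bddm_continuous/continuous_cosM.
have is' a : intg leb1 C (fun t : R => sin (a * t)).
  by apply: (intg_bdd mC muC); apply/bddm_continuous/continuous_sinM.
have one k : (0 < k)%N -> rint leb1 C (fun t => if odd k then cos (freq k * t) else sin (freq k * t)) = 0.
  move=> k0; case: (odd k); last exact: (rint_sinZ (Posz (uphalf k))).
  rewrite (rint_cosZ (Posz (uphalf k))); case: eqP => // -[]; lia.
rewrite /basis; case: (posnP i) => [->|i0]; case: (posnP j) => [->|j0].
- rewrite eqxx s2p rint_circle_cst.
  by rewrite mulVf// gt_eqF// two_pi_gt0.
- rewrite (ltn_eqF j0).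
  rewrite (eq_cint (fun t => (Num.sqrt (2 * pi))^-1 * (Num.sqrt pi)^-1 *
      (if odd j then cos (freq j * t) else sin (freq j * t)))); last by move=> t _; rewrite mulrA.
  by rewrite (rintZ mC) ?one ?mulr0//; case: (odd _).
- rewrite (gtn_eqF i0).
  rewrite (eq_cint (fun t => (Num.sqrt (2 * pi))^-1 * (Num.sqrt pi)^-1 *
      (if odd i then cos (freq i * t) else sin (freq i * t)))); last by move=> t _; ring.
  by rewrite (rintZ mC) ?one ?mulr0//; case: (odd _).
set a : int := Posz (uphalf i); set b : int := Posz (uphalf j).
pose ci (z : int) t : R := cos (z%:~R * t).
pose si (z : int) t : R := sin (z%:~R * t).
have ab0 : (a + b == 0) = false by apply/eqP; rewrite /a /b; lia.
have ba0 : (a - b == 0) = (uphalf i == uphalf j) by rewrite subr_eq0.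
(* Common shape of the four product-to-sum formulas, with the frequencies a - b and a + b, of which
   only a - b can vanish. *)
have E (s : R) (u v : R -> R) (F : R -> R) : intg leb1 C u -> intg leb1 C v ->
   (forall t, F t = pi^-1 * 2^-1 * (u t + s * v t)) ->
   rint leb1 C F = pi^-1 * 2^-1 * (rint leb1 C u + s * rint leb1 C v).
  move=> iu iv hF; rewrite (eq_cint (fun t => pi^-1 * 2^-1 * (u t + s * v t)))//.
  rewrite (rintZ mC); last by apply: (intgD mC) => //; exact: (intgZ mC).
  by rewrite (rintD mC)// ?(rintZ mC)//; exact: (intgZ mC).
have ff (x y : R) : (Num.sqrt pi)^-1 * x * ((Num.sqrt pi)^-1 * y) = pi^-1 * (x * y).
  by rewrite -sp; ring.
case oi: (odd i); case oj: (odd j).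
- rewrite (E (1) (ci (a - b)) (ci (a + b)) _ (ic _) (ic _)); last first.
    move=> t; rewrite ff /ci rmorphB rmorphD mulrBl mulrDl cosB cosD /freq /a /b -mulrA; congr (_ * _); by field.
  rewrite !rint_cosZ ab0 ba0 mulr0 addr0.
  have -> : (uphalf i == uphalf j) = (i == j).
    by apply/eqP/eqP => [h|->//]; have := odd_double_half i; have := odd_double_half j; rewrite oi oj; lia.
  by case: eqP => _; rewrite ?mulr0//= -mulrA mulKf// mulVf.
- rewrite (E (-1) (si (a + b)) (si (a - b)) _ (is' _) (is' _)); last first.
    move=> t; rewrite ff /si rmorphB rmorphD mulrBl mulrDl sinB sinD /freq /a /b -mulrA; congr (_ * _); by field.
  rewrite !rint_sinZ mulr0 addr0 mulr0.
  by case: eqP => // ij; rewrite ij oj in oi.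
- rewrite (E (1) (si (a + b)) (si (a - b)) _ (is' _) (is' _)); last first.
    move=> t; rewrite ff /si rmorphB rmorphD mulrBl mulrDl sinB sinD /freq /a /b -mulrA; congr (_ * _); by field.
  rewrite !rint_sinZ mulr0 addr0 mulr0.
  by case: eqP => // ij; rewrite ij oj in oi.
- rewrite (E (-1) (ci (a - b)) (ci (a + b)) _ (ic _) (ic _)); last first.
    move=> t; rewrite ff /ci rmorphB rmorphD mulrBl mulrDl cosB cosD /freq /a /b -mulrA; congr (_ * _); by field.
  rewrite !rint_cosZ ab0 ba0 mulr0 addr0.
  have -> : (uphalf i == uphalf j) = (i == j).
    by apply/eqP/eqP => [h|->//]; have := odd_double_half i; have := odd_double_half j; rewrite oi oj; lia.
  by case: eqP => _; rewrite ?mulr0//= -mulrA mulKf// mulVf.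
Qed.

Local Notation sqC := (@sqint _ RT R leb1 C).
Local Notation cint := (rint leb1 C).

Lemma sq_basis k : sqC (basis k).
Proof. by apply: (sq_bdd mC muC); exact: bddm_basis. Qed.

Definition fcoef f k : R := rint leb1 C (fun t => f t * basis k t).

Definition psum (x : nat -> R) N (t : R) := \sum_(k < N) x k * basis k t.

Lemma bddm_psum x N : bddmC (psum x N).
Proof. by apply: bddm_sum => k; apply: bddmZ; exact: bddm_basis. Qed.

Lemma sq_psum x N : sqC (psum x N).
Proof. by apply: (sq_bdd mC muC); exact: bddm_psum. Qed.

Lemma rint_mul_psum f x N : sqC f ->
  cint (fun t => f t * psum x N t) = \sum_(k < N) x k * fcoef f k.
Proof.
move=> hf; rewrite (eq_cint (fun t => \sum_(k < N) x k * (f t * basis k t))); last first.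
  by move=> t _; rewrite mulr_sumr; apply: eq_bigr => k _; rewrite mulrCA.
have ik k : intg leb1 C (fun t => f t * basis k t) by apply: (sq_mul mC) => //; exact: sq_basis.
rewrite (rint_sum mC muC); last by move=> k; exact: (intgZ mC).
by apply: eq_bigr => k _; rewrite (rintZ mC).
Qed.

Lemma fcoef_psum x N k : fcoef (psum x N) k = if (k < N)%N then x k else 0.
Proof.
have := rint_mul_psum x N (sq_basis k).
rewrite /fcoef => h.
rewrite (eq_cint (fun t => basis k t * psum x N t)); last by move=> t _; rewrite mulrC.
rewrite h; case: ltnP => kN.
  rewrite (bigD1 (Ordinal kN))//= rint_basis eqxx mulr1 big1 ?addr0// => j jk.
  rewrite rint_basis (_ : (k == j) = false) ?mulr0//.
  by apply/negbTE; apply: contra jk => /eqP kj; apply/eqP/val_inj.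
by rewrite big1// => j _; rewrite rint_basis gtn_eqF ?mulr0// (leq_trans (ltn_ord j)).
Qed.

Lemma rint_psum_psum x y N :
  cint (fun t => psum x N t * psum y N t) = \sum_(k < N) x k * y k.
Proof.
rewrite rint_mul_psum; last exact: sq_psum.
by apply: eq_bigr => k _; rewrite fcoef_psum ltn_ord mulrC.
Qed.

Lemma rint_sqr_psumB f x N : sqC f ->
  cint (fun t => (f t - psum x N t) ^+ 2) =
  cint (fun t => f t ^+ 2) - \sum_(k < N) fcoef f k ^+ 2 +
  \sum_(k < N) (x k - fcoef f k) ^+ 2.
Proof.
move=> hf; have [_ if2] := hf; have hp := sq_psum x N.
have [_ ip] := hp; have ifp := sq_mul mC hf hp.
rewrite (eq_cint (fun t => f t ^+ 2 - 2 * (f t * psum x N t) + psum x N t * psum x N t)); last first.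
  by move=> t _; ring.
rewrite (rintD mC); [|by apply: (intgB mC) => //; exact: (intgZ mC)|exact: (sq_mul mC)].
rewrite (rintB mC)//; last exact: (intgZ mC).
rewrite (rintZ mC)// rint_mul_psum// rint_psum_psum mulr_sumr -addrA -addrA; congr (_ + _).
rewrite -!sumrN -!big_split; apply: eq_bigr => k _ /=; ring.
Qed.

(** Unnormalised family on which multiplication by [cos] and [sin] acts through the addition
    formulas. *)
Definition trigf (i : bool * nat) (t : R) : R :=
  if i.1 then cos (i.2%:R * t) else sin (i.2%:R * t).

Lemma bddm_trigf i : bddmC (trigf i).
Proof.
apply: bddm_continuous; rewrite /trigf; case: i => -[] m /=;
[exact: continuous_cosM|exact: continuous_sinM].
Qed.
Local Notation mlt := (@multiplier _ RT R leb1 C _ trigf).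

Lemma multiplier_cos : mlt cos.
Proof.
apply: (multiplier_gen mC muC bddm_trigf); first exact/bddm_continuous/continuous_cos.
case=> -[] [|m].
- exists [:: (1, (true, 1%N))] => t _.
  by rewrite /comb big_seq1 /trigf /= mul0r cos0 mulr1 !mul1r.
- exists [:: (2^-1, (true, m.+2)); (2^-1, (true, m))] => t _.
  rewrite /comb !big_cons big_nil /trigf /= addr0.
  have -> : m.+2%:R * t = m.+1%:R * t + t by rewrite -natr1 mulrDl mul1r.
  have -> : m%:R * t = m.+1%:R * t - t by rewrite -natr1 mulrDl mul1r addrK.
  by rewrite cosD cosB; field.
- exists [::] => t _; by rewrite /comb big_nil /trigf /= mul0r sin0 mulr0.
- exists [:: (2^-1, (false, m.+2)); (2^-1, (false, m))] => t _.
  rewrite /comb !big_cons big_nil /trigf /= addr0.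
  have -> : m.+2%:R * t = m.+1%:R * t + t by rewrite -natr1 mulrDl mul1r.
  have -> : m%:R * t = m.+1%:R * t - t by rewrite -natr1 mulrDl mul1r addrK.
  by rewrite sinD sinB; field.
Qed.

Lemma multiplier_sin : mlt sin.
Proof.
apply: (multiplier_gen mC muC bddm_trigf); first exact/bddm_continuous/continuous_sin.
case=> -[] [|m].
- exists [:: (1, (false, 1%N))] => t _.
  by rewrite /comb big_seq1 /trigf /= mul0r cos0 mulr1 !mul1r.
- exists [:: (2^-1, (false, m.+2)); (- 2^-1, (false, m))] => t _.
  rewrite /comb !big_cons big_nil /trigf /= addr0.
  have -> : m.+2%:R * t = m.+1%:R * t + t by rewrite -natr1 mulrDl mul1r.
  have -> : m%:R * t = m.+1%:R * t - t by rewrite -natr1 mulrDl mul1r addrK.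
  by rewrite sinD sinB; field.
- exists [::] => t _; by rewrite /comb big_nil /trigf /= mul0r sin0 mulr0.
- exists [:: (- 2^-1, (true, m.+2)); (2^-1, (true, m))] => t _.
  rewrite /comb !big_cons big_nil /trigf /= addr0.
  have -> : m.+2%:R * t = m.+1%:R * t + t by rewrite -natr1 mulrDl mul1r.
  have -> : m%:R * t = m.+1%:R * t - t by rewrite -natr1 mulrDl mul1r addrK.
  by rewrite cosD cosB; field.
Qed.

Lemma sin_lt0_pi2 (t : R) : pi < t < 2 * pi -> sin t < 0.
Proof.
move=> /andP[t0 t1]; have := @sin_gt0_pi R (t - pi).
rewrite sinB cospi sinpi mulr0 subr0 mulrN1 oppr_gt0; apply; apply/andP; split; lra.
Qed.

Lemma ltr_cos_pi2 (x t : R) : pi <= x <= 2 * pi -> pi <= t <= 2 * pi ->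
  (cos x < cos t) = (x < t).
Proof.
have E (y : R) : cos y = cos (2 * pi - y).
  by rewrite -(cosN y) -(cosD2pi (- y)) addrC mulr_natl.
move=> /andP[? ?] /andP[? ?]; rewrite (E x) (E t) ltr_cos; last 2 first.
- by rewrite in_itv/=; apply/andP; split; lra.
- by rewrite in_itv/=; apply/andP; split; lra.
by rewrite ltrD2l ltrN2.
Qed.

(** The angle is not a trigonometric polynomial, but on [0, 2 pi[ each ray of angles is a Boolean
    combination of level sets of [cos] and [sin], which are multipliers; rays generate the Borel
    sets. *)
Lemma multset_circle A : measurable (A : set RT) ->
  @multset _ RT R leb1 C _ trigf A.
Proof.
set ms := @multset _ RT R leb1 C _ trigf.
have [m0 mD mU] := multset_sigma_algebra mC muC bddm_trigf.
have mCc B : ms B -> ms (~` B) by move=> /mD; rewrite setTD.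
have mI B B' : ms B -> ms B' -> ms (B `&` B').
  move=> h h'; have := multiplierM mC h h'.
  by apply: (eq_multiplier mC) => t _; rewrite indicI.
have gt f c : mlt f -> ms [set t | c < f t] by exact: (multset_gt mC muC bddm_trigf).
have msin : mlt (fun t => - sin t).
  have := multiplierM mC (multiplier_cst mC muC bddm_trigf (-1)) multiplier_sin.
  by apply: (eq_multiplier mC) => t _; rewrite /cst mulN1r.
have mcos : mlt (fun t => - cos t).
  have := multiplierM mC (multiplier_cst mC muC bddm_trigf (-1)) multiplier_cos.
  by apply: (eq_multiplier mC) => t _; rewrite /cst mulN1r.
have eqm B B' : (forall t, C t -> (B t <-> B' t)) -> ms B -> ms B'.
  move=> BB'; apply: (eq_multiplier mC) => t Ct; rewrite !indicE.
  congr (_%:R); congr (nat_of_bool _).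
  by apply/idP/idP => /set_mem h; apply/mem_set; apply/(BB' _ Ct).
have ray (x : R) : ms `]x, +oo[%classic.
  have [x0|x0] := ltP x 0.
    apply: (eqm setT); last by have := mCc _ m0; rewrite setC0.
    move=> t; rewrite /circle /= !in_itv/= => /andP[t0 _]; split => // _.
    by rewrite andbT (lt_le_trans x0).
  have [x2|x2] := leP (2 * pi) x.
    apply: (eqm set0) => // t; rewrite /circle /= !in_itv/= => /andP[_ t1]; split => //.
    by rewrite andbT => xt; lra.
  have [xpi|xpi] := leP pi x.
    (* On the lower half circle the cosine increases with the angle. *)
    apply: (eqm ([set t | cos x < cos t] `&` [set t | 0 < - sin t])); last first.
      apply: mI; [exact: (gt _ _ multiplier_cos)|exact: (gt _ _ msin)].
    move=> t; rewrite /circle /= !in_itv/= andbT => /andP[t0 t1].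
    have [tpi|tpi] := leP t pi.
      split; last by move=> xt; move: (le_lt_trans xpi xt); rewrite ltNge tpi.
      by move=> [_]; rewrite oppr_gt0 ltNge sin_ge0_pi// t0 tpi.
    rewrite oppr_gt0 sin_lt0_pi2 ?tpi// ltr_cos_pi2//; last 2 first.
    - by rewrite xpi ltW.
    - by rewrite !ltW.
    by split => [[]|].
  (* For x on the upper half circle: the angles with a smaller cosine, together with the whole lower
     half circle, the union being written with complements and an intersection. *)
  apply: (eqm (~` (~` [set t | - cos x < - cos t] `&` ~` [set t | 0 < - sin t]))); last first.
    by apply: (mCc); apply: mI; apply: (mCc); [exact: (gt _ _ mcos)|exact: (gt _ _ msin)].
  move=> t; rewrite /circle /= !in_itv/= andbT => /andP[t0 t1].
  rewrite ltrN2 oppr_gt0.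
  have [tpi|tpi] := leP t pi.
    have -> : (sin t < 0) = false by rewrite ltNge sin_ge0_pi// t0 tpi.
    have -> : (cos t < cos x) = (x < t).
      by rewrite ltr_cos// in_itv/= ?t0 ?x0 ?(ltW xpi).
    split => [|xt [] //]; case: (ltP x t) => // _ []; split => //.
  rewrite (sin_lt0_pi2 (t := t)) ?tpi//.
  split; first by move=> _; exact: lt_trans tpi.
  by move=> _ [] _; exact.
have sub : <<s @RGenOInfty.G R >> `<=` ms.
  apply: smallest_sub; first exact: (multset_sigma_algebra mC muC bddm_trigf).
  by move=> B [x ->]; exact: ray.
by move=> mA; apply: sub; have := mA;
  rewrite -[X in _ -> X A]/((@RGenOInfty.G R).-sigma.-measurable) -RGenOInfty.measurableE.
Qed.

Lemma sq_approx_circle f : sqC f -> @approximable _ RT R leb1 C _ trigf f.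
Proof.
apply: (sq_approximable mC muC bddm_trigf); last exact: multset_circle.
apply: (eq_approximable mC) (approximable_gen mC muC bddm_trigf (true, 0%N)) => t _.
by rewrite /trigf /= mul0r cos0.
Qed.

(** The partial sum is the orthogonal projection, so its error is at most that of a trigonometric
    polynomial s close to f, once N exceeds all indices that occur in s. *)
Lemma parseval_cvg f : sqC f ->
  (fun N => cint (fun t => (psum (fcoef f) N t - f t) ^+ 2)) @ \oo --> (0 : R).
Proof.
move=> hf; have [_ af] := sq_approx_circle hf.
apply/cvgrPdist_le => eps eps0; have [s hs] := af _ eps0.
(* A sum is used in place of a maximum since it dominates each of its terms; frequency m only
   involves indices up to 2m. *)
pose N0 := \sum_(p <- s) (p.2.2.*2.+2).
exists N0 => // N /= N0N; rewrite sub0r normrN ger0_norm; last first.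
  by apply: rint_ge0 => t _; exact: sqr_ge0.
apply: le_trans hs.
set S := psum _ _.
have hS : sqC S by exact: sq_psum.
have hfS : sqC (fun t => f t - S t) by apply: (sqB mC).
have hc : sqC (comb trigf s).
  by apply: (sq_bdd mC muC); apply: bddm_comb => //; exact: bddm_trigf.
have hSc : sqC (fun t => S t - comb trigf s t) by exact: (sqB mC).
have [_ i1] := hfS; have [_ i2] := hSc; have i3 := sq_mul mC hfS hSc.
have ortb k : (k < N)%N -> cint (fun t => (f t - S t) * basis k t) = 0.
  move=> kN; rewrite (eq_cint (fun t => f t * basis k t - S t * basis k t)); last first.
    by move=> t _; rewrite mulrBl.
  rewrite (rintB mC); [|exact: (sq_mul mC hf (sq_basis _))|exact: (sq_mul mC hS (sq_basis _))].
  by rewrite -/(fcoef f k) -/(fcoef S k) /S fcoef_psum kN subrr.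
have ortt p : (p.2.*2.+2 <= N)%N -> cint (fun t => (f t - S t) * trigf p t) = 0.
  move=> pN.
  have [k [c [kN hk]]] : exists k c, (k < N)%N /\ forall t, trigf p t = c * basis k t.
    case: p pN => -[] [|m] /= pN.
    - exists 0%N, (Num.sqrt (2 * pi)); split; first exact: leq_trans pN.
      move=> t; rewrite /trigf /basis /= mul0r cos0 mulfV// gt_eqF// sqrtr_gt0.
      exact: two_pi_gt0.
    - exists m.*2.+1, (Num.sqrt pi); split; first by lia.
      move=> t; rewrite /trigf /basis /= odd_double /= /freq mulVKf ?gt_eqF ?sqrtr_gt0 ?pi_gt0//.
      by congr (cos (_%:R * t)); lia.
    - exists 0%N, 0; split; first exact: leq_trans pN.
      by move=> t; rewrite /trigf /= mul0r sin0 mul0r.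
    - exists m.+1.*2, (Num.sqrt pi); split; first by lia.
      move=> t; rewrite /trigf /basis /= odd_double /= /freq mulVKf ?gt_eqF ?sqrtr_gt0 ?pi_gt0//.
      by congr (sin (_%:R * t)); lia.
  rewrite (eq_cint (fun t => c * ((f t - S t) * basis k t))); last first.
    by move=> t _; rewrite hk mulrCA.
  rewrite (rintZ mC); last exact: (sq_mul mC hfS (sq_basis _)).
  by rewrite ortb// mulr0.
have ortc : cint (fun t => (f t - S t) * comb trigf s t) = 0.
  rewrite (eq_cint (fun t => \sum_(p <- s) p.1 * ((f t - S t) * trigf p.2 t))); last first.
    by move=> t _; rewrite mulr_sumr; apply: eq_bigr => p _; rewrite mulrCA.
  have it p : intg leb1 C (fun t => (f t - S t) * trigf p t).
    by apply: (sq_mul mC hfS); apply: (sq_bdd mC muC); exact: bddm_trigf.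
  rewrite (rint_sum mC muC); last by move=> p; exact: (intgZ mC).
  rewrite big_seq big1// => p ps; rewrite (rintZ mC)// ortt ?mulr0//.
  apply: leq_trans N0N; rewrite /N0 (big_rem p)//= leq_addr//.
have ortS : cint (fun t => (f t - S t) * S t) = 0.
  rewrite (@rint_mul_psum _ (fcoef f) N hfS) big1// => k _.
  by rewrite /fcoef ortb ?mulr0.
rewrite (eq_cint (fun t => (f t - S t) ^+ 2)); last by move=> t _; ring.
rewrite [leRHS](eq_cint (fun t => (f t - S t) ^+ 2 +
    2 * ((f t - S t) * (S t - comb trigf s t)) + (S t - comb trigf s t) ^+ 2)); last first.
  by move=> t _; ring.
rewrite (rintD mC)//; last by apply: (intgD mC) => //; exact: (intgZ mC).
rewrite (rintD mC)//; last exact: (intgZ mC).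
rewrite (rintZ mC)//.
rewrite [X in 2 * X](eq_cint (fun t => (f t - S t) * S t - (f t - S t) * comb trigf s t)); last first.
  by move=> t _; rewrite mulrBr.
rewrite (rintB mC); [|exact: (sq_mul mC)|exact: (sq_mul mC)].
rewrite ortS ortc subrr mulr0 addr0 lerDl; apply: rint_ge0 => t _; exact: sqr_ge0.
Qed.

Lemma parseval f h : sqC f -> sqC h ->
  (fun N => \sum_(k < N) fcoef f k * fcoef h k) @ \oo --> cint (fun t => f t * h t).
Proof.
move=> hf hh.
have -> : (fun N => \sum_(k < N) fcoef f k * fcoef h k) =
    (fun N => cint (fun t => h t * psum (fcoef f) N t)).
  by apply/funext => N; rewrite rint_mul_psum.
rewrite (eq_cint (fun t => h t * f t)); last by move=> t _; rewrite mulrC.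
exact: (sq_cvg_mul mC hh hf (sq_psum (fcoef f)) (parseval_cvg hf)).
Qed.

Lemma fcoef_eq0 f : sqC f -> (forall k, fcoef f k = 0) -> cint (fun t => f t ^+ 2) = 0.
Proof.
move=> hf f0; have := parseval hf hf.
under eq_fun do (under eq_bigr do rewrite f0 mul0r; rewrite big1//).
move=> /cvg_lim; rewrite lim_cst// => h.
by rewrite (eq_cint (fun t => f t * f t)) -?h// => t _; rewrite expr2.
Qed.

End Circle.

(** * The Gauss-Green formula on the disk *)

Section DiskCalculus.
Variable R : realType.
Local Notation leb1 := (@lebesgue_measure R).
Local Notation leb2 := ((@lebesgue_measure R) \x (@lebesgue_measure R))%E.
Local Notation C := (@circle R).
Local Notation D := (@disk R).
Local Notation RT := (g_sigma_algebraType R.-ocitv.-measurable).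
Local Notation RT2 := (RT * RT)%type.
Local Notation bddmD := (@bddm _ RT2 R D).
Local Notation mC := (@measurable_circle R).
Local Notation muC := (@lebesgue_circle_fin R).
Implicit Types phi : R * R -> R.

(** The rational rectangles contained in U are countably many and cover it; [unpickle] enumerates
    them. *)
Lemma open_measurable_prod (U : set (R * R)) : open U -> measurable (U : set RT2).
Proof.
move=> oU.
pose rect (q : (rat * rat) * (rat * rat)) : set RT2 :=
  `]ratr q.1.1, ratr q.1.2[ `*` `]ratr q.2.1, ratr q.2.2[.
pose F (n : nat) : set RT2 :=
  if unpickle n is Some q then
    (if pselect (rect q `<=` U) then rect q else set0) else set0.
have -> : U = \bigcup_n F n.
  apply/seteqP; split => [[x y] Uxy|[x y] [n _]]; last first.
    by rewrite /F; case: (unpickle n) => // q; case: pselect => // s; exact: s.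
  have /nbhs_ballP[e /= e0 he] : nbhs (x, y) U by exact: open_nbhs_nbhs.
  have [a1 ha1] := @rat_in_itvoo R (x - e) x ltac:(by rewrite ltrBlDr ltrDl).
  have [b1 hb1] := @rat_in_itvoo R x (x + e) ltac:(by rewrite ltrDl).
  have [a2 ha2] := @rat_in_itvoo R (y - e) y ltac:(by rewrite ltrBlDr ltrDl).
  have [b2 hb2] := @rat_in_itvoo R y (y + e) ltac:(by rewrite ltrDl).
  move: ha1 hb1 ha2 hb2; rewrite !in_itv/= => /andP[? ?] /andP[? ?] /andP[? ?] /andP[? ?].
  have [n hn] : exists n, unpickle n = Some ((a1, b1), (a2, b2)).
    by exists (pickle ((a1, b1), (a2, b2))); exact: pickleK.
  exists n; first exact: I.
  rewrite /F hn; case: pselect => [s|[]].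
    by rewrite /rect; split; rewrite /= in_itv/=; apply/andP; split.
  move=> [x' y'] [] /=; rewrite !in_itv/= => /andP[? ?] /andP[? ?]; apply: he.
  by split; rewrite /= /ball/= ltr_norml; apply/andP; split; lra.
apply: bigcupT_measurable => n; rewrite /F; case: (unpickle n) => // q.
case: (pselect (rect q `<=` U)) => [_|_] /=; last exact: measurable0.
by apply: measurableX; exact: measurable_itv.
Qed.

Lemma continuous_measurable_prod phi (A : set RT2) : continuous phi ->
  @measurable_fun _ _ RT2 RT A phi.
Proof.
move=> cphi; apply: measurable_funTS.
apply: (measurability (@RGenOInfty.G R)); first exact: RGenOInfty.measurableE.
move=> /= _ [_ [a ->] <-]; rewrite setTI; apply: open_measurable_prod.
by apply: open_comp; [move=> z _; exact: cphi|exact: interval_open].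
Qed.

Lemma continuous_sqsum : continuous (fun z : R * R => z.1 ^+ 2 + z.2 ^+ 2).
Proof.
move=> z; apply: cvgD; rewrite expr2; apply: cvgM; by [exact: cvg_fst|exact: cvg_snd].
Qed.

Lemma open_disk : open D.
Proof.
rewrite (_ : D = (fun z : R * R => z.1 ^+ 2 + z.2 ^+ 2) @^-1` [set x | x < 1])//.
by apply: open_comp; [move=> z _; exact: continuous_sqsum|exact: open_lt].
Qed.

Lemma measurable_disk : measurable (D : set RT2).
Proof. apply: open_measurable_prod; exact: open_disk. Qed.
Local Notation mD := measurable_disk.

Lemma disk_bound (z : R * R) : D z -> -1 < z.1 < 1 /\ -1 < z.2 < 1.
Proof.
case: z => x y; rewrite /disk /= => h.
by split; apply/andP; split; nra.
Qed.

Lemma lebesgue_disk_fin : (leb2 (D : set RT2) < +oo)%E.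
Proof.
apply: (@le_lt_trans _ _ (leb2 (`[-1, 1]%classic `*` `[-1, 1]%classic : set RT2))).
  apply: le_measure; rewrite ?inE.
  - exact: mD.
  - by apply: measurableX; exact: measurable_itv.
  - move=> z /disk_bound [/andP[? ?] /andP[? ?]]; split; rewrite /= in_itv/=; apply/andP; split; exact: ltW.
rewrite product_measure1E; [|exact: measurable_itv|exact: measurable_itv].
have E : leb1 `[(-1)%R, 1%R]%classic = 2%:E.
  rewrite lebesgue_measure_itv/= lte_fin (_ : (-1 < 1 :> R) = true); last by apply/idP; lra.
  by rewrite -EFinD; congr EFin; lra.
apply: (@le_lt_trans _ _ (2%:E * 2%:E)%E); last by rewrite -EFinM ltry.
by rewrite le_eqVlt; apply/orP; left; apply/eqP; congr (_ * _)%E; exact: E.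
Qed.
Local Notation muD := lebesgue_disk_fin.

Lemma bddm_disk phi : continuous phi -> bddmD phi.
Proof.
move=> cphi; split; first exact: continuous_measurable_prod.
have cK : compact (`[-1, 1]%classic `*` `[-1, 1]%classic : set (R * R)).
  by apply: compact_setX; exact: segment_compact.
have [||c _ hc] := @compact_EVT_max (R * R)%type R (fun z => `|phi z|) _ _ cK.
- by exists (0, 0); split; rewrite /= in_itv/=; apply/andP; split; lra.
- by apply: continuous_subspaceT => z; apply: cvg_norm; exact: cphi.
exists `|phi c| => z Dz; apply: hc; rewrite inE.
by have [/andP[? ?] /andP[? ?]] := disk_bound Dz; split; rewrite /= in_itv/=; apply/andP; split; exact: ltW.
Qed.

Lemma C1_partial1 phi (x y : R) : C1 phi ->
  is_derive x 1 (fun s => phi (s, y)) ('D_(e1 R) phi (x, y)).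
Proof.
move=> /(_ (e1 R) (or_introl erefl)) [dphi _].
have E : (fun h : R => h^-1 *: (phi (h *: e1 R + (x, y)) - phi (x, y))) =
   (fun h : R => h^-1 *: (phi (h *: (1 : R) + x, y) - phi (x, y))).
  apply/funext => h; congr (_ *: (phi _ - _)).
  by rewrite /e1 /= -[LHS]/(h *: 1 + x, h *: 0 + y) scaler0 add0r.
have := dphi (x, y); rewrite /derivable E => hd.
by apply: DeriveDef => //; rewrite /derive E.
Qed.

Lemma C1_partial2 phi (x y : R) : C1 phi ->
  is_derive y 1 (fun s => phi (x, s)) ('D_(e2 R) phi (x, y)).
Proof.
move=> /(_ (e2 R) (or_intror erefl)) [dphi _].
have E : (fun h : R => h^-1 *: (phi (h *: e2 R + (x, y)) - phi (x, y))) =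
   (fun h : R => h^-1 *: (phi (x, h *: (1 : R) + y) - phi (x, y))).
  apply/funext => h; congr (_ *: (phi _ - _)).
  by rewrite /e2 /= -[LHS]/(h *: 0 + x, h *: 1 + y) scaler0 add0r.
have := dphi (x, y); rewrite /derivable E => hd.
by apply: DeriveDef => //; rewrite /derive E.
Qed.

Lemma is_derive_continuous (f : R -> R) (x df : R) : is_derive x 1 f df ->
  {for x, continuous f}.
Proof.
by move=> h; apply: differentiable_continuous; apply/derivable1_diffP; case: h.
Qed.

(** [C1] speaks of partial derivatives only. The increment in x is controlled by the mean value
    theorem with a local bound M on the first partial derivative, the one in y by continuity of a
    single slice. *)
Lemma C1_continuous phi : C1 phi -> continuous phi.
Proof.
move=> hphi [x y].
have [_ c1] := hphi (e1 R) (or_introl erefl).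
have cy : {for y, continuous (fun s => phi (x, s))}.
  exact: is_derive_continuous (C1_partial2 x y hphi).
pose M := `|'D_(e1 R) phi (x, y)| + 1.
have M0 : 0 < M by rewrite ltr_wpDl.
have : \forall z \near (x, y), `|'D_(e1 R) phi z| <= M.
  have : (fun z => `|'D_(e1 R) phi z|) @ (x, y) --> `|'D_(e1 R) phi (x, y)|.
    by apply: cvg_norm; exact: c1.
  move/cvgrPdist_le => /(_ 1 ltr01); apply: filterS => z.
  by rewrite ler_norml /M => /andP[h1 h2]; lra.
move=> /nbhs_ballP[d /= d0 hd].
apply/cvgrPdist_le => e e0.
have e2 : 0 < e / 2 by rewrite divr_gt0.
have [d' /= d'0 hd'] : exists2 d' : R, 0 < d' & forall s, `|y - s| < d' -> `|phi (x, y) - phi (x, s)| <= e / 2.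
  move/cvgrPdist_le : cy => /(_ _ e2) /nbhs_ballP[d' /= d'0 h]; exists d' => // s ys; exact: h.
pose r := Num.min d (Num.min d' (e / 2 / M)).
have r0 : 0 < r by rewrite !lt_min d0 d'0 divr_gt0.
suff h : nbhs ((x, y) : R * R) (fun t => `|phi (x, y) - phi t| <= e) by exact: h.
apply/nbhs_ballP; exists r => //= -[x' y'] [/=]; rewrite /ball/= => bx by'.
have xd : `|x - x'| < d by apply: lt_le_trans bx _; rewrite ge_min lexx.
have yd : `|y - y'| < d by apply: lt_le_trans by' _; rewrite ge_min lexx.
have yd' : `|y - y'| < d' by apply: lt_le_trans by' _; rewrite !ge_min lexx orbT.
have xe : `|x - x'| * M <= e / 2.
  rewrite -ler_pdivlMr// ltW//; apply: lt_le_trans bx _; by rewrite !ge_min lexx !orbT.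
have key (a b : R) : a <= b -> `|x - a| < d -> `|x - b| < d ->
    `|phi (b, y') - phi (a, y')| <= (b - a) * M.
  move=> ab xa xb.
  have [c hc ->] := @MVT_segment R (fun s => phi (s, y')) (fun s => 'D_(e1 R) phi (s, y')) a b ab
    (fun s _ => C1_partial1 s y' hphi)
    (continuous_subspaceT (fun s => is_derive_continuous (C1_partial1 s y' hphi))).
  rewrite normrM mulrC (ger0_norm (_ : 0 <= b - a)) ?subr_ge0// ler_wpM2l ?subr_ge0//.
  apply: hd; split => //=; rewrite /ball/=.
  by move: hc xa xb; rewrite in_itv/= !ltr_norml => /andP[? ?] /andP[? ?] /andP[? ?]; apply/andP; split; lra.
have xx : `|x - x| < d by rewrite subrr normr0.
have k2 : `|phi (x, y') - phi (x', y')| <= `|x - x'| * M.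
  have [xx'|xx'] := leP x x'.
    by rewrite distrC (le_trans (key _ _ xx' xx xd))// distrC ger0_norm// subr_ge0.
  by rewrite (le_trans (key _ _ (ltW xx') xd xx))// ger0_norm// subr_ge0 ltW.
rewrite (_ : phi (x, y) - _ = (phi (x, y) - phi (x, y')) + (phi (x, y') - phi (x', y'))); last by ring.
rewrite (le_trans (ler_normD _ _))// (splitr e) lerD//; first exact: hd'.
exact: le_trans k2 xe.
Qed.

Lemma continuous_sub_cst_id (c : R) : continuous (fun t : R => c - t).
Proof. by move=> t; apply: cvgB; [exact: cvg_cst|exact: cvg_id]. Qed.

Lemma continuous_intg_itv (f : R -> R) (a b : R) : continuous f ->
  leb1.-integrable `[a, b] (EFin \o f).
Proof.
move=> cf; apply: continuous_compact_integrable; first exact: segment_compact.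
exact: continuous_subspaceT.
Qed.

Lemma rint_itv_reflect (f : R -> R) (a b c : R) : a <= b -> continuous f ->
  \int[leb1]_(x in `[a, b]) f (c - x) = \int[leb1]_(x in `[c - b, c - a]) f x.
Proof.
move=> ab cf; pose F (x : R) := c - x.
have dF (x : R) : is_derive x 1 F (-1).
  have := is_deriveB (is_derive_cst c x 1) (is_derive_id x (1 : R)).
  by rewrite sub0r.
have F' : derive1 F = cst (-1).
  by apply/funext => x; rewrite derive1E; have [_ ->] := dF x.
rewrite /Rintegral (@integration_by_substitution_decreasing _ F f a b ab).
- congr fine; apply: eq_integral => x _; congr EFin.
  by rewrite F' !fctE opprK mulr1.
- by move=> x y _ _ xy; rewrite /F ltrD2l ltrN2.
- by rewrite F' => x _; exact: cvg_cst.
- by rewrite F'; exact: is_cvg_cst.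
- by rewrite F'; exact: is_cvg_cst.
- split.
  + by move=> x _; case: (dF x).
  + by apply: cvg_at_right_filter; exact: continuous_sub_cst_id.
  + by apply: cvg_at_left_filter; exact: continuous_sub_cst_id.
- exact: continuous_subspaceT.
Qed.

(** A translation is the composition of two reflections. *)
Lemma rint_itv_shift (f : R -> R) (a b c : R) : a <= b -> continuous f ->
  \int[leb1]_(x in `[a, b]) f (c + x) = \int[leb1]_(x in `[c + a, c + b]) f x.
Proof.
move=> ab cf.
have cf' : continuous (fun x => f (c - x)).
  move=> x; apply: continuous_comp; [exact: continuous_sub_cst_id|exact: cf].
have := @rint_itv_reflect (fun x => f (c - x)) a b 0 ab cf'.
have ba : 0 - b <= 0 - a by rewrite lerD2l lerN2.
rewrite (rint_itv_reflect _ ba cf).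
rewrite !sub0r !opprK => <-.
by apply: eq_Rintegral => x _; rewrite sub0r opprK.
Qed.

Lemma rint_itv_split (f : R -> R) (a b c : R) : a <= b -> b <= c -> continuous f ->
  \int[leb1]_(x in `[a, c]) f x =
  \int[leb1]_(x in `[a, b]) f x + \int[leb1]_(x in `[b, c]) f x.
Proof.
move=> ab bc cf.
have h := @Rintegral_itvB R f (BLeft a) (BRight c) b (continuous_intg_itv _ _ cf).
rewrite [X in _ + X](_ : _ = \int[leb1]_(x in `]b, c]) f x).
  by rewrite -h ?bnd_simp//; ring.
rewrite -Rintegral_itv_obnd_cbnd//.
by apply: integrableS (continuous_intg_itv _ _ cf) => //; exact: subset_itv_oc_cc.
Qed.

(** This reflection exchanges cosine and sine. It carries the period to [- 3 pi / 2, pi / 2], whose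
    negative part is shifted back by 2 pi. *)
Lemma rint_periodic_reflect (f : R -> R) : continuous f ->
  (forall t, f (2 * pi + t) = f t) ->
  \int[leb1]_(t in `[0, 2 * pi]) f (pi / 2 - t) = \int[leb1]_(t in `[0, 2 * pi]) f t.
Proof.
move=> cf pf; have p0 := pi_gt0 R.
rewrite (rint_itv_reflect _ (ltW (two_pi_gt0 R)) cf) subr0.
rewrite (@rint_itv_split _ _ 0)//; [|lra|lra].
rewrite [RHS](@rint_itv_split _ _ (pi / 2))//; [|lra|lra].
rewrite addrC; congr (_ + _).
rewrite [RHS](_ : _ = \int[leb1]_(x in `[2 * pi + (pi / 2 - 2 * pi), 2 * pi + 0]) f x).
  rewrite -rint_itv_shift//; last by lra.
  by apply: eq_Rintegral => x _; rewrite pf.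
by rewrite addr0 addrC subrK.
Qed.

Lemma continuous_sqrt1B : continuous (fun x : R => Num.sqrt (1 - x ^+ 2)).
Proof.
move=> x; apply: (@continuous_comp _ _ _ (fun x : R => 1 - x ^+ 2) Num.sqrt); last exact: sqrt_continuous.
by apply: cvgB; [exact: cvg_cst|rewrite expr2; apply: cvgM; exact: cvg_id].
Qed.

Lemma continuous_pair (f g : R -> R) phi : continuous phi -> continuous f ->
  continuous g -> continuous (fun x => phi (f x, g x)).
Proof.
move=> cphi cf cg x.
apply: (@cvg_comp _ _ _ (fun x => (f x, g x)) phi _ (nbhs (f x, g x))); last exact: cphi.
exact: (cvg_pair (cf x) (cg x)).
Qed.

(* The substitution x = cos t parametrises the upper and lower half circles,
   which are then glued along the period. *)
Lemma rint_halfcircles phi : continuous phi ->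
  \int[leb1]_(x in `[-1, 1])
     (phi (x, Num.sqrt (1 - x ^+ 2)) - phi (x, - Num.sqrt (1 - x ^+ 2))) =
  rint leb1 C (fun t => phi (cos t, sin t) * sin t).
Proof.
move=> cphi; set G := (fun x : R => phi (x, Num.sqrt (1 - x ^+ 2)) - phi (x, - Num.sqrt (1 - x ^+ 2))).
have p0 := pi_gt0 R.
have cid' : continuous (fun x : R => x) by move=> x; exact: cvg_id.
have cG : continuous G.
  move=> x; apply: cvgB.
    by apply: (@continuous_pair (fun x => x) (fun x => Num.sqrt (1 - x ^+ 2))) => //; exact: continuous_sqrt1B.
  apply: (@continuous_pair (fun x => x) (fun x => - Num.sqrt (1 - x ^+ 2))) => //.
  by move=> y; apply: cvgN; exact: continuous_sqrt1B.
have cos' : derive1 (@cos R) = (fun x => - sin x).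
  by apply/funext => x; rewrite derive1E; have [_ ->] := is_derive_cos x.
have csin : continuous (fun x : R => - sin x).
  by move=> x; apply: cvgN; exact: continuous_sin.
have step1 : \int[leb1]_(x in `[-1, 1]) G x =
   \int[leb1]_(t in `[0, pi]) (phi (cos t, sin t) * sin t - phi (cos t, - sin t) * sin t).
  have -> : (-1 : R) = cos pi by rewrite cospi.
  have -> : (1 : R) = cos 0 by rewrite cos0.
  rewrite /Rintegral (@integration_by_substitution_decreasing _ cos G 0 pi (ltW p0)).
  - congr fine; apply: eq_integral => t; rewrite inE/= in_itv/= => ht; congr EFin.
    rewrite cos' !fctE opprK /G -sin2cos2 sqrtr_sqr ger0_norm ?sin_ge0_pi//.
    by rewrite mulrBl.
  - by move=> x y hx hy xy; rewrite ltr_cos.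
  - by rewrite cos' => x _; exact: csin.
  - by rewrite cos'; apply/cvg_ex; eexists; apply: cvg_at_right_filter; exact: csin.
  - by rewrite cos'; apply/cvg_ex; eexists; apply: cvg_at_left_filter; exact: csin.
  - split.
    + by move=> x _; case: (is_derive_cos x).
    + by apply: cvg_at_right_filter; exact: continuous_cos.
    + by apply: cvg_at_left_filter; exact: continuous_cos.
  - exact: continuous_subspaceT.
have cf1 : continuous (fun t => phi (cos t, sin t) * sin t).
  move=> t; apply: cvgM; last exact: continuous_sin.
  by apply: (@continuous_pair cos sin) => //; [exact: continuous_cos|exact: continuous_sin].
have cf2 : continuous (fun t => phi (cos t, - sin t) * sin t).
  move=> t; apply: cvgM; last exact: continuous_sin.
  by apply: (@continuous_pair cos (fun t => - sin t)) => //; exact: continuous_cos.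
rewrite step1 RintegralB//; [|exact: continuous_intg_itv|exact: continuous_intg_itv].
rewrite rint_circleE; last exact: (intg_bdd mC muC (bddm_continuous cf1)).
rewrite (@rint_itv_split _ 0 pi (2 * pi)) ?(ltW p0)//; last by lra.
congr (_ + _).
have -> : \int[leb1]_(t in `[pi, 2 * pi]) (phi (cos t, sin t) * sin t) =
   \int[leb1]_(t in `[0, pi]) (- (phi (cos t, - sin t) * sin t)).
  have := @rint_itv_reflect _ 0 pi (2 * pi) (ltW p0) cf1.
  rewrite subr0 (_ : 2 * pi - pi = pi); last by ring.
  move=> <-; apply: eq_Rintegral => t _.
  by rewrite cosB sinB mulr_natl cos2pi sin2pi !mul0r !mul1r addr0 sub0r mulrN.
rewrite -mulN1r -RintegralZl//; last exact: continuous_intg_itv.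
by apply: eq_Rintegral => t _; rewrite mulN1r.
Qed.

Lemma intg_disk_cont phi : continuous phi -> intg leb2 D phi.
Proof. by move=> cphi; apply: (intg_bdd mD muD); exact: bddm_disk. Qed.

(** [Num.sqrt] is 0 on negative numbers, so the formula also covers |x| >= 1, where the slice is
    empty and both sides vanish. *)
Lemma integral_slice (h k : R -> R) (x : R) : continuous h ->
  (forall y : R, is_derive y 1 k (h y)) ->
  (\int[leb1]_y ((h \_ [set y | (x ^+ 2 + y ^+ 2 < 1)%R]) y)%:E =
   (k (Num.sqrt (1 - x ^+ 2)) - k (- Num.sqrt (1 - x ^+ 2)))%:E)%E.
Proof.
move=> ch dk; set s := Num.sqrt (1 - x ^+ 2).
have s0 : 0 <= s by exact: sqrtr_ge0.
have -> : [set y | x ^+ 2 + y ^+ 2 < 1] = `]- s, s[%classic.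
  apply/seteqP; split => y /=; rewrite in_itv/= -ltr_norml.
    move=> xy; have y0 := sqr_ge0 y; rewrite -sqrtr_sqr /s ltr_sqrt; lra.
  move=> ys; have : y ^+ 2 < s ^+ 2.
    by rewrite -(ger0_norm (sqr_ge0 y)) normrX ltrXn2r// s0.
  have [x1|x1] := leP 0 (1 - x ^+ 2); first by rewrite sqr_sqrtr//; lra.
  by rewrite /s (ltr0_sqrtr x1) expr0n/= ltNge sqr_ge0.
transitivity (\int[leb1]_(y in `](- s)%R, s[) (h y)%:E)%E.
  by rewrite [RHS]integral_mkcond; apply: eq_integral => y _; rewrite !patchE; case: ifP.
move: s0; rewrite le_eqVlt => /predU1P[<-|s0].
  by rewrite oppr0 set_itvoo0 integral_set0 subrr.
rewrite integral_itv_obnd_cbnd; last first.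
  by apply/measurable_EFinP; apply: measurable_funTS; exact: continuous_measurable_fun.
rewrite integral_itv_bndo_bndc; last first.
  by apply/measurable_EFinP; apply: measurable_funTS; exact: continuous_measurable_fun.
have ss : - s < s by lra.
rewrite (@continuous_FTC2 _ h k _ _ ss)//.
- exact: continuous_subspaceT.
- have ck x' : {for x', continuous k} by exact: is_derive_continuous (dk x').
  split.
  + by move=> y _; case: (dk y).
  + by apply: cvg_at_right_filter; exact: ck.
  + by apply: cvg_at_left_filter; exact: ck.
- by move=> y _; rewrite derive1E; have [_ ->] := dk y.
Qed.

Lemma integral_halfcircles phi : continuous phi ->
  (\int[leb1]_x (phi (x, Num.sqrt (1 - x ^+ 2)) - phi (x, - Num.sqrt (1 - x ^+ 2)))%:E)%E =
  (\int[leb1]_(x in `[(-1)%R, 1%R])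
    (phi (x, Num.sqrt (1 - x ^+ 2)) - phi (x, - Num.sqrt (1 - x ^+ 2)))%:E)%E.
Proof.
move=> cphi; rewrite [RHS]integral_mkcond; apply: eq_integral => x _.
rewrite patchE; case: ifPn => //; rewrite notin_setE/= in_itv/= => /negP hx.
have x1 : 1 - x ^+ 2 < 0.
  by move: hx; rewrite negb_and -!ltNge => /orP[h|h]; nra.
by rewrite ltr0_sqrtr// oppr0 subrr.
Qed.

Lemma intg_disk_restrict (g : R * R -> R) : continuous g ->
  leb2.-integrable setT (fun z => ((g \_ D) z)%:E).
Proof.
move=> cg.
have := (integrable_mkcond (mu := leb2) (EFin \o g) mD).1 (intg_disk_cont cg).
by apply: eq_integrable => // z _; rewrite restrict_EFin.
Qed.

Lemma green2 phi : C1 phi ->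
  rint leb2 D ('D_(e2 R) phi) = rint leb1 C (fun t => phi (cos t, sin t) * sin t).
Proof.
move=> hphi; have cphi := C1_continuous hphi.
have [_ c2] := hphi (e2 R) (or_intror erefl).
rewrite -rint_halfcircles// /rint Rintegral_mkcond /Rintegral; congr fine.
rewrite -(integral12_prod_meas1 (intg_disk_restrict c2)) -integral_halfcircles//.
apply: eq_integral => x _.
rewrite -(@integral_slice (fun y => 'D_(e2 R) phi (x, y)) (fun y => phi (x, y)) x _ (fun y => C1_partial2 x y hphi)).
- by apply: eq_integral => y _; rewrite !patchE.
- apply: (@continuous_pair (fun=> x) (fun y => y) ('D_(e2 R) phi)) => // y;
    [exact: cvg_cst|exact: cvg_id].
Qed.

(** Horizontal slices give the formula with the coordinates of the circle exchanged, and the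
    reflection t -> pi / 2 - t exchanges them back. *)
Lemma green1 phi : C1 phi ->
  rint leb2 D ('D_(e1 R) phi) = rint leb1 C (fun t => phi (cos t, sin t) * cos t).
Proof.
move=> hphi; have cphi := C1_continuous hphi.
have [_ c1] := hphi (e1 R) (or_introl erefl).
pose psi (z : R * R) := phi (z.2, z.1).
have cpsi : continuous psi.
  move=> z; apply: (@continuous_comp _ _ _ (fun z : R * R => (z.2, z.1)) phi); last exact: cphi.
  have h2 : (fun z : R * R => z.2) @ z --> z.2 by exact: cvg_snd.
  have h1 : (fun z : R * R => z.1) @ z --> z.1 by exact: cvg_fst.
  exact: (cvg_pair h2 h1).
transitivity (rint leb1 C (fun t => phi (sin t, cos t) * sin t)).
  rewrite -[RHS](rint_halfcircles cpsi) /rint Rintegral_mkcond /Rintegral; congr fine.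
  rewrite -(integral21_prod_meas1 (intg_disk_restrict c1)) -integral_halfcircles//.
  apply: eq_integral => y _.
  rewrite -(@integral_slice (fun x => 'D_(e1 R) phi (x, y)) (fun x => phi (x, y)) y _
    (fun x => C1_partial1 x y hphi)).
  - apply: eq_integral => x _; rewrite !patchE; congr EFin.
    by rewrite (_ : ((x, y) \in D) = (x \in [set x | y ^+ 2 + x ^+ 2 < 1]))// /disk;
      apply/idP/idP => /set_mem h; apply/mem_set; move: h => /=; rewrite addrC.
  - apply: (@continuous_pair (fun x => x) (fun=> y) ('D_(e1 R) phi)) => // x;
      [exact: cvg_id|exact: cvg_cst].
have cf : continuous (fun t => phi (cos t, sin t) * cos t).
  move=> t; apply: cvgM; last exact: continuous_cos.
  by apply: (@continuous_pair cos sin) => //; [exact: continuous_cos|exact: continuous_sin].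
have cg : continuous (fun t => phi (sin t, cos t) * sin t).
  move=> t; apply: cvgM; last exact: continuous_sin.
  by apply: (@continuous_pair sin cos) => //; [exact: continuous_sin|exact: continuous_cos].
rewrite !rint_circleE; [|exact: (intg_bdd mC muC (bddm_continuous _))..].
rewrite -[RHS](rint_periodic_reflect cf).
  by apply: eq_Rintegral => t _; rewrite -(opprB t) cosN sinN cosBpihalf sinBpihalf opprK.
by move=> t; rewrite addrC mulr_natl cosD2pi sinD2pi.
Qed.

End DiskCalculus.

(** * Harmonic polynomials and the Fourier form of the eigenvalue problem *)

Section LfunSquare.
Context d (T : measurableType d) (R : realType) (mu : {measure set T -> \bar R}).
Variable D : set T.
Hypothesis mD : measurable D.

Lemma Lfun2_sqint (f : T -> R) : (f \_ D \in Lfun mu 2%:E) <-> sqint mu D f.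
Proof.
have E x : ((f \_ D) x ^+ 2)%:E = ((EFin \o (fun x => f x ^+ 2)) \_ D) x.
  by rewrite !patchE; case: ifP => // _; rewrite expr0n.
split=> [hf|[mf if2]].
  have := hf; rewrite inE => /andP[/[!inE]/= mf _].
  split; first exact/(measurable_restrictT _ mD).
  apply/(integrable_mkcond _ mD).
  by apply: eq_integrable (Lfun2_integrable_sqr hf) => // x _; rewrite /= E.
rewrite inE; apply/andP; split; rewrite inE/=.
  exact/(measurable_restrictT _ mD).
rewrite /finite_norm unlock /=; apply: poweR_lty.
move: if2 => /(integrable_mkcond _ mD) /integrableP[_]; apply: le_lt_trans.
rewrite le_eqVlt; apply/orP; left; apply/eqP; apply: eq_integral => x _.
by rewrite -E /= powR_mulrn// -normrX.
Qed.

End LfunSquare.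

Section Harmonic.
Variable R : realType.
Local Notation leb1 := (@lebesgue_measure R).
Local Notation leb2 := ((@lebesgue_measure R) \x (@lebesgue_measure R))%E.
Local Notation C := (@circle R).
Local Notation D := (@disk R).
Local Notation RT := (g_sigma_algebraType R.-ocitv.-measurable).
Local Notation RT2 := (RT * RT)%type.
Local Notation sqC := (@sqint _ RT R leb1 C).
Local Notation sqD := (@sqint _ RT2 R leb2 D).
Local Notation cint := (rint leb1 C).
Local Notation dint := (rint leb2 D).
Local Notation mC := (@measurable_circle R).
Local Notation muC := (@lebesgue_circle_fin R).
Local Notation mD := (@measurable_disk R).
Local Notation muD := (@lebesgue_disk_fin R).
Implicit Types phi u v px py : R * R -> R.

Lemma eq_dint (g f : R * R -> R) : (forall t, D t -> f t = g t) ->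
  dint f = dint g.
Proof. exact: (@eq_rint _ RT2 R leb2 D f g). Qed.
Arguments eq_dint g {f} _.

Lemma L2diskP u : L2disk u <-> sqD u.
Proof. exact: (Lfun2_sqint leb2 mD). Qed.

Lemma L2circleP (g : R -> R) : L2circle g <-> sqC g.
Proof. exact: (Lfun2_sqint leb1 mC). Qed.

Lemma sqD_cont phi : continuous phi -> sqD phi.
Proof. by move=> c; apply: (sq_bdd mD muD); exact: bddm_disk. Qed.

Lemma is_derive_fst (z v : R * R) : is_derive z v (fst : R * R -> R) v.1.
Proof.
have E : (fun h : R => h^-1 *: ((h *: v + z).1 - z.1)) @ 0^' --> v.1.
  apply: cvg_near_cst; near=> h.
  have h0 : h != 0 by near: h; exact: nbhs_dnbhs_neq.
  by rewrite /= -[X in _ *: (X - _)]/(h *: v.1 + z.1) addrK scalerA mulVf// scale1r.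
by apply: DeriveDef; [apply/cvg_ex; exists v.1|exact: cvg_lim].
Unshelve. all: by end_near. Qed.

Lemma is_derive_snd (z v : R * R) : is_derive z v (snd : R * R -> R) v.2.
Proof.
have E : (fun h : R => h^-1 *: ((h *: v + z).2 - z.2)) @ 0^' --> v.2.
  apply: cvg_near_cst; near=> h.
  have h0 : h != 0 by near: h; exact: nbhs_dnbhs_neq.
  by rewrite /= -[X in _ *: (X - _)]/(h *: v.2 + z.2) addrK scalerA mulVf// scale1r.
by apply: DeriveDef; [apply/cvg_ex; exists v.2|exact: cvg_lim].
Unshelve. all: by end_near. Qed.

Lemma is_derive_mul (f g : R * R -> R) (z v : R * R) (df dg : R) :
  is_derive z v f df -> is_derive z v g dg ->
  is_derive z v (fun z => f z * g z) (f z * dg + g z * df).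
Proof. by move=> hf hg; exact: is_deriveM. Qed.

Lemma is_derive_add (f g : R * R -> R) (z v : R * R) (df dg : R) :
  is_derive z v f df -> is_derive z v g dg ->
  is_derive z v (fun z => f z + g z) (df + dg).
Proof. by move=> hf hg; exact: is_deriveD. Qed.

Lemma is_derive_scale (f : R * R -> R) (z v : R * R) (c df : R) :
  is_derive z v f df -> is_derive z v (fun z => c * f z) (c * df).
Proof. by move=> hf; exact: is_deriveZ. Qed.

Lemma continuous_mul2 (f g : R * R -> R) : continuous f -> continuous g ->
  continuous (fun z => f z * g z).
Proof. by move=> cf cg z; apply: cvgM; [exact: cf|exact: cg]. Qed.

Lemma continuous_add2 (f g : R * R -> R) : continuous f -> continuous g ->
  continuous (fun z => f z + g z).
Proof. by move=> cf cg z; apply: cvgD; [exact: cf|exact: cg]. Qed.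

Lemma continuous_sub2 (f g : R * R -> R) : continuous f -> continuous g ->
  continuous (fun z => f z - g z).
Proof. by move=> cf cg z; apply: cvgB; [exact: cf|exact: cg]. Qed.

(* zpow m z = (Re z^m, Im z^m) *)
Fixpoint zpow (m : nat) (z : R * R) : R * R :=
  if m is m'.+1 then
    (z.1 * (zpow m' z).1 - z.2 * (zpow m' z).2,
     z.1 * (zpow m' z).2 + z.2 * (zpow m' z).1)
  else (1, 0).

Lemma is_derive_zpow m (z v : R * R) :
  is_derive z v (fun z => (zpow m z).1)
    (m%:R * ((zpow m.-1 z).1 * v.1 - (zpow m.-1 z).2 * v.2)) /\
  is_derive z v (fun z => (zpow m z).2)
    (m%:R * ((zpow m.-1 z).2 * v.1 + (zpow m.-1 z).1 * v.2)).
Proof.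
elim: m => [|m [IH1 IH2]] /=.
  by rewrite !mul0r; split; exact: is_derive_cst.
have d1 := is_derive_fst z v; have d2 := is_derive_snd z v.
split.
  have := is_derive_add (is_derive_mul d1 IH1) (is_derive_scale (-1) (is_derive_mul d2 IH2)).
  under eq_fun do rewrite mulN1r.
  move=> h; apply: is_derive_eq.
  case: m {IH1 IH2 h} => [|m] /=; first by ring.
  rewrite -(natr1 m.+1); ring.
have := is_derive_add (is_derive_mul d1 IH2) (is_derive_mul d2 IH1).
move=> h; apply: is_derive_eq.
case: m {IH1 IH2 h} => [|m] /=; first by ring.
rewrite -(natr1 m.+1); ring.
Qed.

Lemma continuous_zpow m :
  continuous (fun z => (zpow m z).1) /\ continuous (fun z => (zpow m z).2).
Proof.
elim: m => [|m [IH1 IH2]] /=; first by split=> z; exact: cvg_cst.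
have f1 : continuous (fun z : R * R => z.1) by move=> z; exact: cvg_fst.
have f2 : continuous (fun z : R * R => z.2) by move=> z; exact: cvg_snd.
split.
  by apply: continuous_sub2; exact: continuous_mul2.
by apply: continuous_add2; exact: continuous_mul2.
Qed.

Lemma C1_intro phi (f1 f2 : R * R -> R) :
  (forall z, is_derive z (e1 R) phi (f1 z)) ->
  (forall z, is_derive z (e2 R) phi (f2 z)) ->
  continuous f1 -> continuous f2 -> C1 phi.
Proof.
move=> h1 h2 c1 c2 v [->|->]; split.
- by move=> z; case: (h1 z).
- rewrite (_ : 'D_(e1 R) phi = f1)//; apply/funext => z; by case: (h1 z).
- by move=> z; case: (h2 z).
- rewrite (_ : 'D_(e2 R) phi = f2)//; apply/funext => z; by case: (h2 z).
Qed.

Lemma C1_is_derive phi (v z : R * R) : C1 phi -> v = e1 R \/ v = e2 R ->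
  is_derive z v phi ('D_v phi z).
Proof. by move=> h /h [dphi _]; apply: DeriveDef. Qed.

Lemma C1_mul phi v : C1 phi -> C1 v -> C1 (fun z => phi z * v z).
Proof.
move=> hp hv; have cp := C1_continuous hp; have cv := C1_continuous hv.
apply: (@C1_intro _ (fun z => phi z * 'D_(e1 R) v z + v z * 'D_(e1 R) phi z)
  (fun z => phi z * 'D_(e2 R) v z + v z * 'D_(e2 R) phi z)).
- by move=> z; apply: is_derive_mul; apply: C1_is_derive => //; left.
- by move=> z; apply: is_derive_mul; apply: C1_is_derive => //; right.
- have [_ ?] := hp _ (or_introl erefl); have [_ ?] := hv _ (or_introl erefl).
  by apply: continuous_add2; exact: continuous_mul2.
- have [_ ?] := hp _ (or_intror erefl); have [_ ?] := hv _ (or_intror erefl).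
  by apply: continuous_add2; exact: continuous_mul2.
Qed.

Lemma C1_mulD phi v (z w : R * R) : C1 phi -> C1 v -> w = e1 R \/ w = e2 R ->
  'D_w (fun z => phi z * v z) z = phi z * 'D_w v z + v z * 'D_w phi z.
Proof.
move=> hp hv hw.
by have [_ ->] := is_derive_mul (C1_is_derive z hp hw) (C1_is_derive z hv hw).
Qed.

Definition H1tr u px py g := H1_grad u px py /\ is_trace u px py g.

Lemma C1_D phi w : C1 phi -> w = e1 R \/ w = e2 R -> continuous ('D_w phi).
Proof. by move=> h /h []. Qed.

(** Both parts are the Gauss-Green formula for the product of w with a test function. A compactly
    supported one vanishes on the circle, which leaves the weak derivatives. *)
Lemma C1_H1tr w : C1 w ->
  H1tr w ('D_(e1 R) w) ('D_(e2 R) w) (fun t => w (cos t, sin t)).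
Proof.
move=> hw; have cw := C1_continuous hw.
have c1 := C1_D hw (or_introl erefl); have c2 := C1_D hw (or_intror erefl).
have idc (f g : R * R -> R) : continuous f -> continuous g ->
    intg leb2 D (fun z => f z * g z).
  move=> cf cg; apply: intg_disk_cont => z; apply: cvgM; [exact: cf|exact: cg].
have bd phi : C1c_disk phi -> forall t, phi (cos t, sin t) = 0.
  by move=> [_ [r r1 h]] t; apply: h; rewrite /= cos2Dsin2 ltW.
have hl1 : e1 R = e1 R \/ e1 R = e2 R by left.
have hl2 : e2 R = e1 R \/ e2 R = e2 R by right.
have k1 phi : C1 phi -> dint (fun z => w z * 'D_(e1 R) phi z + 'D_(e1 R) w z * phi z) =
    cint (fun t => w (cos t, sin t) * phi (cos t, sin t) * cos t).
  move=> hp; rewrite -(green1 (C1_mul hw hp)); apply: eq_dint => z _.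
  by rewrite (C1_mulD _ hw hp hl1) [phi z * _]mulrC.
have k2 phi : C1 phi -> dint (fun z => w z * 'D_(e2 R) phi z + 'D_(e2 R) w z * phi z) =
    cint (fun t => w (cos t, sin t) * phi (cos t, sin t) * sin t).
  move=> hp; rewrite -(green2 (C1_mul hw hp)); apply: eq_dint => z _.
  by rewrite (C1_mulD _ hw hp hl2) [phi z * _]mulrC.
have z1 phi : C1c_disk phi -> dint (fun z => w z * 'D_(e1 R) phi z) +
    dint (fun z => 'D_(e1 R) w z * phi z) = 0.
  move=> hphi; have [hp _] := hphi; have cp := C1_continuous hp.
  have cp1 := C1_D hp hl1.
  rewrite -(rintD mD (idc _ _ cw cp1) (idc _ _ c1 cp)) k1//.
  rewrite (@eq_cint R (fun=> 0)); first by rewrite rint_circle_cst mul0r.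
  by move=> t _; rewrite (bd _ hphi) mulr0 mul0r.
have z2 phi : C1c_disk phi -> dint (fun z => w z * 'D_(e2 R) phi z) +
    dint (fun z => 'D_(e2 R) w z * phi z) = 0.
  move=> hphi; have [hp _] := hphi; have cp := C1_continuous hp.
  have cp1 := C1_D hp hl2.
  rewrite -(rintD mD (idc _ _ cw cp1) (idc _ _ c2 cp)) k2//.
  rewrite (@eq_cint R (fun=> 0)); first by rewrite rint_circle_cst mul0r.
  by move=> t _; rewrite (bd _ hphi) mulr0 mul0r.
split; split.
- exact/L2diskP/sqD_cont.
- exact/L2diskP/sqD_cont.
- exact/L2diskP/sqD_cont.
- by move=> phi /z1 /eqP h; apply/eqP; rewrite -addr_eq0.
- by move=> phi /z2 /eqP h; apply/eqP; rewrite -addr_eq0.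
- apply/L2circleP; apply: (sq_bdd mC muC); apply: bddm_continuous.
  by apply: (@continuous_pair _ cos sin) => //; [exact: continuous_cos|exact: continuous_sin].
- by move=> phi hp; split; [exact: k1|exact: k2].
Qed.

Definition hc (k : nat) : R :=
  if k == 0%N then (Num.sqrt (2 * pi))^-1 else (Num.sqrt pi)^-1.

Definition hcomp (k : nat) (z : R * R) : R :=
  if odd k || (k == 0%N) then z.1 else z.2.
(** By the Cauchy-Riemann equations, the gradient of [hcomp k (zpow m z)] is m times the pair
    ([hcomp k], [hcomp' k]) at the power m - 1. *)
Definition hcomp' (k : nat) (z : R * R) : R :=
  if odd k || (k == 0%N) then - z.2 else z.1.

Definition harm k (z : R * R) := hc k * hcomp k (zpow (uphalf k) z).
Definition harm1 k (z : R * R) :=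
  hc k * (freq R k * hcomp k (zpow (uphalf k).-1 z)).
Definition harm2 k (z : R * R) :=
  hc k * (freq R k * hcomp' k (zpow (uphalf k).-1 z)).

Lemma is_derive_hcomp k m (z v : R * R) : is_derive z v (fun z => hcomp k (zpow m z))
  (m%:R * (hcomp k (zpow m.-1 z) * v.1 + hcomp' k (zpow m.-1 z) * v.2)).
Proof.
have [h1 h2] := is_derive_zpow m z v.
by rewrite /hcomp /hcomp'; case: (_ || _) => //; rewrite mulNr.
Qed.

Lemma is_derive_hcomp' k m (z v : R * R) : is_derive z v (fun z => hcomp' k (zpow m z))
  (m%:R * (hcomp' k (zpow m.-1 z) * v.1 - hcomp k (zpow m.-1 z) * v.2)).
Proof.
have [h1 h2] := is_derive_zpow m z v.
rewrite /hcomp /hcomp'; case: (_ || _) => //.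
have := is_derive_scale (-1) h2.
under eq_fun do rewrite mulN1r.
by move=> h; apply: is_derive_eq; ring.
Qed.

Lemma continuous_hcomp k m : continuous (fun z => hcomp k (zpow m z)).
Proof. by have [h1 h2] := continuous_zpow m; rewrite /hcomp; case: (_ || _). Qed.

Lemma continuous_hcomp' k m : continuous (fun z => hcomp' k (zpow m z)).
Proof.
have [h1 h2] := continuous_zpow m; rewrite /hcomp'; case: (_ || _) => // z.
by apply: cvgN; exact: h2.
Qed.

Lemma continuousZ (f : R * R -> R) (c : R) : continuous f -> continuous (fun z => c * f z).
Proof. by move=> cf z; apply: cvgMl_tmp; exact: cf. Qed.

Lemma harm_D1 k (z : R * R) : is_derive z (e1 R) (harm k) (harm1 k z).
Proof.
have := is_derive_scale (hc k) (is_derive_hcomp k (uphalf k) z (e1 R)).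
by rewrite /= mulr1 mulr0 addr0.
Qed.

Lemma harm_D2 k (z : R * R) : is_derive z (e2 R) (harm k) (harm2 k z).
Proof.
have := is_derive_scale (hc k) (is_derive_hcomp k (uphalf k) z (e2 R)).
by rewrite /= mulr1 mulr0 add0r.
Qed.

Lemma continuous_harm1 k : continuous (harm1 k).
Proof. by do 2 apply: continuousZ; exact: continuous_hcomp. Qed.
Lemma continuous_harm2 k : continuous (harm2 k).
Proof. by do 2 apply: continuousZ; exact: continuous_hcomp'. Qed.

Lemma C1_harm k : C1 (harm k).
Proof.
exact: (C1_intro (harm_D1 k) (harm_D2 k) (@continuous_harm1 k) (@continuous_harm2 k)).
Qed.

Lemma C1_harm1 k : C1 (harm1 k).
Proof.
apply: C1_intro.
- by move=> z; do 2 apply: is_derive_scale; exact: is_derive_hcomp.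
- by move=> z; do 2 apply: is_derive_scale; exact: is_derive_hcomp.
- do 3 apply: continuousZ; rewrite /=.
  under eq_fun do rewrite mulr1 mulr0 addr0; exact: continuous_hcomp.
- do 3 apply: continuousZ; rewrite /=.
  under eq_fun do rewrite mulr1 mulr0 add0r; exact: continuous_hcomp'.
Qed.

Lemma C1_harm2 k : C1 (harm2 k).
Proof.
apply: C1_intro.
- by move=> z; do 2 apply: is_derive_scale; exact: is_derive_hcomp'.
- by move=> z; do 2 apply: is_derive_scale; exact: is_derive_hcomp'.
- do 3 apply: continuousZ; rewrite /=.
  under eq_fun do rewrite mulr1 mulr0 subr0; exact: continuous_hcomp'.
- do 3 apply: continuousZ; rewrite /=.
  under eq_fun do rewrite mulr1 mulr0 sub0r -mulN1r; apply: continuousZ; exact: continuous_hcomp.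
Qed.

Lemma harm_laplace k z : 'D_(e1 R) (harm1 k) z + 'D_(e2 R) (harm2 k) z = 0.
Proof.
have h1 := is_derive_scale (hc k) (is_derive_scale (freq R k) (is_derive_hcomp k (uphalf k).-1 z (e1 R))).
have h2 := is_derive_scale (hc k) (is_derive_scale (freq R k) (is_derive_hcomp' k (uphalf k).-1 z (e2 R))).
have [_ ->] := h1; have [_ ->] := h2; rewrite /=; ring.
Qed.

Lemma zpow_circle m (t : R) : zpow m (cos t, sin t) = (cos (m%:R * t), sin (m%:R * t)).
Proof.
elim: m => [|m IH] /=; first by rewrite mul0r cos0 sin0.
rewrite IH /= -natr1 mulrDl mul1r cosD sinD; congr pair; ring.
Qed.

Lemma harm_circle k t : harm k (cos t, sin t) = basis k t.
Proof.
rewrite /harm /basis /hc zpow_circle /hcomp /freq.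
case: eqP => [->|_] /=; first by rewrite mul0r cos0 mulr1.
by rewrite orbF; case: ifP.
Qed.

(** Euler's identity: the radial derivative of a homogeneous polynomial of degree m is m times the
    polynomial on the unit circle. *)
Lemma harm_normal k t : harm1 k (cos t, sin t) * cos t + harm2 k (cos t, sin t) * sin t =
  freq R k * basis k t.
Proof.
rewrite /harm1 /harm2 !zpow_circle /hcomp /hcomp' /basis /hc /freq.
case: k => [|k] /=; first by rewrite !(mul0r, mulr0) addr0.
rewrite orbF; set m := uphalf k.+1.
have -> : (half k).+1 = m.-1.+1 by [].
set a := (half k)%:R * t.
have -> : (half k).+1%:R * t = a + t by rewrite -natr1 mulrDl mul1r.
rewrite cosD sinD; case: ifP => _ /=; ring.
Qed.

Lemma harm_H1tr k : H1tr (harm k) (harm1 k) (harm2 k) (basis k).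
Proof.
have := C1_H1tr (C1_harm k).
have -> : 'D_(e1 R) (harm k) = harm1 k by apply/funext => z; have [_ ->] := harm_D1 k z.
have -> : 'D_(e2 R) (harm k) = harm2 k by apply/funext => z; have [_ ->] := harm_D2 k z.
by have -> : (fun t => harm k (cos t, sin t)) = basis k by apply/funext => t; exact: harm_circle.
Qed.

Lemma H1trP u px py g : H1tr u px py g -> [/\ sqD u, sqD px, sqD py & sqC g].
Proof. by move=> [[/L2diskP ? /L2diskP ? /L2diskP ? _ _] [/L2circleP ? _]]; split. Qed.

Lemma sqC_cont (f : R -> R) : continuous f -> sqC f.
Proof. by move=> c; apply: (sq_bdd mC muC); exact: bddm_continuous. Qed.

Lemma continuous_circle phi : continuous phi -> continuous (fun t => phi (cos t, sin t)).
Proof.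
by move=> c; apply: (@continuous_pair R cos sin) => //; [exact: continuous_cos|exact: continuous_sin].
Qed.

(** Gauss-Green for v against the gradient field of [harm k]: its divergence vanishes and its normal
    component is [freq R k * basis k]. *)
Lemma harm_energy v qx qy h k : H1tr v qx qy h ->
  dint (fun z => harm1 k z * qx z + harm2 k z * qy z) = freq R k * fcoef h k.
Proof.
move=> hv; have [sv sx sy sh] := H1trP hv; have [_ [_ tr]] := hv.
have s1 := sqD_cont (@continuous_harm1 k); have s2 := sqD_cont (@continuous_harm2 k).
have cd1 := C1_D (C1_harm1 k) (or_introl erefl).
have cd2 := C1_D (C1_harm2 k) (or_intror erefl).
have i1 := sq_mul mD sv (sqD_cont cd1); have i2 := sq_mul mD sv (sqD_cont cd2).
have j1 := sq_mul mD sx s1; have j2 := sq_mul mD sy s2.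
have [E1 _] := tr _ (C1_harm1 k); have [_ E2] := tr _ (C1_harm2 k).
have c1 := continuous_circle (@continuous_harm1 k).
have c2 := continuous_circle (@continuous_harm2 k).
have k1 : intg leb1 C (fun t => h t * harm1 k (cos t, sin t) * cos t).
  apply: (@eq_intg _ _ _ leb1 C mC (fun t => h t * (harm1 k (cos t, sin t) * cos t))).
    by move=> t _; rewrite mulrA.
  apply: (sq_mul mC sh); apply: sqC_cont => t.
  by apply: cvgM; [exact: c1|exact: continuous_cos].
have k2 : intg leb1 C (fun t => h t * harm2 k (cos t, sin t) * sin t).
  apply: (@eq_intg _ _ _ leb1 C mC (fun t => h t * (harm2 k (cos t, sin t) * sin t))).
    by move=> t _; rewrite mulrA.
  apply: (sq_mul mC sh); apply: sqC_cont => t.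
  by apply: cvgM; [exact: c2|exact: continuous_sin].
transitivity (dint (fun z => v z * 'D_(e1 R) (harm1 k) z + qx z * harm1 k z) +
  dint (fun z => v z * 'D_(e2 R) (harm2 k) z + qy z * harm2 k z)).
  rewrite -(rintD mD); [|exact: (intgD mD)|exact: (intgD mD)].
  apply: eq_dint => z _; have h0 := harm_laplace k z.
  have -> : 'D_(e2 R) (harm2 k) z = - 'D_(e1 R) (harm1 k) z by lra.
  ring.
rewrite /rint E1 E2 -!/(rint _ _ _) -(rintD mC)// -(rintZ mC); last first.
  by apply: (sq_mul mC sh); exact: sq_basis.
apply: eq_cint => t _.
by rewrite [RHS]mulrCA -harm_normal mulrDr !mulrA.
Qed.

End Harmonic.

(** * Weak eigenfunctions and their traces *)

Section Eigenfunctions.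
Variable R : realType.
Local Notation leb1 := (@lebesgue_measure R).
Local Notation leb2 := ((@lebesgue_measure R) \x (@lebesgue_measure R))%E.
Local Notation C := (@circle R).
Local Notation D := (@disk R).
Local Notation RT := (g_sigma_algebraType R.-ocitv.-measurable).
Local Notation RT2 := (RT * RT)%type.
Local Notation bddmC := (@bddm _ RT R C).
Local Notation bddmD := (@bddm _ RT2 R D).
Local Notation sqC := (@sqint _ RT R leb1 C).
Local Notation sqD := (@sqint _ RT2 R leb2 D).
Local Notation cint := (rint leb1 C).
Local Notation dint := (rint leb2 D).
Local Notation mC := (@measurable_circle R).
Local Notation mD := (@measurable_disk R).
Local Notation muD := (@lebesgue_disk_fin R).
Implicit Types phi u v px py : R * R -> R.
Arguments eq_dint [R] g {f} _.
Arguments eq_cint [R] g {f} _.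

Definition mono2 (i : nat * nat) (z : R * R) : R := z.1 ^+ i.1 * z.2 ^+ i.2.

Lemma continuous_fst2 : continuous (fun z : R * R => z.1).
Proof. by move=> z; exact: cvg_fst. Qed.

Lemma continuous_snd2 : continuous (fun z : R * R => z.2).
Proof. by move=> z; exact: cvg_snd. Qed.

Lemma continuous_exp2 (f : R * R -> R) n : continuous f -> continuous (fun z => f z ^+ n).
Proof.
move=> cf; elim: n => [|n IH]; first by move=> z; exact: cvg_cst.
by under eq_fun do rewrite exprS; exact: continuous_mul2.
Qed.

Lemma continuous_mono2 i : continuous (mono2 i).
Proof.
by apply: continuous_mul2; apply: continuous_exp2; [exact: continuous_fst2|exact: continuous_snd2].
Qed.

Lemma bddm_mono2 i : bddmD (mono2 i).
Proof. by apply: bddm_disk; exact: continuous_mono2. Qed.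

(** Both coordinates send monomials to monomials, so the preimages of Borel sets under them have
    multiplier indicators; their intersections are the rectangles that generate the product
    sigma-algebra. *)
Lemma multset_disk A : measurable (A : set RT2) ->
  @multset _ RT2 R leb2 D _ mono2 A.
Proof.
set ms := @multset _ RT2 R leb2 D _ mono2.
have sig : sigma_algebra setT ms := multset_sigma_algebra mD muD bddm_mono2.
have [m0 mDf mU] := sig.
have mI B B' : ms B -> ms B' -> ms (B `&` B').
  move=> h h'; have := multiplierM mD h h'.
  by apply: (eq_multiplier mD) => t _; rewrite indicI.
have m1 : @multiplier _ RT2 R leb2 D _ mono2 (fun z => z.1).
  apply: (multiplier_gen mD muD bddm_mono2); first exact/bddm_disk/continuous_fst2.
  case=> i j; exists [:: (1, (i.+1, j))] => z _.
  by rewrite /comb big_seq1 mul1r /mono2 /= exprS mulrA.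
have m2 : @multiplier _ RT2 R leb2 D _ mono2 (fun z => z.2).
  apply: (multiplier_gen mD muD bddm_mono2); first exact/bddm_disk/continuous_snd2.
  case=> i j; exists [:: (1, (i, j.+1))] => z _.
  by rewrite /comb big_seq1 mul1r /mono2 /= exprS mulrCA.
have pre (f : RT2 -> RT) : @multiplier _ RT2 R leb2 D _ mono2 f ->
    forall B, measurable (B : set RT) -> ms (f @^-1` B).
  move=> mf B mB.
  have sub : <<s @RGenOInfty.G R >> `<=` [set B | ms (f @^-1` B)].
    apply: smallest_sub; last first.
      move=> _ [x ->] /=.
      rewrite (_ : f @^-1` `]x, +oo[ = [set z | x < f z]).
        exact: (multset_gt mD muD bddm_mono2).
      by apply/seteqP; split => z /=; rewrite in_itv/= andbT.
    split.
    - by rewrite /mkset preimage_set0.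
    - by move=> B' mB'; have := mDf _ mB'; rewrite !setTD /mkset preimage_setC.
    - by move=> F mF; rewrite /mkset preimage_bigcup; exact: mU.
  by apply: sub; have := mB; rewrite -[X in _ -> X B]/((@RGenOInfty.G R).-sigma.-measurable) -RGenOInfty.measurableE.
rewrite measurable_prod_measurableType => mA.
have sub : <<s [set A `*` B | A in (measurable : set (set RT)) & B in (measurable : set (set RT))] >> `<=` ms.
  apply: smallest_sub => // _ [B mB [B' mB' <-]].
  rewrite (_ : B `*` B' = (fun z : RT2 => z.1) @^-1` B `&` (fun z : RT2 => z.2) @^-1` B')//.
  by apply: mI; apply: pre.
exact: sub.
Qed.

Lemma mono2_orthogonal u : sqD u ->
  (forall i j, dint (fun z => u z * mono2 (i, j) z) = 0) -> dint (fun z => u z ^+ 2) = 0.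
Proof.
move=> su h; apply: (orthogonal_null mD muD bddm_mono2); last by case.
apply: (sq_approximable mD muD bddm_mono2) => //; last exact: multset_disk.
apply: (eq_approximable mD) (approximable_gen mD muD bddm_mono2 (0%N, 0%N)) => z _.
by rewrite /mono2 !expr0 mulr1.
Qed.

Lemma H1tr_lin u px py g u' px' py' g' (c : R) :
  H1tr u px py g -> H1tr u' px' py' g' ->
  H1tr (fun z => u z + c * u' z) (fun z => px z + c * px' z)
    (fun z => py z + c * py' z) (fun t => g t + c * g' t).
Proof.
move=> h h'; have [su sx sy sg] := H1trP h; have [su' sx' sy' sg'] := H1trP h'.
have [[_ _ _ w1 w2] [_ tr]] := h; have [[_ _ _ w1' w2'] [_ tr']] := h'.
have cD phi (v : R * R) : C1 phi -> v = e1 R \/ v = e2 R -> sqD ('D_v phi).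
  by move=> hp hv; apply: sqD_cont; exact: C1_D.
have c0 phi : C1 phi -> sqD phi by move=> hp; apply: sqD_cont; exact: C1_continuous.
have hl1 : e1 R = e1 R \/ e1 R = e2 R by left.
have hl2 : e2 R = e1 R \/ e2 R = e2 R by right.
have lin f f' k : sqD f -> sqD f' -> sqD k ->
    dint (fun z => (f z + c * f' z) * k z) = dint (fun z => f z * k z) + c * dint (fun z => f' z * k z).
  move=> sf sf' sk; have i1 := sq_mul mD sf sk; have i2 := sq_mul mD sf' sk.
  rewrite -(rintZ mD)// -(rintD mD)//; last exact: (intgZ mD).
  by apply: eq_dint => z _; ring.
split; split.
- by apply/L2diskP; apply: (sq_add mD) => //; exact: (sqZ mD).
- by apply/L2diskP; apply: (sq_add mD) => //; exact: (sqZ mD).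
- by apply/L2diskP; apply: (sq_add mD) => //; exact: (sqZ mD).
- move=> phi hphi; have [hp _] := hphi.
  have := w1 _ hphi; have := w1' _ hphi => E' E.
  apply: (etrans (lin _ _ _ su su' (cD _ _ hp hl1))).
  apply: (etrans _ (congr1 -%R (esym (lin _ _ _ sx sx' (c0 _ hp))))).
  by rewrite /rint E E' opprD mulrN.
- move=> phi hphi; have [hp _] := hphi.
  have := w2 _ hphi; have := w2' _ hphi => E' E.
  apply: (etrans (lin _ _ _ su su' (cD _ _ hp hl2))).
  apply: (etrans _ (congr1 -%R (esym (lin _ _ _ sy sy' (c0 _ hp))))).
  by rewrite /rint E E' opprD mulrN.
- by apply/L2circleP; apply: (sq_add mC) => //; exact: (sqZ mC).
move=> phi hp.
have linC (k : R -> R) : continuous k ->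
    cint (fun t => (g t + c * g' t) * phi (cos t, sin t) * k t) =
    cint (fun t => g t * phi (cos t, sin t) * k t) + c * cint (fun t => g' t * phi (cos t, sin t) * k t).
  move=> ck.
  have sk : sqC (fun t => phi (cos t, sin t) * k t).
    apply: sqC_cont => t; apply: cvgM; last exact: ck.
    by apply: (continuous_circle (C1_continuous hp)).
  have i1 : intg leb1 C (fun t => g t * phi (cos t, sin t) * k t).
    by apply: (eq_intg mC) (sq_mul mC sg sk) => t _; rewrite mulrA.
  have i2 : intg leb1 C (fun t => g' t * phi (cos t, sin t) * k t).
    by apply: (eq_intg mC) (sq_mul mC sg' sk) => t _; rewrite mulrA.
  rewrite -(rintZ mC)// -(rintD mC)//; last exact: (intgZ mC).
  by apply: eq_cint => z _; ring.
have linD f f' k k' : sqD f -> sqD f' -> sqD k -> sqD k' -> sqD phi -> forall d, sqD d ->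
    dint (fun z => (f z + c * f' z) * d z + (k z + c * k' z) * phi z) =
    dint (fun z => f z * d z + k z * phi z) + c * dint (fun z => f' z * d z + k' z * phi z).
  move=> sf sf' sk sk' sp d sd.
  have i1 := sq_mul mD sf sd; have i2 := sq_mul mD sf' sd.
  have i3 := sq_mul mD sk sp; have i4 := sq_mul mD sk' sp.
  rewrite -(rintZ mD); last exact: (intgD mD).
  rewrite -(rintD mD); [|exact: (intgD mD)|by apply: (intgZ mD); exact: (intgD mD)].
  by apply: eq_dint => z _; ring.
have [E1 E2] := tr _ hp; have [E1' E2'] := tr' _ hp.
split.
  apply: (etrans (linD _ _ _ _ su su' sx sx' (c0 _ hp) _ (cD _ _ hp hl1))).
  apply: (etrans _ (esym (linC _ (@continuous_cos R)))).
  by rewrite /rint E1 E1'.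
apply: (etrans (linD _ _ _ _ su su' sy sy' (c0 _ hp) _ (cD _ _ hp hl2))).
apply: (etrans _ (esym (linC _ (@continuous_sin R)))).
by rewrite /rint E2 E2'.
Qed.

Lemma H1tr_sum n (c : 'I_n -> R) (u px py : 'I_n -> R * R -> R) (g : 'I_n -> R -> R) :
  (forall i, H1tr (u i) (px i) (py i) (g i)) ->
  H1tr (fun z => \sum_i c i * u i z) (fun z => \sum_i c i * px i z)
    (fun z => \sum_i c i * py i z) (fun t => \sum_i c i * g i t).
Proof.
move=> h.
have h0 : H1tr (fun=> 0) (fun=> 0) (fun=> 0) (fun=> 0 : R).
  have hz (z v : R * R) : is_derive z v (fun=> 0 : R) 0 by exact: is_derive_cst.
  have c0 : continuous (fun _ : R * R => 0 : R) by move=> z; exact: cvg_cst.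
  have := C1_H1tr (C1_intro (fun z => hz z _) (fun z => hz z _) c0 c0).
  have -> : 'D_(e1 R) (fun=> 0 : R) = fun=> 0 by apply/funext => z; have [_ ->] := hz z (e1 R).
  by [].
have hs (s : seq 'I_n) : H1tr (fun z => \sum_(i <- s) c i * u i z) (fun z => \sum_(i <- s) c i * px i z)
    (fun z => \sum_(i <- s) c i * py i z) (fun t => \sum_(i <- s) c i * g i t).
  elim: s => [|i s IH].
    have E (T : Type) (f : 'I_n -> T -> R) : (fun=> 0) = (fun z => \sum_(j <- [::]) c j * f j z).
      by apply/funext => z; rewrite big_nil.
    by rewrite -!E.
  have := H1tr_lin (c i) IH (h i).
  suff E (T : Type) (f : 'I_n -> T -> R) : (fun z => \sum_(j <- s) c j * f j z + c i * f i z) =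
      (fun z => \sum_(j <- i :: s) c j * f j z) by rewrite !E.
  by apply/funext => z; rewrite big_cons addrC.
exact: hs.
Qed.

Variables (rho : R -> R).
Hypothesis brho : bddmC rho.

Definition weak_eig (lam : R) (u px py : R * R -> R) (g : R -> R) :=
  H1tr u px py g /\ forall v qx qy h, H1tr v qx qy h ->
    dint (fun z => px z * qx z + py z * qy z) =
    lam * cint (fun t => rho t * g t * h t).

Lemma weak_steklovP lam u :
  weak_steklov rho lam u <-> exists px py g, weak_eig lam u px py g.
Proof.
split=> [[px [py [g [h1 h2 h3]]]]|[px [py [g [[h1 h2] h3]]]]]; exists px, py, g.
  by split=> // v qx qy h [hv1 hv2]; exact: h3 hv1 hv2.
split; [exact: h1|exact: h2|] => v qx qy h hv1 hv2.
exact: (h3 v qx qy h (conj hv1 hv2)).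
Qed.

Definition coef_eig (lam : R) (g : R -> R) := sqC g /\
  forall k, freq R k * fcoef g k = lam * fcoef (fun t => rho t * g t) k.

(** Test the weak equation with the harmonic polynomial [harm k]. *)
Lemma weak_eig_coef lam u px py g : weak_eig lam u px py g -> coef_eig lam g.
Proof.
move=> [h he]; have [_ sx sy sg] := H1trP h; split => // k.
rewrite -(harm_energy k h) /fcoef -(he _ _ _ _ (harm_H1tr R k)).
by apply: eq_dint => z _; rewrite [px z * _]mulrC [py z * _]mulrC.
Qed.

(** Any monomial can thus stand as the differentiated test function in the Gauss-Green formula. *)
Lemma C1_mono_primitive i j :
  C1 (fun z : R * R => i.+1%:R^-1 * mono2 (i.+1, j) z) /\
  forall z, 'D_(e1 R) (fun z : R * R => i.+1%:R^-1 * mono2 (i.+1, j) z) z = mono2 (i, j) z.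
Proof.
have dX (f : R * R -> R) (z v : R * R) df n : is_derive z v f df ->
    is_derive z v (fun z => f z ^+ n) (n%:R * f z ^+ n.-1 * df).
  move=> hf; elim: n => [|n IH]; first by rewrite !mul0r; exact: is_derive_cst.
  under eq_fun do rewrite exprS.
  apply: is_derive_eq (is_derive_mul hf IH) _.
  by case: n {IH} => [|n] /=; rewrite ?expr0 -?(natr1 n.+1) ?exprS; ring.
have d1 z := is_derive_scale i.+1%:R^-1 (is_derive_mul (dX _ _ _ _ i.+1 (is_derive_fst z (e1 R)))
  (dX _ _ _ _ j (is_derive_snd z (e1 R)))).
have d2 z := is_derive_scale i.+1%:R^-1 (is_derive_mul (dX _ _ _ _ i.+1 (is_derive_fst z (e2 R)))
  (dX _ _ _ _ j (is_derive_snd z (e2 R)))).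
have i0 : i.+1%:R != 0 :> R by rewrite pnatr_eq0.
split; last first.
  move=> z; have [_ E] := d1 z; rewrite -[LHS]/('D_(e1 R) _ z) E /e1 /mono2 /=.
  by rewrite mulr0 mulr0 add0r mulr1; field.
have c0 (c : R) : continuous (fun _ : R * R => c) by move=> z; exact: cvg_cst.
have cX1 n : continuous (fun z : R * R => z.1 ^+ n) by apply: continuous_exp2; exact: continuous_fst2.
have cX2 n : continuous (fun z : R * R => z.2 ^+ n) by apply: continuous_exp2; exact: continuous_snd2.
apply: (C1_intro d1 d2); rewrite /e1 /e2 /=; apply: continuous_mul2 => //; apply: continuous_add2;
  apply: continuous_mul2 => //; apply: continuous_mul2 => //; exact: continuous_mul2.
Qed.

(** With null trace and null x-derivative, Gauss-Green makes u orthogonal to every monomial. *)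
Lemma H1tr_zero_grad u px py g : H1tr u px py g ->
  dint (fun z => px z ^+ 2) = 0 -> cint (fun t => g t ^+ 2) = 0 ->
  dint (fun z => u z ^+ 2) = 0.
Proof.
move=> h px0 g0; have [su sx sy sg] := H1trP h; have [_ [_ tr]] := h.
apply: mono2_orthogonal => // i j.
have [hc hd] := C1_mono_primitive i j.
set phi := (fun z : R * R => _) in hc hd.
have cphi := C1_continuous hc.
have [E _] := tr _ hc.
have p0 : dint (fun z => px z * phi z) = 0 by apply: (sq_null_mul mD sx) => //; exact: sqD_cont.
have q0 : cint (fun t => g t * phi (cos t, sin t) * cos t) = 0.
  rewrite (eq_cint (fun t => g t * (phi (cos t, sin t) * cos t))); last first.
    by move=> t _; exact: (esym (mulrA _ _ _)).
  apply: (sq_null_mul mC sg) => //; apply: sqC_cont => t.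
  by apply: cvgM; [exact: (continuous_circle cphi)|exact: continuous_cos].
have sd : sqD (mono2 (i, j)) by apply: sqD_cont; exact: continuous_mono2.
rewrite /rint in p0 q0; move: E; rewrite q0 => E.
have := rintD mD (sq_mul mD su sd) (sq_mul mD sx (sqD_cont cphi)).
rewrite {3}/rint p0 addr0 => <-; rewrite -[RHS]E; apply: eq_dint => z _.
by rewrite hd.
Qed.

Section Family.
Variables (n : nat) (c lam : 'I_n -> R) (u px py : 'I_n -> R * R -> R) (g : 'I_n -> R -> R).
Hypothesis he : forall i, weak_eig (lam i) (u i) (px i) (py i) (g i).

(** Testing each equation with the combination itself gives its energy, and the right-hand sides
    contain the null trace as a factor. Linear independence on the disk thereby passes to the
    traces. *)
Lemma trace_null_ae :
  cint (fun t => (\sum_i c i * g i t) ^+ 2) = 0 ->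
  {ae leb2, forall z, D z -> \sum_i c i * u i z = 0}.
Proof.
move=> g0; have hs := H1tr_sum c (fun i => (he i).1).
have [su sx sy sg] := H1trP hs.
apply: (sq_null_ae mD su); apply: (H1tr_zero_grad hs) => //.
set PX := (fun z : R * R => \sum_i c i * px i z) in hs sx *.
set PY := (fun z : R * R => \sum_i c i * py i z) in hs sy *.
set G := (fun t => \sum_i c i * g i t) in hs sg g0 *.
have e0 i : dint (fun z => px i z * PX z + py i z * PY z) = 0.
  have [hi1 hi2] := he i; rewrite (hi2 _ _ _ _ hs).
  have [_ _ _ sgi] := H1trP hi1.
  rewrite (eq_cint (fun t => G t * (rho t * g i t))); last by move=> t _; rewrite mulrC.
  by rewrite (sq_null_mul mC sg)// ?mulr0//; exact: (sq_mulb mC).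
have [_ ix] := sx; have [_ iy] := sy.
have : dint (fun z => PX z ^+ 2 + PY z ^+ 2) = 0.
  rewrite (eq_dint (fun z => \sum_i c i * (px i z * PX z + py i z * PY z))); last first.
    move=> z _; under [RHS]eq_bigr do rewrite mulrDr !mulrA.
    by rewrite big_split /= -!mulr_suml -!expr2.
  have ii i : intg leb2 D (fun z => px i z * PX z + py i z * PY z).
    have [hi _] := he i; have [_ six siy _] := H1trP hi.
    by apply: (intgD mD); exact: (sq_mul mD).
  rewrite (rint_sum mD muD); last by move=> i; exact: (intgZ mD).
  by rewrite big1// => i _; rewrite (rintZ mD)// e0 mulr0.
rewrite (rintD mD)// => h.
have h1 : 0 <= dint (fun z => PX z ^+ 2) by apply: rint_ge0 => z _; exact: sqr_ge0.
have h2 : 0 <= dint (fun z => PY z ^+ 2) by apply: rint_ge0 => z _; exact: sqr_ge0.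
by apply/eqP; rewrite eq_le h1 andbT -[leRHS]h lerDl.
Qed.

End Family.

(* Testing the Gauss-Green formula with phi = |z|^(2n) psi: the interior terms
   vanish in the limit, so the trace only depends on u and its gradient. *)
Lemma null_trace u px py g : H1tr u px py g -> dint (fun z => u z ^+ 2) = 0 ->
  cint (fun t => g t ^+ 2) = 0.
Proof.
move=> h u0; have [su sx sy sg] := H1trP h; have [_ [_ tr]] := h.
have hl1 : e1 R = e1 R \/ e1 R = e2 R by left.
have hl2 : e2 R = e1 R \/ e2 R = e2 R by right.
pose q (z : R * R) : R := z.1 ^+ 2 + z.2 ^+ 2.
have cq : continuous q by exact: continuous_sqsum.
have C1q : C1 q.
  have f1 (z v : R * R) := is_derive_fst z v; have f2 (z v : R * R) := is_derive_snd z v.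
  have hd (z v : R * R) : is_derive z v q (2 * z.1 * v.1 + 2 * z.2 * v.2).
    have := is_derive_add (is_derive_mul (f1 z v) (f1 z v)) (is_derive_mul (f2 z v) (f2 z v)).
    under eq_fun do rewrite -!expr2.
    by move=> hh; apply: is_derive_eq hh _; ring.
  have c0 (c : R) : continuous (fun _ : R * R => c) by move=> z; exact: cvg_cst.
  apply: (C1_intro (fun z => hd z (e1 R)) (fun z => hd z (e2 R))); rewrite /e1 /e2 /=;
  apply: continuous_add2; apply: continuous_mul2 => //; apply: continuous_mul2 => //;
  by [exact: continuous_fst2|exact: continuous_snd2].
have C1q' n psi : C1 psi -> C1 (fun z => q z ^+ n * psi z).
  move=> hp; elim: n => [|n IH].
    by under eq_fun do rewrite expr0 mul1r.
  under eq_fun do rewrite exprS -mulrA; exact: C1_mul.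
have qc t : q (cos t, sin t) = 1 by rewrite /q /= cos2Dsin2.
have cv psi (f : R * R -> R) : continuous psi -> sqD f ->
    (fun n => dint (fun z => f z * (q z ^+ n * psi z))) @ \oo --> (0 : R).
  move=> cpsi sf.
  have ifp := sq_mul mD sf (sqD_cont cpsi).
  have iabs : intg leb2 D (fun z => `|f z * psi z|) by apply: integrable_norm.
  suff [_] : intg leb2 D (fun=> 0) /\ (fun n => dint (fun z => f z * (q z ^+ n * psi z))) @ \oo --> dint (fun=> 0).
    have -> : dint (fun=> 0) = 0 by rewrite /rint Rintegral_cst ?mul0r//; exact: mD.
    exact.
  apply: (@rint_dominated _ RT2 R leb2 D mD (fun n z => f z * (q z ^+ n * psi z))
     (fun=> 0) (fun z => `|f z * psi z|)) => //.
  - move=> n; apply: intg_meas; apply: (sq_mul mD sf); apply: sqD_cont.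
    by apply: continuous_mul2 => //; exact: continuous_exp2.
  - move=> z Dz.
    rewrite (_ : (fun n => _) = (fun n => (f z * psi z) * q z ^+ n)); last first.
      by apply/funext => n; ring.
    rewrite -(mulr0 (f z * psi z)); apply: cvgMl_tmp; apply: cvg_expr.
    by rewrite ger0_norm ?addr_ge0 ?sqr_ge0//; exact: Dz.
  - move=> n z Dz; rewrite mulrCA normrM ler_piMl// normrX exprn_ile1//.
    by rewrite ger0_norm ?addr_ge0 ?sqr_ge0// ltW//; exact: Dz.
have key1 psi : C1 psi -> cint (fun t => g t * psi (cos t, sin t) * cos t) = 0.
  move=> hp; have cpsi := C1_continuous hp.
  have E n : dint (fun z => px z * (q z ^+ n * psi z)) =
      cint (fun t => g t * psi (cos t, sin t) * cos t).
    have hc := C1q' n _ hp; have [En _] := tr _ hc.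
    have sd : sqD ('D_(e1 R) (fun z => q z ^+ n * psi z)) by apply: sqD_cont; exact: C1_D hc hl1.
    have sp : sqD (fun z => q z ^+ n * psi z) by apply: sqD_cont; exact: C1_continuous.
    have un : dint (fun z => u z * 'D_(e1 R) (fun z => q z ^+ n * psi z) z) = 0 by exact: (sq_null_mul mD).
    have := rintD mD (sq_mul mD su sd) (sq_mul mD sx sp).
    rewrite un add0r => <-; apply: (etrans En); apply: eq_cint => t _.
    by rewrite qc expr1n mul1r.
  have := cv _ _ cpsi sx; under eq_fun do rewrite E.
  by move/cvg_lim; rewrite lim_cst// => /(_ (@norm_hausdorff _ _)).
have key2 psi : C1 psi -> cint (fun t => g t * psi (cos t, sin t) * sin t) = 0.
  move=> hp; have cpsi := C1_continuous hp.
  have E n : dint (fun z => py z * (q z ^+ n * psi z)) =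
      cint (fun t => g t * psi (cos t, sin t) * sin t).
    have hc := C1q' n _ hp; have [_ En] := tr _ hc.
    have sd : sqD ('D_(e2 R) (fun z => q z ^+ n * psi z)) by apply: sqD_cont; exact: C1_D hc hl2.
    have sp : sqD (fun z => q z ^+ n * psi z) by apply: sqD_cont; exact: C1_continuous.
    have un : dint (fun z => u z * 'D_(e2 R) (fun z => q z ^+ n * psi z) z) = 0 by exact: (sq_null_mul mD).
    have := rintD mD (sq_mul mD su sd) (sq_mul mD sy sp).
    rewrite un add0r => <-; apply: (etrans En); apply: eq_cint => t _.
    by rewrite qc expr1n mul1r.
  have := cv _ _ cpsi sy; under eq_fun do rewrite E.
  by move/cvg_lim; rewrite lim_cst// => /(_ (@norm_hausdorff _ _)).
apply: fcoef_eq0 => // k.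
(* The tests x E and y E, with E the harmonic polynomial of index k, recombine the normal factors
   into cos^2 + sin^2 = 1 and leave the k-th coefficient of g. *)
have C1x : C1 (fun z : R * R => z.1 * harm k z).
  apply: C1_mul; last exact: C1_harm.
  have c0 (c : R) : continuous (fun _ : R * R => c) by move=> z; exact: cvg_cst.
  exact: (C1_intro (fun z => is_derive_fst z (e1 R)) (fun z => is_derive_fst z (e2 R)) (c0 _) (c0 _)).
have C1y : C1 (fun z : R * R => z.2 * harm k z).
  apply: C1_mul; last exact: C1_harm.
  have c0 (c : R) : continuous (fun _ : R * R => c) by move=> z; exact: cvg_cst.
  exact: (C1_intro (fun z => is_derive_snd z (e1 R)) (fun z => is_derive_snd z (e2 R)) (c0 _) (c0 _)).
have E1 := key1 _ C1x; have E2 := key2 _ C1y.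
have ic f : continuous f -> intg leb1 C (fun t => g t * f t) by move=> cf; apply: (sq_mul mC sg); exact: sqC_cont.
have cb := @continuous_basis R k.
have cc2 : continuous (fun t : R => cos t * basis k t * cos t).
  move=> t; apply: cvgM; last exact: continuous_cos; apply: cvgM; [exact: continuous_cos|exact: cb].
have cs2 : continuous (fun t : R => sin t * basis k t * sin t).
  move=> t; apply: cvgM; last exact: continuous_sin; apply: cvgM; [exact: continuous_sin|exact: cb].
have := rintD mC (ic _ cc2) (ic _ cs2).
rewrite (eq_cint (fun t => g t * basis k t)); last first.
  move=> t _; rewrite -mulrDr; congr (_ * _).
  by rewrite -[RHS]mul1r -(cos2Dsin2 t); ring.
rewrite /fcoef => ->.
rewrite (eq_cint (fun t => g t * (cos t * harm k (cos t, sin t)) * cos t)); last first.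
  by move=> t _; rewrite harm_circle mulrA.
rewrite (@eq_cint R (fun t => g t * (sin t * harm k (cos t, sin t)) * sin t)
  (fun t => g t * (sin t * basis k t * sin t))); last first.
  by move=> t _; rewrite harm_circle mulrA.
by rewrite [X in X + _]E1 [X in _ + X]E2 addr0.
Qed.

End Eigenfunctions.

(** * Successive maximisation of a quadratic form *)

Lemma cauchy_real_cvg (R : realType) (u : nat -> R) :
  (forall e : R, 0 < e ->
     exists N, forall n m, (N <= n)%N -> (n <= m)%N -> `|u m - u n| <= e) ->
  cvgn u.
Proof.
move=> hu; apply: cauchy_cvg; apply: cauchy_exP => e e0.
have e2 : 0 < e / 2 by rewrite divr_gt0.
have [N hN] := hu _ e2.
exists (u N); exists N => // n /= Nn; rewrite /ball/= distrC.
by rewrite (le_lt_trans (hN N n (leqnn _) Nn))// ltr_pdivrMr// ltr_pMr// ltr1n.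
Qed.

Lemma continuous_mulr (R : realType) (T : topologicalType) (c : R) (f g : T -> R) :
  continuous f -> continuous g -> continuous (fun x => c * (f x * g x)).
Proof. by move=> cf cg x; apply: cvgMl_tmp; apply: cvgM; [exact: cf|exact: cg]. Qed.

Lemma continuous_bigsum (R : realType) (T : topologicalType) (f : nat -> T -> R) N :
  (forall k, continuous (f k)) -> continuous (fun x => \sum_(k < N) f k x).
Proof.
move=> cf; elim: N => [|N IH].
  rewrite (_ : (fun x => _) = cst 0); first by move=> x; exact: cvg_cst.
  by apply/funext => x; rewrite big_ord0.
rewrite (_ : (fun x => _) = (fun x => \sum_(k < N) f k x) \+ f N).
  by move=> x; apply: cvgD; [exact: IH|exact: cf].
by apply/funext => x; rewrite big_ord_recr.
Qed.

Section ExtremalSequence.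
Variable R : realType.
Variables (b : nat -> nat -> R) (w : nat -> R).

(** Finite sections of a form, to be the deflated one, of the Dirichlet energy and of the l^2 norm.
    Index 0 has weight 0, which does no harm because the form does not see that coordinate either
    ([b0]). *)
Definition bil N (x y : nat -> R) := \sum_(k < N) \sum_(l < N) b k l * (x k * y l).
Definition wsum N (x : nat -> R) := \sum_(k < N) w k * x k ^+ 2.
Definition ssum N (x : nat -> R) := \sum_(k < N) x k ^+ 2.

Hypothesis bsym : forall k l, b k l = b l k.
Hypothesis b0 : forall l, b 0 l = 0.
Hypothesis bge0 : forall N x, 0 <= bil N x x.
Hypothesis ble1 : forall N x, bil N x x <= ssum N x.
Hypothesis w0 : w 0 = 0.
Hypothesis w1 : forall k, (0 < k)%N -> 1 <= w k.
Hypothesis w_unbounded : forall M, exists N, forall k, (N <= k)%N -> M <= w k.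

Definition trunc N (x : nat -> R) k := if (k < N)%N then x k else 0.

Lemma bilC N x y : bil N x y = bil N y x.
Proof.
rewrite /bil exchange_big; apply: eq_bigr => k _; apply: eq_bigr => l _.
by rewrite bsym; congr (_ * _); exact: mulrC.
Qed.

Lemma bil_lin N x y z (c : R) :
  bil N (fun k => x k + c * y k) z = bil N x z + c * bil N y z.
Proof.
rewrite /bil mulr_sumr -big_split; apply: eq_bigr => k _ /=.
rewrite mulr_sumr -big_split; apply: eq_bigr => l _ /=; ring.
Qed.

Lemma bil_sqrD N x y (c : R) :
  bil N (fun k => x k + c * y k) (fun k => x k + c * y k) =
  bil N x x + 2 * c * bil N x y + c ^+ 2 * bil N y y.
Proof.
rewrite (bil_lin N x y (fun k => x k + c * y k) c).
rewrite (bilC N x (fun k => x k + c * y k)) (bilC N y (fun k => x k + c * y k)).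
rewrite (bil_lin N x y x c) (bil_lin N x y y c) (bilC N y x); ring.
Qed.

Lemma bil_amgm N x y c : 0 < c ->
  2 * `|bil N x y| <= c * bil N x x + c^-1 * bil N y y.
Proof.
move=> c0; have cV : c * c^-1 = 1 by rewrite divff ?gt_eqF.
have cV0 : 0 < c^-1 by rewrite invr_gt0.
have h1 := bge0 N (fun k => x k + c^-1 * y k).
have h2 := bge0 N (fun k => x k + - c^-1 * y k).
rewrite !bil_sqrD in h1 h2.
have e1 : 0 <= c * (bil N x x + 2 * c^-1 * bil N x y + c^-1 ^+ 2 * bil N y y).
  by rewrite mulr_ge0// ltW.
have e2 : 0 <= c * (bil N x x + 2 * - c^-1 * bil N x y + (- c^-1) ^+ 2 * bil N y y).
  by rewrite mulr_ge0// ltW.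
have E1 : c * (bil N x x + 2 * c^-1 * bil N x y + c^-1 ^+ 2 * bil N y y) =
  c * bil N x x + 2 * (c * c^-1) * bil N x y + (c * c^-1) * c^-1 * bil N y y by ring.
have E2 : c * (bil N x x + 2 * - c^-1 * bil N x y + (- c^-1) ^+ 2 * bil N y y) =
  c * bil N x x - 2 * (c * c^-1) * bil N x y + (c * c^-1) * c^-1 * bil N y y by ring.
rewrite E1 cV in e1; rewrite E2 cV in e2.
by case: (ger0P (bil N x y)) => h; lra.
Qed.

Lemma trunc_sum N M x (F : nat -> R -> R) : (N <= M)%N -> (forall k, F k 0 = 0) ->
  \sum_(k < M) F k (trunc N x k) = \sum_(k < N) F k (x k).
Proof.
move=> NM F0; rewrite (big_ord_widen _ (fun k => F k (x k)) NM) [RHS]big_mkcond.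
by apply: eq_bigr => k _; rewrite /trunc; case: ifP => // _; rewrite F0.
Qed.

Lemma bil_trunc N M x y : (N <= M)%N -> bil M (trunc N x) (trunc N y) = bil N x y.
Proof.
move=> NM; rewrite /bil.
rewrite -(@trunc_sum N M x (fun k xk => \sum_(l < N) b k l * (xk * y l)))//; last first.
  by move=> k; apply: big1 => l _; rewrite mul0r mulr0.
apply: eq_bigr => k _.
rewrite -(@trunc_sum N M y (fun l yl => b k l * (trunc N x k * yl)))//.
by move=> l; rewrite !mulr0.
Qed.

Lemma wsum_trunc N M x : (N <= M)%N -> wsum M (trunc N x) = wsum N x.
Proof.
move=> NM; rewrite /wsum -(@trunc_sum N M x (fun k xk => w k * xk ^+ 2))//.
by move=> k; rewrite expr0n mulr0.
Qed.

Lemma wge0 k : 0 <= w k.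
Proof. by case: k => [|k]; [rewrite w0|rewrite (le_trans ler01)// w1]. Qed.

Lemma wsum_le N M x : (N <= M)%N -> wsum N x <= wsum M x.
Proof.
move=> NM; rewrite /wsum (big_ord_widen _ (fun k => w k * x k ^+ 2) NM) big_mkcond.
apply: ler_sum => k _; case: ifP => // _.
by rewrite mulr_ge0 ?wge0 ?sqr_ge0.
Qed.

(** The energy leaves the coordinate 0 free, so it is pinned to keep the set bounded. *)
Definition wball : set (nat -> R) :=
  [set x | x 0%N = 0 /\ forall N, wsum N x <= 1].

(** Split x into its first N terms and the tail y: the energy bound makes the squared norm of the
    tail at most 1 / W, and the cross term is estimated with the weight c. *)
Lemma wball_bil_cauchy x N M c (W : R) : wball x -> (N <= M)%N -> 0 < c -> 0 < W ->
  (forall k, (N <= k)%N -> W <= w k) ->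
  `|bil M x x - bil N x x| <= c + (1 + c^-1) * W^-1.
Proof.
move=> [x0 hx] NM c0 W0 hW.
have c'0 : 0 < c^-1 by rewrite invr_gt0.
pose y k := x k - trunc N x k.
have xE : x = (fun k => trunc N x k + 1 * y k).
  by apply/funext => k; rewrite /y mul1r addrC subrK.
have EM : bil M x x = bil N x x + 2 * bil M (trunc N x) y + bil M y y.
  by rewrite {1 2}xE bil_sqrD bil_trunc// mulr1 expr1n mul1r.
have hy : bil M y y <= W^-1.
  apply: le_trans (ble1 _ _) _.
  rewrite -[leRHS]mulr1 -ler_pdivrMl ?invr_gt0// invrK.
  apply: le_trans (hx M).
  rewrite /ssum /wsum mulr_sumr; apply: ler_sum => k _.
  rewrite /y /trunc; case: ifPn => kN; last by rewrite subr0 ler_wpM2r ?sqr_ge0// hW// leqNgt.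
  by rewrite subrr expr0n mulr0 mulr_ge0 ?wge0 ?sqr_ge0.
have hN : bil N x x <= 1.
  apply: le_trans (ble1 _ _) (le_trans _ (hx N)).
  rewrite /ssum /wsum; apply: ler_sum => -[[|k] kN] _ /=; first by rewrite x0 expr0n mulr0.
  by rewrite ler_peMl ?sqr_ge0// w1.
have := bil_amgm M (trunc N x) y c0; rewrite bil_trunc// => h1.
have hy0 := bge0 M y.
rewrite EM (_ : _ + _ + _ - _ = 2 * bil M (trunc N x) y + bil M y y); last by ring.
apply: le_trans (ler_normD _ _) _; rewrite normrM (ger0_norm hy0) (ger0_norm (_ : 0 <= 2))//.
apply: (@le_trans _ _ (c * bil N x x + c^-1 * bil M y y + bil M y y)); first by rewrite lerD2r.
rewrite mulrDl mul1r addrAC -addrA lerD ?ler_piMr ?(ltW c0)//.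
by rewrite addrC [leRHS]addrC lerD// ler_wpM2l// ltW.
Qed.

Lemma wball_bil_uniform e : 0 < e -> exists N0, forall N M x, wball x ->
  (N0 <= N)%N -> (N <= M)%N -> `|bil M x x - bil N x x| <= e.
Proof.
move=> e0; pose c := e / 2.
have c0 : 0 < c by rewrite divr_gt0.
have c1 : 0 < 1 + c^-1 by rewrite addr_gt0// invr_gt0.
(* Balances the two errors: (1 + 1 / c) / W = c = e / 2. *)
pose W := (1 + c^-1) / c.
have W0 : 0 < W by rewrite divr_gt0.
have [N0 hN0] := w_unbounded W.
exists N0 => N M x hx N0N NM.
apply: le_trans (@wball_bil_cauchy x N M c W hx NM c0 W0 _) _.
  by move=> k Nk; apply: hN0; exact: leq_trans Nk.
rewrite (_ : _ / W = c); first by rewrite /c -splitr.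
rewrite /W; have : c != 0 by rewrite gt_eqF.
have : 1 + c^-1 != 0 by rewrite gt_eqF.
by move: c c1 {c0 W W0 hN0} => c _ h1 h2; rewrite invf_div mulrC -mulrA mulVf ?mulr1.
Qed.

Local Notation PT := (prod_topology (fun _ : nat => R)).

(** Each condition involves finitely many coordinates, so the ball is closed for coordinatewise
    convergence inside the compact product of intervals [-1, 1]. *)
Lemma compact_wball : compact (wball : set PT).
Proof.
have cproj (k : nat) : continuous (fun x : PT => x k) by exact: proj_continuous.
have cterm (k : nat) : continuous (fun x : PT => w k * x k ^+ 2).
  exact: (@continuous_mulr R PT (w k) (fun x => x k) (fun x => x k)).
have csum N : continuous (fun x : PT => wsum N x).
  exact: (@continuous_bigsum R PT (fun k x => w k * x k ^+ 2)).
apply: (@subclosed_compact _ _ [set x : PT | forall k, `[-1, 1]%classic (x k)]).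
- rewrite (_ : wball = [set x : PT | x 0%N = 0] `&` \bigcap_N [set x : PT | wsum N x <= 1]); last first.
    by apply/seteqP; split => x [? h]; split => // N; [move=> _; exact: h|exact: (h N I)].
  apply: closedI.
    rewrite (_ : [set x : PT | x 0%N = 0] = (fun x : PT => x 0%N) @^-1` [set 0])//.
    by apply: preimage_closed; [move=> x _; exact: cproj|exact: closed_eq].
  apply: closed_bigI => N _.
  rewrite (_ : [set x : PT | _] = (fun x : PT => wsum N x) @^-1` [set r | r <= 1])//.
  by apply: preimage_closed; [move=> x _; exact: csum|exact: closed_le].
- by apply: (@tychonoff nat (fun=> R) (fun=> `[-1, 1]%classic)) => _; exact: segment_compact.
- move=> x [x0 hx] k; rewrite /= in_itv/= -ler_norml.
  case: k => [|k]; first by rewrite x0 normr0.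
  have := hx k.+2; rewrite /wsum big_ord_recr /= => h.
  have : w k.+1 * x k.+1 ^+ 2 <= 1.
    apply: le_trans h; rewrite lerDr; apply: sumr_ge0 => l _.
    by rewrite mulr_ge0 ?wge0 ?sqr_ge0.
  have := w1 (ltn0Sn k) => h1 h2.
  have : x k.+1 ^+ 2 <= 1 by apply: le_trans h2; rewrite ler_peMl ?sqr_ge0.
  by rewrite -[X in X <= _](ger0_norm (sqr_ge0 _)) normrX expr_le1.
Qed.

Definition bform (x : nat -> R) : R := limn (fun N => bil N x x).

Lemma wball_bform x : wball x -> (fun N => bil N x x) @ \oo --> bform x.
Proof.
move=> hx; have : cvgn (fun N => bil N x x); last by [].
apply: cauchy_real_cvg => e e0.
have [N0 hN0] := wball_bil_uniform e0.
by exists N0 => n m h1 h2; exact: hN0.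
Qed.

(** On the ball the form is a uniform limit of polynomials in finitely many coordinates. *)
Lemma continuous_bform : {within (wball : set PT), continuous (bform : PT -> R)}.
Proof.
have cproj (k : nat) : continuous (fun x : PT => x k) by exact: proj_continuous.
have cbil N : continuous (fun x : PT => bil N x x).
  apply: (@continuous_bigsum R PT (fun k y => \sum_(l < N) b k l * (y k * y l))) => k.
  apply: (@continuous_bigsum R PT (fun l y => b k l * (y k * y l))) => l.
  exact: (@continuous_mulr R PT (b k l) (fun x => x k) (fun x => x l)).
apply/subspace_continuousP => x hx; apply/cvgrPdist_le => e e0.
have e3 : 0 < e / 3 by rewrite divr_gt0.
have [N0 hN0] := wball_bil_uniform e3.
have lim y : wball y -> `|bform y - bil N0 y y| <= e / 3.
  move=> hy; have cy : (fun N => `|bil N y y - bil N0 y y|) @ \oo --> `|bform y - bil N0 y y|.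
    by apply: cvg_norm; apply: cvgB; [exact: wball_bform|exact: cvg_cst].
  apply: (cvgr_to_le cy); exists N0 => // n /= h; exact: hN0.
have := cbil N0 x; move/cvgrPdist_le => /(_ _ e3); rewrite near_withinE; apply: filterS => y hy By.
have h1 := lim _ hx; have h2 := lim _ By.
change (`|bform x - bform y| <= e).
have -> : e = e / 3 + e / 3 + e / 3 by field.
rewrite (_ : _ - _ = (bform x - bil N0 x x) + (bil N0 x x - bil N0 y y) - (bform y - bil N0 y y));
  last by ring.
apply: le_trans (ler_normB _ _) _; rewrite lerD//.
by apply: le_trans (ler_normD _ _) _; rewrite lerD.
Qed.

(** The form attains its maximum beta on the compact energy ball; homogeneity extends the inequality
    to all sequences, and the first variation along each coordinate is the equation b x = beta w
    x. *)
Lemma extremal_sequence : (exists N x, 0 < bil N x x) ->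
  exists (beta : R) (x : nat -> R), [/\ 0 < beta, wball x, (fun N => bil N x x) @ \oo --> beta,
    forall k, (fun N => \sum_(l < N) b k l * x l) @ \oo --> beta * (w k * x k) &
    forall N y, bil N y y <= beta * wsum N y].
Proof.
move=> [N1 [x1 hx1]].
have wb0 : wball (fun=> 0).
  split => // N; rewrite /wsum big1 ?ler01// => k _; by rewrite expr0n mulr0.
have [|x hx hmax] := @compact_EVT_max PT R bform wball _ compact_wball continuous_bform.
  by exists (fun=> 0).
move/set_mem in hx; pose beta := bform x.
have fin N y : bil N y y <= beta * wsum N y.
  (* Zero energy leaves only the coordinate 0, on which the form vanishes. *)
  have [y0|y0] := eqVneq (wsum N y) 0.
    rewrite y0 mulr0.
    have yk k : (k < N)%N -> (0 < k)%N -> y k = 0.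
      move=> kN k0; apply/eqP; rewrite -sqrf_eq0 eq_le sqr_ge0 andbT.
      rewrite -y0 /wsum (bigD1 (Ordinal kN))//= -[leLHS]addr0 lerD//.
        by rewrite ler_peMl ?sqr_ge0// w1.
      by apply: sumr_ge0 => l _; rewrite mulr_ge0 ?wge0 ?sqr_ge0.
    rewrite /bil big1// => -[k kN] _ /=; apply: big1 => -[l lN] _ /=.
    case: k kN => [|k] kN; first by rewrite b0 mul0r.
    by rewrite yk// mul0r mulr0.
  have y1 : 0 < wsum N y.
    rewrite lt0r y0 /=; apply: sumr_ge0 => k _; by rewrite mulr_ge0 ?wge0 ?sqr_ge0.
  pose s := Num.sqrt (wsum N y).
  have s0 : 0 < s by rewrite sqrtr_gt0.
  have s2 : s ^+ 2 = wsum N y by rewrite sqr_sqrtr// ltW.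
  (* y is cut off at N, cleared at index 0, which neither the form nor the energy sees, and
     normalised to energy 1. *)
  pose z k := if k == 0%N then 0 else s^-1 * trunc N y k.
  have zE M : wsum M z = s^-1 ^+ 2 * wsum M (trunc N y).
    rewrite /wsum mulr_sumr; apply: eq_bigr => k _; rewrite /z; case: eqP => [->|_].
      by rewrite w0 !mul0r mulr0.
    by rewrite exprMn mulrCA.
  have bz M : bil M z z = s^-1 ^+ 2 * bil M (trunc N y) (trunc N y).
    rewrite /bil mulr_sumr; apply: eq_bigr => k _; rewrite mulr_sumr; apply: eq_bigr => l _.
    rewrite /z; case: (eqVneq (nat_of_ord k) 0%N) => [->|_]; first by rewrite b0 !mul0r mulr0.
    case: (eqVneq (nat_of_ord l) 0%N) => [->|_]; first by rewrite bsym b0 !mul0r mulr0.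
    ring.
  have hz : wball z.
    split; first by rewrite /z eqxx.
    move=> M; apply: (@le_trans _ _ (wsum (maxn M N) z)); first by apply: wsum_le; exact: leq_maxl.
    by rewrite zE wsum_trunc ?leq_maxr// -s2 -exprMn mulVf ?expr1n// gt_eqF.
  have bfz : bform z = s^-1 ^+ 2 * bil N y y.
    apply: cvg_lim => //; apply: cvg_near_cst; exists N => // M /= NM.
    by rewrite bz bil_trunc.
  have := hmax z (mem_set hz); rewrite bfz -/beta exprVn s2.
  by rewrite ler_pdivrMl// mulrC.
have beta0 : 0 < beta.
  have := lt_le_trans hx1 (fin N1 x1) => h.
  have W0 : 0 <= wsum N1 x1 by apply: sumr_ge0 => k _; rewrite mulr_ge0 ?wge0 ?sqr_ge0.
  by move: W0 h; rewrite le_eqVlt => /predU1P[<-|W0]; rewrite ?mulr0 ?ltxx// pmulr_lgt0.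
have [x0 hxw] := hx.
have cb := wball_bform hx; rewrite -/beta in cb.
exists beta, x; split => // k.
apply/cvgrPdist_le => e e0.
pose d (j : nat) : R := (j == k)%:R.
have bd N : (k < N)%N -> bil N x d = \sum_(l < N) b k l * x l.
  move=> kN; rewrite bilC /bil (bigD1 (Ordinal kN))//= [X in _ + X]big1 ?addr0; last first.
    move=> j jk; apply: big1 => l _; rewrite /d (_ : (nat_of_ord j == k) = false) ?mul0r ?mulr0//.
    by apply/negbTE; apply: contra jk => /eqP jk; apply/eqP/val_inj.
  by apply: eq_bigr => l _; rewrite /d eqxx mul1r.
have bdd N : (k < N)%N -> bil N d d = b k k.
  move=> kN; rewrite /bil (bigD1 (Ordinal kN))//= [X in _ + X]big1 ?addr0; last first.
    move=> j jk; apply: big1 => l _; rewrite /d (_ : (nat_of_ord j == k) = false) ?mul0r ?mulr0//.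
    by apply/negbTE; apply: contra jk => /eqP jk; apply/eqP/val_inj.
  rewrite (bigD1 (Ordinal kN))//= [X in _ + X]big1 ?addr0; last first.
    move=> j jk; rewrite /d (_ : (nat_of_ord j == k) = false) ?mulr0//.
    by apply/negbTE; apply: contra jk => /eqP jk; apply/eqP/val_inj.
  by rewrite /d eqxx !mulr1.
have wd N (t : R) : (k < N)%N -> wsum N (fun j => x j + t * d j) =
    wsum N x + 2 * t * (w k * x k) + t ^+ 2 * w k.
  move=> kN; rewrite /wsum (bigD1 (Ordinal kN))//= [in RHS](bigD1 (Ordinal kN))//=.
  have -> : \sum_(i < N | i != Ordinal kN) w i * (x i + t * d i) ^+ 2 =
      \sum_(i < N | i != Ordinal kN) w i * x i ^+ 2.
    apply: eq_bigr => j jk; rewrite /d (_ : (nat_of_ord j == k) = false) ?mulr0 ?addr0//.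
    by apply/negbTE; apply: contra jk => /eqP jk; apply/eqP/val_inj.
  rewrite (_ : d k = 1); first by ring.
  by rewrite /d eqxx.
pose c := beta * w k - b k k.
(* first variation at the maximiser, with an explicit step t *)
have var N (t : R) : (k < N)%N ->
    2 * t * (\sum_(l < N) b k l * x l - beta * (w k * x k)) <= (beta - bil N x x) + t ^+ 2 * c.
  move=> kN; have := fin N (fun j => x j + t * d j).
  rewrite bil_sqrD bd// bdd// wd// => h.
  have hw := hxw N.
  have : beta * wsum N x <= beta by rewrite ler_piMr// ltW.
  rewrite /c; move: h; set S := \sum_(l < N) _; set B := bil N x x; set W := wsum N x; nra.
(* The second-order term is then at most t e; with beta - bil N x x <= t e for large N, the steps t
   and - t bound the residual by e from both sides. *)
pose t := e / (`|c| + 1).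
have c1 : 0 < `|c| + 1 by rewrite ltr_wpDl.
have t0 : 0 < t by rewrite divr_gt0.
have tc : t * c <= e.
  rewrite /t mulrAC ler_pdivrMr// ler_pM2l//; have := ler_norm c; lra.
have te0 : 0 < t * e by rewrite mulr_gt0.
move/cvgrPdist_le : cb => /(_ _ te0) [N0 _ hN0].
exists (maxn N0 k.+1) => // N /= hN.
have N0N : (N0 <= N)%N := leq_trans (leq_maxl _ _) hN.
have kN : (k < N)%N := leq_trans (leq_maxr _ _) hN.
have := hN0 N N0N; rewrite ler_norml => /andP[_ hb].
have v1 := var N t kN; have v2 := var N (- t) kN.
set S := \sum_(l < N) _ in v1 v2 *; set X := beta * (w k * x k) in v1 v2 *.
have k1 : t * (2 * (S - X)) <= t * (2 * e) by move: v1 hb tc; nra.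
have k2 : t * (2 * (X - S)) <= t * (2 * e) by move: v2 hb tc; nra.
rewrite !ler_pM2l// in k1 k2.
by rewrite ler_norml; apply/andP; split; lra.
Qed.

(* 2 <b x, v> <= <b v, v> + <b x, x> with v = b x gives |b x| <= |x|. *)
Lemma bil_contraction N (x : nat -> R) : \sum_(k < N) (\sum_(l < N) b k l * x l) ^+ 2 <= ssum N x.
Proof.
pose v k := \sum_(l < N) b k l * x l.
have E : bil N v x = ssum N v.
  rewrite /bil /ssum; apply: eq_bigr => k _.
  rewrite expr2 [in RHS]/v mulr_suml; apply: eq_bigr => l _; rewrite -/(v k); ring.
have := bil_amgm N v x (ltr01 : 0 < 1 :> R).
rewrite invr1 !mul1r E.
have := ble1 N v; have := ble1 N x; have := ler_norm (ssum N v).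
rewrite -/(ssum N v); lra.
Qed.

End ExtremalSequence.

(** * Lower and upper min-max bounds *)

Lemma cvg_bigsum (R : realType) (I : Type) (s : seq I) (f : I -> nat -> R) (l : I -> R) :
  (forall i, f i @ \oo --> l i) ->
  (fun N => \sum_(i <- s) f i N) @ \oo --> \sum_(i <- s) l i.
Proof.
move=> cf; elim: s => [|i s IH].
  by under eq_fun do rewrite big_nil; rewrite big_nil; exact: cvg_cst.
by under eq_fun do rewrite big_cons; rewrite big_cons; apply: cvgD.
Qed.

Section Rayleigh.
Variable R : realType.
Local Notation leb1 := (@lebesgue_measure R).
Local Notation C := (@circle R).
Local Notation RT := (g_sigma_algebraType R.-ocitv.-measurable).
Local Notation bddmC := (@bddm _ RT R C).
Local Notation sqC := (@sqint _ RT R leb1 C).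
Local Notation cint := (rint leb1 C).
Local Notation mC := (@measurable_circle R).
Local Notation muC := (@lebesgue_circle_fin R).
Arguments eq_cint [R] g {f} _.

Section Form.
Variable rho : R -> R.
Hypothesis brho : bddmC rho.

Definition wform (f g : R -> R) : R := cint (fun t => rho t * f t * g t).

Lemma sq_rho f : sqC f -> sqC (fun t => rho t * f t).
Proof. exact: (sq_mulb mC). Qed.

Lemma intg_wform f g : sqC f -> sqC g -> intg leb1 C (fun t => rho t * f t * g t).
Proof. by move=> hf hg; apply: (sq_mul mC) => //; exact: sq_rho. Qed.

Lemma wformC f g : wform f g = wform g f.
Proof. by apply: eq_cint => t _; rewrite mulrAC. Qed.

Lemma eq_wform f g f' g' : (forall t, C t -> f t = f' t) -> (forall t, C t -> g t = g' t) ->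
  wform f g = wform f' g'.
Proof. by move=> hf hg; apply: eq_cint => t Ct; rewrite hf// hg. Qed.

Lemma wformDl f g h : sqC f -> sqC g -> sqC h ->
  wform (fun t => f t + g t) h = wform f h + wform g h.
Proof.
move=> hf hg hh; rewrite -(rintD mC); [|exact: intg_wform..].
by apply: eq_cint => t _; rewrite mulrDr mulrDl.
Qed.

Lemma wformZl c f h : sqC f -> sqC h -> wform (fun t => c * f t) h = c * wform f h.
Proof.
move=> hf hh; rewrite -(rintZ mC); last exact: intg_wform.
by apply: eq_cint => t _; rewrite mulrCA -!mulrA.
Qed.

Lemma wformDr f g h : sqC f -> sqC g -> sqC h ->
  wform h (fun t => f t + g t) = wform h f + wform h g.
Proof. by move=> hf hg hh; rewrite ![wform h _]wformC wformDl. Qed.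

Lemma wformZr c f h : sqC f -> sqC h -> wform h (fun t => c * f t) = c * wform h f.
Proof. by move=> hf hh; rewrite ![wform h _]wformC wformZl. Qed.

Lemma wform_suml (I : Type) (s : seq I) (c : I -> R) (f : I -> R -> R) h :
  (forall i, sqC (f i)) -> sqC h ->
  wform (fun t => \sum_(i <- s) c i * f i t) h = \sum_(i <- s) c i * wform (f i) h.
Proof.
move=> hf hh; rewrite /wform (eq_cint (fun t => \sum_(i <- s) c i * (rho t * f i t * h t))).
  rewrite (rint_sum mC muC); last by move=> i; apply: (intgZ mC); exact: intg_wform.
  by apply: eq_bigr => i _; rewrite (rintZ mC)//; exact: intg_wform.
by move=> t _; rewrite mulr_sumr mulr_suml; apply: eq_bigr => i _; rewrite mulrCA -!mulrA.
Qed.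

Lemma wform_sumr (I : Type) (s : seq I) (c : I -> R) (f : I -> R -> R) h :
  (forall i, sqC (f i)) -> sqC h ->
  wform h (fun t => \sum_(i <- s) c i * f i t) = \sum_(i <- s) c i * wform h (f i).
Proof.
move=> hf hh; rewrite wformC wform_suml//; apply: eq_bigr => i _.
by rewrite wformC.
Qed.

Lemma fcoef_rho f k : fcoef (fun t => rho t * f t) k = wform f (@basis R k).
Proof. by []. Qed.

Lemma wform_parseval f h : sqC f -> sqC h ->
  (fun N => \sum_(k < N) wform f (@basis R k) * fcoef h k) @ \oo --> wform f h.
Proof. by move=> hf hh; apply: (parseval (sq_rho hf) hh). Qed.

Lemma wform_cvg f g (g_ : nat -> R -> R) : sqC f -> sqC g -> (forall n, sqC (g_ n)) ->
  (fun n => cint (fun t => (g_ n t - g t) ^+ 2)) @ \oo --> (0 : R) ->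
  (fun n => wform f (g_ n)) @ \oo --> wform f g.
Proof. by move=> hf hg hg_ cv; exact: (sq_cvg_mul mC (sq_rho hf) hg hg_ cv). Qed.

Hypothesis rho0 : forall t, C t -> 0 <= rho t.

Lemma wform_ge0 f : 0 <= wform f f.
Proof. by apply: rint_ge0 => t Ct; rewrite -mulrA -expr2 mulr_ge0 ?sqr_ge0// rho0. Qed.

Lemma wform_null f g : sqC f -> sqC g -> cint (fun t => f t ^+ 2) = 0 -> wform f g = 0.
Proof.
move=> hf hg f0; rewrite -(sq_null_mul mC hf (sq_rho hg) f0).
by apply: eq_cint => t _; rewrite mulrCA mulrA.
Qed.

Hypothesis rho1 : forall t, C t -> rho t <= 1.

Lemma wform_le f : sqC f -> wform f f <= cint (fun t => f t ^+ 2).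
Proof.
move=> hf; apply: (rint_le mC); [exact: intg_wform|by case: hf|].
by move=> t Ct; rewrite -mulrA -expr2 ler_piMl ?sqr_ge0// rho1.
Qed.

End Form.

Lemma nonzero_ker n k (A : 'M[R]_(n, k)) : (k < n)%N ->
  exists2 c : 'rV[R]_n, c != 0 & c *m A = 0.
Proof.
move=> kn; have : kermx A != 0.
  rewrite -mxrank_eq0 mxrank_ker subn_eq0 -ltnNge.
  exact: leq_ltn_trans (rank_leq_col A) kn.
by move=> /rowV0Pn[c /sub_kermxP h c0]; exists c.
Qed.

(** [steklov_ev] unfolds to the infimum of this set. Naming it separates membership, which takes a
    construction of eigenfunctions, from lower bounds on its elements. *)
Definition eigset (rho : R -> R) (k : nat) : set R :=
  [set mu | exists u : 'I_k.+1 -> R * R -> R, lin_indep u /\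
    forall i, exists2 lam, lam <= mu & weak_steklov rho lam (u i)].

Lemma fcoef_sum (I : Type) (s : seq I) (c : I -> R) (f : I -> R -> R) k :
  (forall i, sqC (f i)) ->
  fcoef (fun t => \sum_(i <- s) c i * f i t) k = \sum_(i <- s) c i * fcoef (f i) k.
Proof.
move=> hf; rewrite /fcoef.
rewrite (eq_cint (fun t => \sum_(i <- s) c i * (f i t * @basis R k t))).
  rewrite (rint_sum mC muC); last first.
    by move=> i; apply: (intgZ mC); apply: (sq_mul mC) => //; exact: sq_basis.
  by apply: eq_bigr => i _; rewrite (rintZ mC)//; apply: (sq_mul mC) => //; exact: sq_basis.
by move=> t _; rewrite mulr_suml; apply: eq_bigr => i _; rewrite -mulrA.
Qed.

Lemma freq_ge0 k : 0 <= freq R k. Proof. by rewrite ler0n. Qed.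

Lemma freq_le k l : (k <= l)%N -> freq R k <= freq R l.
Proof. by move=> kl; rewrite ler_nat uphalf_leq. Qed.

Section Lower.
Variables (rho : R -> R) (k : nat) (mu : R) (s : nat -> nat).
Hypothesis brho : bddmC rho.
Hypothesis rho0 : forall t, C t -> 0 <= rho t.

(* Since lam_i B_ij = lam_j B_ij, the quadratic form (mu - lam_i) B_ij is the form
   B of the combination with the coefficients sqrt (mu - lam_i) c_i. *)
Lemma eigset_lower : eigset rho k mu ->
  exists g : R -> R, [/\ sqC g, 0 < cint (fun t => g t ^+ 2),
    forall j, (j < k)%N -> fcoef g (s j) = 0 &
    forall N, \sum_(j < N) freq R j * fcoef g j ^+ 2 <= mu * wform rho g g].
Proof.
move=> [u [indep eig]].
have /choice[lam hlam] : forall i, exists lam, lam <= mu /\ weak_steklov rho lam (u i).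
  by move=> i; have [l h1 h2] := eig i; exists l.
have /choice[px hpx] : forall i, exists px, exists py g, weak_eig rho (lam i) (u i) px py g.
  by move=> i; apply/weak_steklovP; exact: (hlam i).2.
have /choice[py hpy] := hpx; have /choice[g hg] := hpy.
have sg i : sqC (g i) by have [h _] := hg i; have [] := H1trP h.
have cg i := weak_eig_coef (hg i).
(* There are k + 1 traces and k conditions: some nonzero combination has vanishing coefficients at
   the k chosen indices. *)
pose A := \matrix_(i < k.+1, j < k) fcoef (g i) (s j).
have [c c0 cA] := nonzero_ker A (ltnSn k).
pose G t := \sum_i c 0 i * g i t.
have sG : sqC G by apply: (sq_sum mC muC) => i; exact: (sqZ mC).
exists G; split => //.
- rewrite lt0r; apply/andP; split; last by apply: rint_ge0 => t _; exact: sqr_ge0.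
  apply: contraNneq c0 => G0; apply/eqP/rowP => i; rewrite mxE.
  by apply: (indep (fun i => c 0 i)); exact: (trace_null_ae brho hg).
- move=> j jk; rewrite fcoef_sum//.
  have := congr1 (fun M : 'rV_k => M 0 (Ordinal jk)) cA; rewrite !mxE => cAj; rewrite -[RHS]cAj.
  by apply: eq_bigr => i _; rewrite !mxE.
pose B i j := wform rho (g i) (g j).
have Bsym i j : B i j = B j i by exact: wformC.
have cvA i j : (fun N => \sum_(n < N) freq R n * fcoef (g i) n * fcoef (g j) n) @ \oo -->
    lam i * B i j.
  under eq_fun do (under eq_bigr do rewrite (cg i).2 -mulrA; rewrite -mulr_sumr).
  by apply: cvgMl_tmp; exact: wform_parseval.
(* The sums in [cvA] are symmetric in i and j. This is orthogonality of eigenfunctions with distinct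
   eigenvalues. *)
have lamB i j : lam i * B i j = lam j * B i j.
  have /cvg_lim <- // := cvA i j; rewrite Bsym.
  apply/cvg_lim => //; have := cvA j i.
  by under eq_fun do under eq_bigr do rewrite mulrAC.
have cvG : (fun N => \sum_(n < N) freq R n * fcoef G n ^+ 2) @ \oo -->
    \sum_i \sum_j c 0 i * (c 0 j * (lam i * B i j)).
  have -> : (fun N => \sum_(n < N) freq R n * fcoef G n ^+ 2) = (fun N =>
     \sum_i \sum_j c 0 i * (c 0 j * \sum_(n < N) freq R n * fcoef (g i) n * fcoef (g j) n)).
    apply/funext => N; transitivity (\sum_(n < N) \sum_i \sum_j
        c 0 i * (c 0 j * (freq R n * fcoef (g i) n * fcoef (g j) n))).
      apply: eq_bigr => n _; rewrite fcoef_sum// expr2 mulr_suml mulr_sumr.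
      apply: eq_bigr => i _; rewrite !mulr_sumr; apply: eq_bigr => j _; ring.
    rewrite exchange_big; apply: eq_bigr => i _ /=.
    rewrite exchange_big; apply: eq_bigr => j _ /=.
    by rewrite !mulr_sumr.
  by apply: cvg_bigsum => i; apply: cvg_bigsum => j; apply: cvgMl_tmp; apply: cvgMl_tmp.
have BG : wform rho G G = \sum_i \sum_j c 0 i * (c 0 j * B i j).
  rewrite wform_suml//; apply: eq_bigr => i _; rewrite wform_sumr// mulr_sumr.
  by apply: eq_bigr.
pose r i := Num.sqrt (mu - lam i).
have rr i : r i ^+ 2 = mu - lam i by rewrite sqr_sqrtr// subr_ge0 (hlam i).1.
pose H t := \sum_i (r i * c 0 i) * g i t.
have sH : sqC H by apply: (sq_sum mC muC) => j; exact: (sqZ mC).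
have BH : wform rho H H = \sum_i \sum_j c 0 i * (c 0 j * ((mu - lam i) * B i j)).
  rewrite wform_suml//; apply: eq_bigr => i _; rewrite wform_sumr// mulr_sumr.
  apply: eq_bigr => j _; rewrite -/(B i j).
  have [B0|B0] := eqVneq (B i j) 0; first by rewrite B0 !mulr0.
  have E : lam i = lam j by apply: (mulIf B0).
  have -> : r j = r i by rewrite /r E.
  rewrite -rr; ring.
have key : \sum_i \sum_j c 0 i * (c 0 j * (lam i * B i j)) <= mu * wform rho G G.
  rewrite -subr_ge0; suff -> : mu * wform rho G G - \sum_i \sum_j c 0 i * (c 0 j * (lam i * B i j))
     = wform rho H H by exact: wform_ge0.
  rewrite BG BH mulr_sumr -sumrB; apply: eq_bigr => i _.
  rewrite mulr_sumr -sumrB; apply: eq_bigr => j _; ring.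
move=> N; apply: le_trans key.
apply: (cvgr_to_ge cvG); exists N => // M /= NM.
rewrite (big_ord_widen _ (fun n => freq R n * fcoef G n ^+ 2) NM) big_mkcond.
by apply: ler_sum => n _; case: (_ < _)%N => //; rewrite mulr_ge0 ?sqr_ge0 ?freq_ge0.
Qed.

(** The modes from N on carry at least freq N times their square sum, which Parseval rewrites as a
    remainder. *)
Lemma eigset_lower_split : eigset rho k mu ->
  exists g : R -> R, [/\ sqC g, 0 < cint (fun t => g t ^+ 2),
    forall j, (j < k)%N -> fcoef g (s j) = 0 &
    forall N, \sum_(j < N) freq R j * fcoef g j ^+ 2 +
      freq R N * (cint (fun t => g t ^+ 2) - \sum_(j < N) fcoef g j ^+ 2) <= mu * wform rho g g].
Proof.
move=> /eigset_lower[g [sg g0 hs hN]]; exists g; split => // N.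
have cv : (fun M => \sum_(j < N) freq R j * fcoef g j ^+ 2 +
    freq R N * (\sum_(j < M) fcoef g j ^+ 2 - \sum_(j < N) fcoef g j ^+ 2)) @ \oo -->
  \sum_(j < N) freq R j * fcoef g j ^+ 2 +
      freq R N * (cint (fun t => g t ^+ 2) - \sum_(j < N) fcoef g j ^+ 2).
  apply: cvgD; first exact: cvg_cst.
  apply: cvgMl_tmp; apply: cvgB; last exact: cvg_cst.
  under eq_fun do under eq_bigr do rewrite expr2.
  rewrite (eq_cint (fun t => g t * g t)); last by move=> t _; rewrite expr2.
  exact: parseval.
apply: (cvgr_to_le cv); exists N => // M /= NM.
apply: le_trans (hN M).
have sp (F : nat -> R) : \sum_(j < M) F j = \sum_(j < N) F j + \sum_(N <= j < M) F j.
  by rewrite -!(big_mkord xpredT F) -big_cat_nat.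
rewrite (sp (fun j => fcoef g j ^+ 2)) (sp (fun j => freq R j * fcoef g j ^+ 2)).
rewrite addrAC subrr add0r lerD2l mulr_sumr; apply: ler_sum_nat => j /andP[Nj _].
by rewrite ler_wpM2r ?sqr_ge0// freq_le.
Qed.

(** For mu < 0, the function given by [eigset_lower] would have zero form and zero energy, hence be
    constant, and the positive mass of rho would make it null. This keeps the infimum away from its
    default value. *)
Lemma eigset_ge0 : 0 < wform rho (cst 1) (cst 1) -> eigset rho k mu -> 0 <= mu.
Proof.
move=> p /eigset_lower[g [sg g0 hs hN]]; rewrite leNgt; apply/negP => mu0.
have B0 : wform rho g g = 0.
  apply/eqP; rewrite eq_le wform_ge0 ?andbT//.
  have := hN 0%N; rewrite big_ord0 nmulr_rge0//.
have f0 j : (0 < j)%N -> fcoef g j = 0.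
  move=> j0; have := hN j.+1; rewrite B0 mulr0 big_ord_recr /= => h.
  have h1 : freq R j * fcoef g j ^+ 2 <= 0.
    apply: le_trans h; rewrite lerDr sumr_ge0// => i _.
    by rewrite mulr_ge0 ?sqr_ge0 ?freq_ge0.
  apply/eqP; rewrite -sqrf_eq0 eq_le sqr_ge0 andbT.
  by move: h1; rewrite pmulr_rle0// ltr0n; case: j j0 {h}.
pose c := fcoef g 0; pose h t := g t - c * @basis R 0 t.
have sh : sqC h by apply: (sqB mC) => //; apply: (sqZ mC); exact: sq_basis.
have h0 : cint (fun t => h t ^+ 2) = 0.
  apply: fcoef_eq0 => // j; rewrite /fcoef /h.
  rewrite (eq_cint (fun t => g t * @basis R j t - c * (@basis R 0 t * @basis R j t))); last first.
    by move=> t _; rewrite mulrBl mulrA.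
  have i1 := sq_mul mC sg (sq_basis R j); have i2 := sq_mul mC (sq_basis R 0) (sq_basis R j).
  rewrite (rintB mC)//; last exact: (intgZ mC).
  rewrite (rintZ mC)// rint_basis -/(fcoef g j).
  by case: j {i1 i2} => [|j] /=; rewrite ?mulr1 ?subrr// f0// mulr0 subr0.
have E : wform rho g g = c ^+ 2 * hc R 0 ^+ 2 * wform rho (cst 1) (cst 1).
  pose b0 t := c * @basis R 0 t.
  have sb : sqC b0 by apply: (sqZ mC); exact: sq_basis.
  rewrite (@eq_wform rho _ _ (fun t => h t + b0 t) (fun t => h t + b0 t)); last 2 first.
  - by move=> t _; rewrite /h subrK.
  - by move=> t _; rewrite /h subrK.
  have shb : sqC (fun t => h t + b0 t) by exact: (sq_add mC).
  rewrite wformDl// (wform_null _ _ _ h0)// add0r wformDr// wformC (wform_null _ _ _ h0)// add0r.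
  rewrite -(rintZ mC); last by apply: intg_wform => //; apply: (sq_bdd mC muC); exact: bddm_cst.
  apply: eq_cint => t _; rewrite /b0 /basis/= /hc /=; ring.
have c0 : c = 0.
  apply/eqP; rewrite -sqrf_eq0; move/eqP: B0; rewrite E mulf_eq0 (gt_eqF p) orbF mulf_eq0.
  by case/orP => //; rewrite (sqrf_eq0 (hc R 0)) /hc /= invr_eq0 gt_eqF// sqrtr_gt0 two_pi_gt0.
move: g0; rewrite (eq_cint (fun t => h t ^+ 2)) ?h0 ?ltxx// => t _.
by rewrite /h c0 mul0r subr0.
Qed.

End Lower.

Lemma steklov_ev_le rho k M : bddmC rho -> (forall t, C t -> 0 <= rho t) ->
  0 < wform rho (cst 1) (cst 1) -> eigset rho k M -> steklov_ev rho k <= M.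
Proof.
move=> brho rho0 p hM; apply: ge_inf => //.
by exists 0 => mu; exact: (@eigset_ge0 rho k mu id).
Qed.

Lemma steklov_ev_ge rho k m : eigset rho k !=set0 ->
  (forall mu, eigset rho k mu -> m <= mu) -> m <= steklov_ev rho k.
Proof. by move=> h1 h2; apply: lb_le_inf. Qed.

Lemma eigset_ae (rho rho' : R -> R) k :
  measurable_fun (C : set RT) rho -> measurable_fun (C : set RT) rho' ->
  {ae leb1, forall t, C t -> rho t = rho' t} -> eigset rho k = eigset rho' k.
Proof.
move=> b b' h.
have key (r r' : R -> R) : measurable_fun (C : set RT) r -> measurable_fun (C : set RT) r' ->
    {ae leb1, forall t, C t -> r t = r' t} ->
    forall lam u, weak_steklov r lam u -> weak_steklov r' lam u.
  move=> br br' hr lam u /weak_steklovP[px [py [g [h1 h2]]]].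
  apply/weak_steklovP; exists px, py, g; split => // v qx qy f hv; rewrite (h2 _ _ _ _ hv).
  congr (_ * _); rewrite /rint /Rintegral; congr fine.
  have [_ _ _ sg] := H1trP h1; have [_ _ _ sf] := H1trP hv.
  apply: (@ae_eq_integral _ RT R leb1 C (fun x => (r' x * g x * f x)%:E)
    (fun x => (r x * g x * f x)%:E) mC).
  - apply/measurable_EFinP; apply: measurable_funM; last by case: sf.
    by apply: measurable_funM => //; case: sg.
  - apply/measurable_EFinP; apply: measurable_funM; last by case: sf.
    by apply: measurable_funM => //; case: sg.
  - case: hr => N [mN N0 sN]; exists N; split => // t ht; apply: sN => hE; apply: ht => Ct.
    by rewrite hE.
have h' : {ae leb1, forall t, C t -> rho' t = rho t}.
  by case: h => N [mN N0 sN]; exists N; split => // t ht; apply: sN => hE; apply: ht => Ct; rewrite hE.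
apply/seteqP; split => mu [u [hu he]]; exists u; split => // i; have [l l1 l2] := he i; exists l => //.
- exact: key l2.
- exact: key l2.
Qed.

End Rayleigh.

Lemma lim_uniq (R : realType) (u : nat -> R) (a b : R) :
  u @ \oo --> a -> u @ \oo --> b -> a = b.
Proof. by move=> /cvg_lim <- // /cvg_lim <-. Qed.

Lemma sum_tail (R : realType) (a : nat -> R) (K : R) : (forall k, 0 <= a k) ->
  (forall N, \sum_(k < N) a k <= K) ->
  exists2 t : nat -> R, t @ \oo --> 0 &
    forall n m, (n <= m)%N -> \sum_(k < m) a k - \sum_(k < n) a k <= t n.
Proof.
move=> a0 hK; pose S N := \sum_(k < N) a k.
have nd : nondecreasing_seq S.
  apply/nondecreasing_seqP => n; rewrite /S big_ord_recr /= lerDl//.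
have cS : cvgn S by apply: nondecreasing_is_cvgn => //; exists K => _ [n _ <-]; exact: hK.
exists (fun n => limn S - S n).
  by rewrite -(subrr (limn S)); apply: cvgB => //; exact: cvg_cst.
by move=> n m nm; rewrite lerD2r; exact: nondecreasing_cvgn_le.
Qed.

Lemma abs_sum_cvg (R : realType) (a b : nat -> R) (K : R) :
  (forall k, `|a k| <= b k) -> (forall N, \sum_(k < N) b k <= K) ->
  cvgn (fun N => \sum_(k < N) a k).
Proof.
move=> ab hK; have b0 k : 0 <= b k by apply: le_trans (ab k).
have [t t0 ht] := sum_tail b0 hK.
apply: cauchy_real_cvg => e e0.
move/cvgrPdist_le : t0 => /(_ e e0)[N _ hN].
exists N => n m Nn nm; have := hN n Nn; rewrite sub0r normrN => h.
apply: le_trans (le_trans (ht n m nm) (le_trans (ler_norm _) h)).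
have sp (F : nat -> R) : \sum_(j < m) F j = \sum_(j < n) F j + \sum_(n <= j < m) F j.
  by rewrite -!(big_mkord xpredT F) -big_cat_nat.
rewrite (sp a) (sp b) addrAC subrr add0r addrAC subrr add0r.
by apply: le_trans (ler_norm_sum _ _ _) _; apply: ler_sum_nat => j _.
Qed.

(** * Harmonic extension of a Fourier series *)

Section HarmonicSeries.
Variable R : realType.
Local Notation leb1 := (@lebesgue_measure R).
Local Notation leb2 := ((@lebesgue_measure R) \x (@lebesgue_measure R))%E.
Local Notation C := (@circle R).
Local Notation D := (@disk R).
Local Notation RT := (g_sigma_algebraType R.-ocitv.-measurable).
Local Notation RT2 := (RT * RT)%type.
Local Notation bddmC := (@bddm _ RT R C).
Local Notation sqC := (@sqint _ RT R leb1 C).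
Local Notation sqD := (@sqint _ RT2 R leb2 D).
Local Notation cint := (rint leb1 C).
Local Notation dint := (rint leb2 D).
Local Notation mC := (@measurable_circle R).
Local Notation muC := (@lebesgue_circle_fin R).
Local Notation mD := (@measurable_disk R).
Local Notation muD := (@lebesgue_disk_fin R).
Arguments eq_dint [R] g {f} _.
Arguments eq_cint [R] g {f} _.
Implicit Types u v px py : R * R -> R.

Definition sq_lim (f_ : nat -> R * R -> R) f := [/\ forall n, sqD (f_ n), sqD f &
  (fun n => dint (fun z => (f_ n z - f z) ^+ 2)) @ \oo --> (0 : R)].

Lemma sq_lim_mul f_ f k : sq_lim f_ f -> sqD k ->
  (fun n => dint (fun z => f_ n z * k z)) @ \oo --> dint (fun z => f z * k z).
Proof.
move=> [h1 h2 h3] hk.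
rewrite (eq_dint (fun z => k z * f z)); last by move=> z _; rewrite mulrC.
rewrite (_ : (fun n => _) = (fun n => dint (fun z => k z * f_ n z))).
  exact: (sq_cvg_mul mD hk h2 h1 h3).
by apply/funext => n; apply: eq_dint => z _; rewrite mulrC.
Qed.

(** For a fixed test function, all terms of the defining identities are L^2 pairings, which pass to
    the limit. *)
Lemma H1tr_lim (u_ px_ py_ : nat -> R * R -> R) (g_ : nat -> R -> R) u px py g :
  (forall n, H1tr (u_ n) (px_ n) (py_ n) (g_ n)) ->
  sq_lim u_ u -> sq_lim px_ px -> sq_lim py_ py -> sqC g ->
  (fun n => cint (fun t => (g_ n t - g t) ^+ 2)) @ \oo --> (0 : R) ->
  H1tr u px py g.
Proof.
move=> h lu lx ly sg lg.
have sg_ n : sqC (g_ n) by have [] := H1trP (h n).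
have cD phi (v : R * R) : C1 phi -> v = e1 R \/ v = e2 R -> sqD ('D_v phi).
  by move=> hp hv; apply: sqD_cont; exact: C1_D.
have c0 phi : C1 phi -> sqD phi by move=> hp; apply: sqD_cont; exact: C1_continuous.
have hl1 : e1 R = e1 R \/ e1 R = e2 R by left.
have hl2 : e2 R = e1 R \/ e2 R = e2 R by right.
have [su_ su _] := lu; have [sx_ sx _] := lx; have [sy_ sy _] := ly.
have W (v : R * R) p_ p : v = e1 R \/ v = e2 R -> sq_lim p_ p ->
    (forall n, weak_partial v (u_ n) (p_ n)) -> weak_partial v u p.
  move=> hv lp hw phi hphi; have [hp _] := hphi.
  have cl := sq_lim_mul lu (cD _ _ hp hv); have cr := sq_lim_mul lp (c0 _ hp).
  apply: (lim_uniq cl).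
  rewrite (_ : (fun n => _) = (fun n => - dint (fun z => p_ n z * phi z))).
    by apply: cvgN.
  by apply/funext => n; exact: hw.
have T (v : R * R) p_ p (k : R -> R) : v = e1 R \/ v = e2 R -> sq_lim p_ p -> continuous k ->
    (forall n, forall phi, C1 phi -> dint (fun z => u_ n z * 'D_v phi z + p_ n z * phi z) =
       cint (fun t => g_ n t * phi (cos t, sin t) * k t)) ->
    forall phi, C1 phi -> dint (fun z => u z * 'D_v phi z + p z * phi z) =
       cint (fun t => g t * phi (cos t, sin t) * k t).
  move=> hv lp ck hw phi hp; have [sp_ sp _] := lp.
  have cl : (fun n => dint (fun z => u_ n z * 'D_v phi z) + dint (fun z => p_ n z * phi z))
      @ \oo --> dint (fun z => u z * 'D_v phi z) + dint (fun z => p z * phi z).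
    exact: (cvgD (sq_lim_mul lu (cD _ _ hp hv)) (sq_lim_mul lp (c0 _ hp))).
  rewrite (rintD mD); [|exact: (sq_mul mD su (cD _ _ hp hv))|exact: (sq_mul mD sp (c0 _ hp))].
  apply: (lim_uniq cl).
  have sk : sqC (fun t => phi (cos t, sin t) * k t).
    apply: sqC_cont => t; apply: cvgM; last exact: ck.
    by apply: (continuous_circle (C1_continuous hp)).
  have cc := sq_cvg_mul mC sk sg sg_ lg.
  rewrite (eq_cint (fun t => phi (cos t, sin t) * k t * g t)); last first.
    by move=> t _; rewrite [RHS]mulrC mulrA.
  rewrite (_ : (fun n => _) = (fun n => cint (fun t => phi (cos t, sin t) * k t * g_ n t)))//.
  apply/funext => n /=.
  rewrite -(rintD mD); [|exact: (sq_mul mD (su_ n) (cD _ _ hp hv))|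
    exact: (sq_mul mD (sp_ n) (c0 _ hp))].
  by rewrite (hw n _ hp); apply: eq_cint => t _; rewrite [RHS]mulrC mulrA.
split; split.
- exact/L2diskP.
- exact/L2diskP.
- exact/L2diskP.
- by apply: (W _ _ _ hl1 lx) => n; have [[]] := h n.
- by apply: (W _ _ _ hl2 ly) => n; have [[]] := h n.
- exact/L2circleP.
move=> phi hp; split.
  apply: (T _ _ _ _ hl1 lx (@continuous_cos R)) => // n psi hpsi.
  by have [_ [_ /(_ _ hpsi)[]]] := h n.
apply: (T _ _ _ _ hl2 ly (@continuous_sin R)) => // n psi hpsi.
by have [_ [_ /(_ _ hpsi)[]]] := h n.
Qed.

Definition sqnorm (z : R * R) : R := z.1 ^+ 2 + z.2 ^+ 2.

Lemma zpow_norm m z : (zpow m z).1 ^+ 2 + (zpow m z).2 ^+ 2 = sqnorm z ^+ m.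
Proof.
elim: m => [|m IH] /=; first by rewrite expr0 expr1n expr0n addr0.
rewrite (exprS (sqnorm z)) -IH /sqnorm; ring.
Qed.

Lemma hcomp_sqr_le k m z : hcomp k (zpow m z) ^+ 2 <= sqnorm z ^+ m.
Proof. by rewrite -zpow_norm /hcomp; case: (_ || _); rewrite ?lerDl ?lerDr sqr_ge0. Qed.

Lemma hcomp'_sqr_le k m z : hcomp' k (zpow m z) ^+ 2 <= sqnorm z ^+ m.
Proof.
by rewrite -zpow_norm /hcomp'; case: (_ || _); rewrite ?sqrrN ?lerDl ?lerDr sqr_ge0.
Qed.

Lemma hc_ge0 k : 0 <= hc R k.
Proof. by rewrite /hc; case: (k == _); rewrite invr_ge0 sqrtr_ge0. Qed.

Lemma hc_le1 k : hc R k <= 1.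
Proof.
have pi1 : 1 <= pi :> R by have := @pi_ge2 R; lra.
rewrite /hc; case: (k == _); rewrite invf_le1 ?sqrtr_gt0; try lra;
  rewrite -[leLHS]sqrtr1 ler_wsqrtr//; lra.
Qed.

Lemma sqnorm_ge0 z : 0 <= sqnorm z.
Proof. by rewrite addr_ge0 ?sqr_ge0. Qed.

Lemma harm_le1 k z : D z -> `|harm k z| <= 1.
Proof.
move=> Dz; rewrite /harm normrM (ger0_norm (hc_ge0 _)).
rewrite mulr_ile1 ?hc_ge0 ?hc_le1 ?normr_ge0//.
rewrite -(@expr_le1 _ 2)// -normrX ger0_norm ?sqr_ge0//.
apply: le_trans (hcomp_sqr_le _ _ _) _; apply: exprn_ile1; first exact: sqnorm_ge0.
exact: ltW.
Qed.

(** The exponent is 0 for k = 0 and then takes each value twice, so 2M + 1 terms add up to 1 + 2 (1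
    - q^M) / (1 - q). *)
Lemma geo_pairs (q : R) N : 0 <= q < 1 ->
  \sum_(k < N) q ^+ (uphalf k).-1 <= 1 + 2 / (1 - q).
Proof.
move=> /andP[q0 q1]; have q1' : 0 < 1 - q by rewrite subr_gt0.
have E M : \sum_(k < M.*2.+1) q ^+ (uphalf k).-1 = 1 + 2 * (1 - q ^+ M) / (1 - q).
  elim: M => [|M IH]; first by rewrite big_ord_recr big_ord0 /= !expr0 subrr mulr0 mul0r addr0 add0r.
  rewrite doubleS 2!big_ord_recr /= IH.
  rewrite doubleK uphalf_double.
  by rewrite exprS; field; rewrite gt_eqF.
apply: (@le_trans _ _ (\sum_(k < N.*2.+1) q ^+ (uphalf k).-1)).
  have NN : (N <= N.*2.+1)%N by lia.
  rewrite (big_ord_widen _ (fun k => q ^+ (uphalf k).-1) NN) big_mkcond.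
  by apply: ler_sum => k _; case: (_ < _)%N => //; rewrite exprn_ge0.
rewrite E lerD2l ler_pM2r ?invr_gt0// -[leRHS]mulr1 ler_pM2l// lerBlDr lerDl exprn_ge0//.
Qed.

(** From freq k >= k / 2, the term k > 0 is at most 4 / k^2 <= 8 / k - 8 / (k + 1), which
    telescopes. The term k = 0 is 0 because the inverse of 0 is 0. *)
Lemma sum_inv_freq N : \sum_(k < N) (freq R k ^+ 2)^-1 <= 8.
Proof.
have E M : \sum_(k < M.+1) (freq R k ^+ 2)^-1 <= 8 - 8 / M.+1%:R.
  elim: M => [|M IH]; first by rewrite big_ord_recr big_ord0 /= /freq /= expr0n invr0; lra.
  rewrite big_ord_recr /=; apply: le_trans (lerD IH (lexx _)) _.
  have M0 : 0 < M.+1%:R :> R by rewrite ltr0n.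
  have M1 : 0 < M.+2%:R :> R by rewrite ltr0n.
  have f2 : M.+1%:R / 2 <= freq R M.+1.
    rewrite /freq ler_pdivrMr// -natrM ler_nat; lia.
  have f0 : 0 < M.+1%:R / 2 :> R by rewrite divr_gt0.
  have : (freq R M.+1 ^+ 2)^-1 <= ((M.+1%:R / 2) ^+ 2)^-1.
    have fp : 0 < freq R M.+1 := lt_le_trans f0 f2.
    rewrite lef_pV2 ?posrE ?exprn_gt0//.
    by rewrite lerXn2r ?nnegrE// ltW// (lt_le_trans f0).
  have : ((M.+1%:R / 2) ^+ 2)^-1 <= 8 / M.+1%:R - 8 / M.+2%:R :> R.
    have -> : 8 / M.+1%:R - 8 / M.+2%:R = 8 / (M.+1%:R * M.+2%:R) :> R.
      rewrite -!natr1; field; rewrite -!natr1 in M0 M1; by rewrite !gt_eqF.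
    have -> : ((M.+1%:R / 2) ^+ 2)^-1 = 4 / (M.+1%:R * M.+1%:R) :> R.
      by field; rewrite gt_eqF.
    rewrite ler_pdivlMr ?mulr_gt0// mulrAC ler_pdivrMr ?mulr_gt0//.
    have : M.+2%:R <= 2 * M.+1%:R :> R by rewrite -natrM ler_nat; lia.
    move: M0; set a := M.+1%:R; set b := M.+2%:R => a0 h; nra.
  move=> h1 h2; apply: (@le_trans _ _ (8 - 8 / M.+1%:R + (8 / M.+1%:R - 8 / M.+2%:R))).
    by rewrite lerD2l (le_trans h2).
  by rewrite addrA subrK.
case: N => [|N]; first by rewrite big_ord0.
by apply: le_trans (E N) _; rewrite gerBl divr_ge0.
Qed.

Section Series.
Variables (x : nat -> R) (K : R).
Hypothesis hx : forall N, \sum_(k < N) (freq R k * x k) ^+ 2 <= K.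

Definition hsum (h : nat -> R * R -> R) N z := \sum_(k < N) x k * h k z.

(** |x_k| is at most half the sum of (freq k x_k)^2 and 1 / (freq k)^2; the coefficient of index 0,
    which has no frequency, is counted apart. *)
Lemma sum_abs_coef N : \sum_(k < N) `|x k| <= `|x 0%N| + (K + 8) / 2.
Proof.
apply: (@le_trans _ _ (\sum_(k < N) ((k == 0%N :> nat)%:R * `|x 0%N| +
    ((freq R k * x k) ^+ 2 + (freq R k ^+ 2)^-1) / 2))).
  apply: ler_sum => -[[|k] kN] _ /=.
    by rewrite mul1r lerDl divr_ge0// addr_ge0 ?sqr_ge0 ?invr_ge0 ?sqr_ge0.
  rewrite mul0r add0r ler_pdivlMr//.
  have f0 : freq R k.+1 != 0 by rewrite /freq pnatr_eq0.
  have E : `|x k.+1| = `|freq R k.+1 * x k.+1| * (freq R k.+1)^-1.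
    by rewrite normrM (ger0_norm (freq_ge0 _ _)) mulrAC divff// mul1r.
  rewrite -exprVn E -[X in _ <= X + _]real_normK ?num_real//.
  have := sqr_ge0 (`|freq R k.+1 * x k.+1| - (freq R k.+1)^-1); lra.
rewrite big_split /= lerD//.
  rewrite -mulr_suml ler_piMl//.
  case: N => [|N]; first by rewrite big_ord0.
  by rewrite big_ord_recl /= big1 ?addr0.
rewrite -mulr_suml ler_pM2r ?invr_gt0// big_split /=.
by apply: lerD; [exact: hx|exact: sum_inv_freq].
Qed.

Lemma hsum_H1tr N : H1tr (hsum (@harm R) N) (hsum (@harm1 R) N) (hsum (@harm2 R) N) (psum x N).
Proof. exact: (H1tr_sum (fun k : 'I_N => x k) (fun k : 'I_N => harm_H1tr R k)). Qed.

Lemma hsum_pair_energy N v qx qy h : H1tr v qx qy h ->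
  dint (fun z => hsum (@harm1 R) N z * qx z + hsum (@harm2 R) N z * qy z) =
  \sum_(k < N) freq R k * x k * fcoef h k.
Proof.
move=> hv; have [sv sx sy sh] := H1trP hv.
rewrite (eq_dint (fun z => \sum_(k < N) x k * (harm1 k z * qx z + harm2 k z * qy z))); last first.
  move=> z _; rewrite /hsum !mulr_suml -big_split; apply: eq_bigr => k _ /=; ring.
have i k : intg leb2 D (fun z => harm1 k z * qx z + harm2 k z * qy z).
  by apply: (intgD mD); apply: (sq_mul mD) => //; apply: sqD_cont;
    [exact: continuous_harm1|exact: continuous_harm2].
rewrite (rint_sum mD muD); last by move=> k; exact: (intgZ mD).
by apply: eq_bigr => k _; rewrite (rintZ mD)// (harm_energy _ hv) mulrA [x k * _]mulrC.
Qed.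

End Series.

Lemma hsum_energy x N :
  dint (fun z => hsum x (@harm1 R) N z ^+ 2 + hsum x (@harm2 R) N z ^+ 2) =
  \sum_(k < N) freq R k * x k ^+ 2.
Proof.
under eq_bigr do rewrite expr2 mulrA.
rewrite (eq_dint (fun z => hsum x (@harm1 R) N z * hsum x (@harm1 R) N z +
  hsum x (@harm2 R) N z * hsum x (@harm2 R) N z)); last by move=> z _; rewrite !expr2.
rewrite (hsum_pair_energy _ _ (hsum_H1tr x N)); apply: eq_bigr => k _.
by rewrite fcoef_psum ltn_ord.
Qed.

Section Limit.
Variables (x : nat -> R) (K : R).
Hypothesis hx : forall N, \sum_(k < N) (freq R k * x k) ^+ 2 <= K.

(** Pointwise limits give definite functions rather than classes; for the gradient, convergence is
    only established inside the disk. *)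
Definition hlim (h : nat -> R * R -> R) (z : R * R) : R := limn (fun N => hsum x h N z).
Definition hlimC (t : R) : R := limn (fun N => psum x N t).

Lemma hsumB h n m z : (n <= m)%N ->
  hsum x h m z - hsum x h n z = hsum (fun k => if (k < n)%N then 0 else x k) h m z.
Proof.
move=> nm; rewrite /hsum (big_ord_widen _ (fun k => x k * h k z) nm) [X in _ - X]big_mkcond.
rewrite -sumrB; apply: eq_bigr => k _.
by case: (_ < _)%N; rewrite ?subrr ?mul0r// subr0.
Qed.

Lemma psumB n m t : (n <= m)%N ->
  psum x m t - psum x n t = psum (fun k => if (k < n)%N then 0 else x k) m t.
Proof. by move=> nm; exact: (@hsumB (fun k _ => basis k t) n m (0, 0) nm). Qed.

Lemma sumB (F : nat -> R) n m : (n <= m)%N ->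
  \sum_(k < m) F k - \sum_(k < n) F k = \sum_(k < m) if (k < n)%N then 0 else F k.
Proof.
move=> nm; rewrite (big_ord_widen _ F nm) [X in _ - X]big_mkcond.
by rewrite -sumrB; apply: eq_bigr => k _; case: (_ < _)%N; rewrite ?subrr// subr0.
Qed.

Lemma hsum_harm_cvg z : D z -> (fun N => hsum x (@harm R) N z) @ \oo --> hlim (@harm R) z.
Proof.
move=> Dz; apply: (@abs_sum_cvg R (fun k => x k * harm k z) (fun k => `|x k|)).
  by move=> k; rewrite normrM ler_piMr// harm_le1.
exact: sum_abs_coef.
Qed.

Lemma psum_cvg t : (fun N => psum x N t) @ \oo --> hlimC t.
Proof.
apply: (@abs_sum_cvg R (fun k => x k * basis k t) (fun k => `|x k|)).
  by move=> k; rewrite normrM ler_piMr// basis_le1.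
exact: sum_abs_coef.
Qed.

(** The hypothesis on x gives no absolute convergence of the gradient up to the circle. At an
    interior point, the geometric decay of the powers of |z| is paired with the square-summable freq
    k x_k. *)
Lemma hsum_grad_cvg (c : nat -> R * R -> R) z : D z ->
  (forall k m, c k (zpow m z) ^+ 2 <= sqnorm z ^+ m) ->
  cvgn (fun N => hsum x (fun k z => hc R k * (freq R k * c k (zpow (uphalf k).-1 z))) N z).
Proof.
move=> Dz hcz.
apply: (@abs_sum_cvg R (fun k => x k * (hc R k * (freq R k * c k (zpow (uphalf k).-1 z))))
   (fun k => ((freq R k * x k) ^+ 2 + sqnorm z ^+ (uphalf k).-1) / 2)
   ((K + (1 + 2 / (1 - sqnorm z))) / 2)); last first.
  move=> N; rewrite -mulr_suml ler_pM2r ?invr_gt0// big_split /=.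
  by apply: lerD; [exact: hx|apply: geo_pairs; rewrite sqnorm_ge0].
move=> k; rewrite (_ : _ * _ = hc R k * ((freq R k * x k) * c k (zpow (uphalf k).-1 z))); last by ring.
rewrite normrM (ger0_norm (hc_ge0 _)).
apply: (@le_trans _ _ `|(freq R k * x k) * c k (zpow (uphalf k).-1 z)|).
  by rewrite ler_piMl ?normr_ge0// hc_le1.
rewrite ler_pdivlMr//; apply: le_trans (lerD (lexx _) (hcz k _)).
set a := freq R k * x k; set b := c k _; rewrite normrM.
have := sqr_ge0 (`|a| - `|b|); rewrite -[a ^+ 2]real_normK ?num_real//.
rewrite -[b ^+ 2]real_normK ?num_real//; lra.
Qed.

Lemma hsum_harm1_cvg z : D z -> (fun N => hsum x (@harm1 R) N z) @ \oo --> hlim (@harm1 R) z.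
Proof. by move=> Dz; apply: hsum_grad_cvg => // k m; exact: hcomp_sqr_le. Qed.

Lemma hsum_harm2_cvg z : D z -> (fun N => hsum x (@harm2 R) N z) @ \oo --> hlim (@harm2 R) z.
Proof. by move=> Dz; apply: hsum_grad_cvg => // k m; exact: hcomp'_sqr_le. Qed.

Lemma freq_sqr_le k (a : R) : freq R k * a ^+ 2 <= (freq R k * a) ^+ 2.
Proof.
rewrite exprMn ler_wpM2r ?sqr_ge0// /freq.
by case: (uphalf k) => [|m]; rewrite ?expr0n// expr2 ler_peMl ?ler0n// ler1n.
Qed.

Lemma energy_tail : exists2 t : nat -> R, t @ \oo --> 0 & forall n m, (n <= m)%N ->
  \sum_(k < m) freq R k * (if (k < n)%N then 0 else x k) ^+ 2 <= t n.
Proof.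
have [||t t0 ht] := @sum_tail R (fun k => freq R k * x k ^+ 2) K.
- by move=> k; rewrite mulr_ge0 ?freq_ge0 ?sqr_ge0.
- by move=> N; apply: le_trans (hx N); apply: ler_sum => k _; exact: freq_sqr_le.
exists t => // n m nm; apply: le_trans (ht n m nm); rewrite (sumB (fun k => freq R k * x k ^+ 2) nm).
by apply: ler_sum => k _; case: (_ < _)%N => //; rewrite expr0n mulr0.
Qed.

Lemma sq_lim_intro (f_ : nat -> R * R -> R) f (t : nat -> R) : (forall n, sqD (f_ n)) ->
  (forall z, D z -> (fun n => f_ n z) @ \oo --> f z) -> t @ \oo --> 0 ->
  (forall n m, (n <= m)%N -> dint (fun z => (f_ m z - f_ n z) ^+ 2) <= t n) -> sq_lim f_ f.
Proof.
move=> sf cf t0 ht; have [s h] := sq_fatou mD sf cf ht; split => //.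
apply: (squeeze_cvgr _ (cvg_cst 0) t0); apply: nearW => n; rewrite h andbT.
by apply: rint_ge0 => z _; exact: sqr_ge0.
Qed.

(** The gradients are Cauchy in L^2 by the tail of the energy; the functions and their traces
    converge uniformly, the coefficients being absolutely summable. *)
Lemma hlim_H1tr : [/\ sq_lim (hsum x (@harm1 R)) (hlim (@harm1 R)),
  sq_lim (hsum x (@harm2 R)) (hlim (@harm2 R)), sqC hlimC,
  (fun n => cint (fun t => (psum x n t - hlimC t) ^+ 2)) @ \oo --> (0 : R) &
  H1tr (hlim (@harm R)) (hlim (@harm1 R)) (hlim (@harm2 R)) hlimC].
Proof.
have [t t0 ht] := energy_tail.
have s1 n : sqD (hsum x (@harm1 R) n) by have [] := H1trP (hsum_H1tr x n).
have s2 n : sqD (hsum x (@harm2 R) n) by have [] := H1trP (hsum_H1tr x n).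
have s0 n : sqD (hsum x (@harm R) n) by have [] := H1trP (hsum_H1tr x n).
have E n m : (n <= m)%N -> dint (fun z => (hsum x (@harm1 R) m z - hsum x (@harm1 R) n z) ^+ 2) +
    dint (fun z => (hsum x (@harm2 R) m z - hsum x (@harm2 R) n z) ^+ 2) <= t n.
  move=> nm; have [_ i1] := sqB mD (s1 m) (s1 n); have [_ i2] := sqB mD (s2 m) (s2 n).
  rewrite -(rintD mD)//; apply: le_trans (ht _ _ nm); rewrite -(hsum_energy (fun k => if (k < n)%N then 0 else x k)).
  by rewrite le_eqVlt; apply/orP; left; apply/eqP; apply: eq_dint => z _; rewrite !hsumB.
have p1 n m : 0 <= dint (fun z => (hsum x (@harm1 R) m z - hsum x (@harm1 R) n z) ^+ 2).
  by apply: rint_ge0 => z _; exact: sqr_ge0.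
have p2 n m : 0 <= dint (fun z => (hsum x (@harm2 R) m z - hsum x (@harm2 R) n z) ^+ 2).
  by apply: rint_ge0 => z _; exact: sqr_ge0.
have l1 : sq_lim (hsum x (@harm1 R)) (hlim (@harm1 R)).
  apply: (@sq_lim_intro _ _ t) => //; first exact: hsum_harm1_cvg.
  by move=> n m nm; apply: le_trans (E _ _ nm); rewrite lerDl.
have l2 : sq_lim (hsum x (@harm2 R)) (hlim (@harm2 R)).
  apply: (@sq_lim_intro _ _ t) => //; first exact: hsum_harm2_cvg.
  by move=> n m nm; apply: le_trans (E _ _ nm); rewrite lerDr.
have [||r r0 hr] := @sum_tail R (fun k => `|x k|) (`|x 0%N| + (K + 8) / 2).
- by move=> k; exact: normr_ge0.
- exact: sum_abs_coef.
have bnd (f : nat -> R) n m : (n <= m)%N -> (forall k, `|f k| <= 1) ->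
    (\sum_(k < m) (if (k < n)%N then 0 else x k) * f k) ^+ 2 <= r n ^+ 2.
  move=> nm hf; have r0' : 0 <= r n by have := hr n n (leqnn n); rewrite subrr.
  rewrite -[leLHS]real_normK ?num_real// lerXn2r ?nnegrE//.
  apply: le_trans (hr _ _ nm); rewrite (sumB (fun k => `|x k|) nm).
  apply: le_trans (ler_norm_sum _ _ _) _; apply: ler_sum => k _.
  by case: (_ < _)%N; rewrite ?mul0r ?normr0// normrM ler_piMr.
have r20 c : (fun n => r n ^+ 2 * c) @ \oo --> (0 : R).
  rewrite (_ : 0 = 0 ^+ 2 * c :> R); last by rewrite expr0n mul0r.
  by apply: cvgMr_tmp; apply: (@cvg_comp _ _ _ r (fun y : R => y ^+ 2) _ (nbhs 0)) => //; exact: exprn_continuous.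
have l0 : sq_lim (hsum x (@harm R)) (hlim (@harm R)).
  apply: (sq_lim_intro s0 hsum_harm_cvg (r20 (dint (fun=> 1)))) => n m nm.
  rewrite -(rintZ mD); last exact: (intg_cst mD muD).
  have [_ i] := sqB mD (s0 m) (s0 n).
  apply: (rint_le mD) => //; first by apply: (intgZ mD); exact: (intg_cst mD muD).
  by move=> z Dz; rewrite mulr1 hsumB//; apply: (bnd (fun k => harm k z)) => // k; exact: harm_le1.
have htC n m : (n <= m)%N ->
    cint (fun t => (psum x m t - psum x n t) ^+ 2) <= r n ^+ 2 * cint (fun=> 1).
  move=> nm; rewrite -(rintZ mC); last exact: (intg_cst mC muC).
  have [_ i] := sqB mC (sq_psum x m) (sq_psum x n).
  apply: (rint_le mC) => //; first by apply: (intgZ mC); exact: (intg_cst mC muC).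
  by move=> t' Ct; rewrite mulr1 psumB//; apply: (bnd (fun k => basis k t')) => // k; exact: basis_le1.
have cC (t' : RT) : C t' -> (fun n => psum x n t') @ \oo --> hlimC t'.
  by move=> _; exact: psum_cvg.
have [sC hC] := @sq_fatou _ RT R leb1 C mC (fun n => psum x n) hlimC _ (sq_psum x) cC htC.
have lC : (fun n => cint (fun t => (psum x n t - hlimC t) ^+ 2)) @ \oo --> (0 : R).
  apply: (squeeze_cvgr _ (cvg_cst 0) (r20 (cint (fun=> 1)))); apply: nearW => n; apply/andP; split; last exact: hC.
  by apply: rint_ge0 => z _; exact: sqr_ge0.
split => //; exact: (H1tr_lim (hsum_H1tr x) l0 l1 l2 sC lC).
Qed.

Lemma fcoef_hlimC k : fcoef hlimC k = x k.
Proof.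
have [_ _ s l _] := hlim_H1tr.
have := sq_cvg_mul mC (sq_basis R k) s (sq_psum x) l.
rewrite (eq_cint (fun t => hlimC t * basis k t)); last by move=> t _; rewrite mulrC.
move=> h; apply: (lim_uniq h).
apply: cvg_near_cst; exists k.+1 => // n /= kn.
rewrite (eq_cint (fun t => psum x n t * basis k t)); last by move=> t _; rewrite mulrC.
by rewrite -/(fcoef _ _) fcoef_psum kn.
Qed.

(** Converse of [weak_eig_coef]: the energy pairing of a partial sum with v is a partial Parseval
    sum of the right-hand side. *)
Lemma eigenfunction_series rho lam : bddmC rho ->
  (forall k, freq R k * x k = lam * fcoef (fun t => rho t * hlimC t) k) ->
  exists u px py, weak_eig rho lam u px py hlimC.
Proof.
move=> brho he; have [l1 l2 sg _ h] := hlim_H1tr.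
exists (hlim (@harm R)), (hlim (@harm1 R)), (hlim (@harm2 R)); split => // v qx qy f hv.
have [sv sx sy sf] := H1trP hv.
have [_ s1 _] := l1; have [_ s2 _] := l2.
rewrite (rintD mD); [|exact: (sq_mul mD)|exact: (sq_mul mD)].
have cl : (fun n => dint (fun z => hsum x (@harm1 R) n z * qx z) +
    dint (fun z => hsum x (@harm2 R) n z * qy z)) @ \oo -->
    dint (fun z => hlim (@harm1 R) z * qx z) + dint (fun z => hlim (@harm2 R) z * qy z).
  exact: (cvgD (sq_lim_mul l1 sx) (sq_lim_mul l2 sy)).
apply: (lim_uniq cl).
have cP : (fun N => lam * \sum_(k < N) fcoef (fun t => rho t * hlimC t) k * fcoef f k) @ \oo -->
    lam * cint (fun t => rho t * hlimC t * f t).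
  by apply: cvgMl_tmp; apply: parseval => //; exact: (sq_mulb mC).
rewrite (_ : (fun n => _) = (fun N => lam * \sum_(k < N) fcoef (fun t => rho t * hlimC t) k * fcoef f k))//.
apply/funext => N /=; have [k1 _ _] := l1; have [k2 _ _] := l2.
rewrite -(rintD mD); [|exact: (sq_mul mD)|exact: (sq_mul mD)].
rewrite (hsum_pair_energy _ _ hv) mulr_sumr; apply: eq_bigr => k _.
by rewrite he mulrA.
Qed.

End Limit.
End HarmonicSeries.

(** * Construction of eigenfunctions and the upper min-max bound *)

Section Upper.
Variable R : realType.
Local Notation leb1 := (@lebesgue_measure R).
Local Notation leb2 := ((@lebesgue_measure R) \x (@lebesgue_measure R))%E.
Local Notation C := (@circle R).
Local Notation D := (@disk R).
Local Notation RT := (g_sigma_algebraType R.-ocitv.-measurable).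
Local Notation RT2 := (RT * RT)%type.
Local Notation bddmC := (@bddm _ RT R C).
Local Notation sqC := (@sqint _ RT R leb1 C).
Local Notation cint := (rint leb1 C).
Local Notation dint := (rint leb2 D).
Local Notation mC := (@measurable_circle R).
Local Notation muC := (@lebesgue_circle_fin R).
Local Notation mD := (@measurable_disk R).
Arguments eq_dint [R] g {f} _.
Arguments eq_cint [R] g {f} _.

Lemma cst_H1tr (c : R) : exists u px py, H1tr u px py (fun=> c) /\
  forall qx qy, dint (fun z => px z * qx z + py z * qy z) = 0.
Proof.
have hc : C1 (cst c : R * R -> R).
  by apply: (@C1_intro _ _ (fun=> 0) (fun=> 0)) => z; try exact: cvg_cst; exact: is_derive_cst.
exists (cst c), ('D_(e1 R) (cst c)), ('D_(e2 R) (cst c)); split; first exact: (C1_H1tr hc).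
move=> qx qy; rewrite (eq_dint (fun=> 0)); last first.
  by move=> z _; rewrite !derive_cst !mul0r addr0.
by rewrite /rint Rintegral_cst ?mul0r//; exact: mD.
Qed.

Section Density.
Variable rho : R -> R.
Hypothesis brho : bddmC rho.
Hypothesis rho0 : forall t, C t -> 0 <= rho t.
Hypothesis rho1 : forall t, C t -> rho t <= 1.

Lemma wform_cvg_sqr f (f_ : nat -> R -> R) : sqC f -> (forall n, sqC (f_ n)) ->
  (fun n => cint (fun t => (f_ n t - f t) ^+ 2)) @ \oo --> (0 : R) ->
  (fun n => wform rho (f_ n) (f_ n)) @ \oo --> wform rho f f.
Proof.
move=> hf hf_ cv.
have sB n : sqC (fun t => f_ n t - f t) by exact: (sqB mC).
have cB : (fun n => wform rho (fun t => f_ n t - f t) (fun t => f_ n t - f t)) @ \oo --> (0 : R).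
  apply: (squeeze_cvgr _ (cvg_cst 0) cv); apply: nearW => n.
  by rewrite wform_ge0//=; exact: wform_le.
(* Expansion around f: the form of the difference tends to 0, and the remaining term is linear in
   f_n. *)
have -> : (fun n => wform rho (f_ n) (f_ n)) = (fun n =>
    wform rho (fun t => f_ n t - f t) (fun t => f_ n t - f t) +
    2 * wform rho f (f_ n) - wform rho f f).
  apply/funext => n; rewrite -(rintZ mC); last exact: intg_wform.
  rewrite -(rintD mC); [|exact: intg_wform|by apply: (intgZ mC); exact: intg_wform].
  rewrite -(rintB mC); [by apply: eq_cint => t _; ring| |exact: intg_wform].
  by apply: (intgD mC); [exact: intg_wform|apply: (intgZ mC); exact: intg_wform].
rewrite [X in _ --> X](_ : _ = 0 + 2 * wform rho f f - wform rho f f); last by ring.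
apply: cvgB; last exact: cvg_cst.
by apply: cvgD => //; apply: cvgMl_tmp; exact: wform_cvg.
Qed.

(** A solution of the coefficient equations is determined up to null sets only. The sum of its
    Fourier series is the representative that is the trace of a weak eigenfunction, and values of
    the form do not change. *)
Lemma coef_eig_weak lam h K : coef_eig rho lam h ->
  (forall N, \sum_(k < N) (freq R k * fcoef h k) ^+ 2 <= K) ->
  exists h', [/\ sqC h', (exists u px py, weak_eig rho lam u px py h') &
    forall g, sqC g -> wform rho h' g = wform rho h g].
Proof.
move=> [sh he] hK; pose h' := hlimC (fcoef h).
have [_ _ sh' _ _] := hlim_H1tr hK.
have E k : fcoef h' k = fcoef h k by exact: fcoef_hlimC hK k.
have sB : sqC (fun t => h' t - h t) by exact: (sqB mC).
have h0 : cint (fun t => (h' t - h t) ^+ 2) = 0.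
  apply: fcoef_eq0 => // k; rewrite /fcoef.
  rewrite (eq_cint (fun t => h' t * basis k t - h t * basis k t)); last first.
    by move=> t _; rewrite mulrBl.
  rewrite (rintB mC); [|exact: (sq_mul mC sh' (sq_basis R k))|exact: (sq_mul mC sh (sq_basis R k))].
  by rewrite -!/(fcoef _ _) E subrr.
have W g : sqC g -> wform rho h' g = wform rho h g.
  move=> sg; rewrite (@eq_wform _ rho _ _ (fun t => h t + (h' t - h t)) g)//.
    by rewrite wformDl// [X in _ + X]wform_null// addr0.
  by move=> t _; rewrite addrC subrK.
exists h'; split => //; apply: (eigenfunction_series hK brho) => k.
by rewrite he fcoef_rho [RHS](_ : _ = lam * wform rho h' (@basis R k))// W//; exact: sq_basis.
Qed.

Section Deflation.
Variables (n : nat) (y : 'I_n.+1 -> R -> R) (lam : 'I_n.+1 -> R) (c0 : R).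
Hypothesis ye : forall i, coef_eig rho (lam i) (y i).
Hypothesis y0 : y ord0 = fun=> c0.
Hypothesis yo : forall i j, wform rho (y i) (y j) = (i == j)%:R.

Let sy i : sqC (y i). Proof. exact: (ye i).1. Qed.

(** The form rho evaluated on the components orthogonal to the eigenfunctions already found, which
    [dproj] extracts; it remains nonnegative and bounded by the L^2 norm. *)
Definition dform f g := wform rho f g - \sum_i wform rho f (y i) * wform rho g (y i).

Definition dproj (g : R -> R) (t : R) := g t + \sum_i (- wform rho g (y i)) * y i t.

Lemma sq_dproj g : sqC g -> sqC (dproj g).
Proof.
by move=> sg; apply: (sq_add mC) => //; apply: (sq_sum mC muC) => i; exact: (sqZ mC).
Qed.

Lemma wform_dproj f g : sqC f -> sqC g -> wform rho f (dproj g) = dform f g.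
Proof.
move=> sf sg; rewrite wformDr//; last by apply: (sq_sum mC muC) => i; exact: (sqZ mC).
rewrite wform_sumr// /dform -sumrN; congr (_ + _); apply: eq_bigr => i _.
by rewrite mulNr mulrC.
Qed.

Lemma dform_y f i : sqC f -> dform f (y i) = 0.
Proof.
move=> sf; rewrite /dform (bigD1 i)//= yo eqxx mulr1 big1 ?addr0 ?subrr// => j ji.
by rewrite yo eq_sym (negbTE ji) mulr0.
Qed.

Lemma dformC f g : dform f g = dform g f.
Proof.
by rewrite /dform wformC; congr (_ - _); apply: eq_bigr => i _; rewrite mulrC.
Qed.

Lemma wform_dproj_y g i : sqC g -> wform rho (dproj g) (y i) = 0.
Proof. by move=> sg; rewrite wformC wform_dproj// dformC dform_y. Qed.

Lemma wform_dproj_dproj g : sqC g -> wform rho (dproj g) (dproj g) = dform g g.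
Proof.
move=> sg; have sd := sq_dproj sg.
rewrite wform_dproj// /dform [X in _ - X]big1 ?subr0.
  by rewrite wformC wform_dproj.
by move=> i _; rewrite wform_dproj_y// mul0r.
Qed.

Lemma dform_ge0 g : sqC g -> 0 <= dform g g.
Proof. by move=> sg; rewrite -wform_dproj_dproj//; exact: wform_ge0. Qed.

Lemma dform_le g : sqC g -> dform g g <= cint (fun t => g t ^+ 2).
Proof.
move=> sg; apply: le_trans (wform_le brho rho1 sg).
by rewrite gerBl sumr_ge0// => i _; rewrite -expr2 sqr_ge0.
Qed.

Lemma dform_cvg f g (g_ : nat -> R -> R) : sqC f -> sqC g -> (forall m, sqC (g_ m)) ->
  (fun m => cint (fun t => (g_ m t - g t) ^+ 2)) @ \oo --> (0 : R) ->
  (fun m => dform f (g_ m)) @ \oo --> dform f g.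
Proof.
move=> sf sg sg_ cv; apply: cvgB; first exact: wform_cvg.
apply: (@cvg_bigsum R 'I_n.+1 _ (fun i m => wform rho f (y i) * wform rho (g_ m) (y i))) => i.
apply: cvgMl_tmp; rewrite wformC; under eq_fun do rewrite wformC.
exact: wform_cvg.
Qed.

Lemma dform_cvg_sqr g (g_ : nat -> R -> R) : sqC g -> (forall m, sqC (g_ m)) ->
  (fun m => cint (fun t => (g_ m t - g t) ^+ 2)) @ \oo --> (0 : R) ->
  (fun m => dform (g_ m) (g_ m)) @ \oo --> dform g g.
Proof.
move=> sg sg_ cv; apply: cvgB; first exact: wform_cvg_sqr.
apply: (@cvg_bigsum R 'I_n.+1 _ (fun i m => wform rho (g_ m) (y i) * wform rho (g_ m) (y i))) => i.
have h : (fun m => wform rho (g_ m) (y i)) @ \oo --> wform rho g (y i).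
  by rewrite wformC; under eq_fun do rewrite wformC; exact: wform_cvg.
exact: cvgM.
Qed.

Definition dcoef k l := dform (@basis R k) (@basis R l).

Lemma dform_psumr f x N : sqC f ->
  dform f (psum x N) = \sum_(l < N) dform f (@basis R l) * x l.
Proof.
move=> sf; have sb := sq_basis R; have sp := sq_psum x N.
have E g : sqC g -> wform rho g (psum x N) = \sum_(l < N) x l * wform rho g (@basis R l).
  by move=> sg; exact: (@wform_sumr R rho brho 'I_N (index_enum _) (fun l => x l) (fun l => @basis R l) g).
rewrite /dform E//.
have -> : \sum_i wform rho f (y i) * wform rho (psum x N) (y i) =
    \sum_(l < N) \sum_i x l * (wform rho f (y i) * wform rho (@basis R l) (y i)).
  rewrite exchange_big; apply: eq_bigr => i _; rewrite [wform rho (psum x N) _]wformC E// mulr_sumr.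
  by apply: eq_bigr => l _; rewrite mulrCA; congr (_ * (_ * _)); exact: wformC.
rewrite -sumrB; apply: eq_bigr => l _; rewrite -mulr_sumr; ring.
Qed.

Lemma bil_dcoef N x z : bil dcoef N x z = dform (psum x N) (psum z N).
Proof.
rewrite dform_psumr; last exact: sq_psum.
rewrite /bil exchange_big; apply: eq_bigr => l _ /=.
rewrite dformC dform_psumr; last exact: sq_basis.
by rewrite mulr_suml; apply: eq_bigr => k _; rewrite mulrA; congr (_ * _ * _); exact: dformC.
Qed.

(** The first function of the family is a nonzero constant, so deflation removes constants. This
    provides [b0] in the extremal problem and makes up for the zero frequency. *)
Lemma dform_cst f : sqC f -> dform (fun=> 1) f = 0.
Proof.
move=> sf.
have c00 : c0 != 0.
  apply/eqP => c00; have := yo ord0 ord0; rewrite y0 c00 eqxx.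
  rewrite /wform (eq_cint (fun=> 0)); last by move=> t _; rewrite !mulr0.
  by rewrite rint_circle_cst mul0r => /esym/eqP; rewrite oner_eq0.
have E g : sqC g -> wform rho (fun=> 1) g = c0^-1 * wform rho (y ord0) g.
  move=> sg; rewrite -wformZl//; apply: eq_wform => t _ //.
  by rewrite y0 mulVf.
rewrite /dform E// (bigD1 ord0)//= big1 ?addr0.
  by rewrite E// yo eqxx mulr1 [wform rho f _]wformC subrr.
by move=> i i0; rewrite E// yo eq_sym (negbTE i0) mulr0 mul0r.
Qed.

(** w shows that the deflated maximum beta is at least 1 / M. The maximiser solves the equation of
    the deflated form; removing its components along the y_i gives a solution of the one for rho,
    with eigenvalue 1 / beta. *)
Lemma next_eigenfunction w M : sqC w -> (forall i, wform rho w (y i) = 0) ->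
  0 < wform rho w w ->
  (forall N, \sum_(k < N) freq R k * fcoef w k ^+ 2 <= M * wform rho w w) ->
  exists y' lam', [/\ (exists u px py, weak_eig rho lam' u px py y'), sqC y', lam' <= M,
    wform rho y' y' = 1 & forall i, wform rho y' (y i) = 0].
Proof.
move=> sw wy w0 wM; have sb := sq_basis R.
have dw : dform w w = wform rho w w.
  by rewrite /dform big1 ?subr0// => i _; rewrite wy mul0r.
have cw := dform_cvg_sqr sw (sq_psum (fcoef w)) (parseval_cvg sw); rewrite dw in cw.
have H1 k l : dcoef k l = dcoef l k by exact: dformC.
have H2 l : dcoef 0 l = 0.
  rewrite /dcoef; have : dform (fun=> 1) (@basis R l) = 0 by exact: dform_cst.
  rewrite /dform => h.
  have E g : sqC g -> wform rho (@basis R 0) g = hc R 0 * wform rho (fun=> 1) g.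
    move=> sg; rewrite -wformZl//; last by apply: (sq_bdd mC muC); exact: bddm_cst.
    by apply: eq_wform => t _ //; rewrite mulr1.
  rewrite E// (eq_bigr (fun i => hc R 0 * (wform rho (fun=> 1) (y i) * wform rho (@basis R l) (y i)))).
    by rewrite -mulr_sumr -mulrBr h mulr0.
  by move=> i _; rewrite E// mulrA.
have H3 N x : 0 <= bil dcoef N x x by rewrite bil_dcoef; apply: dform_ge0; exact: sq_psum.
have H4 N x : bil dcoef N x x <= ssum N x.
  rewrite bil_dcoef; apply: le_trans (dform_le (sq_psum x N)) _.
  rewrite (eq_cint (fun t => psum x N t * psum x N t)); last by move=> t _; rewrite expr2.
  by rewrite rint_psum_psum /ssum; under eq_bigr do rewrite -expr2.
have H5 : freq R 0 = 0 by [].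
have H6 k : (0 < k)%N -> 1 <= freq R k by case: k => // k _; rewrite /freq ler1n.
have H7 (A : R) : exists N, forall k, (N <= k)%N -> A <= freq R k.
  exists (Num.bound `|A|).*2 => k hk; apply: le_trans (ler_norm _) _.
  apply: ltW; apply: lt_le_trans (archi_boundP (normr_ge0 _)) _.
  by rewrite /freq ler_nat -[leqLHS]uphalf_double uphalf_leq.
have [|beta [x [beta0 xw cx cb fin]]] := @extremal_sequence R dcoef (freq R) H1 H2 H3 H4 H5 H6 H7.
  have /cvgrPdist_lt /(_ _ w0)[N _ /(_ N (leqnn N)) hN] := cw.
  exists N, (fcoef w); rewrite bil_dcoef.
  by have := lt_le_trans hN (lexx _); rewrite ltr_norml => /andP[_]; lra.
have [x0 hxw] := xw.
have bM : beta^-1 <= M.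
  have : wform rho w w <= beta * (M * wform rho w w).
    apply: (cvgr_to_le cw); apply: nearW => N; rewrite -bil_dcoef.
    by apply: le_trans (fin N (fcoef w)) _; rewrite ler_pM2l//; exact: wM.
  rewrite mulrA -{1}[wform rho w w]mul1r ler_pM2r// => h.
  by rewrite -[leLHS]mulr1 ler_pdivrMl.
(* Regularity from the equation: beta freq x = b x has l^2 norm at most that of x, which the energy
   bounds by 1. *)
have hK N : \sum_(k < N) (freq R k * x k) ^+ 2 <= beta^-1 ^+ 2.
  have cN : (fun N' => \sum_(k < N) (\sum_(l < N') dcoef k l * x l) ^+ 2) @ \oo -->
      \sum_(k < N) (beta * (freq R k * x k)) ^+ 2.
    apply: (@cvg_bigsum R 'I_N _ (fun k N' => (\sum_(l < N') dcoef k l * x l) ^+ 2)) => k.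
    by apply: cvgM; exact: cb.
  have : \sum_(k < N) (beta * (freq R k * x k)) ^+ 2 <= 1.
    apply: (cvgr_to_le cN); exists N => // N' /= NN'.
    apply: le_trans (le_trans (bil_contraction H1 H3 H4 N' x) _).
      rewrite (big_ord_widen _ (fun k => (\sum_(l < N') dcoef k l * x l) ^+ 2) NN') big_mkcond.
      by apply: ler_sum => k _; case: (_ < _)%N; rewrite ?sqr_ge0.
    apply: le_trans (hxw N'); apply: ler_sum => -[[|k] kN] _ /=; first by rewrite x0 expr0n mulr0.
    by rewrite ler_peMl ?sqr_ge0// H6.
  under eq_bigr do rewrite exprMn.
  rewrite -mulr_sumr exprVn => h.
  by rewrite -[leRHS]mulr1 ler_pdivlMl ?exprn_gt0.
have [_ _ sg lg _] := hlim_H1tr hK; set g := hlimC x in sg lg.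
have fg k : fcoef g k = x k by exact: fcoef_hlimC hK k.
have dg : dform g g = beta.
  apply: (lim_uniq (dform_cvg_sqr sg (sq_psum x) lg)).
  by under eq_fun do rewrite -bil_dcoef.
pose h := dproj g; have sh : sqC h by exact: sq_dproj.
have hE k : wform rho h (@basis R k) = beta * (freq R k * x k).
  rewrite wformC wform_dproj//; apply: (lim_uniq (dform_cvg (sb k) sg (sq_psum x) lg)).
  rewrite (_ : (fun m => _) = (fun N => \sum_(l < N) dcoef k l * x l)); first exact: cb.
  by apply/funext => N; exact: (dform_psumr x N (sb k)).
(* Parseval pairs h with y_i in two ways, giving 0 by orthogonality and beta lam_i B(g, y_i) by the
   equation of y_i. Only components with lam_i = 0 are thus subtracted, and freq k times the k-th
   coefficient is unaffected. *)
have la i : lam i * wform rho g (y i) = 0.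
  have c1 : (fun N => lam i * \sum_(k < N) wform rho (y i) (@basis R k) * fcoef g k) @ \oo -->
      lam i * wform rho (y i) g by apply: cvgMl_tmp; exact: wform_parseval.
  have c2 := wform_parseval brho sh (sy i); rewrite wform_dproj_y// in c2.
  have c3 : (fun N => beta * (lam i * \sum_(k < N) wform rho (y i) (@basis R k) * fcoef g k)) @ \oo -->
      beta * (lam i * wform rho (y i) g) by exact: cvgMl_tmp.
  have E : (fun N => \sum_(k < N) wform rho h (@basis R k) * fcoef (y i) k) =
      (fun N => beta * (lam i * \sum_(k < N) wform rho (y i) (@basis R k) * fcoef g k)).
    apply/funext => N; rewrite !mulr_sumr; apply: eq_bigr => k _.
    rewrite hE fg; have := (ye i).2 k; rewrite fcoef_rho => ek.
    by rewrite -mulrA; congr (_ * _); rewrite mulrAC ek mulrA.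
  rewrite E in c2; have /eqP := lim_uniq c3 c2.
  by rewrite mulf_eq0 gt_eqF//= wformC => /eqP.
have fh k : freq R k * fcoef h k = freq R k * x k.
  have -> : fcoef h k = x k + \sum_i (- wform rho g (y i)) * fcoef (y i) k.
    rewrite /fcoef /h /dproj.
    rewrite (eq_cint (fun t => g t * basis k t +
      (\sum_i (- wform rho g (y i)) * y i t) * basis k t)); last by move=> t _; rewrite mulrDl.
    have ss : sqC (fun t => \sum_i (- wform rho g (y i)) * y i t).
      by apply: (sq_sum mC muC) => i; exact: (sqZ mC).
    rewrite (rintD mC); [|exact: (sq_mul mC sg (sb k))|exact: (sq_mul mC ss (sb k))].
    by rewrite -!/(fcoef _ _) fg fcoef_sum.
  rewrite mulrDr mulr_sumr big1 ?addr0// => i _.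
  by rewrite mulrCA (ye i).2 mulrA mulNr [wform _ _ _ * _]mulrC la oppr0 mul0r.
pose s := Num.sqrt beta; have s0 : 0 < s by rewrite sqrtr_gt0.
have s2 : s ^+ 2 = beta by rewrite sqr_sqrtr// ltW.
pose h1 t := s^-1 * h t; have sh1 : sqC h1 by exact: (sqZ mC).
have fh1 k : fcoef h1 k = s^-1 * fcoef h k.
  rewrite /fcoef -(rintZ mC); last exact: (sq_mul mC sh (sb k)).
  by apply: eq_cint => t _; rewrite /h1 mulrA.
have ch1 : coef_eig rho beta^-1 h1.
  split => // k; rewrite fcoef_rho wformZl// hE fh1 mulrCA fh.
  by rewrite [RHS]mulrCA mulKf// gt_eqF.
have [|h' [sh' hw' hwf]] := @coef_eig_weak _ _ (s^-1 ^+ 2 * beta^-1 ^+ 2) ch1.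
  move=> N; apply: le_trans (_ : s^-1 ^+ 2 * \sum_(k < N) (freq R k * x k) ^+ 2 <= _).
    by rewrite mulr_sumr; apply: ler_sum => k _; rewrite fh1 mulrCA fh exprMn.
  by rewrite ler_wpM2l ?sqr_ge0.
exists h', beta^-1; split => //.
- rewrite hwf// wformC hwf// wformZl// wformZr// wform_dproj_dproj// dg mulrA -expr2 exprVn s2.
  by rewrite mulVf// gt_eqF.
- by move=> i; rewrite hwf// wformZl// wform_dproj_y// mulr0.
Qed.

End Deflation.

Hypothesis rho_pos : 0 < wform rho (cst 1) (cst 1).

(** Induction on the number of eigenfunctions found: while it is at most k, the k + 1 test functions
    have a nonzero combination orthogonal to all of them, and its Rayleigh quotient bounds the next
    eigenvalue by M. *)
Lemma eigset_upper k M (f : 'I_k.+1 -> R -> R) : (forall i, sqC (f i)) ->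
  (forall c : 'I_k.+1 -> R, (exists i, c i != 0) ->
     let w t := \sum_i c i * f i t in
     0 < wform rho w w /\
     forall N, \sum_(j < N) freq R j * fcoef w j ^+ 2 <= M * wform rho w w) ->
  eigset rho k M.
Proof.
move=> sf hf.
have sw (c : 'I_k.+1 -> R) : sqC (fun t => \sum_i c i * f i t).
  by apply: (sq_sum mC muC) => i; exact: (sqZ mC).
(* The case N = 0 of the hypothesis; the induction starts from constants, whose eigenvalue 0 must be
   at most M. *)
have M0 : 0 <= M.
  have [|p /(_ 0%N)] := hf (fun=> 1); first by exists ord0; exact: oner_neq0.
  by rewrite big_ord0 pmulr_lge0.
pose P n (y : 'I_n.+1 -> R -> R) (lam : 'I_n.+1 -> R) := [/\
  forall i, exists u px py, weak_eig rho (lam i) u px py (y i),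
  forall i, lam i <= M, exists c0, y ord0 = (fun=> c0) &
  forall i j, wform rho (y i) (y j) = (i == j)%:R].
have main n : (n <= k)%N -> exists y lam, P n y lam.
  elim: n => [_|n IH nk].
    pose c0 := (Num.sqrt (wform rho (cst 1) (cst 1)))^-1.
    exists (fun _ _ => c0), (fun=> 0); split => //; last first.
    - move=> i j; rewrite !ord1 eqxx.
      have s1 : sqC (cst 1) by apply: (sq_bdd mC muC); exact: bddm_cst.
      have s2 : sqC (fun t => c0 * cst 1 t) by exact: (sqZ mC).
      rewrite (@eq_wform _ rho _ _ (fun t => c0 * cst 1 t) (fun t => c0 * cst 1 t)).
      - rewrite wformZl// wformZr// mulrA -expr2 exprVn sqr_sqrtr ?ltW// mulVf// gt_eqF//.
      - by move=> t _; rewrite mulr1.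
      - by move=> t _; rewrite mulr1.
    - by exists c0.
    - move=> i; have [u [px [py [h1 h2]]]] := cst_H1tr c0; exists u, px, py; split => //.
      by move=> v qx qy h _; rewrite h2 mul0r.
  have [y [lam [he hl [c0 hy0] ho]]] := IH (ltnW nk).
  have hce i : coef_eig rho (lam i) (y i).
    by have [u [px [py h]]] := he i; exact: weak_eig_coef h.
  pose A := \matrix_(i < k.+1, j < n.+1) wform rho (f i) (y j).
  have [c cn0 cA] : exists2 c : 'rV[R]_k.+1, c != 0 & c *m A = 0 by apply: nonzero_ker; rewrite ltnS.
  have [|w0 wM] := hf (fun i => c 0 i).
    by apply/existsP; move: cn0; apply: contraR; rewrite negb_exists => /forallP h;
      apply/eqP/rowP => i; rewrite mxE; apply/eqP; have := h i; rewrite negbK.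
  have wy j : wform rho (fun t => \sum_i c 0 i * f i t) (y j) = 0.
    have [sy _] := hce j; rewrite wform_suml//.
    have := congr1 (fun B : 'rV_n.+1 => B 0 j) cA; rewrite !mxE => cAj; rewrite -[RHS]cAj.
    by apply: eq_bigr => i _; rewrite !mxE.
  have [y' [lam' [he' sy' hl' hn' ho']]] := next_eigenfunction hce hy0 ho (sw _) wy w0 wM.
  pose Y (i : 'I_n.+2) := if unlift ord_max i is Some j then y j else y'.
  pose L (i : 'I_n.+2) := if unlift ord_max i is Some j then lam j else lam'.
  exists Y, L; split.
  - by move=> i; rewrite /Y /L; case: (unliftP ord_max i) => [j _|_]; [exact: he|exact: he'].
  - by move=> i; rewrite /L; case: (unliftP ord_max i) => [j _|_].
  - exists c0; rewrite /Y; case: (unliftP ord_max ord0) => [j ij|/(congr1 val)//].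
    rewrite -hy0; congr y; apply: val_inj; have := congr1 val ij; rewrite /= /bump.
    by have := ltn_ord j; lia.
  - move=> i j; rewrite /Y; case: (unliftP ord_max i) => [i' ->|->];
      case: (unliftP ord_max j) => [j' ->|->].
    + by rewrite ho (inj_eq lift_inj).
    + by rewrite wformC ho' eq_sym (negbTE (neq_lift _ _)).
    + by rewrite ho' (negbTE (neq_lift _ _)).
    + by rewrite hn' eqxx.
have [y [lam [he hl _ ho]]] := main k (leqnn k).
have /choice[u hu] := he; have /choice[px hpx] := hu; have /choice[py hy] := hpx.
exists u; split; last by move=> i; exists (lam i) => //; apply/weak_steklovP; exists (px i), (py i), (y i).
(* A combination that is null on the disk has a null trace, and pairing the trace with y_i isolates
   c_i. *)
move=> c hae i.
have hs := H1tr_sum c (fun i => (hy i).1); have [su _ _ sg] := H1trP hs.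
have u0 : dint (fun z => (\sum_i c i * u i z) ^+ 2) = 0.
  transitivity (dint (fun=> 0)); last by rewrite /rint Rintegral_cst ?mul0r//; exact: mD.
  rewrite /rint /Rintegral; congr fine.
  apply: (@ae_eq_integral _ RT2 R leb2 D (fun=> 0%E) (fun z => ((\sum_i c i * u i z) ^+ 2)%:E) mD).
  - by case: su => _ /integrableP[].
  - exact: measurable_cst.
  - case: hae => N [mN N0 sN]; exists N; split => // z hz; apply: sN => hE; apply: hz => Dz.
    by rewrite hE// expr0n.
have g0 := null_trace hs u0.
have sy j : sqC (y j) by have [] := H1trP (hy j).1.
have := wform_null brho sg (sy i) g0.
rewrite wform_suml// (bigD1 i)//= ho eqxx mulr1 big1 ?addr0// => j ji.
by rewrite ho (negbTE ji) mulr0.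
Qed.

End Density.
End Upper.

(** * Perturbations of the constant density *)

Section Perturbation.
Variable R : realType.
Local Notation leb1 := (@lebesgue_measure R).
Local Notation C := (@circle R).
Local Notation RT := (g_sigma_algebraType R.-ocitv.-measurable).
Local Notation bddmC := (@bddm _ RT R C).
Local Notation sqC := (@sqint _ RT R leb1 C).
Local Notation cint := (rint leb1 C).
Local Notation mC := (@measurable_circle R).
Local Notation muC := (@lebesgue_circle_fin R).
Arguments eq_cint [R] g {f} _.

Lemma cint_sqr_lin (a : R) f g : sqC f -> sqC g ->
  cint (fun t => (a * f t + g t) ^+ 2) =
  a ^+ 2 * cint (fun t => f t ^+ 2) + 2 * a * cint (fun t => f t * g t) + cint (fun t => g t ^+ 2).
Proof.
move=> sf sg; have [_ i1] := sf; have [_ i2] := sg; have i3 := sq_mul mC sf sg.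
rewrite -(rintZ mC)// -(rintZ mC)// -(rintD mC); [|exact: (intgZ mC)|exact: (intgZ mC)].
rewrite -(rintD mC)//; last by apply: (intgD mC); exact: (intgZ mC).
by apply: eq_cint => t _; ring.
Qed.

Lemma eigset_upper_basis (rho : R -> R) k M (s : 'I_k.+1 -> nat) : bddmC rho ->
  (forall t, C t -> 0 <= rho t) -> (forall t, C t -> rho t <= 1) ->
  0 < wform rho (cst 1) (cst 1) -> injective s ->
  (forall c : 'I_k.+1 -> R, (exists i, c i != 0) ->
     let w t := \sum_i c i * @basis R (s i) t in
     0 < wform rho w w /\ \sum_i freq R (s i) * c i ^+ 2 <= M * wform rho w w) ->
  eigset rho k M.
Proof.
move=> brho rho0 rho1 p sinj hc.
apply: (eigset_upper brho rho0 rho1 p (f := fun i => @basis R (s i))).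
  by move=> i; exact: sq_basis.
move=> c cn0 w; have [w0 wM] := hc c cn0; split => // N; apply: le_trans wM.
have fw j : fcoef w j = \sum_i c i * (s i == j)%:R.
  by rewrite fcoef_sum; [apply: eq_bigr => i _; rewrite /fcoef rint_basis|move=> i; exact: sq_basis].
have fw2 j : fcoef w j ^+ 2 = \sum_i c i ^+ 2 * (s i == j)%:R.
  rewrite fw; have [[i ij]|/forallNP nij] := pselect (exists i, s i = j).
    rewrite (bigD1 i)//= ij eqxx mulr1 big1 ?addr0; last first.
      move=> l li; rewrite (_ : s l == j = false) ?mulr0//.
      by apply/negbTE; rewrite -ij (inj_eq sinj).
    rewrite (bigD1 i)//= ij eqxx mulr1 big1 ?addr0// => l li.
    by rewrite (_ : s l == j = false) ?mulr0//; apply/negbTE; rewrite -ij (inj_eq sinj).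
  have z (F : R -> R) : \sum_i F (c i) * (s i == j)%:R = 0.
    by apply: big1 => i _; rewrite (_ : s i == j = false) ?mulr0//; apply/eqP; exact: nij.
  by rewrite (z id) expr0n (z (fun r => r ^+ 2)).
under eq_bigr do rewrite fw2 mulr_sumr.
rewrite exchange_big; apply: ler_sum => i _ /=.
have [sN|sN] := ltnP (s i) N.
  rewrite (bigD1 (Ordinal sN))//= eqxx mulr1 big1 ?addr0// => j.
  by rewrite -val_eqE /= eq_sym => /negbTE ->; rewrite !mulr0.
rewrite big1; first by rewrite mulr_ge0 ?freq_ge0 ?sqr_ge0.
move=> j _.
rewrite (_ : s i == j = false) ?mulr0//; apply/negbTE/eqP => h.
by have := ltn_ord j; rewrite -h ltnNge sN.
Qed.

Lemma cint_sum_basis k (c : 'I_k -> R) (s : 'I_k -> nat) : injective s ->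
  cint (fun t => (\sum_i c i * @basis R (s i) t) ^+ 2) = \sum_i c i ^+ 2.
Proof.
move=> sinj; have sb i : sqC (@basis R (s i)) := sq_basis R (s i).
have E f g : wform (fun=> 1) f g = cint (fun t => f t * g t).
  by apply: eq_cint => t _; rewrite mul1r.
have b1 : bddmC (fun=> 1) by exact: bddm_cst.
rewrite (eq_cint (fun t => (\sum_i c i * @basis R (s i) t) * (\sum_i c i * @basis R (s i) t))); last first.
  by move=> t _; rewrite expr2.
have sw : sqC (fun t => \sum_i c i * @basis R (s i) t).
  by apply: (sq_sum mC muC) => i; exact: (sqZ mC).
rewrite -E wform_suml//; apply: eq_bigr => i _.
rewrite wform_sumr// (bigD1 i)//= E rint_basis eqxx mulr1 big1 ?addr0 ?expr2// => j ji.
by rewrite E rint_basis (inj_eq sinj) eq_sym (negbTE ji) mulr0.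
Qed.

Lemma sum_sqr_gt0 k (c : 'I_k -> R) : (exists i, c i != 0) -> 0 < \sum_i c i ^+ 2.
Proof.
move=> [i ci]; rewrite (bigD1 i)//= ltr_pwDl ?sumr_ge0// ?exprn_even_gt0// => j _.
exact: sqr_ge0.
Qed.

Lemma wform_ge_cst (rho : R -> R) a f : bddmC rho -> (forall t, C t -> a <= rho t) -> sqC f ->
  a * cint (fun t => f t ^+ 2) <= wform rho f f.
Proof.
move=> brho ha sf; have [_ i] := sf; rewrite -(rintZ mC)//.
apply: (rint_le mC); [exact: (intgZ mC)|exact: intg_wform|].
by move=> t Ct; rewrite -[X in _ <= X]mulrA -expr2 ler_wpM2r ?sqr_ge0// ha.
Qed.

Lemma sq_cst1 : sqC (cst 1). Proof. by apply: (sq_bdd mC muC); exact: bddm_cst. Qed.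

Lemma wform_pos (rho : R -> R) a : bddmC rho -> 0 < a -> (forall t, C t -> a <= rho t) ->
  0 < wform rho (cst 1) (cst 1).
Proof.
move=> brho a0 ha; apply: lt_le_trans (wform_ge_cst brho ha sq_cst1).
rewrite (eq_cint (fun=> 1)); last by move=> t _; rewrite expr1n.
by rewrite rint_circle_cst mul1r mulr_gt0// two_pi_gt0.
Qed.

(** Sharp for a constant density; for other densities bounded away from 0 it serves to show that the
    set under the infimum is nonempty. *)
Lemma eigset_freq (rho : R -> R) a k : bddmC rho -> 0 < a -> (forall t, C t -> a <= rho t <= 1) ->
  eigset rho k (freq R k / a).
Proof.
move=> brho a0 ha.
have h0 t : C t -> a <= rho t by move=> /ha/andP[].
have h1 t : C t -> rho t <= 1 by move=> /ha/andP[].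
apply: (@eigset_upper_basis _ _ _ (fun i => i)) => //.
- by move=> t Ct; exact: le_trans (ltW a0) (h0 _ Ct).
- exact: wform_pos a0 h0.
- exact: ord_inj.
move=> c cn0 w.
have sw : sqC w by apply: (sq_sum mC muC) => i; apply: (sqZ mC); exact: sq_basis.
have := wform_ge_cst brho h0 sw; rewrite cint_sum_basis; last exact: ord_inj.
have c0 := sum_sqr_gt0 cn0 => h; split; first by apply: lt_le_trans h; rewrite mulr_gt0.
apply: (@le_trans _ _ (freq R k * \sum_i c i ^+ 2)).
  by rewrite mulr_sumr; apply: ler_sum => i _; rewrite ler_wpM2r ?sqr_ge0// freq_le// -ltnS.
by rewrite -mulrA ler_wpM2l ?freq_ge0// ler_pdivlMl.
Qed.

Lemma bddm_cstC (a : R) : bddmC (cst a). Proof. exact: bddm_cst. Qed.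

Lemma steklov_ev_cst alpha k : 0 < alpha <= 1 -> steklov_ev (cst alpha) k = freq R k / alpha.
Proof.
move=> /andP[a0 a1]; have b := bddm_cstC alpha.
have h : eigset (cst alpha) k (freq R k / alpha).
  by apply: eigset_freq => // t _; rewrite lexx.
have h0 t : C t -> 0 <= cst alpha t by move=> _; exact: ltW.
apply/eqP; rewrite eq_le; apply/andP; split.
  apply: steklov_ev_le => //; apply: (wform_pos b a0) => t _; exact: lexx.
apply: steklov_ev_ge; first by exists (freq R k / alpha).
move=> mu /(eigset_lower_split id b h0)[g [sg g0 gk /(_ k)]].
rewrite big1; last by move=> j _; rewrite gk// expr0n mulr0.
rewrite big1 ?subr0 ?add0r; last by move=> j _; rewrite gk// expr0n.
have -> : wform (cst alpha) g g = alpha * cint (fun t => g t ^+ 2).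
  have [_ i] := sg; rewrite -(rintZ mC)//; apply: eq_cint => t _; by rewrite -mulrA -expr2.
by rewrite mulrA ler_pM2r// ler_pdivrMr.
Qed.

Lemma pred_or_eq j k : (k.-1 <= j <= k)%N -> j = k.-1 \/ j = k.
Proof. by move=> /andP[h1 h2]; lia. Qed.

Lemma freq_ge1 k : (0 < k)%N -> 1 <= freq R k.
Proof. by case: k => // k _; rewrite ler1n. Qed.

Lemma freq_oddS k : odd k -> freq R k.+1 = freq R k.
Proof. by move=> ok; rewrite /freq /= uphalf_half ok; congr _%:R; lia. Qed.

Lemma freq_evenS k : ~~ odd k -> freq R k.+1 = freq R k + 1.
Proof. by move=> ek; rewrite /freq /= natr1 uphalf_half (negbTE ek). Qed.

Section Bound.
Variables (delta : R -> R) (K : R).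
Hypothesis bdelta : bddmC delta.
Hypothesis hK : forall t, C t -> `|delta t| <= K.

(** The cross term is split with weight eta: the distinguished mode only gets a small error, and the
    large constant 1 / eta falls on h, where a spectral gap will absorb it. *)
Lemma perturb_bound i s h eta : sqC h -> 0 < eta ->
  `|wform delta (fun t => s * @basis R i t + h t) (fun t => s * @basis R i t + h t) -
    s ^+ 2 * wform delta (@basis R i) (@basis R i)| <=
  eta * K ^+ 2 * s ^+ 2 + (eta^-1 + K) * cint (fun t => h t ^+ 2).
Proof.
move=> sh eta0; have sb := sq_basis R i; have [_ ih] := sh.
have sE : sqC (fun t => s * @basis R i t) by exact: (sqZ mC).
have sf := sq_add mC sE sh.
have sd : sqC (fun t => delta t * (s * @basis R i t)) by exact: sq_rho.
rewrite wformDl// wformDr// wformDr// (wformC delta h (fun t => s * @basis R i t)).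
have -> : wform delta (fun t => s * @basis R i t) (fun t => s * @basis R i t) =
    s ^+ 2 * wform delta (@basis R i) (@basis R i) by rewrite wformZl// wformZr// mulrA expr2.
set X := wform delta _ h; set Y := wform delta h h.
rewrite (_ : _ - _ = 2 * X + Y); last by ring.
have K0 : 0 <= K by apply: le_trans (hK (_ : C 0)); rewrite // /circle /= in_itv /= lexx two_pi_gt0.
have hX : 2 * `|X| <= eta * (K ^+ 2 * s ^+ 2) + eta^-1 * cint (fun t => h t ^+ 2).
  apply: le_trans (rint_amgm mC eta0 sd sh) _; rewrite lerD2r ler_pM2l//.
  apply: (@le_trans _ _ (K ^+ 2 * s ^+ 2 * cint (fun t => @basis R i t * @basis R i t))).
    have ib := sq_mul mC sb sb.
    rewrite -(rintZ mC)//; apply: (rint_le mC); [by have [] := sd|exact: (intgZ mC)|].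
    move=> t Ct; rewrite -expr2 !exprMn mulrA ler_wpM2r ?sqr_ge0// ler_wpM2r ?sqr_ge0//.
    rewrite -[leLHS]real_normK ?num_real// lerXn2r ?nnegrE//; exact: hK.
  by rewrite rint_basis eqxx mulr1.
have hY : `|Y| <= K * cint (fun t => h t ^+ 2).
  have iY := intg_wform bdelta sh sh.
  rewrite ler_norml; apply/andP; split.
    rewrite -mulNr -(rintZ mC)//; apply: (rint_le mC) => //; first exact: (intgZ mC).
    move=> t Ct; rewrite -mulrA -expr2 ler_wpM2r ?sqr_ge0//.
    by have := hK Ct; rewrite ler_norml => /andP[].
  rewrite -(rintZ mC)//; apply: (rint_le mC) => //; first exact: (intgZ mC).
  move=> t Ct; rewrite -mulrA -expr2 ler_wpM2r ?sqr_ge0//.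
  by have := hK Ct; rewrite ler_norml => /andP[].
apply: le_trans (ler_normD _ _) _; rewrite normrM ger0_norm// [(eta^-1 + K) * _]mulrDl addrA lerD//.
by rewrite -mulrA.
Qed.

Lemma wform_perturb alpha e f : sqC f ->
  wform (perturb alpha delta e) f f = alpha * cint (fun t => f t ^+ 2) + e * wform delta f f.
Proof.
move=> sf; have [_ i] := sf; have i' := intg_wform bdelta sf sf.
rewrite -(rintZ mC)// -(rintZ mC)// -(rintD mC); [|exact: (intgZ mC)|exact: (intgZ mC)].
by apply: eq_cint => t _; rewrite /perturb; ring.
Qed.

Lemma bddm_perturb alpha e : bddmC (perturb alpha delta e).
Proof. by apply: bddm_add; [exact: bddm_cst|exact: bddmZ]. Qed.

Variables (alpha e eta : R) (k i : nat).
Hypotheses (eta0 : 0 < eta) (e0 : 0 < e) (k0 : (0 < k)%N).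
Let rho := perturb alpha delta e.
Let m := freq R k.

(** A single mode i of the pair {k - 1, k} decides: the other modes up to k are made to vanish, so
    what remains is the mode i, of frequency m, and modes of frequency at least m + 1. The last
    inequality assumed lets this gap absorb 1 / eta + K. *)
Lemma perturb_lower Du mu : ~~ odd k -> (i == k) || (i == k.-1) ->
  (forall t, C t -> 0 <= rho t) -> 0 < wform rho (cst 1) (cst 1) ->
  wform delta (@basis R i) (@basis R i) <= Du ->
  let P := alpha + e * (Du + eta * K ^+ 2) in
  0 < P -> m * (alpha + e * (eta^-1 + K)) <= (m + 1) * P ->
  eigset rho k mu -> m / P <= mu.
Proof.
move=> ek hi rho0 rp hD P P0 hQ hmu.
have brho : bddmC rho by exact: bddm_perturb.
have mu0 := eigset_ge0 id brho rho0 rp hmu.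
(* Enumerates the k indices from 0 to k other than i. *)
pose s j := if (j < k.-1)%N then j else if i == k then k.-1 else k.
have [g [sg g0 gk /(_ k.+1)]] := eigset_lower_split s brho rho0 hmu.
have gz j : (j <= k)%N -> j != i -> fcoef g j = 0.
  move=> jk ji; have [j1|j1] := ltnP j k.-1.
    by have := gk j; rewrite /s j1; apply; exact: leq_trans j1 (leq_pred k).
  have := gk k.-1; rewrite /s ltnn prednK// leqnn => /(_ isT) h.
  have [jk'|jk'] := @pred_or_eq j k (introT andP (conj j1 jk)); subst j.
    by case: (eqVneq i k) h hi ji => // ik h /= /eqP ->; rewrite eqxx.
  by move: h; rewrite (eq_sym i k) (negbTE ji).
have ik : (i < k.+1)%N by case/orP: hi => /eqP ->; rewrite ltnS ?leq_pred.
have fi : freq R i = m.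
  case/orP: hi => /eqP -> //; rewrite /m -{2}(prednK k0) freq_oddS//.
  by move: ek; rewrite -{1}(prednK k0) /= negbK.
have fk1 : freq R k.+1 = m + 1 by exact: freq_evenS.
pose a := fcoef g i; pose h t := g t - a * @basis R i t.
have sb := sq_basis R i; have sab : sqC (fun t => a * @basis R i t) by exact: (sqZ mC).
have sh : sqC h by exact: (sqB mC).
have gE t : g t = a * @basis R i t + h t by rewrite /h addrC subrK.
have oh : cint (fun t => @basis R i t * h t) = 0.
  rewrite (eq_cint (fun t => g t * @basis R i t - a * (@basis R i t * @basis R i t))); last first.
    by move=> t _; rewrite /h; ring.
  have ib := sq_mul mC sb sb.
  rewrite (rintB mC); [|exact: (sq_mul mC sg sb)|exact: (intgZ mC)].
  by rewrite (rintZ mC)// rint_basis eqxx mulr1 -/(fcoef g i) subrr.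
have ng : cint (fun t => g t ^+ 2) = a ^+ 2 + cint (fun t => h t ^+ 2).
  rewrite (eq_cint (fun t => (a * @basis R i t + h t) ^+ 2)); last by move=> t _; rewrite gE.
  rewrite cint_sqr_lin// oh mulr0 addr0; congr (_ + _).
  rewrite (eq_cint (fun t => @basis R i t * @basis R i t)); last by move=> t _; rewrite expr2.
  by rewrite rint_basis eqxx mulr1.
have S (F : nat -> R) : \sum_(j < k.+1) F j * fcoef g j ^+ 2 = F i * a ^+ 2.
  rewrite (bigD1 (Ordinal ik))//= big1 ?addr0// => j ji.
  by rewrite gz ?expr0n ?mulr0// -ltnS.
have S1 : \sum_(j < k.+1) fcoef g j ^+ 2 = a ^+ 2.
  by rewrite -[RHS]mul1r -(S (fun=> 1)); apply: eq_bigr => j _; rewrite mul1r.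
rewrite S S1 fi fk1 ng addrAC subrr add0r wform_perturb// ng.
have W : wform delta g g <= (Du + eta * K ^+ 2) * a ^+ 2 + (eta^-1 + K) * cint (fun t => h t ^+ 2).
  have := perturb_bound i a sh eta0.
  rewrite (@eq_wform _ delta _ _ g g); [|by move=> t _; rewrite gE..].
  rewrite ler_norml => /andP[_ W]; have : a ^+ 2 * wform delta (@basis R i) (@basis R i) <= a ^+ 2 * Du.
    by rewrite ler_wpM2l ?sqr_ge0.
  move: W; lra.
move: g0; rewrite ng; have a2 : 0 <= a ^+ 2 := sqr_ge0 a.
have h2 : 0 <= cint (fun t => h t ^+ 2) by apply: rint_ge0 => t _; exact: sqr_ge0.
have m0 : 0 < m by exact: (lt_le_trans ltr01 (freq_ge1 k0)).
move: W; set A := a ^+ 2 in a2 *; set H := cint _ in h2 *; set B := wform _ _ _ => W AH hle.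
rewrite leNgt; apply/negP => lt_mu.
have lt1 : mu * P < m by rewrite -ltr_pdivlMr.
(* [hQ] carries mu P < m over to the high modes: multiply by m and compare with (m + 1) P. *)
have lt2 : mu * (alpha + e * (eta^-1 + K)) < m + 1.
  rewrite -(ltr_pM2l m0); apply: (@le_lt_trans _ _ (mu * ((m + 1) * P))).
    by rewrite mulrCA ler_wpM2l.
  by rewrite mulrCA [ltRHS]mulrC ltr_pM2l// addr_gt0.
have : m * A + (m + 1) * H <= mu * P * A + mu * (alpha + e * (eta^-1 + K)) * H.
  apply: le_trans hle _; apply: le_trans (ler_wpM2l mu0 (lerD (lexx _) (ler_wpM2l (ltW e0) W))) _.
  by rewrite /P le_eqVlt; apply/orP; left; apply/eqP; ring.
have [A0|A0] := eqVneq A 0.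
  have H0 : 0 < H by move: AH; rewrite A0 add0r.
  by rewrite A0 !mulr0 !add0r ler_pM2r// leNgt lt2.
have A0' : 0 < A by rewrite lt0r A0.
have : mu * P * A < m * A by rewrite ltr_pM2r.
have : mu * (alpha + e * (eta^-1 + K)) * H <= (m + 1) * H by rewrite ler_wpM2r// ltW.
by move=> h3 h4 h5; have := lt_le_trans (ltr_leD h4 h3) h5; rewrite ltxx.
Qed.

(** The test space is spanned by the modes below k, of frequency at most m - 1, and a single mode i
    of the pair {k, k + 1}, of frequency m. The inequality between P and Q lets the gap absorb 1 /
    eta + K. *)
Lemma perturb_upper Dl : odd k -> (i == k) || (i == k.+1) ->
  (forall t, C t -> 0 <= rho t) -> (forall t, C t -> rho t <= 1) ->
  0 < wform rho (cst 1) (cst 1) -> Dl <= wform delta (@basis R i) (@basis R i) ->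
  let P := alpha + e * (Dl - eta * K ^+ 2) in let Q := alpha - e * (eta^-1 + K) in
  0 < P -> 0 < Q -> (m - 1) * P <= m * Q -> eigset rho k (m / P).
Proof.
move=> ok hi rho0 rho1 rp hD P Q P0 Q0 hQ.
have brho : bddmC rho by exact: bddm_perturb.
pose s (j : 'I_k.+1) := if (j < k)%N then nat_of_ord j else i.
have sinj : injective s.
  have ik : (k <= i)%N by case/orP: hi => /eqP ->.
  move=> j l; rewrite /s => h; apply: val_inj => /=; move: h.
  have := ltn_ord j; have := ltn_ord l.
  by case: (ltnP j k); case: (ltnP l k); lia.
apply: (eigset_upper_basis brho rho0 rho1 rp sinj) => c cn0 w.
pose a := c ord_max; pose h t := \sum_(j < k) c (widen_ord (leqnSn k) j) * @basis R j t.
have wE t : w t = a * @basis R i t + h t.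
  rewrite /w big_ord_recr /= addrC; congr (_ * _ + _); first by rewrite /s ltnn.
  by apply: eq_bigr => j _; rewrite /s /= ltn_ord.
have sh : sqC h by apply: (sq_sum mC muC) => j; apply: (sqZ mC); exact: sq_basis.
have nh : cint (fun t => h t ^+ 2) = \sum_(j < k) c (widen_ord (leqnSn k) j) ^+ 2.
  by apply: cint_sum_basis; exact: ord_inj.
have nc : \sum_j c j ^+ 2 = a ^+ 2 + cint (fun t => h t ^+ 2).
  by rewrite big_ord_recr /= addrC nh.
have sw : sqC w by apply: (sq_sum mC muC) => j; apply: (sqZ mC); exact: sq_basis.
have nw : cint (fun t => w t ^+ 2) = a ^+ 2 + cint (fun t => h t ^+ 2).
  by rewrite -nc; exact: cint_sum_basis.
have fi : freq R i = m.
  by case/orP: hi => /eqP -> //; exact: freq_oddS.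
have W : wform delta w w >= (Dl - eta * K ^+ 2) * a ^+ 2 - (eta^-1 + K) * cint (fun t => h t ^+ 2).
  have := perturb_bound i a sh eta0.
  rewrite (@eq_wform _ delta _ _ w w); [|by move=> t _; rewrite wE..].
  rewrite ler_norml => /andP[W _]; have : a ^+ 2 * Dl <= a ^+ 2 * wform delta (@basis R i) (@basis R i).
    by rewrite ler_wpM2l ?sqr_ge0.
  move: W; lra.
have hA : \sum_j freq R (s j) * c j ^+ 2 <= m * a ^+ 2 + (m - 1) * cint (fun t => h t ^+ 2).
  rewrite big_ord_recr /= {2}/s ltnn fi addrC lerD2l nh mulr_sumr; apply: ler_sum => j _.
  rewrite ler_wpM2r ?sqr_ge0// /s /= ltn_ord.
  apply: (@le_trans _ _ (freq R k.-1)); first by apply: freq_le; rewrite -ltnS (prednK k0).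
  rewrite lerBrDr -freq_evenS ?(prednK k0)//.
  by move: ok; rewrite -{1}(prednK k0).
have := sum_sqr_gt0 cn0; rewrite nc.
have a2 : 0 <= a ^+ 2 := sqr_ge0 a.
have h2 : 0 <= cint (fun t => h t ^+ 2) by apply: rint_ge0 => t _; exact: sqr_ge0.
have m1 : 1 <= m by exact: freq_ge1.
have B : P * a ^+ 2 + Q * cint (fun t => h t ^+ 2) <= wform rho w w.
  rewrite wform_perturb// nw.
  apply: le_trans (lerD (lexx _) (ler_wpM2l (ltW e0) W)).
  by rewrite /P /Q le_eqVlt; apply/orP; left; apply/eqP; ring.
move: B hA; set A := a ^+ 2 in a2 *; set H := cint (fun t => h t ^+ 2) in h2 *.
set T := wform rho w w; set S := \sum_j _ => B hA AH.
have T0 : 0 < P * A + Q * H.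
  have [A0|A0] := eqVneq A 0.
    by rewrite A0 mulr0 add0r mulr_gt0//; move: AH; rewrite A0 add0r.
  have A1 : 0 < A by rewrite lt0r A0.
  by rewrite ltr_pwDl ?(mulr_gt0 P0)// mulr_ge0// ltW.
split; first exact: lt_le_trans B.
apply: le_trans hA _; rewrite mulrAC ler_pdivlMr//.
apply: (@le_trans _ _ (m * (P * A + Q * H))); last by rewrite ler_wpM2l// (le_trans ler01).
have : (m - 1) * P * H <= m * Q * H by rewrite ler_wpM2r.
move=> h3; rewrite (_ : _ * P = m * P * A + (m - 1) * P * H); last by ring.
by rewrite [m * (_ + _)]mulrDr !mulrA lerD2l.
Qed.

End Bound.
End Perturbation.

(** * First-order behaviour at the constant density *)

Section FirstOrder.
Variable R : realType.
Local Notation leb1 := (@lebesgue_measure R).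
Local Notation C := (@circle R).
Local Notation D := (@disk R).
Local Notation RT := (g_sigma_algebraType R.-ocitv.-measurable).
Local Notation bddmC := (@bddm _ RT R C).
Local Notation cint := (rint leb1 C).
Local Notation mC := (@measurable_circle R).
Local Notation muC := (@lebesgue_circle_fin R).
Arguments eq_cint [R] g {f} _.

Lemma Loo_measurable f : Loocircle f -> measurable_fun (C : set RT) f.
Proof.
rewrite /Loocircle inE => /andP[/[!inE]/= mf _].
exact/(measurable_restrictT _ mC).
Qed.

Lemma Loonorm_le f r : 0 <= r -> (forall t, C t -> `|f t| <= r) -> (Loonorm f <= r%:E)%E.
Proof.
move=> r0 hf; rewrite /Loonorm unlock.
case: ifP => _; last by rewrite lee_fin.
apply/ess_supP; apply: aeW => t; rewrite /= lee_fin patchE.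
by case: ifP => [/set_mem /hf //|_]; rewrite normr0.
Qed.

Lemma bddm_Loo f : bddmC f -> Loocircle f.
Proof.
move=> [mf [r hr]]; rewrite /Loocircle inE; apply/andP; split; rewrite inE/=.
  exact/(measurable_restrictT _ mC).
rewrite /finite_norm; apply: (@le_lt_trans _ _ (`|r|)%:E); last exact: ltry.
apply: Loonorm_le => // t Ct; exact: le_trans (hr t Ct) (ler_norm r).
Qed.

(** Admissible densities lie in [0, 1] almost everywhere only, while the bounds on the form ask for
    it at every point; clipping alters them on a null set. *)
Definition clip01 (x : R) : R := Num.max 0 (Num.min 1 x).

Lemma clip01_range x : 0 <= clip01 x <= 1.
Proof. by rewrite /clip01 le_max lexx /= ge_max ler01 ge_min lexx. Qed.

Lemma clip01_id x : 0 <= x <= 1 -> clip01 x = x.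
Proof. by move=> /andP[h0 h1]; rewrite /clip01 min_r// max_r. Qed.

Lemma admissible_clip alpha rho : admissible alpha rho ->
  [/\ bddmC (clip01 \o rho), forall t, 0 <= clip01 (rho t) <= 1,
   cint (clip01 \o rho) = alpha * (2 * pi) &
   {ae leb1, forall t, C t -> rho t = clip01 (rho t)}].
Proof.
move=> [hL hae hI]; have mr := Loo_measurable hL.
have mc : measurable_fun (C : set RT) (clip01 \o rho).
  by apply: measurable_maxr; [exact: measurable_cst|apply: measurable_minr => //; exact: measurable_cst].
have ae : {ae leb1, forall t, C t -> rho t = clip01 (rho t)}.
  case: hae => N [mN N0 sN]; exists N; split => // t ht; apply: sN => hE; apply: ht => Ct.
  by rewrite clip01_id// hE.
split => //; [|by move=> t; exact: clip01_range|].
  split => //; exists 1 => t _; have /andP[h0 h1] := clip01_range (rho t).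
  by rewrite /= ger0_norm.
rewrite -hI /rint /Rintegral; congr fine.
apply: (@ae_eq_integral _ RT R leb1 C (fun x => (rho x)%:E) (fun x => (clip01 (rho x))%:E) mC).
- exact/measurable_EFinP.
- exact/measurable_EFinP.
- case: ae => N [mN N0 sN]; exists N; split => // t ht; apply: sN => hE; apply: ht => Ct.
  by rewrite -hE.
Qed.

(** The direction is read off the clipped density at one value e0. It is bounded everywhere, and for
    e <= e0 the perturbed density is a convex combination of alpha and the clipped density. *)
Lemma perturb_normal alpha drho : 0 < alpha <= 1 -> admissible_perturbation alpha drho ->
  exists delta K e0, [/\ bddmC delta, forall t, C t -> `|delta t| <= K, cint delta = 0, 0 < e0 &
   forall e, 0 < e <= e0 -> (forall t, 0 <= perturb alpha delta e t <= 1) /\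
     forall k, eigset (perturb alpha drho e) k = eigset (perturb alpha delta e) k].
Proof.
move=> /andP[a0 a1] [hL hn].
have [e0 [e0p hadm]] : exists e0 : R, 0 < e0 /\ admissible alpha (perturb alpha drho e0).
  have h : \forall e \near 0^'+, 0 < e /\ admissible alpha (perturb alpha drho e).
    by apply: filterS2 (nbhs_right_gt (0 : R)) hn => e.
  by have [e he] := filter_ex h; exists e.
have [b r I ae] := admissible_clip hadm.
pose delta t := e0^-1 * (clip01 (perturb alpha drho e0 t) - alpha).
have e0n : e0 != 0 by rewrite gt_eqF.
have bd : bddmC delta.
  by apply: bddmZ; apply: bddm_add => //; exact: bddm_cst.
exists delta, e0^-1, e0; split => //.
- have eV : 0 <= e0^-1 by rewrite invr_ge0 ltW.
  move=> t _; rewrite /delta normrM (ger0_norm eV) ler_piMr//; have /andP[h0 h1] := r t.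
  by rewrite ler_norml; apply/andP; split; lra.
- have ib := intg_bdd mC muC b.
  have ic := intg_cst mC muC alpha.
  rewrite (rintZ mC); last exact: (intgB mC).
  by rewrite (rintB mC)// I rint_circle_cst subrr mulr0.
move=> e /andP[ep ele]; have he1 : 0 <= e / e0 <= 1.
  apply/andP; split; first by rewrite divr_ge0 ?(ltW ep) ?(ltW e0p).
  by rewrite ler_pdivrMr// mul1r.
split.
  move=> t; rewrite /perturb /delta mulrA; have /andP[h0 h1] := r t.
  set x := clip01 _ in h0 h1 *; set c := e / e0 in he1 *.
  have /andP[c0 c1] := he1.
  have E : alpha + c * (x - alpha) = (1 - c) * alpha + c * x by ring.
  rewrite E; apply/andP; split.
    by rewrite addr_ge0// mulr_ge0// ?subr_ge0// ltW.
  apply: (@le_trans _ _ ((1 - c) * 1 + c * 1)); last by rewrite !mulr1 subrK.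
  by apply: lerD; apply: ler_wpM2l; rewrite ?subr_ge0.
move=> k; apply: eigset_ae.
- have := Loo_measurable hL => m.
  by apply: measurable_funD; [exact: measurable_cst|apply: measurable_funM => //; exact: measurable_cst].
- by have [] := bddm_perturb bd alpha e.
- case: ae => N [mN N0 sN]; exists N; split => // t ht; apply: sN => hE; apply: ht => Ct.
  rewrite /perturb /delta -hE// /perturb addrAC subrr add0r mulKf//.
Qed.

(** By cos^2 + sin^2 = 1 the sum of the two entries is the integral of delta divided by pi. *)
Lemma basis_pair k delta : odd k -> bddmC delta -> cint delta = 0 ->
  wform delta (@basis R k) (@basis R k) + wform delta (@basis R k.+1) (@basis R k.+1) = 0.
Proof.
move=> ok bd d0; have sb := sq_basis R.
rewrite -(rintD mC); [|exact: intg_wform..].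
rewrite (eq_cint (fun t => pi^-1 * delta t)).
  by rewrite (rintZ mC) ?d0 ?mulr0//; exact: (intg_bdd mC muC).
move=> t _; rewrite /basis /= ok /= (_ : (k == 0%N) = false) ?freq_oddS//; last by case: k ok.
have s0 : Num.sqrt pi != 0 :> R by rewrite gt_eqF// sqrtr_gt0 pi_gt0.
have -> : pi^-1 = (Num.sqrt pi)^-1 * (Num.sqrt pi)^-1 :> R.
  by rewrite -invfM -expr2 sqr_sqrtr// pi_ge0.
have := cos2Dsin2 (freq R k * t).
set c := cos _; set s := sin _; set q := (Num.sqrt pi)^-1 => cs.
transitivity (q * q * delta t * (c ^+ 2 + s ^+ 2)); first by ring.
by rewrite cs; ring.
Qed.

Section Derivative.
Variables (alpha : R) (drho : R -> R) (d : R) (k : nat).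
Hypotheses (ha : 0 < alpha <= 1) (hadm : admissible_perturbation alpha drho).
Hypotheses (k0 : (0 < k)%N) (hd : gateaux k alpha drho d).

(** One diagonal entry is enough: the two entries on the pair {k - 1, k} add up to 0, so one of them
    is at most 0. For fixed eta, letting e tend to 0 bounds d below by - eta c, and eta is
    arbitrary. *)
Lemma gateaux_ge0 : ~~ odd k -> 0 <= d.
Proof.
move=> ek; have /andP[a0 a1] := ha.
have [delta [K [e0 [bd hK dI e0p he]]]] := perturb_normal ha hadm.
have K0 : 0 <= K by apply: le_trans (hK 0 _) => //; rewrite /circle /= in_itv /= lexx two_pi_gt0.
have [i hi hDi] : exists2 i, (i == k) || (i == k.-1) & wform delta (@basis R i) (@basis R i) <= 0.
  have ok1 : odd k.-1 by move: ek; rewrite -{1}(prednK k0) /= negbK.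
  have := basis_pair ok1 bd dI; rewrite prednK// => h.
  have [h1|h1] := lerP (wform delta (@basis R k) (@basis R k)) 0; first by exists k; rewrite ?eqxx.
  by exists k.-1; rewrite ?eqxx ?orbT//; lra.
pose m := freq R k; have m1 : 1 <= m by exact: freq_ge1.
have m0 : 0 < m by exact: lt_le_trans m1.
have key eta : 0 < eta -> - (eta * (m * K ^+ 2 / alpha ^+ 2)) <= d.
  move=> eta0; apply: (cvgr_to_ge hd).
  have eK0 : 0 <= eta * K ^+ 2 by rewrite mulr_ge0 ?sqr_ge0 ?ltW.
  have q0 : 0 < m * (eta^-1 + K) by rewrite mulr_gt0// ltr_pwDl ?invr_gt0.
  have K10 : 0 < 2 * (K + 1) by rewrite mulr_gt0// ltr_wpDl.
  near=> e; have ep : 0 < e by near: e; exact: nbhs_right_gt.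
  have ee0 : e <= e0 by near: e; exact: nbhs_right_ltW.
  have eQ : e <= alpha / (m * (eta^-1 + K)) by near: e; apply: nbhs_right_ltW; rewrite divr_gt0.
  have eK : e <= alpha / (2 * (K + 1)) by near: e; apply: nbhs_right_ltW; rewrite divr_gt0.
  have [rng es] := he e (introT andP (conj ep ee0)).
  have eK' : e * K <= alpha / 2.
    move: eK; rewrite ler_pdivlMr// => eK; have : 0 <= e := ltW ep; lra.
  set rho := perturb alpha delta e in rng es.
  have low t : C t -> alpha / 2 <= rho t.
    move=> Ct; rewrite /rho /perturb; have := hK t Ct; rewrite ler_norml => /andP[h _].
    have : e * - K <= e * delta t by rewrite ler_wpM2l// ltW.
    lra.
  have brho : bddmC rho by exact: bddm_perturb.
  have a20 : 0 < alpha / 2 by rewrite divr_gt0.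
  have rp := wform_pos brho a20 low.
  have P0 : 0 < alpha + e * (0 + eta * K ^+ 2) by rewrite add0r ltr_pwDl// mulr_ge0// ltW.
  have hQ : m * (alpha + e * (eta^-1 + K)) <= (m + 1) * (alpha + e * (0 + eta * K ^+ 2)).
    move: eQ; rewrite ler_pdivlMr// => eQ; rewrite add0r.
    have : 0 <= (m + 1) * (e * (eta * K ^+ 2)).
      by apply: mulr_ge0; [exact: addr_ge0 (ltW m0) ler01|exact: mulr_ge0 (ltW ep) eK0].
    set X := eta^-1 + K in eQ *; set x := eta * K ^+ 2 => h; lra.
  have hev : m / (alpha + e * (0 + eta * K ^+ 2)) <= steklov_ev rho k.
    apply: steklov_ev_ge.
      exists (freq R k / (alpha / 2)); apply: eigset_freq => // t Ct.
      by rewrite low//=; have /andP[] := rng t.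
    move=> mu hmu; apply: (perturb_lower bd hK eta0 ep k0 ek hi _ rp hDi P0 hQ hmu) => t Ct.
    by have /andP[] := rng t.
  have -> : steklov_ev (perturb alpha drho e) k = steklov_ev rho k.
    by congr inf; exact: es.
  rewrite steklov_ev_cst// ler_pdivlMr//; apply: le_trans (lerB hev (lexx _)).
  rewrite -/m add0r; set x := eta * K ^+ 2 in eK0 *.
  have P1 : 0 < alpha + e * x by rewrite ltr_pwDl// mulr_ge0// ltW.
  have -> : m / (alpha + e * x) - m / alpha = - (e * (m * x / (alpha * (alpha + e * x)))).
    by field; rewrite !gt_eqF.
  rewrite mulNr lerN2 [leLHS]mulrC ler_pM2r//.
  have -> : eta * (m * K ^+ 2 / alpha ^+ 2) = m * x / alpha ^+ 2 by rewrite /x; ring.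
  rewrite ler_wpM2l ?(mulr_ge0 (ltW m0) eK0)//.
  by rewrite lef_pV2 ?posrE ?mulr_gt0 ?exprn_gt0// expr2 ler_pM2l// lerDl mulr_ge0// ltW.
rewrite leNgt; apply/negP => dn; set c := m * K ^+ 2 / alpha ^+ 2 in key.
have c0 : 0 <= c.
  apply: divr_ge0; last exact: sqr_ge0.
  by apply: mulr_ge0; [rewrite ?mulr_ge0// ltW|exact: sqr_ge0].
have c1 : 0 < 2 * (c + 1) by rewrite mulr_gt0// ltr_wpDl.
(* For this eta one has eta c < - d, against the bound. *)
have e0' : 0 < - d / (2 * (c + 1)) by rewrite divr_gt0// oppr_gt0.
have := key _ e0'; apply/negP; rewrite -ltNge ltrNr mulrAC ltr_pdivrMr//.
have : 0 < - d by rewrite oppr_gt0.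
by move: c0; move: (- d) => x h1 h2; nra.
Unshelve. all: by end_near.
Qed.

(** Dual argument on the pair {k, k + 1}, with an entry that is at least 0 and a test space in place
    of constraints. *)
Lemma gateaux_le0 : odd k -> d <= 0.
Proof.
move=> ok; have /andP[a0 a1] := ha.
have [delta [K [e0 [bd hK dI e0p he]]]] := perturb_normal ha hadm.
have K0 : 0 <= K by apply: le_trans (hK 0 _) => //; rewrite /circle /= in_itv /= lexx two_pi_gt0.
have [i hi hDi] : exists2 i, (i == k) || (i == k.+1) & 0 <= wform delta (@basis R i) (@basis R i).
  have h := basis_pair ok bd dI.
  have [h1|h1] := lerP 0 (wform delta (@basis R k) (@basis R k)); first by exists k; rewrite ?eqxx.
  by exists k.+1; rewrite ?eqxx ?orbT//; lra.
pose m := freq R k; have m1 : 1 <= m by exact: freq_ge1.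
have m0 : 0 < m by exact: lt_le_trans m1.
(* The factor 2 appears because the denominator alpha - e eta K^2 is only known to be at least alpha
   / 2. *)
have key eta : 0 < eta -> d <= eta * (2 * m * K ^+ 2 / alpha ^+ 2).
  move=> eta0; apply: (cvgr_to_le hd).
  have eK0 : 0 <= eta * K ^+ 2 by rewrite mulr_ge0 ?sqr_ge0 ?ltW.
  have q0 : 0 < 2 * m * (eta^-1 + K).
    by apply: mulr_gt0; [apply: mulr_gt0|rewrite ltr_pwDl ?invr_gt0].
  have K10 : 0 < 2 * (K + 1) by rewrite mulr_gt0// ltr_wpDl.
  have K11 : 0 < 2 * (eta * K ^+ 2 + 1) by rewrite mulr_gt0// ltr_wpDl.
  near=> e; have ep : 0 < e by near: e; exact: nbhs_right_gt.
  have ee0 : e <= e0 by near: e; exact: nbhs_right_ltW.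
  have eQ : e <= alpha / (2 * m * (eta^-1 + K)) by near: e; apply: nbhs_right_ltW; rewrite divr_gt0.
  have eK : e <= alpha / (2 * (K + 1)) by near: e; apply: nbhs_right_ltW; rewrite divr_gt0.
  have eP : e <= alpha / (2 * (eta * K ^+ 2 + 1)) by near: e; apply: nbhs_right_ltW; rewrite divr_gt0.
  have [rng es] := he e (introT andP (conj ep ee0)).
  have eK' : e * K <= alpha / 2.
    move: eK; rewrite ler_pdivlMr// => eK; have : 0 <= e := ltW ep; lra.
  have eP' : e * (eta * K ^+ 2) <= alpha / 2.
    move: eP; rewrite ler_pdivlMr//; set x := eta * K ^+ 2 => eP; have : 0 <= e := ltW ep; lra.
  have eQ' : m * (e * (eta^-1 + K)) <= alpha / 2.
    move: eQ; rewrite ler_pdivlMr//; set x := eta^-1 + K => eQ.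
    rewrite ler_pdivlMr//; apply: le_trans eQ; by rewrite le_eqVlt; apply/orP; left; apply/eqP; ring.
  have eQ2 : e * (eta^-1 + K) <= alpha / 2.
    apply: le_trans eQ'; rewrite ler_peMl// mulr_ge0 ?(ltW ep)// addr_ge0// invr_ge0 ltW//.
  set rho := perturb alpha delta e in rng es.
  have low t : C t -> alpha / 2 <= rho t.
    move=> Ct; rewrite /rho /perturb; have := hK t Ct; rewrite ler_norml => /andP[h _].
    have : e * - K <= e * delta t by rewrite ler_wpM2l// ltW.
    lra.
  have brho : bddmC rho by exact: bddm_perturb.
  have a20 : 0 < alpha / 2 by rewrite divr_gt0.
  have rp := wform_pos brho a20 low.
  have P0 : 0 < alpha + e * (0 - eta * K ^+ 2) by rewrite add0r mulrN; lra.
  have Q0 : 0 < alpha - e * (eta^-1 + K) by lra.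
  have r0 t : C t -> 0 <= rho t by move=> _; have /andP[] := rng t.
  have r1 t : C t -> rho t <= 1 by move=> _; have /andP[] := rng t.
  have hQ : (m - 1) * (alpha + e * (0 - eta * K ^+ 2)) <= m * (alpha - e * (eta^-1 + K)).
    apply: (@le_trans _ _ ((m - 1) * alpha)).
      by rewrite ler_wpM2l ?subr_ge0// add0r mulrN gerBl mulr_ge0// ltW.
    by rewrite mulrBl mul1r mulrBr; lra.
  have hev : steklov_ev rho k <= m / (alpha + e * (0 - eta * K ^+ 2)).
    apply: (steklov_ev_le brho r0 rp).
    exact: (perturb_upper bd hK eta0 ep k0 ok hi r0 r1 rp hDi P0 Q0 hQ).
  have -> : steklov_ev (perturb alpha drho e) k = steklov_ev rho k.
    by congr inf; exact: es.
  rewrite steklov_ev_cst// ler_pdivrMr//; apply: le_trans (lerB hev (lexx _)) _.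
  rewrite -/m add0r mulrN; set x := eta * K ^+ 2 in eK0 eP' *.
  have P1 : 0 < alpha - e * x by lra.
  have -> : m / (alpha - e * x) - m / alpha = e * (m * x / (alpha * (alpha - e * x))).
    by field; rewrite !gt_eqF.
  rewrite [leRHS]mulrC ler_pM2l//.
  have -> : eta * (2 * m * K ^+ 2 / alpha ^+ 2) = m * x * (alpha * (alpha / 2))^-1.
    by rewrite /x; field; rewrite gt_eqF.
  rewrite ler_wpM2l ?(mulr_ge0 (ltW m0) eK0)//.
  by rewrite lef_pV2 ?posrE ?mulr_gt0// ler_pM2l//; lra.
rewrite leNgt; apply/negP => dn; set c := 2 * m * K ^+ 2 / alpha ^+ 2 in key.
have c0 : 0 <= c.
  apply: divr_ge0; last exact: sqr_ge0.
  by apply: mulr_ge0; [rewrite ?mulr_ge0// ltW|exact: sqr_ge0].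
have c1 : 0 < 2 * (c + 1) by rewrite mulr_gt0// ltr_wpDl.
have e0' : 0 < d / (2 * (c + 1)) by rewrite divr_gt0.
have := key _ e0'; apply/negP; rewrite -ltNge mulrAC ltr_pdivrMr//.
by move: c0 dn; move: d => x h1 h2; nra.
Unshelve. all: by end_near.
Qed.

End Derivative.

Section Cosine.
Variables (alpha : R) (k : nat).
Hypotheses (ha : 0 < alpha < 1) (k0 : (0 < k)%N).

(** Twice the frequency of the mode k: the direction that separates its cosine from its sine at
    first order. *)
Definition cosdir (t : R) : R := cos (2 * freq R k * t).

Lemma bddm_cosdir : bddmC cosdir.
Proof. by apply: bddm_continuous; exact: continuous_cosM. Qed.

Lemma cosdir_le1 t : `|cosdir t| <= 1.
Proof. by rewrite ler_norml cos_geN1 cos_le1. Qed.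

Lemma cint_cosdir n : (0 < n)%N -> cint (fun t => cos (n%:R * (freq R k * t))) = 0.
Proof.
move=> n0; rewrite (eq_cint (fun t => cos ((n * uphalf k)%:Z%:~R * t))); last first.
  by move=> t _; rewrite mulrA /freq -natrM.
rewrite rint_cosZ; case: eqP => // -[] /eqP; rewrite muln_eq0.
by case: n n0 => // n _; case: k k0.
Qed.

Lemma wform_cosdir : wform cosdir (@basis R k) (@basis R k) = if odd k then 1 / 2 else - (1 / 2).
Proof.
have kn : (k == 0%N) = false by case: k k0.
have s0 : Num.sqrt pi != 0 :> R by rewrite gt_eqF// sqrtr_gt0 pi_gt0.
have pi0 : pi != 0 :> R by rewrite gt_eqF// pi_gt0.
have q2 : (Num.sqrt pi)^-1 * (Num.sqrt pi)^-1 = pi^-1 :> R.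
  by rewrite -invfM -expr2 sqr_sqrtr// pi_ge0.
pose sg : R := if odd k then 1 else -1.
rewrite /wform (eq_cint (fun t => pi^-1 / 2 * cos (2%:R * (freq R k * t)) +
   (sg * pi^-1 / 4 * cos (4%:R * (freq R k * t)) + sg * pi^-1 / 4))); last first.
  move=> t _; rewrite /cosdir /basis kn.
  set x := freq R k * t; set q := (Num.sqrt pi)^-1 in q2 *.
  have -> : 2 * freq R k * t = 2 * x by rewrite /x mulrA.
  have -> : 4 * x = 2 * (2 * x) by rewrite mulrA -natrM.
  have c2 y : cos (2 * y) = 2 * cos y ^+ 2 - 1 :> R.
    by rewrite mulr_natl mulr2n cosD -!expr2 sin2cos2; ring.
  have cx : cos x ^+ 2 = (1 + cos (2 * x)) / 2 by rewrite (c2 x); field.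
  have sx : sin x ^+ 2 = (1 - cos (2 * x)) / 2 by rewrite sin2cos2 (c2 x); field.
  rewrite (c2 (2 * x)) -q2 /sg; case: (odd k).
    transitivity (q * q * cos (2 * x) * cos x ^+ 2); first by ring.
    by rewrite cx; field.
  transitivity (q * q * cos (2 * x) * sin x ^+ 2); first by ring.
  by rewrite sx; field.
have ic n : intg leb1 C (fun t => cos (n%:R * (freq R k * t))).
  apply: (intg_bdd mC muC); apply: (bddm_continuous) => t.
  by under eq_fun do rewrite mulrA; exact: continuous_cosM.
rewrite (rintD mC); last 2 first.
- exact: (intgZ mC).
- by apply: (intgD mC); [exact: (intgZ mC)|exact: (intg_cst mC muC)].
rewrite (rintD mC); last 2 first.
- exact: (intgZ mC).
- exact: (intg_cst mC muC).
have E c n : (0 < n)%N -> cint (fun t => c * cos (n%:R * (freq R k * t))) = 0.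
  by move=> n0; rewrite (rintZ mC)// cint_cosdir// mulr0.
rewrite (E _ 2%N isT) (E _ 4%N isT) !add0r rint_circle_cst /sg.
have F (s p : R) : p != 0 -> s / p / 4 * (2 * p) = s / 2 by move=> p0; field.
by rewrite F//; case: (odd k); rewrite // mulN1r mul1r.
Qed.

Lemma admissible_cosdir e : 0 <= e -> e <= alpha -> e <= 1 - alpha ->
  admissible alpha (perturb alpha cosdir e).
Proof.
move=> e0 ea ea1; have b := bddm_perturb bddm_cosdir alpha e.
split; first exact: bddm_Loo.
  apply: aeW => t _; rewrite /perturb; have := cosdir_le1 t; rewrite ler_norml => /andP[h1 h2].
  have : e * -1 <= e * cosdir t by rewrite ler_wpM2l.
  have : e * cosdir t <= e * 1 by rewrite ler_wpM2l.
  by move=> h3 h4; apply/andP; split; lra.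
rewrite -/(rint _ _ _) (rintD mC); last 2 first.
- exact: (intg_cst mC muC).
- by apply: (intgZ mC); apply: (intg_bdd mC muC); exact: bddm_cosdir.
rewrite rint_circle_cst (rintZ mC); last by apply: (intg_bdd mC muC); exact: bddm_cosdir.
rewrite (_ : cint cosdir = 0) ?mulr0 ?addr0// -[RHS](@cint_cosdir 2)//.
by apply: eq_cint => t _; rewrite /cosdir mulrA.
Qed.

Lemma cosdir_neighbour r : 0 < r -> exists e, [/\ 0 < e, admissible alpha (perturb alpha cosdir e),
  (Loonorm (fun t => perturb alpha cosdir e t - cst alpha t)%R < r%:E)%E,
  e <= alpha / 2 /\ e <= (1 - alpha) / 2 & freq R k * (e * 5) <= alpha / 2].
Proof.
move=> r0; have /andP[a0 a1] := ha.
have m0 : 0 < freq R k by exact: lt_le_trans (freq_ge1 R k0).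
(* The bounds keep the perturbation in the given ball and the density in [alpha / 2, 1]; the last
   one gives freq k * 5 e <= alpha / 2, where 5 = 1 / eta + K for eta = 1 / 4 and K = 1. *)
pose e := Num.min (r / 2) (Num.min (alpha / 2) (Num.min ((1 - alpha) / 2) (alpha / (10 * freq R k)))).
have e0 : 0 < e.
  rewrite !lt_min !divr_gt0 ?subr_gt0//=; apply: mulr_gt0 => //.
have h1 : e <= r / 2 by rewrite ge_min lexx.
have h2 : e <= alpha / 2 by rewrite !ge_min lexx orbT.
have h3 : e <= (1 - alpha) / 2 by rewrite !ge_min lexx !orbT.
have h4 : e <= alpha / (10 * freq R k) by rewrite !ge_min lexx !orbT.
exists e; split => //.
- by apply: admissible_cosdir; lra.
- apply: (@le_lt_trans _ _ e%:E); last by rewrite lte_fin; lra.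
  apply: Loonorm_le; first exact: ltW.
  move=> t _; rewrite /perturb addrAC subrr add0r normrM (ger0_norm (ltW e0)).
  by rewrite ler_piMr ?(ltW e0)// cosdir_le1.
move: h4; rewrite ler_pdivlMr ?mulr_gt0//; set m := freq R k => h4.
by rewrite ler_pdivlMr//; apply: le_trans h4; rewrite le_eqVlt; apply/orP; left; apply/eqP; ring.
Qed.

Lemma perturb_cosdir_ge e : 0 < e -> e <= alpha / 2 -> forall t, alpha / 2 <= perturb alpha cosdir e t.
Proof.
move=> e0 he t; rewrite /perturb; have := cosdir_le1 t; rewrite ler_norml => /andP[h1 h2].
have : e * -1 <= e * cosdir t by rewrite ler_wpM2l// ltW.
by lra.
Qed.

Lemma perturb_cosdir_le e : 0 < e -> e <= (1 - alpha) / 2 -> forall t, perturb alpha cosdir e t <= 1.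
Proof.
move=> e0 he t; have /andP[a0 a1] := ha.
rewrite /perturb; have := cosdir_le1 t; rewrite ler_norml => /andP[h1 h2].
have : e * cosdir t <= e * 1 by rewrite ler_wpM2l// ltW.
by lra.
Qed.

(** For odd k the cosine has diagonal entry 1 / 2, of which the cross terms with eta = 1 / 4 cost
    half: the eigenvalue is at most m / (alpha + e / 4). *)
Lemma not_local_minimizer : odd k ->
  ~ local_minimizer (admissible alpha) (fun rho => steklov_ev rho k) (cst alpha).
Proof.
move=> ok [_ [r r0 hmin]]; have /andP[a0 a1] := ha.
have [e [e0 hadm hn [e1 e2] e3]] := cosdir_neighbour r0.
have := hmin _ hadm hn; apply/negP; rewrite -ltNge steklov_ev_cst ?a0 ?ltW//.
set rho := perturb alpha cosdir e; set m := freq R k in e3 *.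
have m1 : 1 <= m by exact: freq_ge1.
have m0 : 0 < m by exact: lt_le_trans m1.
have brho : bddmC rho by exact: bddm_perturb bddm_cosdir _ _.
have a20 : 0 < alpha / 2 by rewrite divr_gt0.
have low t : C t -> alpha / 2 <= rho t by move=> _; exact: perturb_cosdir_ge.
have r0' t : C t -> 0 <= rho t by move=> Ct; exact: le_trans (ltW a20) (low t Ct).
have r1 t : C t -> rho t <= 1 by move=> _; exact: perturb_cosdir_le.
have rp := wform_pos brho a20 low.
have D : 1 / 2 <= wform cosdir (@basis R k) (@basis R k) by rewrite wform_cosdir ok.
have eta0 : 0 < 1 / 4 :> R by rewrite divr_gt0.
have e5 : e * 5 <= alpha / 2 by apply: le_trans e3; rewrite ler_peMl// mulr_ge0// ltW.
have E4 : (1 / 4)^-1 + 1 = 5 :> R by field.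
have EP : alpha + e * (1 / 2 - 1 / 4 * 1 ^+ 2) = alpha + e / 4 by field.
have P0 : 0 < alpha + e * (1 / 2 - 1 / 4 * 1 ^+ 2) by rewrite EP addr_gt0// divr_gt0.
have Q0 : 0 < alpha - e * ((1 / 4)^-1 + 1) by rewrite E4; lra.
have hQ : (m - 1) * (alpha + e * (1 / 2 - 1 / 4 * 1 ^+ 2)) <= m * (alpha - e * ((1 / 4)^-1 + 1)).
  rewrite E4 EP mulrBr mulrBl mul1r mulrDr.
  have : m * (e / 4) <= m * (e * 5) by rewrite ler_wpM2l ?(ltW m0)//; lra.
  have : 0 <= e / 4 by rewrite divr_ge0// ltW.
  lra.
have h := perturb_upper bddm_cosdir (fun t _ => cosdir_le1 t) eta0 e0 k0 ok
  (introT orP (or_introl (eqxx k))) r0' r1 rp D P0 Q0 hQ.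
apply: le_lt_trans (steklov_ev_le brho r0' rp h) _; rewrite -/m EP.
rewrite ltr_pM2l// ltf_pV2 ?posrE//; last by rewrite addr_gt0// divr_gt0.
by rewrite ltrDl divr_gt0.
Qed.

(** For even k the sine has diagonal entry - 1 / 2, and with eta = 1 / 4 the eigenvalue is at least
    m / (alpha - e / 4). *)
Lemma not_local_maximizer : ~~ odd k ->
  ~ local_maximizer (admissible alpha) (fun rho => steklov_ev rho k) (cst alpha).
Proof.
move=> ek [_ [r r0 hmin]]; have /andP[a0 a1] := ha.
have [e [e0 hadm hn [e1 e2] e3]] := cosdir_neighbour r0.
have := hmin _ hadm hn; apply/negP; rewrite -ltNge steklov_ev_cst ?a0 ?ltW//.
set rho := perturb alpha cosdir e; set m := freq R k in e3 *.
have m1 : 1 <= m by exact: freq_ge1.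
have m0 : 0 < m by exact: lt_le_trans m1.
have brho : bddmC rho by exact: bddm_perturb bddm_cosdir _ _.
have a20 : 0 < alpha / 2 by rewrite divr_gt0.
have low t : C t -> alpha / 2 <= rho t by move=> _; exact: perturb_cosdir_ge.
have r0' t : C t -> 0 <= rho t by move=> Ct; exact: le_trans (ltW a20) (low t Ct).
have r1 t : C t -> rho t <= 1 by move=> _; exact: perturb_cosdir_le.
have rp := wform_pos brho a20 low.
have D : wform cosdir (@basis R k) (@basis R k) <= - (1 / 2) by rewrite wform_cosdir (negbTE ek).
have eta0 : 0 < 1 / 4 :> R by rewrite divr_gt0.
have e5 : e * 5 <= alpha / 2 by apply: le_trans e3; rewrite ler_peMl// mulr_ge0// ltW.
have E4 : (1 / 4)^-1 + 1 = 5 :> R by field.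
have EP : alpha + e * (- (1 / 2) + 1 / 4 * 1 ^+ 2) = alpha - e / 4 by field.
have P0' : 0 < alpha - e / 4 by lra.
have P0 : 0 < alpha + e * (- (1 / 2) + 1 / 4 * 1 ^+ 2) by rewrite EP.
have hQ : m * (alpha + e * ((1 / 4)^-1 + 1)) <= (m + 1) * (alpha + e * (- (1 / 2) + 1 / 4 * 1 ^+ 2)).
  rewrite E4 EP mulrDr mulrDl mul1r mulrBr.
  have : m * (e / 4) <= m * (e * 5) / 20 by rewrite le_eqVlt; apply/orP; left; apply/eqP; field.
  lra.
have h : m / (alpha - e / 4) <= steklov_ev rho k.
  apply: steklov_ev_ge.
    exists (freq R k / (alpha / 2)); apply: eigset_freq => // t Ct.
    by rewrite low// r1.
  move=> mu hmu; rewrite -EP.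
  exact: (perturb_lower bddm_cosdir (fun t _ => cosdir_le1 t) eta0 e0 k0 ek
    (introT orP (or_introl (eqxx k))) r0' rp D P0 hQ hmu).
apply: lt_le_trans h; rewrite -/m ltr_pM2l// ltf_pV2 ?posrE//.
by rewrite gtrBl divr_gt0.
Qed.

End Cosine.
End FirstOrder.

(** * Evenly spaced arcs *)

Section Gaps.
Variable R : realType.
Local Notation leb1 := (@lebesgue_measure R).
Local Notation C := (@circle R).
Local Notation RT := (g_sigma_algebraType R.-ocitv.-measurable).
Local Notation bddmC := (@bddm _ RT R C).
Local Notation cint := (rint leb1 C).
Local Notation mC := (@measurable_circle R).
Local Notation muC := (@lebesgue_circle_fin R).
Arguments eq_cint [R] g {f} _.

(** With e = 1 - alpha, the gap l lies between the arcs l and l + 1 and is centred at pi (2 l + 1) /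
    n. The arc of index n crosses the angle 0 but no gap does, so no reduction modulo 2 pi
    remains. *)
Definition gap_lo (n : nat) (e : R) (l : nat) : R := pi * (2 * l%:R + 1 - e) / n%:R.
Definition gap_hi (n : nat) (e : R) (l : nat) : R := pi * (2 * l%:R + 1 + e) / n%:R.
Definition gap (n : nat) (e : R) (l : nat) : set R := `]gap_lo n e l, gap_hi n e l[.
Definition gaps (n : nat) (e : R) : set R := [set t | exists2 l, (l < n)%N & gap n e l t].

Lemma cint_indic (A : set R) f : measurable (A : set RT) -> A `<=` C ->
  \int[leb1]_(t in A) f t = cint (fun t => \1_A t * f t).
Proof.
move=> mA AC; rewrite /rint /Rintegral; congr fine.
rewrite [LHS]integral_mkcond [RHS]integral_mkcond; apply: eq_integral => t _.
rewrite !patchE indicE; case: (boolP (t \in A)) => tA.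
  by rewrite mul1r (mem_set (AC _ (set_mem tA))).
by case: ifP => // _; rewrite mul0r.
Qed.

Section Fixed.
Variables (n : nat) (e : R).
Hypotheses (n0 : (0 < n)%N) (e0 : 0 <= e) (e1 : e < 1).

Let nR : 0 < n%:R :> R. Proof. by rewrite ltr0n. Qed.

Lemma gap_sub l : (l < n)%N -> gap n e l `<=` C.
Proof.
move=> ln t; rewrite /gap /circle /= !in_itv /= => /andP[h1 h2]; apply/andP; split.
  apply: le_trans (ltW h1); rewrite divr_ge0 ?ler0n// mulr_ge0 ?pi_ge0// subr_ge0.
  by rewrite (le_trans (ltW e1))// lerDr mulr_ge0 ?ler0n.
apply: lt_le_trans h2 _; rewrite ler_pdivrMr// [leRHS](_ : _ = pi * (2 * n%:R)) ?ler_pM2l ?pi_gt0//; last by ring.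
have : l.+1%:R <= n%:R :> R by rewrite ler_nat.
rewrite -natr1 => h; have := e1; lra.
Qed.

Lemma gaps_sub : gaps n e `<=` C.
Proof. by move=> t [l ln]; exact: gap_sub. Qed.

Lemma gap_order l l' : (l < l')%N -> gap_hi n e l <= gap_lo n e l'.
Proof.
move=> ll; rewrite ler_pM2r ?invr_gt0// ler_pM2l ?pi_gt0//.
have : l.+1%:R <= l'%:R :> R by rewrite ler_nat.
rewrite -natr1 => h; have := e1; lra.
Qed.

Lemma gap_uniq l l' t : gap n e l t -> gap n e l' t -> l = l'.
Proof.
rewrite /gap /= !in_itv /= => /andP[h1 h2] /andP[h3 h4].
case: (ltngtP l l') => // /gap_order h; exfalso.
  by have := lt_le_trans h2 (le_trans h (ltW h3)); rewrite ltxx.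
by have := lt_le_trans h4 (le_trans h (ltW h1)); rewrite ltxx.
Qed.

Lemma indic_gaps t : \1_(gaps n e) t = \sum_(l < n) \1_(gap n e l) t :> R.
Proof.
rewrite indicE; case: (boolP (t \in gaps n e)) => [/set_mem[l ln hl]|nt].
  rewrite (bigD1 (Ordinal ln))//= indicE (mem_set hl) big1 ?addr0// => j jl.
  rewrite indicE (_ : t \in _ = false)//; apply/negbTE; apply: contra jl => /set_mem hj.
  by apply/eqP/val_inj => /=; exact: gap_uniq hj hl.
rewrite big1// => l _; rewrite indicE (_ : t \in _ = false)//; apply/negbTE.
by apply: contra nt => /set_mem h; apply/mem_set; exists l.
Qed.

Lemma measurable_gaps : measurable (gaps n e : set RT).
Proof.
rewrite (_ : gaps n e = \bigcup_(l in [set l | (l < n)%N]) gap n e l); last first.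
  by apply/seteqP; split => t [l ln h]; exists l.
by apply: bigcup_measurable => l _; exact: measurable_itv.
Qed.

Lemma cint_gaps (F f : R -> R) : (forall x : R, is_derive x 1 F (f x)) -> continuous f ->
  cint (fun t => \1_(gaps n e) t * f t) = \sum_(l < n) (F (gap_hi n e l) - F (gap_lo n e l)).
Proof.
move=> dF cf.
rewrite (eq_cint (fun t => \sum_(l < n) (\1_(gap n e l) t * f t))); last first.
  by move=> t _; rewrite indic_gaps mulr_suml.
have bf := bddm_continuous cf.
have bi l : bddmC (\1_(gap n e l) : R -> R).
  split; first by apply: measurable_indic; exact: measurable_itv.
  exists 1 => t _; rewrite indicE; by case: (_ \in _); rewrite ?normr1 ?normr0.
rewrite (rint_sum mC muC); last by move=> l; apply: (intg_bdd mC muC); exact: bddm_mul.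
apply: eq_bigr => l _; rewrite -cint_indic; [|exact: measurable_itv|exact: gap_sub].
have lh : gap_lo n e l <= gap_hi n e l.
  rewrite ler_pM2r ?invr_gt0// ler_pM2l ?pi_gt0//; have := e0; lra.
rewrite -(rint_itv_FTC lh dF cf) /gap.
have i := continuous_intg_itv (gap_lo n e l) (gap_hi n e l) cf.
rewrite -Rintegral_itv_obnd_cbnd; last first.
  by apply: integrableS i => //; first [exact: subset_itv_oo_cc|exact: subset_itv_oc_cc].
rewrite -Rintegral_itv_bndo_bndc//.
by apply: integrableS i => //; first [exact: subset_itv_oo_cc|exact: subset_itv_co_cc].
Qed.

Lemma cint_gaps_cst (c : R) : cint (fun t => \1_(gaps n e) t * c) = c * (2 * pi * e).
Proof.
have dF (x : R) : is_derive x 1 (fun t => c * t) c.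
  by have := is_deriveZ c (is_derive_id x (1 : R)); rewrite /GRing.scale /= mulr1.
rewrite (cint_gaps dF); last by move=> x; exact: cvg_cst.
rewrite (eq_bigr (fun=> c * (2 * pi * e) / n%:R)).
  by rewrite sumr_const card_ord -[LHS]mulr_natr divfK// gt_eqF.
by move=> l _; rewrite /gap_hi /gap_lo; field; rewrite gt_eqF.
Qed.

Let theta (j l : nat) : R := j%:R * (pi * (2 * l%:R + 1) / n%:R).

Lemma cint_gaps_cos j : (0 < j)%N ->
  cint (fun t => \1_(gaps n e) t * cos (j%:R * t)) =
  2 / j%:R * sin (j%:R * pi * e / n%:R) * \sum_(l < n) cos (theta j l).
Proof.
move=> j0; have jR : j%:R != 0 :> R by rewrite pnatr_eq0 -lt0n.
have dF (x : R) : is_derive x 1 (fun t => j%:R^-1 * sin (j%:R * t)) (cos (j%:R * x)).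
  have := is_deriveZ (j%:R^-1) (is_derive_sinM j%:R x).
  by rewrite /GRing.scale /= mulrA mulVf// mul1r.
rewrite (cint_gaps dF); last exact: continuous_cosM.
rewrite mulr_sumr; apply: eq_bigr => l _.
have nN : n%:R != 0 :> R by rewrite gt_eqF.
have -> : j%:R * gap_hi n e l = theta j l + j%:R * pi * e / n%:R.
  by rewrite /gap_hi /theta; field.
have -> : j%:R * gap_lo n e l = theta j l - j%:R * pi * e / n%:R.
  by rewrite /gap_lo /theta; field.
by rewrite sinD sinB; field.
Qed.

Lemma cint_gaps_sin j : (0 < j)%N ->
  cint (fun t => \1_(gaps n e) t * sin (j%:R * t)) =
  2 / j%:R * sin (j%:R * pi * e / n%:R) * \sum_(l < n) sin (theta j l).
Proof.
move=> j0; have jR : j%:R != 0 :> R by rewrite pnatr_eq0 -lt0n.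
have dF (x : R) : is_derive x 1 (fun t => - j%:R^-1 * cos (j%:R * t)) (sin (j%:R * x)).
  have := is_deriveZ (- j%:R^-1) (is_derive_cosM j%:R x).
  by rewrite /GRing.scale /= mulrNN mulrA mulVf// mul1r.
rewrite (cint_gaps dF); last exact: continuous_sinM.
rewrite mulr_sumr; apply: eq_bigr => l _.
have nN : n%:R != 0 :> R by rewrite gt_eqF.
have -> : j%:R * gap_hi n e l = theta j l + j%:R * pi * e / n%:R.
  by rewrite /gap_hi /theta; field.
have -> : j%:R * gap_lo n e l = theta j l - j%:R * pi * e / n%:R.
  by rewrite /gap_lo /theta; field.
by rewrite cosD cosB; field.
Qed.

Lemma sin_frac_gt0 j : (0 < j < n)%N -> 0 < sin (j%:R * pi / n%:R : R).
Proof.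
move=> /andP[j0 jn]; apply: sin_gt0_pi; rewrite divr_gt0 ?mulr_gt0 ?pi_gt0 ?ltr0n//=.
by rewrite ltr_pdivrMr// mulrC ltr_pM2l ?pi_gt0// ltr_nat.
Qed.

(* Multiplied by 2 sin (j pi / n), the sums over the gap centres telescope. *)
Lemma sum_theta j : sin (j%:R * pi / n%:R : R) != 0 ->
  \sum_(l < n) cos (theta j l) = 0 /\ \sum_(l < n) sin (theta j l) = 0.
Proof.
pose s := j%:R * pi / n%:R : R; rewrite -/s => s0.
have nN : n%:R != 0 :> R by rewrite gt_eqF.
have s20 : 2 * sin s != 0 by rewrite mulf_neq0.
pose phi (l : nat) : R := j%:R * (pi * (2 * l%:R) / n%:R).
have phin : phi n = j%:R * (2 * pi) by rewrite /phi; field.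
have phi0 : phi 0%N = 0 by rewrite /phi mulr0 mulr0 mul0r mulr0.
have t1 l : phi l = theta j l - s by rewrite /phi /theta /s; field.
have t2 l : phi l.+1 = theta j l + s by rewrite /phi /theta /s -natr1; field.
split; apply: (mulfI s20); rewrite mulr0 mulr_sumr.
  rewrite (eq_bigr (fun l : 'I_n => sin (phi l.+1) - sin (phi l))); last first.
    by move=> l _; rewrite t2 t1 sinD sinB; ring.
  rewrite -(big_mkord xpredT (fun l => sin (phi l.+1) - sin (phi l))) telescope_sumr//.
  by rewrite phin phi0 sin0 subr0; have := sin_int2pi R j.
rewrite (eq_bigr (fun l : 'I_n => - (cos (phi l.+1) - cos (phi l)))); last first.
  by move=> l _; rewrite t2 t1 cosD cosB; ring.
rewrite sumrN -(big_mkord xpredT (fun l => cos (phi l.+1) - cos (phi l))) telescope_sumr//.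
by rewrite phin phi0 cos0; have := cos_int2pi R j; rewrite -pmulrn => ->; rewrite subrr oppr0.
Qed.

(** The resonant frequency: n times a gap centre is an odd multiple of pi. *)
Lemma sum_theta_n : \sum_(l < n) cos (theta n l) = - n%:R /\ \sum_(l < n) sin (theta n l) = 0.
Proof.
have nN : n%:R != 0 :> R by rewrite gt_eqF.
have t l : theta n l = l%:R * (2 * pi) + pi by rewrite /theta; field.
have c2 (l : nat) : cos (l%:R * (2 * pi)) = 1 :> R by exact: (cos_int2pi R l).
have s2 (l : nat) : sin (l%:R * (2 * pi)) = 0 :> R by exact: (sin_int2pi R l).
split.
  rewrite (eq_bigr (fun=> -1)); first by rewrite sumr_const card_ord mulNrn.
  by move=> l _; rewrite t cosDpi c2.
by apply: big1 => l _; rewrite t sinDpi s2 oppr0.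
Qed.

End Fixed.

(** In the unit 2 pi / n the arcs are centred at the integers and the gaps at the half-integers, so
    the integer part of the angle determines the gap. *)
Lemma arcs_gaps n alpha : (0 < n)%N -> 0 < alpha <= 1 -> C `\` arcs n alpha = gaps n (1 - alpha).
Proof.
move=> n0 /andP[a0 a1]; have nR : 0 < n%:R :> R by rewrite ltr0n.
have F2 (p N s : R) : 0 < p -> 0 < N -> s = p * (2 * (s / (2 * p / N))) / N.
  by move=> h1 h2; field; rewrite (gt_eqF h1) (gt_eqF h2).
have F1 (p N s : R) : 0 < p -> 0 < N -> s = p * (s / (p / N)) / N.
  by move=> h1 h2; field; rewrite (gt_eqF h1) (gt_eqF h2).
have pi0 := @pi_gt0 R.
have pn0 : 0 < pi / n%:R :> R by rewrite divr_gt0.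
apply/seteqP; split => t.
  move=> [Ct nt]; have := Ct; rewrite /circle /= in_itv /= => /andP[t0 t2].
  pose x := t / (2 * pi / n%:R); have p2 : 0 < 2 * pi / n%:R :> R by rewrite divr_gt0 ?two_pi_gt0.
  have x0 : 0 <= x := divr_ge0 t0 (ltW p2).
  have xn : x < n%:R by rewrite ltr_pdivrMr// mulrC divfK// gt_eqF.
  pose l := Num.truncn x; have [lx xl] : l%:R <= x /\ x < l.+1%:R.
    by have /andP[] := truncn_itv x0.
  have ln : (l < n)%N by rewrite -(ltr_nat R) (le_lt_trans lx).
  have tE : t = pi * (2 * x) / n%:R by exact: F2.
  (* The arc centred at 0 is the arc of index n moved by a full turn, whence the witnesses n and 1
     for p = 0. *)
  have inar (p : nat) : (p <= n)%N -> pi * (2 * p%:R - alpha) / n%:R <= t <= pi * (2 * p%:R + alpha) / n%:R ->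
      arcs n alpha t.
    move=> pn h; split => //; case: p pn h => [|p] pn h; last first.
      by exists p.+1, 0; rewrite pn mulr0 addr0.
    exists n, 1; rewrite n0 leqnn mulr1; split => //.
    have E (s : R) : pi * (2 * n%:R + s) / n%:R = pi * (2 * 0%:R + s) / n%:R + 2 * pi.
      by field; rewrite gt_eqF.
    by rewrite (E alpha) (E (- alpha)) !lerD2r.
  exists l => //; rewrite /gap /= in_itv /=; apply/andP; split; rewrite ltNge; apply/negP => h.
    apply: nt; apply: (inar l (ltnW ln)); rewrite tE !ler_pM2r ?invr_gt0// !ler_pM2l//.
    move: h; rewrite tE /gap_lo ler_pM2r ?invr_gt0// ler_pM2l//; lra.
  apply: nt; apply: (inar l.+1 ln); rewrite tE !ler_pM2r ?invr_gt0// !ler_pM2l//.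
  move: h xl; rewrite tE /gap_hi ler_pM2r ?invr_gt0// ler_pM2l// -natr1; lra.
move=> ht; have e0 : 0 <= 1 - alpha by rewrite subr_ge0.
have e1 : 1 - alpha < 1 by lra.
split; first exact: (gaps_sub n0 e1 ht).
move: ht => [l ln]; rewrite /gap /= in_itv /= => /andP[h1 h2] [_ [p [z [_ /andP[h3 h4]]]]].
pose x := t / (pi / n%:R); have tE : t = pi * x / n%:R by exact: F1.
have zE : 2 * pi * z%:~R = pi * (2 * (n%:R * z%:~R)) / n%:R :> R by field; rewrite gt_eqF.
move: h1 h2 h3 h4; rewrite zE tE /gap_lo /gap_hi -mulrDl -mulrDr.
rewrite !ltr_pM2r ?invr_gt0// !ltr_pM2l// !ler_pM2r ?invr_gt0// !ler_pM2l// => h1 h2 h3 h4.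
(* A point both in a gap and in an arc would place the integer p - n z strictly between l and l +
   1. *)
have lt1 : (l%:Z < p%:Z - n%:Z * z)%R.
  by rewrite -(ltr_int R) rmorphB rmorphM /=; lra.
have lt2 : (p%:Z - n%:Z * z < l%:Z + 1)%R.
  by rewrite -(ltr_int R) rmorphB rmorphM rmorphD /=; lra.
by move: lt1 lt2; lia.
Qed.

End Gaps.

(** * Homogenization of evenly spaced arcs *)

Section Homogenization.
Variable R : realType.
Local Notation leb1 := (@lebesgue_measure R).
Local Notation C := (@circle R).
Local Notation RT := (g_sigma_algebraType R.-ocitv.-measurable).
Local Notation bddmC := (@bddm _ RT R C).
Local Notation sqC := (@sqint _ RT R leb1 C).
Local Notation cint := (rint leb1 C).
Local Notation mC := (@measurable_circle R).
Local Notation muC := (@lebesgue_circle_fin R).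
Arguments eq_cint [R] g {f} _.

Section Average.
Variables (n : nat) (e : R).
Hypotheses (n0 : (0 < n)%N) (e0 : 0 <= e) (e1 : e < 1).

Lemma bddm_gaps : bddmC (\1_(gaps n e) : R -> R).
Proof.
split; first by apply: measurable_indic; exact: measurable_gaps.
by exists 1 => t _; rewrite indicE; case: (_ \in _); rewrite ?normr1 ?normr0.
Qed.

(** Deviation of the integral over the gaps from the average, e being the proportion of the circle
    that they occupy. *)
Definition gap_defect f := cint (fun t => \1_(gaps n e) t * f t) - e * cint f.

Lemma gap_defect_lin (a b : R) (f g : R -> R) : continuous f -> continuous g ->
  gap_defect (fun t => a * f t + b * g t) = a * gap_defect f + b * gap_defect g.
Proof.
move=> cf cg; have bf := bddm_continuous cf; have bg := bddm_continuous cg.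
have jf := intg_bdd mC muC bf; have jg := intg_bdd mC muC bg.
have kf := intg_bdd mC muC (bddm_mul bddm_gaps bf); have kg := intg_bdd mC muC (bddm_mul bddm_gaps bg).
rewrite /gap_defect (rintD mC); [|exact: (intgZ mC)|exact: (intgZ mC)].
rewrite !(rintZ mC)//.
rewrite (eq_cint (fun t => a * (\1_(gaps n e) t * f t) + b * (\1_(gaps n e) t * g t))); last first.
  by move=> t _; ring.
rewrite (rintD mC); [|exact: (intgZ mC)|exact: (intgZ mC)].
rewrite !(rintZ mC)//; ring.
Qed.

Lemma gap_defect_nat j : (j < n)%N ->
  gap_defect (fun t => cos (j%:R * t)) = 0 /\ gap_defect (fun t => sin (j%:R * t)) = 0.
Proof.
move=> jn; rewrite /gap_defect; case: (posnP j) => [->|j0].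
  split.
    rewrite (eq_cint (fun t => \1_(gaps n e) t * 1)); last by move=> t _; rewrite mul0r cos0.
    rewrite cint_gaps_cst// (eq_cint (fun=> 1)); last by move=> t _; rewrite mul0r cos0.
    by rewrite rint_circle_cst !mul1r mulrC subrr.
  rewrite (eq_cint (fun t => \1_(gaps n e) t * 0)); last by move=> t _; rewrite mul0r sin0.
  rewrite cint_gaps_cst// (eq_cint (fun=> 0)); last by move=> t _; rewrite mul0r sin0.
  by rewrite rint_circle_cst !mul0r mulr0 subrr.
have s0 : sin (j%:R * pi / n%:R : R) != 0 by rewrite gt_eqF// sin_frac_gt0// j0.
have [h1 h2] := sum_theta n0 s0; rewrite cint_gaps_cos// cint_gaps_sin// h1 h2 !mulr0 !sub0r.
have := rint_cosZ R j; have := rint_sinZ R j; rewrite -pmulrn => -> ->.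
by rewrite eqz_nat (gtn_eqF j0) mulr0 oppr0.
Qed.

Lemma gap_defect_int (z : int) : (`|z| < n)%N ->
  gap_defect (fun t => cos (z%:~R * t)) = 0 /\ gap_defect (fun t => sin (z%:~R * t)) = 0.
Proof.
case: z => j; first exact: gap_defect_nat.
move=> hj; have [h1 h2] := @gap_defect_nat j.+1 hj; split.
  by rewrite -[RHS]h1; congr gap_defect; apply/funext => t; rewrite NegzE rmorphN mulNr cosN.
transitivity (gap_defect (fun t => (-1) * sin (j.+1%:R * t) + 0 * sin (j.+1%:R * t))).
  congr gap_defect; apply/funext => t.
  by rewrite mulN1r mul0r addr0 NegzE rmorphN mulNr sinN.
by rewrite gap_defect_lin ?h2 ?mulr0 ?addr0//; exact: continuous_sinM.
Qed.

Lemma basis_trigf i t : @basis R i t = hc R i * trigf (odd i || (i == 0%N), uphalf i) t.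
Proof.
rewrite /basis /hc /trigf /freq; case: (eqVneq i 0%N) => [->|i0] /=; last by rewrite orbF.
by rewrite mul0r cos0 mulr1.
Qed.

(** The product splits into the frequencies p - q and p + q, both of modulus less than n. *)
Lemma gap_defect_basis i j : (uphalf i + uphalf j < n)%N ->
  gap_defect (fun t => @basis R i t * @basis R j t) = 0.
Proof.
move=> ij; set p := uphalf i in ij *; set q := uphalf j in ij *.
have [d1 d2] : gap_defect (fun t => cos ((p%:Z - q%:Z)%:~R * t)) = 0 /\
    gap_defect (fun t => sin ((p%:Z - q%:Z)%:~R * t)) = 0 by apply: gap_defect_int; lia.
have [s1 s2] : gap_defect (fun t => cos ((p%:Z + q%:Z)%:~R * t)) = 0 /\
    gap_defect (fun t => sin ((p%:Z + q%:Z)%:~R * t)) = 0 by apply: gap_defect_int; lia.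
pose c := hc R i * hc R j / 2.
have fin (u v : R -> R) (s : R) : continuous u -> continuous v -> gap_defect u = 0 ->
    gap_defect v = 0 -> (forall t, @basis R i t * @basis R j t = c * u t + c * s * v t) ->
    gap_defect (fun t => @basis R i t * @basis R j t) = 0.
  move=> cu cv u0 v0 E; rewrite (_ : (fun t => _) = (fun t => c * u t + c * s * v t)).
    by rewrite gap_defect_lin// u0 v0 !mulr0 addr0.
  by apply/funext => t; exact: E.
have cc (z : int) : continuous (fun t : R => cos (z%:~R * t)) by exact: continuous_cosM.
have cs (z : int) : continuous (fun t : R => sin (z%:~R * t)) by exact: continuous_sinM.
case oi: (odd i || (i == 0%N)); case oj: (odd j || (j == 0%N)).
- apply: (fin _ _ 1 (cc _) (cc _) d1 s1) => t; rewrite !basis_trigf oi oj /trigf /=.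
  by rewrite rmorphB rmorphD mulrBl mulrDl cosB cosD /c; field.
- apply: (fin _ _ (-1) (cs _) (cs _) s2 d2) => t; rewrite !basis_trigf oi oj /trigf /=.
  by rewrite rmorphB rmorphD mulrBl mulrDl sinB sinD /c; field.
- apply: (fin _ _ 1 (cs _) (cs _) s2 d2) => t; rewrite !basis_trigf oi oj /trigf /=.
  by rewrite rmorphB rmorphD mulrBl mulrDl sinB sinD /c; field.
- apply: (fin _ _ (-1) (cc _) (cc _) d1 s1) => t; rewrite !basis_trigf oi oj /trigf /=.
  by rewrite rmorphB rmorphD mulrBl mulrDl cosB cosD /c; field.
Qed.

End Average.

Section Arcs.
Variables (n : nat) (alpha : R).
Hypotheses (n0 : (0 < n)%N) (ha : 0 < alpha <= 1).
Let rho : R -> R := \1_(arcs n alpha).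

Lemma indic_arcs t : C t -> rho t = 1 - \1_(gaps n (1 - alpha)) t.
Proof.
move=> Ct; rewrite /rho -arcs_gaps// !indicE.
case: (boolP (t \in arcs n alpha)) => [/set_mem h|h].
  by rewrite (_ : t \in _ = false) ?subr0//; apply/negbTE/negP => /set_mem[].
rewrite (_ : t \in _ = true) ?subrr//; apply/mem_set; split => //.
by move=> h'; move: h; rewrite (mem_set h').
Qed.

Lemma arcs_range t : C t -> 0 <= rho t <= 1.
Proof. by move=> Ct; rewrite /rho indicE; case: (_ \in _); rewrite ?ler01 lexx. Qed.

Let e0 : 0 <= 1 - alpha. Proof. by have /andP[_] := ha; rewrite subr_ge0. Qed.
Let e1 : 1 - alpha < 1. Proof. by have /andP[h _] := ha; rewrite gtrBl. Qed.

Lemma bddm_arcs : bddmC rho.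
Proof.
split; last by exists 1 => t Ct; have /andP[h0 h1] := arcs_range Ct; rewrite ger0_norm.
apply: (@eq_measurable_fun _ _ RT R C (fun t => 1 - \1_(gaps n (1 - alpha)) t)).
  by move=> t /set_mem Ct; rewrite indic_arcs.
apply: measurable_funB; first exact: measurable_cst.
by have [] := bddm_gaps n (1 - alpha).
Qed.

Lemma wform_arcs_basis i j : (uphalf i + uphalf j < n)%N ->
  wform rho (@basis R i) (@basis R j) = alpha * (i == j)%:R.
Proof.
move=> ij; have := gap_defect_basis n0 e0 e1 ij; rewrite /gap_defect rint_basis => /eqP.
rewrite subr_eq0 => /eqP E.
have ib := sq_mul mC (sq_basis R i) (sq_basis R j).
have bb := bddm_mul (bddm_basis R i) (bddm_basis R j).
rewrite /wform (eq_cint (fun t => @basis R i t * @basis R j t -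
   \1_(gaps n (1 - alpha)) t * (@basis R i t * @basis R j t))); last first.
  by move=> t Ct; rewrite indic_arcs//; ring.
rewrite (rintB mC)//; last first.
  by apply: (intg_bdd mC muC); apply: bddm_mul => //; exact: bddm_gaps.
by rewrite E rint_basis; ring.
Qed.

Lemma wform_arcs_sum k (c : 'I_k -> R) : (forall i : 'I_k, 2 * uphalf i < n)%N ->
  wform rho (fun t => \sum_(i < k) c i * @basis R i t) (fun t => \sum_(i < k) c i * @basis R i t) =
  alpha * \sum_i c i ^+ 2.
Proof.
move=> hk; have sb i := sq_basis R i; have br := bddm_arcs.
have sw : sqC (fun t => \sum_(i < k) c i * @basis R i t).
  by apply: (sq_sum mC muC) => i; exact: (sqZ mC).
rewrite wform_suml// mulr_sumr; apply: eq_bigr => i _.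
have h (j : 'I_k) : (uphalf i + uphalf j < n)%N.
  by move: (hk i) (hk j); lia.
rewrite wform_sumr// (bigD1 i)//= big1 ?addr0.
  rewrite wform_arcs_basis// eqxx mulr1; ring.
move=> j ji; rewrite wform_arcs_basis// (_ : (nat_of_ord i == j) = false) ?mulr0//.
by rewrite eq_sym; apply/negbTE.
Qed.

Lemma wform_arcs_pos : 0 < wform rho (cst 1) (cst 1).
Proof.
have /andP[a0 _] := ha.
have -> : wform rho (cst 1) (cst 1) = alpha * (2 * pi).
  rewrite /wform (eq_cint (fun t => 1 - \1_(gaps n (1 - alpha)) t * 1)); last first.
    by move=> t Ct; rewrite indic_arcs// !mulr1.
  have ig : intg leb1 C (fun t => \1_(gaps n (1 - alpha)) t * 1).
    by apply: (intg_bdd mC muC); apply: bddm_mul; [exact: bddm_gaps|exact: bddm_cst].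
  rewrite (rintB mC)//; last exact: (intg_cst mC muC).
  by rewrite rint_circle_cst cint_gaps_cst//; ring.
by rewrite mulr_gt0 ?two_pi_gt0.
Qed.

Lemma eigset_arcs k : (2 * uphalf k < n)%N -> eigset rho k (freq R k / alpha).
Proof.
move=> kn; have /andP[a0 _] := ha; have br := bddm_arcs.
have r0 t : C t -> 0 <= rho t by move=> /arcs_range/andP[].
have r1 t : C t -> rho t <= 1 by move=> /arcs_range/andP[].
apply: (@eigset_upper_basis R rho k _ (fun i => i)) => //.
- exact: wform_arcs_pos.
- exact: ord_inj.
move=> c cn0 w; rewrite wform_arcs_sum; last first.
  move=> i; apply: leq_ltn_trans kn; rewrite leq_mul2l /= uphalf_leq// -ltnS.
  exact: ltn_ord.
have c0 := sum_sqr_gt0 cn0; split; first by rewrite mulr_gt0.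
rewrite mulrA divfK ?gt_eqF// mulr_sumr; apply: ler_sum => i _.
by rewrite ler_wpM2r ?sqr_ge0// freq_le// -ltnS.
Qed.

Lemma eigset_arcs_ge0 k mu : eigset rho k mu -> 0 <= mu.
Proof.
move=> h; apply: (eigset_ge0 id bddm_arcs _ wform_arcs_pos h) => t Ct.
by have /andP[] := arcs_range Ct.
Qed.

(* The modes below N only see the average alpha; the remaining ones carry the energy N at least. *)
Lemma eigset_arcs_lower k N tau mu : 0 < tau -> (2 * uphalf N < n)%N -> (k <= N)%N -> (0 < k)%N ->
  freq R k / (alpha * tau) <= freq R N -> eigset rho k mu ->
  freq R k / (alpha * (1 + tau)) <= mu.
Proof.
move=> tau0 Nn kN k0 hN hmu; have /andP[a0 a1] := ha; have br := bddm_arcs.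
have r0 t : C t -> 0 <= rho t by move=> /arcs_range/andP[].
have r1 t : C t -> rho t <= 1 by move=> /arcs_range/andP[].
have mu0 := eigset_arcs_ge0 hmu.
have [g [sg g0 gk /(_ N)]] := eigset_lower_split id br r0 hmu.
set m := freq R k in hN *; have m0 : 0 < m by exact: lt_le_trans (freq_ge1 R k0).
pose p := psum (fcoef g) N; pose h t := g t - p t.
have sp : sqC p by exact: sq_psum.
have sh : sqC h by exact: (sqB mC).
set P := \sum_(j < N) fcoef g j ^+ 2; set H := _ - P.
have hH : cint (fun t => h t ^+ 2) = H.
  rewrite (rint_sqr_psumB (fcoef g) N sg) /H [X in _ + X]big1 ?addr0// => j _.
  by rewrite subrr expr0n.
have H0 : 0 <= H by rewrite -hH; apply: rint_ge0 => t _; exact: sqr_ge0.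
have P0 : 0 <= P by apply: sumr_ge0 => j _; exact: sqr_ge0.
have PH : 0 < P + H by rewrite /H addrC subrK.
have hp : wform rho p p = alpha * P.
  by apply: wform_arcs_sum => i; apply: leq_ltn_trans Nn; rewrite leq_mul2l /= uphalf_leq// ltnW.
have hh : wform rho h h <= H by rewrite -hH; exact: wform_le.
have mP : m * P <= \sum_(j < N) freq R j * fcoef g j ^+ 2.
  rewrite mulr_sumr; apply: ler_sum => j _.
  have [jk|kj] := ltnP j k; first by rewrite gk// expr0n !mulr0.
  by rewrite ler_wpM2r ?sqr_ge0// freq_le.
have tV : 0 < tau^-1 by rewrite invr_gt0.
(* From 0 <= tau B(p - h / tau, p - h / tau), that is, 2 B(p, h) <= tau B(p, p) + B(h, h) / tau. *)
have hW : wform rho g g <= (1 + tau) * (alpha * P) + (1 + tau^-1) * H.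
  have sq' : sqC (fun t => - tau^-1 * h t) by exact: (sqZ mC).
  have q0 := wform_ge0 r0 (fun t => p t + - tau^-1 * h t).
  have spq : sqC (fun t => p t + - tau^-1 * h t) by exact: (sq_add mC).
  rewrite wformDl// !wformDr// !wformZl// !wformZr// [wform rho h p]wformC in q0.
  rewrite (@eq_wform _ rho g g (fun t => p t + h t) (fun t => p t + h t)); last 2 first.
  - by move=> t _; rewrite /h addrC subrK.
  - by move=> t _; rewrite /h addrC subrK.
  have sph : sqC (fun t => p t + h t) by exact: (sq_add mC).
  rewrite (wformDl br sp sh sph) (wformDr br sp sh sp) (wformDr br sp sh sh).
  rewrite (wformC rho h p) -hp.
  have tt : tau * tau^-1 = 1 by rewrite divff// gt_eqF.
  have h0 := wform_ge0 r0 h.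
  have : 0 <= tau * (wform rho p p + - tau^-1 * wform rho p h +
      (- tau^-1 * wform rho p h + - tau^-1 * (- tau^-1 * wform rho h h))).
    by apply: mulr_ge0; [exact: ltW|exact: q0].
  have hh' : tau^-1 * wform rho h h <= tau^-1 * H by rewrite ler_pM2l.
  move: hh hh' h0; set A := wform rho p p; set B := wform rho p h; set E := wform rho h h.
  move=> hh hh' h0.
  have -> : tau * (A + - tau^-1 * B + (- tau^-1 * B + - tau^-1 * (- tau^-1 * E))) =
     tau * A - 2 * (tau * tau^-1) * B + (tau * tau^-1) * tau^-1 * E by ring.
  by rewrite tt; lra.
move=> hle; rewrite leNgt; apply/negP => lt.
have ta : 0 < alpha * (1 + tau) by rewrite mulr_gt0// addr_gt0.
have l1 : mu * (alpha * (1 + tau)) < m by rewrite -ltr_pdivlMr.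
(* (1 + 1 / tau) m / (alpha (1 + tau)) = m / (alpha tau), which [hN] bounds by freq N. *)
have l2 : mu * (1 + tau^-1) < freq R N.
  apply: lt_le_trans hN; rewrite ltr_pdivlMr ?mulr_gt0//.
  rewrite [ltLHS](_ : _ = mu * (alpha * (tau + tau * tau^-1))); last by ring.
  by rewrite divff ?gt_eqF// [tau + 1]addrC.
have : m * P + freq R N * H <= mu * (alpha * (1 + tau)) * P + mu * (1 + tau^-1) * H.
  apply: le_trans (le_trans _ hle) _; first by rewrite lerD2r.
  apply: le_trans (ler_wpM2l mu0 hW) _.
  by rewrite le_eqVlt; apply/orP; left; apply/eqP; ring.
have [PZ|PZ] := eqVneq P 0.
  have H1 : 0 < H by move: PH; rewrite PZ add0r.
  by rewrite PZ !mulr0 !add0r ler_pM2r// leNgt l2.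
have P1 : 0 < P by rewrite lt0r PZ.
have : mu * (alpha * (1 + tau)) * P < m * P by rewrite ltr_pM2r.
have : mu * (1 + tau^-1) * H <= freq R N * H by rewrite ler_wpM2r// ltW.
by move=> h3 h4 h5; have := lt_le_trans (ltr_leD h4 h3) h5; rewrite ltxx.
Qed.

End Arcs.

Lemma steklov_arcs_cvg alpha k : 0 < alpha <= 1 ->
  steklov_neumann_ev (arcs n alpha) k @[n --> \oo] --> steklov_ev (@cst R R alpha) k.
Proof.
move=> ha; have /andP[a0 a1] := ha; rewrite steklov_ev_cst//.
apply/cvgrPdist_le => eps eps0.
have up n : (0 < n)%N -> (2 * uphalf k < n)%N ->
    steklov_neumann_ev (arcs n alpha) k <= freq R k / alpha.
  move=> n0 kn; apply: (steklov_ev_le (bddm_arcs n0 ha) _ (wform_arcs_pos n0 ha)).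
    by move=> t Ct; have /andP[] := arcs_range n alpha Ct.
  exact: eigset_arcs.
(* Index 0 is settled directly, both sides being 0: the lower estimate below asks for a positive
   frequency. *)
case: (posnP k) => [k0|k0].
  exists 1%N => // n /= n0.
  have h1 : steklov_neumann_ev (arcs n alpha) k <= freq R k / alpha by apply: up => //; rewrite k0.
  have h2 : 0 <= steklov_neumann_ev (arcs n alpha) k.
    apply: steklov_ev_ge; first by exists (freq R k / alpha); apply: eigset_arcs => //; rewrite k0.
    by move=> mu; exact: eigset_arcs_ge0.
  move: h1 h2; rewrite k0 [freq R 0](_ : _ = 0)// mul0r sub0r normrN => h1 h2.
  by rewrite ger0_norm// (le_trans h1)// ltW.
set m := freq R k; have m0 : 0 < m by exact: lt_le_trans (freq_ge1 R k0).
have ma : 0 < m / alpha by rewrite divr_gt0.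
(* Then (m / alpha) / (1 + tau) >= (m / alpha) (1 - tau) = m / alpha - eps. *)
pose tau := eps / (m / alpha); have tau0 : 0 < tau by rewrite divr_gt0.
pose N := maxn k (Num.bound (m / (alpha * tau))).*2.
have hN : m / (alpha * tau) <= freq R N.
  apply: (@le_trans _ _ (Num.bound (m / (alpha * tau)))%:R).
    by apply/ltW/archi_boundP; rewrite divr_ge0 ?(ltW m0)// ltW// mulr_gt0.
  by rewrite /freq ler_nat -[leqLHS]uphalf_double uphalf_leq// leq_maxr.
have kN : (k <= N)%N by exact: leq_maxl.
exists (2 * uphalf N).+1 => // n /= hn.
have n0 : (0 < n)%N by exact: leq_ltn_trans hn.
have kn : (2 * uphalf k < n)%N.
  by apply: leq_ltn_trans hn; rewrite leq_mul2l /= uphalf_leq.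
have h1 := up n n0 kn; rewrite -/m in h1.
have h2 : m / (alpha * (1 + tau)) <= steklov_neumann_ev (arcs n alpha) k.
  apply: steklov_ev_ge; first by exists (m / alpha); exact: eigset_arcs.
  by move=> mu; exact: (eigset_arcs_lower n0 ha tau0 hn kN k0 hN).
have h3 : m / alpha - eps <= m / (alpha * (1 + tau)).
  have t1 : 0 < 1 + tau by rewrite addr_gt0.
  have -> : m / alpha - eps = m / alpha * (1 - tau).
    have E : m / alpha * tau = eps by rewrite /tau mulrC divfK// gt_eqF.
    by rewrite mulrBr mulr1 E.
  rewrite invfM mulrA ler_pM2l// -[leRHS]mul1r ler_pdivlMr//.
  have := sqr_ge0 tau; lra.
rewrite ler_norml; apply/andP; split; lra.
Qed.

End Homogenization.

(** * The linearized eigenvalues *)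

Section Linearized.
Variable R : realType.
Local Notation leb1 := (@lebesgue_measure R).
Local Notation C := (@circle R).
Local Notation RT := (g_sigma_algebraType R.-ocitv.-measurable).
Local Notation mC := (@measurable_circle R).

Lemma det2 (A : 'M[R]_2) : \det A = A 0 0 * A 1 1 - A 0 1 * A 1 0.
Proof.
rewrite (expand_det_row _ ord0) !big_ord_recl big_ord0 /cofactor !det_mx11 !mxE /=.
rewrite expr0 expr1 mul1r addr0 mulN1r mulrN.
by congr (A _ _ * A _ _ - A _ _ * A _ _); apply: val_inj.
Qed.

Section Spectrum.
Variables (k : nat) (S : set R) (e : R).
Hypotheses (k0 : (0 < k)%N) (e0 : 0 < e).
Hypothesis hS : subsets_of_length (2 * pi * e) S.
Let m : R := freq R k.

Let mS : measurable (S : set RT). Proof. by case: hS. Qed.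
Let SC : S `<=` C. Proof. by case: hS. Qed.
Let lS : leb1 S = (2 * pi * e)%:E. Proof. by case: hS. Qed.

Let m1 : 1 <= m. Proof. exact: freq_ge1. Qed.
Let m0 : 0 < m. Proof. exact: lt_le_trans m1. Qed.
Let pe0 : 0 < 2 * pi * e. Proof. by rewrite mulr_gt0 ?two_pi_gt0. Qed.
Let muS : (leb1 (S : set RT) < +oo)%E. Proof. by rewrite [X in (X < _)%E]lS ltry. Qed.

Let sint (f : R -> R) : R := rint leb1 S f.

Let intg_S (f : R -> R) : continuous f -> intg leb1 S f.
Proof.
move=> cf; apply: (intg_bdd mS muS); have [mf [K hK]] := bddm_continuous cf.
split; first exact: measurable_funS mC SC mf.
by exists K => t /SC /hK.
Qed.

(* The centred moments of order 2m of S: pert_mx m S = m [1 + x, y; y, 1 - x]. *)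
Definition moment_cos (T : set R) : R := (2 * pi * e)^-1 * rint leb1 T (fun t => cos (2 * m * t)).
Definition moment_sin (T : set R) : R := (2 * pi * e)^-1 * rint leb1 T (fun t => sin (2 * m * t)).
Definition moment (T : set R) : R := Num.sqrt (moment_cos T ^+ 2 + moment_sin T ^+ 2).

Let x := moment_cos S.
Let y := moment_sin S.

Let sint_cst c : sint (fun=> c) = c * (2 * pi * e).
Proof. by rewrite /sint /rint Rintegral_cst; [rewrite [X in fine X]lS|exact: mS]. Qed.

Lemma pert_mxE : pert_mx (uphalf k) S =
  \matrix_(i, j) (m * (if i == 0 then if j == 0 then 1 + x else y else if j == 0 then y else 1 - x)).
Proof.
have E : fine (leb1 S) / (2 * pi) = e.
  by rewrite lS /= mulrC mulKf// gt_eqF// two_pi_gt0.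
have cc a := @continuous_cosM R a; have cs a := @continuous_sinM R a.
have pi0 : pi != 0 :> R by rewrite gt_eqF// pi_gt0.
have e00 : e != 0 by rewrite gt_eqF.
have dbl t : 2 * m * t = m * t + m * t by ring.
have c2 t : cos (2 * m * t) = 2 * cos (m * t) ^+ 2 - 1.
  by rewrite dbl cosD -!expr2 sin2cos2; ring.
have F (f : R -> R) (a b : R) (u : R -> R) : continuous u ->
    (forall t, f t = a + b * u t) ->
    m / (pi * e) * \int[leb1]_(t in S) f t = m * (2 * a + 2 * b * ((2 * pi * e)^-1 * sint u)).
  move=> cu hf; rewrite -/(rint _ _ _) (@eq_rint _ _ R leb1 S _ (fun t => a + b * u t)); last first.
    by move=> t _; exact: hf.
  have iu := intg_S cu.
  rewrite (rintD mS); [|exact: (intg_cst mS muS)|exact: (intgZ mS)].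
  have alg (p q s : R) : p != 0 -> q != 0 ->
      m / (p * q) * (a * (2 * p * q) + b * s) = m * (2 * a + 2 * b * ((2 * p * q)^-1 * s)).
    by move=> h1 h2; field; rewrite h1 h2.
  by rewrite (rintZ mS)// -/(sint _) -/(sint _) sint_cst alg.
apply/matrixP => i j; rewrite !mxE E.
case: (eqVneq i 0) => [->|i0]; case: (eqVneq j 0) => [->|j0]; rewrite /trig ?eqxx ?(negbTE i0) ?(negbTE j0).
- rewrite (F _ (1 / 2) (1 / 2) (fun t => cos (2 * m * t)) (cc _)).
    by rewrite -/x /moment_cos; congr (_ * _); rewrite -/(moment_cos S) -/x; field.
  by move=> t; rewrite c2 -expr2 -/(freq R k) -/m; field.
- rewrite (F _ 0 (1 / 2) (fun t => sin (2 * m * t)) (cs _)).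
    by congr (_ * _); rewrite -/(moment_sin S) -/y; field.
  by move=> t; rewrite dbl sinD -/(freq R k) -/m; field.
- rewrite (F _ 0 (1 / 2) (fun t => sin (2 * m * t)) (cs _)).
    by congr (_ * _); rewrite -/(moment_sin S) -/y; field.
  by move=> t; rewrite dbl sinD -/(freq R k) -/m; field.
- rewrite (F _ (1 / 2) (- (1 / 2)) (fun t => cos (2 * m * t)) (cc _)).
    by congr (_ * _); rewrite -/(moment_cos S) -/x; field.
  by move=> t; rewrite c2 -expr2 sin2cos2 -/(freq R k) -/m; field.
Qed.

Let r := moment S.

Let r2 : r ^+ 2 = x ^+ 2 + y ^+ 2.
Proof. by rewrite /r sqr_sqrtr// addr_ge0 ?sqr_ge0. Qed.

Lemma moment_ge0 T : 0 <= moment T. Proof. exact: sqrtr_ge0. Qed.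

(** r^2 is the mean over S of x cos + y sin, whose values are at most r by Cauchy-Schwarz. *)
Lemma moment_le1 : r <= 1.
Proof.
have r0 : 0 <= r by exact: moment_ge0.
have [->|rn0] := eqVneq r 0; first exact: ler01.
have rp : 0 < r by rewrite lt0r rn0.
have cc a := @continuous_cosM R a; have cs a := @continuous_sinM R a.
have ic := intg_S (cc (2 * m)); have is' := intg_S (cs (2 * m)).
rewrite -(ler_pM2l rp) mulr1 -expr2 r2.
have -> : x ^+ 2 + y ^+ 2 = (2 * pi * e)^-1 * sint (fun t => x * cos (2 * m * t) + y * sin (2 * m * t)).
  rewrite /sint (rintD mS); [|exact: (intgZ mS)|exact: (intgZ mS)].
  by rewrite !(rintZ mS)// mulrDr (mulrCA _ x) (mulrCA _ y) -/(moment_cos S) -/(moment_sin S) -!expr2.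
rewrite ler_pdivrMl// [leRHS]mulrC -sint_cst.
apply: (rint_le mS); [|exact: (intg_cst mS muS)|].
  by apply: (intgD mS); exact: (intgZ mS).
move=> t _; set c := cos _; set s := sin _.
have cs1 : c ^+ 2 + s ^+ 2 = 1 by exact: cos2Dsin2.
have h : (x * c + y * s) ^+ 2 <= r ^+ 2.
  rewrite r2; have := sqr_ge0 (x * s - y * c).
  have -> : x ^+ 2 + y ^+ 2 = (x ^+ 2 + y ^+ 2) * (c ^+ 2 + s ^+ 2) by rewrite cs1 mulr1.
  lra.
apply: le_trans (ler_norm _) _; rewrite -(@ler_pXn2r _ 2)// ?nnegrE// -normrX ger0_norm ?sqr_ge0//.
Qed.

(** Characteristic polynomial of m [1 + x, y; y, 1 - x], with r^2 = x^2 + y^2. *)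
Lemma eigenvalue_pert a :
  eigenvalue (pert_mx (uphalf k) S) a = ((a - m) ^+ 2 == (m * r) ^+ 2).
Proof.
rewrite /eigenvalue /eigenspace kermx_eq0 row_free_unit unitmxE unitfE negbK det2.
rewrite pert_mxE !mxE /= exprMn r2 -subr_eq0 -[RHS]subr_eq0; congr (_ == 0).
by rewrite !mulr1n !mulr0n; ring.
Qed.

Lemma nu_moment : nu k S = if odd k then m * (1 - r) else m * (1 + r).
Proof.
have r0 : 0 <= m * r by rewrite mulr_ge0 ?(ltW m0)//; exact: moment_ge0.
have spE : [set a | eigenvalue (pert_mx (uphalf k) S) a] = [set m * (1 - r); m * (1 + r)].
  apply/seteqP; split => a /=.
    rewrite eigenvalue_pert eqf_sqr => /orP[] /eqP h; [right|left]; lra.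
  by rewrite eigenvalue_pert eqf_sqr => -[] ->; apply/orP; [right|left]; apply/eqP; ring.
rewrite /nu spE; case: (odd k).
  apply/eqP; rewrite eq_le; apply/andP; split.
    apply: ge_inf; last by left.
    by exists (m * (1 - r)) => _ [] -> //; rewrite mulrBr mulrDr; lra.
  apply: lb_le_inf; first by exists (m * (1 - r)); left.
  by move=> _ [] -> //; rewrite mulrBr mulrDr; lra.
apply/eqP; rewrite eq_le; apply/andP; split.
  apply: ge_sup; first by exists (m * (1 - r)); left.
  by move=> _ [] -> //; rewrite mulrBr mulrDr; lra.
apply: ub_le_sup; last by right.
by exists (m * (1 + r)) => _ [] -> //; rewrite mulrBr mulrDr; lra.
Qed.

End Spectrum.

Lemma gaps_length n (e : R) : (0 < n)%N -> 0 < e < 1 -> subsets_of_length (2 * pi * e) (gaps n e).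
Proof.
move=> n0 /andP[e0 e1]; have mg := measurable_gaps n e; have gC := gaps_sub n0 e1.
split => //.
have := cint_gaps_cst n0 (ltW e0) e1 1; rewrite mul1r -cint_indic// Rintegral_cst; last exact: mg.
rewrite mul1r => <-; rewrite fineK// ge0_fin_numE ?measure_ge0//.
by apply: le_lt_trans (@lebesgue_circle_fin R); apply: le_measure; rewrite ?inE//; exact: mC.
Qed.

Lemma moment_gaps n (e : R) k : (0 < n)%N -> 0 < e < 1 -> (0 < k)%N ->
  moment_cos k e (gaps n e) = (2 * pi * e)^-1 * (2 / (2 * uphalf k)%:R *
    sin ((2 * uphalf k)%:R * pi * e / n%:R) *
    \sum_(l < n) cos ((2 * uphalf k)%:R * (pi * (2 * l%:R + 1) / n%:R))) /\
  moment_sin k e (gaps n e) = (2 * pi * e)^-1 * (2 / (2 * uphalf k)%:R *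
    sin ((2 * uphalf k)%:R * pi * e / n%:R) *
    \sum_(l < n) sin ((2 * uphalf k)%:R * (pi * (2 * l%:R + 1) / n%:R))).
Proof.
move=> n0 /andP[e0 e1] k0; have mg := measurable_gaps n e; have gC := gaps_sub n0 e1.
have j0 : (0 < 2 * uphalf k)%N by case: k k0.
have E : 2 * freq R k = (2 * uphalf k)%:R by rewrite natrM.
rewrite /moment_cos /moment_sin -!/(\int[_]_(_ in _) _) /rint !cint_indic// E; split; congr (_ * _).
  exact: (cint_gaps_cos n0 (ltW e0) e1 j0).
exact: (cint_gaps_sin n0 (ltW e0) e1 j0).
Qed.

Lemma moment_gaps0 n (e : R) k : (0 < n)%N -> 0 < e < 1 -> (0 < k)%N ->
  sin ((2 * uphalf k)%:R * pi / n%:R : R) != 0 -> moment k e (gaps n e) = 0.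
Proof.
move=> n0 he k0 s0; have [h1 h2] := moment_gaps n0 he k0; have [t1 t2] := sum_theta n0 s0.
by rewrite /moment h1 h2 t1 t2 !mulr0 expr0n addr0 sqrtr0.
Qed.

Lemma moment_gaps_n n (e : R) k : (0 < n)%N -> 0 < e < 1 -> (0 < k)%N -> (2 * uphalf k = n)%N ->
  moment k e (gaps n e) = `|sin (pi * e) / (pi * e)|.
Proof.
move=> n0 he k0 nk; have [h1 h2] := moment_gaps n0 he k0; have [t1 t2] := sum_theta_n R n0.
have nR : n%:R != 0 :> R by rewrite pnatr_eq0 -lt0n.
have pi0 : pi != 0 :> R by rewrite gt_eqF// pi_gt0.
have e0 : e != 0 by case/andP: he => h _; rewrite gt_eqF.
rewrite /moment h1 h2 nk t1 t2 !mulr0 expr0n addr0 sqrtr_sqr.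
have -> : n%:R * pi * e / n%:R = pi * e :> R by rewrite -!mulrA mulrC -!mulrA mulVf ?mulr1.
rewrite -normrN; congr (`|_|).
have alg (p q N s : R) : p != 0 -> q != 0 -> N != 0 ->
    - ((2 * p * q)^-1 * (2 / N * s * - N)) = s / (p * q).
  by move=> p0 q0 N0; field; rewrite p0 q0 N0.
exact: alg.
Qed.

(** sin (pi e) / e is the difference quotient at 0 of a function with derivative pi there. *)
Lemma sinc_cvg : `|sin (pi * e) / (pi * e)| @[e --> 0^'+] --> (1 : R).
Proof.
have [d E] := is_derive_sinM pi (0 : R).
have p0 : pi != 0 :> R by rewrite gt_eqF// pi_gt0.
have c : h^-1 *: (sin (pi * (h *: (1 : R) + 0)) - sin (pi * 0)) @[h --> 0^'] --> (pi * cos (pi * 0) : R).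
  by rewrite -E; exact: d.
rewrite mulr0 cos0 mulr1 sin0 in c.
have c' : sin (pi * h) / h @[h --> 0^'+] --> (pi : R).
  apply: (@cvg_trans _ (h^-1 *: (sin (pi * (h *: (1 : R) + 0)) - 0) @[h --> 0^'+])).
    apply: near_eq_cvg; apply: nearW => h.
    by rewrite subr0 addr0 /GRing.scale /= mulr1 mulrC.
  exact: (cvg_dnbhs_at_right c).
have c2 : pi^-1 * (sin (pi * h) / h) @[h --> 0^'+] --> (pi^-1 * pi : R) by exact: cvgMl_tmp.
rewrite mulVf// in c2.
have -> : (1 : R) = `|1| by rewrite normr1.
apply: cvg_norm; apply: cvg_trans c2; apply: near_eq_cvg; near=> h.
by rewrite invfM mulrCA mulrA [sin _ * _]mulrC -mulrA.
Unshelve. all: by end_near.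
Qed.

Lemma circle_arcsD n (e : R) : (0 < n)%N -> 0 < e < 1 -> C `\` arcs n (1 - e) = gaps n e.
Proof.
move=> n0 /andP[e0 e1]; rewrite arcs_gaps//; first by rewrite opprB addrC subrK.
by rewrite subr_gt0 e1 gerBl ltW.
Qed.

Lemma near_unit : \forall e \near 0^'+, 0 < (e : R) < 1.
Proof.
near=> e; apply/andP; split; near: e; [exact: nbhs_right_gt|exact: nbhs_right_lt].
Unshelve. all: by end_near.
Qed.

Section Optimal.
Variables (k n : nat) (L : R).
Hypotheses (k0 : (0 < k)%N) (n0 : (0 < n)%N).

Lemma nu_gaps_cvg (F : R -> R) :
  (forall e, 0 < e < 1 -> nu k (gaps n e) = F e) -> F e @[e --> 0^'+] --> L ->
  nu k (C `\` arcs n (1 - e)) @[e --> 0^'+] --> L.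
Proof.
move=> hF cF; apply: cvg_trans cF; apply: near_eq_cvg.
by apply: filterS near_unit => e he; rewrite circle_arcsD// hF.
Qed.

(** The infimum is enclosed between the bound L, valid for every S, and the value F e on the
    gaps. *)
Lemma inf_nu_cvg (F : R -> R) :
  (forall e, 0 < e < 1 -> nu k (gaps n e) = F e) -> F e @[e --> 0^'+] --> L ->
  (forall e S, 0 < e -> subsets_of_length (2 * pi * e) S -> L <= nu k S) ->
  inf [set nu k S | S in subsets_of_length (2 * pi * e)] @[e --> 0^'+] --> L.
Proof.
move=> hF cF lb; apply: (squeeze_cvgr _ (cvg_cst L) cF).
apply: filterS near_unit => e he; have e0 : 0 < e by case/andP: he.
have hg : subsets_of_length (2 * pi * e) (gaps n e) by exact: gaps_length.
apply/andP; split.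
  apply: lb_le_inf; first by exists (nu k (gaps n e)), (gaps n e).
  by move=> _ [S hS <-]; exact: lb hS.
rewrite -hF//; apply: ge_inf; last by exists (gaps n e).
by exists L => _ [S hS <-]; exact: lb hS.
Qed.

Lemma sup_nu_cvg (F : R -> R) :
  (forall e, 0 < e < 1 -> nu k (gaps n e) = F e) -> F e @[e --> 0^'+] --> L ->
  (forall e S, 0 < e -> subsets_of_length (2 * pi * e) S -> nu k S <= L) ->
  sup [set nu k S | S in subsets_of_length (2 * pi * e)] @[e --> 0^'+] --> L.
Proof.
move=> hF cF ub; apply: (squeeze_cvgr _ cF (cvg_cst L)).
apply: filterS near_unit => e he; have e0 : 0 < e by case/andP: he.
have hg : subsets_of_length (2 * pi * e) (gaps n e) by exact: gaps_length.
apply/andP; split.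
  rewrite -hF//; apply: ub_le_sup; last by exists (gaps n e).
  by exists L => _ [S hS <-]; exact: ub hS.
apply: ge_sup; first by exists (nu k (gaps n e)), (gaps n e).
by move=> _ [S hS <-]; exact: ub hS.
Qed.

End Optimal.

(** For odd k the k + 1 = 2m gaps are resonant, so r tends to 1 and the limit is 0; for even k one
    has 2m = k < k + 1, so r = 0 and the limit is m. Both attain the bounds that 0 <= r <= 1 imposes
    on every S. *)
Lemma linearized_min k : (1 <= k)%N -> exists L : R,
  nu k (C `\` arcs k.+1 (1 - e)) @[e --> 0^'+] --> L /\
  inf [set nu k S | S in subsets_of_length (2 * pi * e)] @[e --> 0^'+] --> L.
Proof.
move=> k0; have m0 : 0 <= freq R k by exact: freq_ge0.
have nuE e S : 0 < e -> subsets_of_length (2 * pi * e) S -> nu k S =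
    if odd k then freq R k * (1 - moment k e S) else freq R k * (1 + moment k e S).
  by move=> e0 hS; exact: (nu_moment k0 e0 hS).
case ok: (odd k).
  pose F e := freq R k * (1 - `|sin (pi * e) / (pi * e)|).
  have hF e : 0 < e < 1 -> nu k (gaps k.+1 e) = F e.
    move=> he; have /andP[e0 _] := he; rewrite (nuE e _ e0 (gaps_length _ he))// ok moment_gaps_n//.
    by rewrite uphalf_half ok; have := odd_double_half k; rewrite ok; lia.
  have cF : F e @[e --> 0^'+] --> freq R k * (1 - 1).
    by apply: cvgMl_tmp; apply: cvgB; [exact: cvg_cst|exact: sinc_cvg].
  exists (freq R k * (1 - 1)); split; first exact: nu_gaps_cvg hF cF.
  apply: (inf_nu_cvg _ hF cF) => // e S e0 hS; rewrite (nuE e S e0 hS) ok.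
  by rewrite subrr mulr0 mulr_ge0// subr_ge0; exact: (moment_le1 k e0 hS).
pose F (_ : R) := freq R k * (1 + 0).
have kn : (2 * uphalf k = k)%N by rewrite uphalf_half ok; have := odd_double_half k; rewrite ok; lia.
have hF e : 0 < e < 1 -> nu k (gaps k.+1 e) = F e.
  move=> he; have /andP[e0 _] := he; rewrite (nuE e _ e0 (gaps_length _ he))// ok moment_gaps0//.
  by rewrite gt_eqF// sin_frac_gt0// kn k0 ltnSn.
have cF : F e @[e --> 0^'+] --> freq R k * (1 + 0) by exact: cvg_cst.
exists (freq R k * (1 + 0)); split; first exact: nu_gaps_cvg hF cF.
apply: (inf_nu_cvg _ hF cF) => // e S e0 hS; rewrite (nuE e S e0 hS) ok.
by rewrite ler_wpM2l// lerD2l moment_ge0.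
Qed.

(** For odd k > 1, (k + 1) pi / k = pi / k + pi is not a multiple of pi, so r = 0 and the limit is
    m; for even k the k = 2m gaps are resonant and the limit is 2m. Again these are the bounds
    imposed by 0 <= r <= 1. *)
Lemma linearized_max k : (1 < k)%N -> exists L : R,
  nu k (C `\` arcs k (1 - e)) @[e --> 0^'+] --> L /\
  sup [set nu k S | S in subsets_of_length (2 * pi * e)] @[e --> 0^'+] --> L.
Proof.
move=> k1; have k0 : (0 < k)%N by exact: ltnW.
have m0 : 0 <= freq R k by exact: freq_ge0.
have nuE e S : 0 < e -> subsets_of_length (2 * pi * e) S -> nu k S =
    if odd k then freq R k * (1 - moment k e S) else freq R k * (1 + moment k e S).
  by move=> e0 hS; exact: (nu_moment k0 e0 hS).
case ok: (odd k).
  pose F (_ : R) := freq R k * (1 - 0).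
  have kn : (2 * uphalf k = k + 1)%N by rewrite uphalf_half ok; have := odd_double_half k; rewrite ok; lia.
  have kR : k%:R != 0 :> R by rewrite pnatr_eq0 -lt0n.
  have hF e : 0 < e < 1 -> nu k (gaps k e) = F e.
    move=> he; have /andP[e0 _] := he; rewrite (nuE e _ e0 (gaps_length _ he))// ok moment_gaps0//.
    have -> : (2 * uphalf k)%:R * pi / k%:R = 1%:R * pi / k%:R + pi :> R.
      by rewrite kn natrD; field.
    by rewrite sinDpi oppr_eq0 gt_eqF// sin_frac_gt0.
  have cF : F e @[e --> 0^'+] --> freq R k * (1 - 0) by exact: cvg_cst.
  exists (freq R k * (1 - 0)); split; first exact: nu_gaps_cvg hF cF.
  apply: (sup_nu_cvg _ hF cF) => // e S e0 hS; rewrite (nuE e S e0 hS) ok.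
  by rewrite ler_wpM2l// lerD2l lerN2 moment_ge0.
pose F e := freq R k * (1 + `|sin (pi * e) / (pi * e)|).
have hF e : 0 < e < 1 -> nu k (gaps k e) = F e.
  move=> he; have /andP[e0 _] := he; rewrite (nuE e _ e0 (gaps_length _ he))// ok moment_gaps_n//.
  by rewrite uphalf_half ok; have := odd_double_half k; rewrite ok; lia.
have cF : F e @[e --> 0^'+] --> freq R k * (1 + 1).
  by apply: cvgMl_tmp; apply: cvgD; [exact: cvg_cst|exact: sinc_cvg].
exists (freq R k * (1 + 1)); split; first exact: nu_gaps_cvg hF cF.
apply: (sup_nu_cvg _ hF cF) => // e S e0 hS; rewrite (nuE e S e0 hS) ok.
by rewrite ler_wpM2l// lerD2l; exact: (moment_le1 k e0 hS).
Qed.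

End Linearized.

(** * Centering by Moebius maps *)

Section Moebius.
Variable R : realType.
Local Notation leb1 := (@lebesgue_measure R).
Local Notation C := (@circle R).
Local Notation cint := (rint leb1 C).
Local Notation mC := (@measurable_circle R).
Local Notation muC := (@lebesgue_circle_fin R).
Arguments eq_cint [R] g {f} _.
Implicit Types a b : R * R.

(** At z = exp (i t) this is |z - a|^2 = |1 - conj a z|^2. *)
Definition mob_den a (t : R) : R := 1 - 2 * (a.1 * cos t + a.2 * sin t) + sqnorm a.

(* The components of the Moebius map (z - a) / (1 - conj a z) at z = exp (i t). *)
Definition mob1 a (t : R) : R := - a.1 + (1 - sqnorm a) * (cos t - a.1) / mob_den a t.
Definition mob2 a (t : R) : R := - a.2 + (1 - sqnorm a) * (sin t - a.2) / mob_den a t.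

Lemma dot_sqr_le a t : (a.1 * cos t + a.2 * sin t) ^+ 2 <= sqnorm a.
Proof.
have cs := cos2Dsin2 t; rewrite /sqnorm; have := sqr_ge0 (a.1 * sin t - a.2 * cos t).
move: cs; set c := cos t; set s := sin t => cs.
have -> : a.1 ^+ 2 + a.2 ^+ 2 = (a.1 ^+ 2 + a.2 ^+ 2) * (c ^+ 2 + s ^+ 2) by rewrite cs mulr1.
lra.
Qed.

(** With p = a . z, q = |a|^2 and s = (1 + q) / 2, the inequality 2 s p <= s^2 + p^2 <= s^2 + q
    gives s D >= s^2 - q = (1 - q)^2 / 4, and s <= 1. This avoids the square root of q. *)
Lemma mob_den_ge a t : sqnorm a < 1 -> (1 - sqnorm a) ^+ 2 / 4 <= mob_den a t.
Proof.
move=> q1; have h := dot_sqr_le a t; rewrite /mob_den; have q0 := sqnorm_ge0 a.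
move: h q1 q0; set p := _ + _; set q := sqnorm a => h q1 q0.
pose s := (1 + q) / 2; have sE : 2 * s = 1 + q by rewrite /s; field.
have h2 : 2 * s * p <= s ^+ 2 + q by have := sqr_ge0 (s - p); lra.
have s0 : 0 < s by rewrite /s divr_gt0// ltr_pwDl.
rewrite -(ler_pM2l s0).
have s1 : s <= 1 by rewrite /s ler_pdivrMr//; lra.
have h3 : s * ((1 - q) ^+ 2 / 4) <= (1 - q) ^+ 2 / 4.
  by rewrite ler_piMl// divr_ge0// sqr_ge0.
apply: le_trans h3 _.
have qE : q = 2 * s - 1 by lra.
rewrite qE; rewrite qE in h2; have := h2; lra.
Qed.

Lemma mob_den_gt0 a t : sqnorm a < 1 -> 0 < mob_den a t.
Proof.
move=> q1; apply: lt_le_trans (mob_den_ge t q1).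
by rewrite divr_gt0// exprn_gt0// subr_gt0.
Qed.

Lemma mob_den_le4 a t : sqnorm a < 1 -> mob_den a t <= 4.
Proof.
move=> q1; have h := dot_sqr_le a t; rewrite /mob_den.
move: h q1; set p := _ + _; set q := sqnorm a => h q1.
have := sqr_ge0 (1 + p); lra.
Qed.

Lemma continuous_mob_den a : continuous (mob_den a).
Proof.
move=> t; apply: cvgD; last exact: cvg_cst.
apply: cvgB; first exact: cvg_cst.
apply: cvgMl_tmp; apply: cvgD; apply: cvgMl_tmp; [exact: continuous_cos|exact: continuous_sin].
Qed.

Section Fixed.
Variable a : R * R.
Hypothesis a1 : sqnorm a < 1.
Let q := sqnorm a.
Let D0 t : mob_den a t != 0. Proof. by rewrite gt_eqF// mob_den_gt0. Qed.
Let q0 : 0 <= q. Proof. exact: sqnorm_ge0. Qed.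
Let q1 : 0 < 1 - q. Proof. by rewrite subr_gt0. Qed.

Lemma continuous_den_inv : continuous (fun t => (mob_den a t)^-1).
Proof. by move=> t; apply: cvgV; [exact: D0|exact: continuous_mob_den]. Qed.

Lemma continuous_mob1 : continuous (mob1 a).
Proof.
move=> t; apply: cvgD; first exact: cvg_cst.
apply: cvgM; last exact: continuous_den_inv.
by apply: cvgMl_tmp; apply: cvgB; [exact: continuous_cos|exact: cvg_cst].
Qed.

Lemma continuous_mob2 : continuous (mob2 a).
Proof.
move=> t; apply: cvgD; first exact: cvg_cst.
apply: cvgM; last exact: continuous_den_inv.
by apply: cvgMl_tmp; apply: cvgB; [exact: continuous_sin|exact: cvg_cst].
Qed.

Lemma mob_norm t : mob1 a t ^+ 2 + mob2 a t ^+ 2 = 1.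
Proof.
have cs := cos2Dsin2 t; have d0 := D0 t.
have E : (mob1 a t ^+ 2 + mob2 a t ^+ 2) * mob_den a t ^+ 2 = mob_den a t ^+ 2.
  have m1 : mob1 a t * mob_den a t = - a.1 * mob_den a t + (1 - q) * (cos t - a.1).
    by rewrite /mob1 mulrDl divfK.
  have m2 : mob2 a t * mob_den a t = - a.2 * mob_den a t + (1 - q) * (sin t - a.2).
    by rewrite /mob2 mulrDl divfK.
  rewrite mulrDl -!exprMn m1 m2.
  have nz : (cos t - a.1) ^+ 2 + (sin t - a.2) ^+ 2 = mob_den a t.
    transitivity ((cos t ^+ 2 + sin t ^+ 2) - 2 * (a.1 * cos t + a.2 * sin t) + sqnorm a).
      by rewrite /sqnorm; ring.
    by rewrite cs.
  have pz : 2 * (a.1 * (cos t - a.1) + a.2 * (sin t - a.2)) = 1 - q - mob_den a t.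
    by rewrite /mob_den /q /sqnorm; ring.
  have qE : q = a.1 ^+ 2 + a.2 ^+ 2 by [].
  move: nz pz qE; set d := mob_den a t; set x := cos t - _; set y := sin t - _ => nz pz qE.
  have -> : (- a.1 * d + (1 - q) * x) ^+ 2 + (- a.2 * d + (1 - q) * y) ^+ 2 =
    (a.1 ^+ 2 + a.2 ^+ 2) * d ^+ 2 - d * (1 - q) * (2 * (a.1 * x + a.2 * y)) +
    (1 - q) ^+ 2 * (x ^+ 2 + y ^+ 2) by ring.
  rewrite nz pz -qE; ring.
by apply: (mulIf (_ : mob_den a t ^+ 2 != 0)); rewrite ?expf_neq0// mul1r.
Qed.

(** Read off (z - a) / (1 - conj a z) = - a + (1 - |a|^2) sum_M (conj a)^M z^(M + 1), the real part
    here and the imaginary part in [mob_coef2]. *)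
Definition mob_coef1 k : R :=
  if k == 0%N then - a.1 * Num.sqrt (2 * pi)
  else Num.sqrt pi * ((1 - q) *
    (if odd k then (zpow (uphalf k).-1 a).1 else (zpow (uphalf k).-1 a).2)).

Definition mob_coef2 k : R :=
  if k == 0%N then - a.2 * Num.sqrt (2 * pi)
  else Num.sqrt pi * ((1 - q) *
    (if odd k then - (zpow (uphalf k).-1 a).2 else (zpow (uphalf k).-1 a).1)).

(** [w1] and [w2] are the real and imaginary parts of (conj a)^M z^(M + 1); [p] and [o] are those of
    conj a z. *)
Let w1 M t := (zpow M a).1 * cos (M.+1%:R * t) + (zpow M a).2 * sin (M.+1%:R * t).
Let w2 M t := (zpow M a).1 * sin (M.+1%:R * t) - (zpow M a).2 * cos (M.+1%:R * t).
Let p t := a.1 * cos t + a.2 * sin t.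
Let o t := a.1 * sin t - a.2 * cos t.

Let wS M t : w1 M.+1 t = p t * w1 M t - o t * w2 M t /\ w2 M.+1 t = o t * w1 M t + p t * w2 M t.
Proof.
rewrite /w1 /w2 /p /o /= -!(natr1 M.+1) !mulrDl !mul1r cosD sinD.
set C' := cos (_ * t); set S' := sin (_ * t); split; ring.
Qed.

Let wN M t : w1 M t ^+ 2 + w2 M t ^+ 2 = q ^+ M.
Proof.
rewrite -zpow_norm /w1 /w2; have := cos2Dsin2 (M.+1%:R * t).
set C' := cos _; set S' := sin _; set u := (zpow M a).1; set v := (zpow M a).2 => cs.
transitivity ((u ^+ 2 + v ^+ 2) * (C' ^+ 2 + S' ^+ 2)); first by ring.
by rewrite cs mulr1.
Qed.

Let denE t : mob_den a t = (1 - p t) ^+ 2 + o t ^+ 2.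
Proof.
have cs := cos2Dsin2 t; rewrite /mob_den -/(p t) /sqnorm.
have -> : a.1 ^+ 2 + a.2 ^+ 2 = p t ^+ 2 + o t ^+ 2.
  transitivity ((a.1 ^+ 2 + a.2 ^+ 2) * (cos t ^+ 2 + sin t ^+ 2)); first by rewrite cs mulr1.
  by rewrite /p /o; ring.
ring.
Qed.

(** Remainder of the geometric series after M terms, (1 - |a|^2) (conj a)^M z^(M + 1) / (1 - conj a
    z), multiplied out by the conjugate of the denominator. *)
Let err1 M t := (1 - q) * (w1 M t * (1 - p t) - w2 M t * o t) / mob_den a t.
Let err2 M t := (1 - q) * (w1 M t * o t + w2 M t * (1 - p t)) / mob_den a t.

Let errS M t : err1 M t = (1 - q) * w1 M t + err1 M.+1 t /\ err2 M t = (1 - q) * w2 M t + err2 M.+1 t.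
Proof.
have [h1 h2] := wS M t; have d0 := D0 t; rewrite /err1 /err2 h1 h2.
have frac X W Y : X = W * mob_den a t + Y -> X / mob_den a t = W + Y / mob_den a t.
  by move=> ->; rewrite mulrDl mulfK.
by split; apply: frac; rewrite denE; ring.
Qed.

Let err_sqr M t : err1 M t ^+ 2 <= 4 * q ^+ M /\ err2 M t ^+ 2 <= 4 * q ^+ M.
Proof.
have d0 := D0 t; have dp := mob_den_gt0 t a1.
have E : err1 M t ^+ 2 + err2 M t ^+ 2 = (1 - q) ^+ 2 / mob_den a t * q ^+ M.
  set X := (1 - q) * (w1 M t * (1 - p t) - w2 M t * o t).
  set Y := (1 - q) * (w1 M t * o t + w2 M t * (1 - p t)).
  have XY : X ^+ 2 + Y ^+ 2 = (1 - q) ^+ 2 * mob_den a t * q ^+ M.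
    by rewrite denE -(wN M t) /X /Y; ring.
  have frac2 (x y d : R) : (x / d) ^+ 2 + (y / d) ^+ 2 = (x ^+ 2 + y ^+ 2) / d ^+ 2.
    by rewrite !exprMn exprVn -mulrDl.
  rewrite /err1 /err2 frac2 XY.
  by move: (mob_den a t) (q ^+ M) d0 => d qM d0; field.
have b : (1 - q) ^+ 2 / mob_den a t * q ^+ M <= 4 * q ^+ M.
  rewrite ler_wpM2r ?exprn_ge0// ler_pdivrMr//.
  by have := mob_den_ge t a1; rewrite ler_pdivrMr// mulrC.
by split; apply: le_trans b; rewrite -E; rewrite ?lerDl ?lerDr sqr_ge0.
Qed.

Let psum1 M t : mob1 a t = psum mob_coef1 M.*2.+1 t + err1 M t.
Proof.
have sp0 : Num.sqrt pi != 0 :> R by rewrite gt_eqF// sqrtr_gt0 pi_gt0.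
have s2p0 : Num.sqrt (2 * pi) != 0 :> R by rewrite gt_eqF// sqrtr_gt0 two_pi_gt0.
elim: M => [|M IH].
  rewrite /psum big_ord_recr big_ord0 /= add0r /mob_coef1 /basis /= mulfK//.
  rewrite /err1 /w1 /w2 /= /mob1 !mul1r !mul0r addr0 subr0; congr (_ + _ / _); congr (_ * _).
  have cs := cos2Dsin2 t; rewrite /p /o.
  transitivity (cos t - a.1 * (cos t ^+ 2 + sin t ^+ 2)); first by rewrite cs mulr1.
  ring.
rewrite IH (errS M t).1 doubleS /psum 2![in RHS]big_ord_recr /= -!addrA; congr (_ + _).
rewrite addrA; congr (_ + _); 
rewrite /mob_coef1 /basis /= odd_double /= uphalf_double /freq /= doubleK uphalf_double.
rewrite /w1; set u := (zpow M a).1; set v := (zpow M a).2.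
rewrite [X in _ = X + _](_ : _ = (Num.sqrt pi / Num.sqrt pi) * ((1 - q) * u * cos (M.+1%:R * t))); last by ring.
rewrite [X in _ = _ + X](_ : _ = (Num.sqrt pi / Num.sqrt pi) * ((1 - q) * v * sin (M.+1%:R * t))); last by ring.
by rewrite divff// !mul1r; ring.
Qed.

Let psum2 M t : mob2 a t = psum mob_coef2 M.*2.+1 t + err2 M t.
Proof.
have sp0 : Num.sqrt pi != 0 :> R by rewrite gt_eqF// sqrtr_gt0 pi_gt0.
have s2p0 : Num.sqrt (2 * pi) != 0 :> R by rewrite gt_eqF// sqrtr_gt0 two_pi_gt0.
elim: M => [|M IH].
  rewrite /psum big_ord_recr big_ord0 /= add0r /mob_coef2 /basis /= mulfK//.
  rewrite /err2 /w1 /w2 /= /mob2 !mul1r !mul0r addr0 subr0; congr (_ + _ / _); congr (_ * _).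
  have cs := cos2Dsin2 t; rewrite /p /o.
  transitivity (sin t - a.2 * (cos t ^+ 2 + sin t ^+ 2)); first by rewrite cs mulr1.
  ring.
rewrite IH (errS M t).2 doubleS /psum 2![in RHS]big_ord_recr /= -!addrA; congr (_ + _).
rewrite addrA; congr (_ + _); 
rewrite /mob_coef2 /basis /= odd_double /= uphalf_double /freq /= doubleK uphalf_double.
rewrite /w2; set u := (zpow M a).1; set v := (zpow M a).2.
rewrite [X in _ = X + _](_ : _ = (Num.sqrt pi / Num.sqrt pi) * (- ((1 - q) * v * cos (M.+1%:R * t)))); last by ring.
rewrite [X in _ = _ + X](_ : _ = (Num.sqrt pi / Num.sqrt pi) * ((1 - q) * u * sin (M.+1%:R * t))); last by ring.
by rewrite divff// !mul1r; ring.
Qed.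

(** The remainder is uniformly geometric, so the partial sums converge in L^2 and their
    coefficients, eventually constant, are those of f. *)
Lemma fcoef_geometric (f : R -> R) (x : nat -> R) (err : nat -> R -> R) k : continuous f ->
  (forall M t, f t = psum x M.*2.+1 t + err M t) -> (forall M t, err M t ^+ 2 <= 4 * q ^+ M) ->
  fcoef f k = x k.
Proof.
move=> cf hf he; have sf := sqC_cont cf.
have cv : (fun M => cint (fun t => (psum x M.*2.+1 t - f t) ^+ 2)) @ \oo --> (0 : R).
  have c0 : (fun M => 4 * q ^+ M * (2 * pi)) @ \oo --> (0 : R).
    have : (fun M => q ^+ M) @ \oo --> (0 : R) by apply: cvg_expr; rewrite ger0_norm.
    move=> c; rewrite (_ : 0 = 4 * 0 * (2 * pi)); last by rewrite mulr0 mul0r.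
    by apply: cvgMr_tmp; apply: cvgMl_tmp.
  apply: (squeeze_cvgr _ (cvg_cst 0) c0); apply: nearW => M; apply/andP; split.
    by apply: rint_ge0 => t _; exact: sqr_ge0.
  rewrite -rint_circle_cst; have [_ i] := sqB mC (sq_psum x M.*2.+1) sf.
  apply: (rint_le mC) => //; first exact: (intg_cst mC muC).
  by move=> t _; rewrite (hf M t) opprD addrA subrr sub0r sqrrN.
have h := sq_cvg_mul mC (sq_basis R k) sf (fun M => sq_psum x M.*2.+1) cv.
rewrite /fcoef (eq_cint (fun t => basis k t * f t)); last by move=> t _; rewrite mulrC.
apply: (lim_uniq h); apply: cvg_near_cst; exists k.+1 => // M /= kM.
rewrite (eq_cint (fun t => psum x M.*2.+1 t * basis k t)); last by move=> t _; rewrite mulrC.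
rewrite -/(fcoef _ _) fcoef_psum ifT//; lia.
Qed.

Lemma fcoef_mob1 k : fcoef (mob1 a) k = mob_coef1 k.
Proof.
exact: (fcoef_geometric k continuous_mob1 psum1 (fun M t => (err_sqr M t).1)).
Qed.

Lemma fcoef_mob2 k : fcoef (mob2 a) k = mob_coef2 k.
Proof.
exact: (fcoef_geometric k continuous_mob2 psum2 (fun M t => (err_sqr M t).2)).
Qed.

(** Frequency M + 1 contributes pi (1 - q)^2 (M + 1) q^M, and these terms sum in closed form to at
    most pi. Odd lengths are used so that the cosine-sine pairs are complete. *)
Lemma energy_geometric (x : nat -> R) N :
  (forall M, x M.*2.+1 ^+ 2 + x M.*2.+2 ^+ 2 = pi * (1 - q) ^+ 2 * q ^+ M) ->
  \sum_(k < N) freq R k * x k ^+ 2 <= pi.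
Proof.
move=> hx.
have E M : \sum_(k < M.*2.+1) freq R k * x k ^+ 2 = pi * (1 - M.+1%:R * q ^+ M + M%:R * q ^+ M.+1).
  elim: M => [|M IH].
    by rewrite big_ord_recr big_ord0 /= /freq /= mul0r add0r expr0 mulr1 subrr mul0r addr0 mulr0.
  rewrite doubleS 2!big_ord_recr /= IH.
  have -> : freq R M.*2.+1 = M.+1%:R by rewrite /freq /= doubleK.
  have -> : freq R M.*2.+2 = M.+1%:R by rewrite /freq /= uphalf_double.
  by rewrite -addrA -mulrDr hx !exprS -!natr1; ring.
apply: (@le_trans _ _ (\sum_(k < N.*2.+1) freq R k * x k ^+ 2)).
  have NN : (N <= N.*2.+1)%N by lia.
  rewrite (big_ord_widen _ (fun k => freq R k * x k ^+ 2) NN) big_mkcond.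
  by apply: ler_sum => k _; case: (_ < _)%N => //; rewrite mulr_ge0 ?sqr_ge0 ?freq_ge0.
rewrite E -[leRHS]mulr1 ler_pM2l ?pi_gt0// -addrA gerDl addrC subr_le0.
by apply: ler_pM; rewrite ?ler0n ?exprn_ge0// ?ler_nat// exprS ler_piMl ?exprn_ge0// ltW.
Qed.

Lemma mob_energy N :
  \sum_(k < N) freq R k * fcoef (mob1 a) k ^+ 2 <= pi /\
  \sum_(k < N) freq R k * fcoef (mob2 a) k ^+ 2 <= pi.
Proof.
have sp : Num.sqrt pi ^+ 2 = pi :> R by rewrite sqr_sqrtr// pi_ge0.
have zn M := zpow_norm M a.
split; apply: energy_geometric => M; rewrite ?fcoef_mob1 ?fcoef_mob2 /mob_coef1 /mob_coef2 /=;
  rewrite odd_double /= doubleK uphalf_double /= -/q -zn !exprMn sp; ring.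
Qed.

Lemma cint_mob : cint (mob1 a) = - a.1 * (2 * pi) /\ cint (mob2 a) = - a.2 * (2 * pi).
Proof.
have s2p0 : Num.sqrt (2 * pi) != 0 :> R by rewrite gt_eqF// sqrtr_gt0 two_pi_gt0.
have s2 : Num.sqrt (2 * pi) * Num.sqrt (2 * pi) = 2 * pi :> R.
  by rewrite -expr2 sqr_sqrtr// ltW// two_pi_gt0.
have key f (c : R) : continuous f -> fcoef f 0 = c * Num.sqrt (2 * pi) -> cint f = c * (2 * pi).
  move=> cf; rewrite /fcoef (eq_cint (fun t => (Num.sqrt (2 * pi))^-1 * f t)); last first.
    by move=> t _; rewrite mulrC.
  rewrite (rintZ mC); last by apply: (intg_bdd mC muC); exact: bddm_continuous.
  move=> h; transitivity (Num.sqrt (2 * pi) * ((Num.sqrt (2 * pi))^-1 * cint f)).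
    by rewrite mulrA divff// mul1r.
  by rewrite h mulrCA s2.
split.
  by apply: key; [exact: continuous_mob1|rewrite fcoef_mob1].
by apply: key; [exact: continuous_mob2|rewrite fcoef_mob2].
Qed.

End Fixed.
End Moebius.

(** * Hersch's upper bound for the first eigenvalue *)

Section Hersch.
Variable R : realType.
Local Notation leb1 := (@lebesgue_measure R).
Local Notation C := (@circle R).
Local Notation RT := (g_sigma_algebraType R.-ocitv.-measurable).
Local Notation bddmC := (@bddm _ RT R C).
Local Notation sqC := (@sqint _ RT R leb1 C).
Local Notation cint := (rint leb1 C).
Local Notation mC := (@measurable_circle R).
Local Notation muC := (@lebesgue_circle_fin R).
Arguments eq_cint [R] g {f} _.
Implicit Types a b : R * R.

Lemma ln_diff_le (x y : R) : 0 < x -> 0 < y -> ln y - ln x <= y / x - 1.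
Proof.
move=> x0 y0; rewrite -ln_div ?posrE//.
have -> : ln (y / x) = ln (1 + (y / x - 1)) by rewrite addrCA subrr addr0.
by apply: le_ln1Dx; rewrite ltrBrDr addrC subrr divr_gt0.
Qed.

Lemma continuous_ln_den a : sqnorm a < 1 -> continuous (fun t => ln (mob_den a t)).
Proof.
move=> a1 t; apply: continuous_comp; first exact: continuous_mob_den.
by apply: continuous_ln; exact: mob_den_gt0.
Qed.

Lemma bddm_ln_den a : sqnorm a < 1 -> bddmC (fun t => ln (mob_den a t)).
Proof. by move=> a1; apply: bddm_continuous; exact: continuous_ln_den. Qed.

Lemma mob_den_inv_le a t : sqnorm a < 1 -> (mob_den a t)^-1 <= 4 / (1 - sqnorm a) ^+ 2.
Proof.
move=> a1; have d0 := mob_den_gt0 t a1; have h := mob_den_ge t a1.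
have m0 : 0 < (1 - sqnorm a) ^+ 2 by rewrite exprn_gt0// subr_gt0.
rewrite -[leLHS]mul1r ler_pdivrMr// mulrAC ler_pdivlMr// mul1r.
by rewrite mulrC -ler_pdivrMr.
Qed.

Definition dsq a b : R := (b.1 - a.1) ^+ 2 + (b.2 - a.2) ^+ 2.

Lemma dsq_ge0 a b : 0 <= dsq a b. Proof. by rewrite addr_ge0 ?sqr_ge0. Qed.

(* ln x <= x - 1, and the first-order term vanishes since (z - a) / D_a integrates to 0. *)
Lemma log_potential_step a b : sqnorm a < 1 -> sqnorm b < 1 ->
  cint (fun t => ln (mob_den b t)) - cint (fun t => ln (mob_den a t)) <=
  dsq a b * (4 / (1 - sqnorm a) ^+ 2) * (2 * pi).
Proof.
move=> ha hb; have q1 : 1 - sqnorm a != 0 by rewrite gt_eqF// subr_gt0.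
have ia := intg_bdd mC muC (bddm_ln_den ha); have ib := intg_bdd mC muC (bddm_ln_den hb).
have b1 := bddm_continuous (continuous_mob1 ha); have b2 := bddm_continuous (continuous_mob2 ha).
pose g1 t := mob1 a t + a.1; pose g2 t := mob2 a t + a.2.
have bg1 : bddmC g1 by apply: bddm_add => //; exact: bddm_cst.
have bg2 : bddmC g2 by apply: bddm_add => //; exact: bddm_cst.
have [z1 z2] := cint_mob ha.
have Ig1 : cint g1 = 0.
  rewrite (rintD mC) ?z1 ?rint_circle_cst; [ring|exact: (intg_bdd mC muC)|exact: (intg_cst mC muC)].
have Ig2 : cint g2 = 0.
  rewrite (rintD mC) ?z2 ?rint_circle_cst; [ring|exact: (intg_bdd mC muC)|exact: (intg_cst mC muC)].
pose k1 := - 2 / (1 - sqnorm a) * (b.1 - a.1); pose k2 := - 2 / (1 - sqnorm a) * (b.2 - a.2).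
have bk1 : bddmC (fun t => k1 * g1 t) by exact: bddmZ.
have bk2 : bddmC (fun t => k2 * g2 t) by exact: bddmZ.
have bk : bddmC (fun t => k1 * g1 t + k2 * g2 t) by exact: bddm_add.
rewrite -(rintB mC)//; apply: (@le_trans _ _
  (cint (fun t => (k1 * g1 t + k2 * g2 t) + dsq a b * (4 / (1 - sqnorm a) ^+ 2)))).
  apply: (rint_le mC); [exact: (intgB mC)|apply: (intg_bdd mC muC); apply: bddm_add => //; exact: bddm_cst|].
  move=> t _; have d0 := mob_den_gt0 t ha; have d0' := mob_den_gt0 t hb.
  apply: le_trans (ln_diff_le d0 d0') _.
  have -> : mob_den b t / mob_den a t - 1 = (k1 * g1 t + k2 * g2 t) + dsq a b * (mob_den a t)^-1.
    rewrite /k1 /k2 /g1 /g2 /mob1 /mob2.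
    have -> : mob_den b t = mob_den a t - 2 * ((b.1 - a.1) * (cos t - a.1) + (b.2 - a.2) * (sin t - a.2)) + dsq a b.
      by rewrite /mob_den /dsq /sqnorm; ring.
    move: (mob_den a t) (gt_eqF d0) (1 - sqnorm a) q1 (dsq a b) => d /negbT dn q qn e; field.
    by rewrite dn.
  by rewrite lerD2l; apply: (ler_wpM2l (dsq_ge0 _ _)); exact: mob_den_inv_le.
rewrite (rintD mC); [|exact: (intg_bdd mC muC)|exact: (intg_cst mC muC)].
rewrite (rintD mC); [|exact: (intg_bdd mC muC)..].
rewrite (rintZ mC k1 (intg_bdd mC muC bg1)) (rintZ mC k2 (intg_bdd mC muC bg2)) Ig1 Ig2.
by rewrite !mulr0 !add0r rint_circle_cst.
Qed.

(* The logarithmic potential is locally 2-Hoelder by the previous lemma, hence constant. *)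
Lemma log_potential_ge0 a : sqnorm a < 1 -> 0 <= cint (fun t => ln (mob_den a t)).
Proof.
move=> ha; pose I b := cint (fun t => ln (mob_den b t)).
(* The segment from 0 to a is cut into n steps; each costs at most K / n^2 and their total at most K
   / n. *)
pose b (n j : nat) : R * R := (j%:R / n%:R * a.1, j%:R / n%:R * a.2).
have q0 : 0 <= sqnorm a := sqnorm_ge0 a.
pose K := sqnorm a * (4 / (1 - sqnorm a) ^+ 2) * (2 * pi).
have K0 : 0 <= K 
  by apply: mulr_ge0; [apply: mulr_ge0 => //; rewrite divr_ge0 ?sqr_ge0|rewrite mulr_ge0 ?pi_ge0].
have sb n j : (0 < n)%N -> (j <= n)%N -> sqnorm (b n j) <= sqnorm a.
  move=> n0 jn; have nn : 0 < n%:R :> R by rewrite ltr0n.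
  have -> : sqnorm (b n j) = (j%:R / n%:R) ^+ 2 * sqnorm a by rewrite /sqnorm /b /=; ring.
  by rewrite ler_piMl// exprn_ile1 ?divr_ge0// ler_pdivrMr// mul1r ler_nat.
have step n j : (0 < n)%N -> (j < n)%N -> I (b n j) - I (b n j.+1) <= K / n%:R ^+ 2.
  move=> n0 jn; have nn : n%:R != 0 :> R by rewrite pnatr_eq0 -lt0n.
  have h1 := sb n j n0 (ltnW jn); have h2 := sb n j.+1 n0 jn.
  apply: le_trans (log_potential_step (le_lt_trans h2 ha) (le_lt_trans h1 ha)) _.
  have -> : dsq (b n j.+1) (b n j) = sqnorm a / n%:R ^+ 2.
    by rewrite /dsq /b /sqnorm /= -natr1; field.
  have m : 4 / (1 - sqnorm (b n j.+1)) ^+ 2 <= 4 / (1 - sqnorm a) ^+ 2.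
    rewrite ler_pM2l// lef_pV2 ?posrE ?exprn_gt0 ?subr_gt0 ?(le_lt_trans h2 ha)//.
    by rewrite lerXn2r ?nnegrE ?subr_ge0 ?(ltW ha) ?(le_trans h2 (ltW ha))// lerD2l lerN2.
  have -> : K / n%:R ^+ 2 = (sqnorm a / n%:R ^+ 2) * (4 / (1 - sqnorm a) ^+ 2) * (2 * pi).
    by rewrite /K; ring.
  apply: ler_wpM2r; first by rewrite mulr_ge0// pi_ge0.
  by apply: (ler_wpM2l _ m); rewrite divr_ge0 ?exprn_ge0.
have tot n : (0 < n)%N -> - I a <= K / n%:R.
  move=> n0; have nn : n%:R != 0 :> R by rewrite pnatr_eq0 -lt0n.
  have h j : (j <= n)%N -> I (b n 0%N) - I (b n j) <= j%:R * (K / n%:R ^+ 2).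
    elim: j => [|j IH] jn; first by rewrite subrr mul0r.
    have := IH (ltnW jn); have := step n j n0 jn; rewrite -natr1 mulrDl mul1r; lra.
  have := h n (leqnn n); have -> : b n 0%N = (0, 0) by rewrite /b !mul0r.
  have -> : b n n = a by rewrite /b divff// !mul1r -surjective_pairing.
  have -> : I (0, 0) = 0.
    rewrite /I (eq_cint (fun=> 0)) ?rint_circle_cst ?mul0r// => t _.
    by rewrite /mob_den /sqnorm /= !mul0r addr0 mulr0 subr0 expr0n /= !addr0 ln1.
  rewrite sub0r; have -> // : n%:R * (K / n%:R ^+ 2) = K / n%:R by field.
rewrite leNgt; apply/negP => In.
have In0 : 0 < - I a by rewrite oppr_gt0.
pose n := (Num.truncn (K / - I a)).+1.
have hn : K / - I a < n%:R by rewrite /n truncnS_gt.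
have := tot n isT; rewrite ler_pdivlMr ?ltr0n// mulrC -ler_pdivlMr// => h.
by have := le_lt_trans h hn; rewrite ltxx.
Qed.

Section Centering.
Variables (rho : R -> R) (alpha : R).
Hypothesis brho : bddmC rho.
Hypothesis rho0 : forall t, 0 <= rho t.
Hypothesis rho1 : forall t, rho t <= 1.
Hypothesis a0 : 0 < alpha.
Hypothesis Irho : cint rho = alpha * (2 * pi).

Let F a := cint (fun t => rho t * ln (mob_den a t)) - alpha * (2 * pi) * ln (1 - sqnorm a).
Let J1 a := cint (fun t => rho t * mob1 a t).
Let J2 a := cint (fun t => rho t * mob2 a t).

(* F b - F a is the integral against rho of the logarithm of
   D_b (1 - |a|^2) / (D_a (1 - |b|^2)), to which ln x <= x - 1 applies; the linear
   term exhibits - 2 J / (1 - |a|^2) as the gradient of F. *)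
Let F_step a b : sqnorm a < 1 -> sqnorm b < 1 ->
  (1 - sqnorm b) * (F b - F a) <=
  - 2 * ((b.1 - a.1) * J1 a + (b.2 - a.2) * J2 a) +
  dsq a b * (4 / (1 - sqnorm a) + 1) * (2 * pi).
Proof.
move=> ha hb; have qa : 0 < 1 - sqnorm a by rewrite subr_gt0.
have qb : 0 < 1 - sqnorm b by rewrite subr_gt0.
have bla := bddm_mul brho (bddm_ln_den ha); have blb := bddm_mul brho (bddm_ln_den hb).
have b1 := bddm_mul brho (bddm_continuous (continuous_mob1 ha)).
have b2 := bddm_mul brho (bddm_continuous (continuous_mob2 ha)).
pose c := ln (1 - sqnorm a) - ln (1 - sqnorm b).
have bc : bddmC (fun t => c * rho t) by exact: bddmZ.
have -> : F b - F a = cint (fun t => (rho t * ln (mob_den b t) - rho t * ln (mob_den a t)) + c * rho t).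
  rewrite (rintD mC); [|by apply: (intgB mC); exact: (intg_bdd mC muC)|exact: (intg_bdd mC muC)].
  rewrite (rintB mC); [|exact: (intg_bdd mC muC)..].
  by rewrite (rintZ mC) ?Irho; [rewrite /F /c; ring|exact: (intg_bdd mC muC)].
have iL : intg leb1 (C : set RT) (fun t => (rho t * ln (mob_den b t) - rho t * ln (mob_den a t)) + c * rho t).
  apply: (intgD mC); last exact: (intg_bdd mC muC).
  by apply: (intgB mC); exact: (intg_bdd mC muC).
rewrite -(rintZ mC)//.
pose k1 := - 2 * (b.1 - a.1); pose k2 := - 2 * (b.2 - a.2).
pose K := dsq a b * (4 / (1 - sqnorm a) + 1).
have bk : bddmC (fun t => k1 * (rho t * mob1 a t) + k2 * (rho t * mob2 a t)).
  by apply: bddm_add; exact: bddmZ.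
apply: (@le_trans _ _ (cint (fun t => (k1 * (rho t * mob1 a t) + k2 * (rho t * mob2 a t)) + K))).
  apply: (rint_le mC); [exact: (intgZ mC)|apply: (intg_bdd mC muC); apply: bddm_add => //; exact: bddm_cst|].
  move=> t _; have d0 := mob_den_gt0 t ha; have d0' := mob_den_gt0 t hb.
  have l1 := ln_diff_le (mulr_gt0 d0 qb) (mulr_gt0 d0' qa).
  have -> : (rho t * ln (mob_den b t) - rho t * ln (mob_den a t)) + c * rho t =
     rho t * (ln (mob_den b t * (1 - sqnorm a)) - ln (mob_den a t * (1 - sqnorm b))).
    by rewrite /c !lnM ?posrE//; ring.
  apply: (@le_trans _ _ ((1 - sqnorm b) *
    (rho t * (mob_den b t * (1 - sqnorm a) / (mob_den a t * (1 - sqnorm b)) - 1)))).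
    by apply: (ler_wpM2l (ltW qb)); exact: ler_wpM2l.
  have E : (1 - sqnorm b) * (mob_den b t * (1 - sqnorm a) / (mob_den a t * (1 - sqnorm b)) - 1) =
    k1 * mob1 a t + k2 * mob2 a t + dsq a b * ((1 - sqnorm a) / mob_den a t + 1).
    have h1 : mob_den b t = mob_den a t - 2 * ((b.1 - a.1) * (cos t - a.1) + (b.2 - a.2) * (sin t - a.2)) + dsq a b.
      by rewrite /mob_den /dsq /sqnorm; ring.
    have h2 : 1 - sqnorm b = (1 - sqnorm a) - 2 * ((b.1 - a.1) * a.1 + (b.2 - a.2) * a.2) - dsq a b.
      by rewrite /dsq /sqnorm; ring.
    rewrite {1}(_ : (1 - sqnorm b) * _ = mob_den b t * (1 - sqnorm a) / mob_den a t - (1 - sqnorm b)).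
      rewrite h1 h2 /k1 /k2 /mob1 /mob2.
      move: (mob_den a t) (gt_eqF d0) (1 - sqnorm a) (dsq a b) => d /negbT dn q e; field.
      by rewrite dn.
    move: (mob_den a t) (gt_eqF d0) (1 - sqnorm b) (gt_eqF qb) (1 - sqnorm a) (mob_den b t) =>
      d /negbT dn q /negbT qn e e'; field.
    by rewrite dn.
  have -> : (1 - sqnorm b) * (rho t * (mob_den b t * (1 - sqnorm a) / (mob_den a t * (1 - sqnorm b)) - 1)) =
    (k1 * (rho t * mob1 a t) + k2 * (rho t * mob2 a t)) + rho t * (dsq a b * ((1 - sqnorm a) / mob_den a t + 1)).
    by rewrite mulrCA E; ring.
  have i1 : (1 - sqnorm a) / mob_den a t <= 4 / (1 - sqnorm a).
    apply: (@le_trans _ _ ((1 - sqnorm a) * (4 / (1 - sqnorm a) ^+ 2))).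
      by apply: (ler_wpM2l (ltW qa)); exact: mob_den_inv_le.
    by rewrite le_eqVlt; apply/orP; left; apply/eqP; move: (1 - sqnorm a) (gt_eqF qa) => q /negbT qn; field.
  rewrite lerD2l; apply: (@le_trans _ _ (dsq a b * ((1 - sqnorm a) / mob_den a t + 1))).
    by rewrite ler_piMl// mulr_ge0 ?dsq_ge0// addr_ge0// divr_ge0// ltW.
  by apply: (ler_wpM2l (dsq_ge0 _ _)); rewrite lerD2r.
rewrite (rintD mC); [|exact: (intg_bdd mC muC)|exact: (intg_cst mC muC)].
have i1 := intg_bdd mC muC b1; have i2 := intg_bdd mC muC b2.
rewrite (rintD mC); [|exact: (intgZ mC)..].
by rewrite (rintZ mC)// (rintZ mC)// rint_circle_cst lerD2r -/(J1 a) -/(J2 a) /k1 /k2 -!mulrA -mulrDr.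
Qed.

Let F0 : F (0, 0) = 0.
Proof.
rewrite /F (eq_cint (fun=> 0)).
  by rewrite rint_circle_cst mul0r /sqnorm /= expr0n /= addr0 subr0 ln1 mulr0 subr0.
move=> t _; by rewrite /mob_den /sqnorm /= !mul0r addr0 mulr0 subr0 expr0n /= !addr0 ln1 mulr0.
Qed.

(** Since 0 <= rho <= 1 and ln (D / 4) <= 0, the weighted integral of ln (D / 4) is at least the
    unweighted one, which [log_potential_ge0] controls. *)
Let F_lb a : sqnorm a < 1 -> - (2 * pi * ln 4) - alpha * (2 * pi) * ln (1 - sqnorm a) <= F a.
Proof.
move=> ha; rewrite /F lerD2r.
have ia := intg_bdd mC muC (bddm_ln_den ha).
have h : cint (fun t => ln (mob_den a t) - ln 4) <= cint (fun t => rho t * ln (mob_den a t)).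
  apply: (rint_le mC); [by apply: (intgB mC) => //; exact: (intg_cst mC muC)| |].
    by apply: (intg_bdd mC muC); apply: bddm_mul => //; exact: bddm_ln_den.
  move=> t _; have d0 := mob_den_gt0 t ha.
  have l4 : ln (mob_den a t) <= ln 4 by rewrite ler_ln ?posrE// mob_den_le4.
  have l40 : 0 <= ln 4 :> R by apply: ln_ge0; rewrite ler1n.
  have h1 := mulr_ge0 (rho0 t) l40.
  have : (1 - rho t) * (ln 4 - ln (mob_den a t)) >= 0 by rewrite mulr_ge0// subr_ge0.
  lra.
apply: le_trans h; rewrite (rintB mC)//; last exact: (intg_cst mC muC).
rewrite rint_circle_cst; have := log_potential_ge0 ha; lra.
Qed.

Let J_bound a : sqnorm a < 1 -> `|J1 a| <= 2 * pi /\ `|J2 a| <= 2 * pi.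
Proof.
move=> ha; have N t := mob_norm ha t.
have key f : continuous f -> (forall t, `|f t| <= 1) -> `|cint (fun t => rho t * f t)| <= 2 * pi.
  move=> cf f1; have i := intg_bdd mC muC (bddm_mul brho (bddm_continuous cf)).
  have h t : `|rho t * f t| <= 1 by rewrite normrM mulr_ile1// ger0_norm.
  rewrite ler_norml -[2 * pi]mul1r -mulNr -!rint_circle_cst; apply/andP; split.
    by apply: (rint_le mC) => //; [exact: (intg_cst mC muC)|move=> t _; have := h t; rewrite ler_norml => /andP[]].
  by apply: (rint_le mC) => //; [exact: (intg_cst mC muC)|move=> t _; have := h t; rewrite ler_norml => /andP[]].
split; apply: key; [exact: continuous_mob1| |exact: continuous_mob2|] => t.
  by rewrite -(ler_pXn2r (n := 2))// ?nnegrE// -normrX ger0_norm ?sqr_ge0// expr1n -(N t) lerDl sqr_ge0.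
by rewrite -(ler_pXn2r (n := 2))// ?nnegrE// -normrX ger0_norm ?sqr_ge0// expr1n -(N t) lerDr sqr_ge0.
Qed.

(** [F_step] used in both directions: on a smaller disk 1 - |b|^2 stays at least 1 - r, and the
    quadratic term is bounded by a linear one. *)
Let F_lip r : r < 1 -> exists2 K, 0 < K & forall a b, sqnorm a <= r -> sqnorm b <= r ->
  `|F a - F b| <= K * (`|a.1 - b.1| + `|a.2 - b.2|).
Proof.
move=> r1; pose m := 1 - r; have m0 : 0 < m by rewrite subr_gt0.
have p0 := @pi_gt0 R.
pose K := (2 * (2 * pi) + 2 * (4 / m + 1) * (2 * pi)) / m.
have K0 : 0 < K.
  rewrite divr_gt0// addr_gt0// !mulr_gt0// addr_gt0// divr_gt0//.
have one a b : sqnorm a <= r -> sqnorm b <= r -> F b - F a <= K * (`|b.1 - a.1| + `|b.2 - a.2|).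
  move=> ha hb; have ha1 := le_lt_trans ha r1; have hb1 := le_lt_trans hb r1.
  have qa : m <= 1 - sqnorm a by rewrite lerD2l lerN2.
  have qb : m <= 1 - sqnorm b by rewrite lerD2l lerN2.
  have qa0 := lt_le_trans m0 qa; have qb0 := lt_le_trans m0 qb.
  have sm (u v : R) : `|u| <= 1 -> `|v| <= 1 -> (u - v) ^+ 2 <= 2 * `|u - v|.
    move=> u1 v1; rewrite -(ger0_norm (sqr_ge0 _)) normrX expr2 ler_wpM2r//.
    by apply: le_trans (ler_normB _ _) _; lra.
  have c1 (x : R * R) : sqnorm x < 1 -> `|x.1| <= 1 /\ `|x.2| <= 1.
    move=> /ltW hx; split; rewrite -(ler_pXn2r (n := 2))// ?nnegrE// -normrX ger0_norm ?sqr_ge0// expr1n;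
    apply: le_trans hx; rewrite /sqnorm ?lerDl ?lerDr sqr_ge0//.
  have [a11 a21] := c1 _ ha1; have [b11 b21] := c1 _ hb1.
  have d1 := sm b.1 a.1 b11 a11; have d2 := sm b.2 a.2 b21 a21.
  set L := `|b.1 - a.1| + `|b.2 - a.2|; have L0 : 0 <= L by rewrite addr_ge0.
  have dd : dsq a b <= 2 * L by rewrite /dsq /L; lra.
  have [F0'|F0'] := lerP (F b - F a) 0; first by apply: le_trans F0' _; rewrite mulr_ge0// ltW.
  have -> : K * L = (2 * (2 * pi) * L + 2 * L * (4 / m + 1) * (2 * pi)) / m by rewrite /K; ring.
  rewrite ler_pdivlMr//.
  apply: (@le_trans _ _ ((1 - sqnorm b) * (F b - F a))).
    by rewrite mulrC ler_wpM2r// ltW.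
  apply: le_trans (F_step ha1 hb1) _; apply: lerD.
    have [j1 j2] := J_bound ha1.
    apply: le_trans (ler_norm _) _; rewrite normrM normrN [`|2|]ger0_norm//.
    have -> : 2 * (2 * pi) * L = 2 * (2 * pi * L) by ring.
    rewrite ler_pM2l//.
    apply: le_trans (ler_normD _ _) _; rewrite !normrM /L mulrDr.
    by apply: lerD; rewrite mulrC ler_wpM2r.
  apply: ler_wpM2r; first by rewrite mulr_ge0// ltW.
  apply: ler_pM => //; [exact: dsq_ge0|by rewrite addr_ge0// divr_ge0// ltW|].
  by rewrite lerD2r ler_pM2l// lef_pV2.
exists K => // a b ha hb; rewrite ler_norml; apply/andP; split; last exact: one.
by rewrite lerNl opprB (distrC a.1) (distrC a.2); exact: one.
Qed.

Let min_compact r : 0 <= r -> r < 1 -> exists2 a, sqnorm a <= r & forall b, sqnorm b <= r -> F a <= F b.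
Proof.
move=> r0 r1; have [K K0 hK] := F_lip r1.
pose A : set (R * R) := [set a | sqnorm a <= r].
have cs : continuous (@sqnorm R).
  have -> : @sqnorm R = fun z => z.1 * z.1 + z.2 * z.2 by apply/funext => z; rewrite /sqnorm !expr2.
  by move=> z; apply: cvgD; apply: cvgM; (exact: cvg_fst || exact: cvg_snd).
have cA : compact A.
  have cK : compact (`[-1, 1]%classic `*` `[-1, 1]%classic : set (R * R)).
    by apply: compact_setX; exact: segment_compact.
  have clA : closed A.
    have -> : A = (@sqnorm R) @^-1` [set x | x <= r] by [].
    apply: preimage_closed; first by move=> z _; exact: cs.
    exact: closed_le.
  apply: (subclosed_compact clA cK) => a /= ha; move: ha => /= ha; have {}ha := le_trans ha (ltW r1).
  split; rewrite /= in_itv /= -ler_norml -(ler_pXn2r (n := 2))// ?nnegrE// -normrX ger0_norm ?sqr_ge0// expr1n;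
    apply: le_trans ha; rewrite /sqnorm ?lerDl ?lerDr sqr_ge0//.
have cF : {within A, continuous F}.
  apply/subspace_continuousP => a ha; apply/cvgrPdist_le => e e0.
  have e0' : 0 < e / (2 * K) by rewrite divr_gt0// mulr_gt0.
  rewrite near_withinE.
  have n1 : \forall b \near a, `|a.1 - b.1| <= e / (2 * K).
    exact: (@cvgr_dist_le _ _ _ (nbhs a) _ fst a.1 cvg_fst).
  have n2 : \forall b \near a, `|a.2 - b.2| <= e / (2 * K).
    exact: (@cvgr_dist_le _ _ _ (nbhs a) _ snd a.2 cvg_snd).
  apply: filterS2 n1 n2 => b h1 h2 hb; apply: le_trans (hK a b ha hb) _.
  have -> : e = K * (e / (2 * K) + e / (2 * K)) by field; rewrite gt_eqF.
  by rewrite ler_pM2l// lerD.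
have [|a ha hmin] := compact_EVT_min _ cA cF.
  by exists (0, 0); rewrite /A /= /sqnorm /= expr0n /= addr0.
by exists a; [move: ha; rewrite inE|move=> b hb; apply: hmin; rewrite inE].
Qed.

Let min_disk : exists2 a, sqnorm a < 1 & forall b, sqnorm b < 1 -> F a <= F b.
Proof.
have l40 : 0 <= ln 4 :> R by apply: ln_ge0; rewrite ler1n.
(* Where 1 - |b|^2 < x, the bound [F_lb] is nonnegative, hence at least F (0, 0) = 0; a minimiser
   over |a|^2 <= 1 - x is therefore global. *)
pose x := expR (- (ln 4 / alpha)) : R.
have x0 : 0 < x by exact: expR_gt0.
have x1 : x <= 1 by rewrite expR_le1 oppr_le0 divr_ge0// ltW.
have [||a ha hmin] := @min_compact (1 - x); rewrite ?subr_ge0 ?ltrBlDr ?ltrDl//.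
exists a; first by apply: le_lt_trans ha _; rewrite ltrBlDr ltrDl.
move=> b hb; have [h|h] := lerP (sqnorm b) (1 - x); first exact: hmin.
have Fa : F a <= 0.
  by rewrite -F0; apply: hmin; rewrite /sqnorm /= expr0n /= addr0 subr_ge0.
apply: le_trans Fa _; apply: le_trans (F_lb hb).
have hl : ln (1 - sqnorm b) <= - (ln 4 / alpha).
  by rewrite -[leRHS]expRK -/x ler_ln ?posrE// ?subr_gt0//; lra.
have := ler_wpM2l (_ : 0 <= alpha * (2 * pi)) hl; rewrite mulr_ge0 ?(ltW a0) ?mulr_ge0 ?pi_ge0//.
move=> /(_ isT).
have -> : alpha * (2 * pi) * - (ln 4 / alpha) = - (2 * pi * ln 4).
  by move: (pi : R) (ln 4 : R) => p l; field; rewrite gt_eqF.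
lra.
Qed.

(** A step e J from the minimiser, against the gradient, changes F by at most a positive multiple of
    e |J|^2 (e c - 2), which is negative for small e unless J = 0. *)
Lemma centering : exists2 a, sqnorm a < 1 &
  cint (fun t => rho t * mob1 a t) = 0 /\ cint (fun t => rho t * mob2 a t) = 0.
Proof.
have [a ha hmin] := min_disk; exists a => //; rewrite -/(J1 a) -/(J2 a).
pose j := J1 a ^+ 2 + J2 a ^+ 2; have j0 : 0 <= j by rewrite addr_ge0 ?sqr_ge0.
have qa : 0 < 1 - sqnorm a by rewrite subr_gt0.
pose p := a.1 * J1 a + a.2 * J2 a.
pose c := (4 / (1 - sqnorm a) + 1) * (2 * pi).
have c0 : 0 <= c by rewrite mulr_ge0 ?mulr_ge0 ?pi_ge0// addr_ge0// divr_ge0// ltW.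
(* With e = (1 - |a|^2) / m, the terms 2 |p| + j keep the new point in the disk, and the term c
   ensures e c < 2. *)
pose m := 2 * `|p| + j + c + 1.
have m0 : 0 < m by rewrite /m; have := normr_ge0 p; lra.
pose e := (1 - sqnorm a) / m.
have e0 : 0 < e by rewrite divr_gt0.
have em : e * m = 1 - sqnorm a by rewrite divfK// gt_eqF.
have q0 := sqnorm_ge0 a.
have e1 : e <= 1.
  rewrite ler_pdivrMr// mul1r /m; have := normr_ge0 p; lra.
pose b : R * R := (a.1 + e * J1 a, a.2 + e * J2 a).
have hb : sqnorm b < 1.
  have -> : sqnorm b = sqnorm a + e * (2 * p + e * j) by rewrite /sqnorm /b /p /j /=; ring.
  rewrite -ltrBrDl -em ltr_pM2l// /m.
  have := ler_norm p; have : e * j <= j by rewrite ler_piMl.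
  lra.
have := F_step ha hb.
have -> : dsq a b = e ^+ 2 * j by rewrite /dsq /b /j /=; ring.
have -> : b.1 - a.1 = e * J1 a by rewrite /b /= addrAC subrr add0r.
have -> : b.2 - a.2 = e * J2 a by rewrite /b /= addrAC subrr add0r.
have -> : - 2 * (e * J1 a * J1 a + e * J2 a * J2 a) + e ^+ 2 * j * (4 / (1 - sqnorm a) + 1) * (2 * pi) =
   e * j * (e * c - 2) by rewrite /j /c; ring.
move=> h; have : 0 <= e * j * (e * c - 2).
  by apply: le_trans h; rewrite mulr_ge0 ?subr_ge0 ?(ltW hb)// hmin.
have ec : e * c < 2.
  have : e * c <= e * m by rewrite ler_pM2l// /m; have := normr_ge0 p; lra.
  rewrite em; lra.
have [jz _|jn] := eqVneq j 0.
  by move/eqP: jz; rewrite paddr_eq0 ?sqr_ge0// !sqrf_eq0 => /andP[/eqP-> /eqP->].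
rewrite leNgt => /negP[]; rewrite nmulr_llt0 ?subr_lt0// mulr_gt0// lt0r jn//.
Qed.

End Centering.

(** Constants have no energy and are orthogonal to phi for rho, so both forms are diagonal on the
    test space: energy at most pi on phi, against mass at least pi alpha. *)
Lemma eigset1_upper (rho : R -> R) alpha : bddmC rho -> (forall t, 0 <= rho t <= 1) -> 0 < alpha ->
  cint rho = alpha * (2 * pi) -> eigset rho 1 alpha^-1.
Proof.
move=> br r01 a0 I.
have r0 t : 0 <= rho t by have /andP[] := r01 t.
have r1 t : rho t <= 1 by have /andP[] := r01 t.
have [a ha [z1 z2]] := centering br r0 r1 a0 I.
have c1 := sqC_cont (continuous_mob1 ha); have c2 := sqC_cont (continuous_mob2 ha).
have w11 : wform rho (cst 1) (cst 1) = alpha * (2 * pi).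
  by rewrite -I; apply: eq_cint => t _; rewrite !mulr1.
have p0 := @pi_gt0 R; have a2 : 0 < alpha * (2 * pi) by rewrite !mulr_gt0.
have wsum : wform rho (mob1 a) (mob1 a) + wform rho (mob2 a) (mob2 a) = alpha * (2 * pi).
  rewrite -I -(rintD mC); [|exact: intg_wform..]; apply: eq_cint => t _.
  by rewrite -!mulrA -mulrDr -!expr2 mob_norm// mulr1.
have [phi [sphi zphi hw en]] : exists phi, [/\ sqC phi, wform rho phi (cst 1) = 0,
    alpha * pi <= wform rho phi phi & forall N, \sum_(k < N) freq R k * fcoef phi k ^+ 2 <= pi].
  have [h|h] := lerP (alpha * pi) (wform rho (mob1 a) (mob1 a)).
    exists (mob1 a); split => //; last by move=> N; have [] := mob_energy ha N.
    by rewrite -z1; apply: eq_cint => t _; rewrite mulr1.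
  exists (mob2 a); split => //; last by move=> N; have [] := mob_energy ha N.
    by rewrite -z2; apply: eq_cint => t _; rewrite mulr1.
  lra.
pose f (i : 'I_2) : R -> R := if i == ord0 then cst 1 else phi.
have sf i : sqC (f i) by rewrite /f; case: ifP => // _; exact: sq_cst1.
apply: (eigset_upper br (fun t _ => r0 t) (fun t _ => r1 t) _ (f := f)) => //; first by rewrite w11.
move=> c cn w.
have wE : wform rho w w = c ord0 ^+ 2 * (alpha * (2 * pi)) + c ord_max ^+ 2 * wform rho phi phi.
  rewrite wform_suml//; last by apply: (sq_sum mC muC) => i; exact: (sqZ mC).
  rewrite big_ord_recl big_ord1 /f /= !wform_sumr// ?big_ord_recl ?big_ord0 /=; [|exact: sq_cst1..].
  rewrite ![wform rho (cst 1) phi]wformC zphi w11 (_ : lift ord0 ord0 = ord_max); last exact: val_inj.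
  ring.
have wp : 0 < wform rho phi phi by apply: lt_le_trans hw; rewrite mulr_gt0.
have s := sum_sqr_gt0 cn; rewrite big_ord_recl big_ord1 (_ : lift ord0 ord0 = ord_max) in s; last exact: val_inj.
split.
  rewrite wE; have [z|z] := eqVneq (c ord_max) 0.
    rewrite z expr0n mul0r addr0 mulr_gt0//; by move: s; rewrite z expr0n addr0.
  have l : 0 <= c ord0 ^+ 2 * (alpha * (2 * pi)) by apply: mulr_ge0; [exact: sqr_ge0|exact: ltW].
  by apply: (ltr_wpDl l); apply: mulr_gt0 => //; rewrite exprn_even_gt0.
move=> N.
have E k : freq R k * fcoef w k ^+ 2 = c ord_max ^+ 2 * (freq R k * fcoef phi k ^+ 2).
  rewrite fcoef_sum// big_ord_recl big_ord1 /f /= (_ : lift ord0 ord0 = ord_max); last exact: val_inj.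
  case: k => [|k]; first by rewrite /freq /= !mul0r mulr0.
  have -> : fcoef (cst 1) k.+1 = 0 :> R.
    rewrite /fcoef (eq_cint (fun t => Num.sqrt (2 * pi) * (basis 0 t * basis k.+1 t))).
      rewrite (rintZ mC); last exact: (sq_mul mC (sq_basis R 0) (sq_basis R k.+1)).
      by rewrite rint_basis mulr0.
    move=> t _; have e : Num.sqrt (2 * pi) * basis 0 t = 1 :> R.
      by rewrite /basis /= divff// gt_eqF// sqrtr_gt0 two_pi_gt0.
    by rewrite [RHS]mulrA e.
  by rewrite mulr0 add0r; ring.
under eq_bigr do rewrite E; rewrite -mulr_sumr wE mulrDr.
have h1 : 0 <= alpha^-1 * (c ord0 ^+ 2 * (alpha * (2 * pi))).
  by apply: mulr_ge0; [rewrite invr_ge0 ltW|apply: mulr_ge0; [exact: sqr_ge0|exact: ltW]].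
have h2 : c ord_max ^+ 2 * \sum_(k < N) freq R k * fcoef phi k ^+ 2 <=
    alpha^-1 * (c ord_max ^+ 2 * wform rho phi phi).
  rewrite mulrCA ler_wpM2l ?sqr_ge0//; apply: le_trans (en N) _.
  by rewrite mulrC ler_pdivlMr// mulrC.
lra.
Qed.

Lemma steklov_ev1_max (alpha : R) eta : 0 < alpha <= 1 -> admissible alpha eta ->
  steklov_ev eta 1 <= steklov_ev (@cst R R alpha) 1.
Proof.
move=> ha; rewrite steklov_ev_cst// /freq /= mul1r => heta; have /andP[a0 a1] := ha.
have [b r I ae] := admissible_clip heta.
have [L _ _] := heta; have me := Loo_measurable L.
have -> : steklov_ev eta 1 = steklov_ev (fun t => clip01 (eta t)) 1.
  rewrite /steklov_ev; congr (inf _); apply: (eigset_ae _ me _ ae); by case: b.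
apply: steklov_ev_le => //; [by move=> t _; have /andP[] := r t| |exact: (eigset1_upper b r a0 I)].
rewrite /wform (eq_cint (fun t => clip01 (eta t))); last by move=> t _; rewrite !mulr1.
by rewrite -/(cint _) I !mulr_gt0 ?pi_gt0.
Qed.

Lemma admissible_cst (alpha : R) : 0 < alpha <= 1 -> admissible alpha (cst alpha).
Proof.
move=> /andP[a0 a1]; split; [by apply: bddm_Loo; exact: bddm_cstC| |exact: rint_circle_cst].
by apply: aeW => t _; rewrite /= (ltW a0).
Qed.

End Hersch.

(* Two degenerate cases are excluded, because the assertion fails there.
   - If alpha = 1, the admissible set consists of the constant 1 alone (up to
     null sets), which is then trivially a local minimizer and maximizer.
   - If k = 1, the complement of arcs 1 (1 - e) is one arc of length 2 pi e,
     for which nu 1 tends to 0, while two arcs of length pi e at distance pi / 2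
     give nu 1 = 1. *)
Theorem theorem1p7 (R : realType) :
  (forall alpha : R, 0 < alpha <= 1 ->
     maximizer (admissible alpha) (fun rho => steklov_ev rho 1) (cst alpha)) /\
  (forall alpha : R, 0 < alpha <= 1 ->
     [/\ forall k : nat, ~~ odd k -> (2 <= k)%N ->
           ~ exists drho : R -> R, exists d : R,
               [/\ admissible_perturbation alpha drho,
                   gateaux k alpha drho d & d < 0],
         forall k : nat, odd k -> (1 <= k)%N -> alpha < 1 ->
           ~ local_minimizer (admissible alpha) (fun rho => steklov_ev rho k)
               (cst alpha),
         forall k : nat, odd k -> (1 <= k)%N ->
           ~ exists drho : R -> R, exists d : R,
               [/\ admissible_perturbation alpha drho,
                   gateaux k alpha drho d & 0 < d]
       & forall k : nat, ~~ odd k -> (2 <= k)%N -> alpha < 1 ->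
           ~ local_maximizer (admissible alpha) (fun rho => steklov_ev rho k)
               (cst alpha)]) /\
  (forall k : nat, (1 <= k)%N ->
     (exists L : R,
        nu k (@circle R `\` arcs k.+1 (1 - e)) @[e --> 0^'+] --> L /\
        inf [set nu k S | S in subsets_of_length (2 * pi * e)]
          @[e --> 0^'+] --> L) /\
     ((1 < k)%N -> exists L : R,
        nu k (@circle R `\` arcs k (1 - e)) @[e --> 0^'+] --> L /\
        sup [set nu k S | S in subsets_of_length (2 * pi * e)]
          @[e --> 0^'+] --> L)) /\
  (forall alpha : R, 0 < alpha <= 1 -> forall k : nat,
     steklov_neumann_ev (arcs n alpha) k @[n --> \oo]
       --> steklov_ev (@cst R R alpha) k).
Proof.
split; last split; last split.
- by move=> alpha ha; split; [exact: admissible_cst|move=> eta; exact: steklov_ev1_max].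
- move=> alpha ha; have /andP[a0 _] := ha; split.
  + move=> k ok k2 [drho [d [hp hd dn]]].
    have := gateaux_ge0 ha hp (ltnW k2) hd ok; by rewrite leNgt dn.
  + move=> k ok k1 a1; apply: not_local_minimizer => //; by rewrite a0.
  + move=> k ok k1 [drho [d [hp hd dp]]].
    have := gateaux_le0 ha hp k1 hd ok; by rewrite leNgt dp.
  + move=> k ok k2 a1; apply: not_local_maximizer => //; [by rewrite a0|exact: ltnW].
- by move=> k k1; split; [exact: linearized_min|exact: linearized_max].
- by move=> alpha ha k; exact: steklov_arcs_cvg.
Qed.
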